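(* Each of the following holds. (i) Every $5$-edge-connected planar graph is $\mathbb{Z}_3$-connected. (ii) Every $5$-edge-connected planar graph is $\mathbb{Z}_3$-extendable at every vertex of degree $5$. (iii) Every $\mathbb{Z}_3$-reduced planar graph has minimum degree at most $4$. (iv) Every $5$-edge-connected graph with crossing number at most one is $\mathbb{Z}_3$-connected.
   Context: All graphs are finite, without loops, but parallel edges are allowed. For $A\subseteq V(G)$, $\partial_G(A)$ is the set of edges with exactly one end in $A$; $\partial_G(x)=\partial_G(\{x\})$. A boundary function of $G$ is a map $\beta:V(G)\to\mathbb{Z}_3$ with $\sum_{x\in V(G)}\beta(x)=0$ in $\mathbb{Z}_3$. For such $\beta$, a $\beta$-orientation is an orientation $D$ of $G$ with $d^+_D(v)-d^-_D(v)\equiv\beta(v)\pmod 3$ for all $v$. $G$ is $\mathbb{Z}_3$-connected if it has a $\beta$-orientation for every boundary function $\beta$. $G$ is $\mathbb{Z}_3$-extendable at a vertex $x$ if for every boundary function $\beta$ and every orientation $D_x$ of the edges of $\partial_G(x)$ with $d^+_{D_x}(x)-d^-_{D_x}(x)\equiv\beta(x)\pmod 3$, $D_x$ extends to a $\beta$-orientation of $G$. $G$ is $\mathbb{Z}_3$-reduced if it contains no $\mathbb{Z}_3$-connected subgraph with at least two vertices. *)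

(* Defs.v *)
From HB Require Import structures.
From mathcomp Require Import all_boot all_order all_algebra.
From mathcomp Require Import all_classical all_reals all_analysis.

Set Implicit Arguments.
Unset Strict Implicit.
Unset Printing Implicit Defensive.

Import Order.TTheory GRing.Theory Num.Theory.
Import numFieldNormedType.Exports.

(* Finite loopless multigraphs: every edge has exactly two ends, and distinct
   edges may have the same pair of ends. *)
Record mgraph := MGraph {
  vert : finType;
  edge : finType;
  ends : edge -> {set vert};
  card_ends : forall e, #|ends e| = 2
}.

Section Graphs.

Local Open Scope set_scope.

Variable G : mgraph.

Implicit Types (A W : {set vert G}) (F : {set edge G}) (x v : vert G).

Definition edge_boundary A : {set edge G} := [set e | #|ends e :&: A| == 1].

Definition degree x : nat := #|edge_boundary [set x]|.

(* No degree exceeds #|edge G|, so the default value is neutral; the graph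
   without vertices gets the value 0. *)
Definition min_degree : nat := \big[minn/#|edge G|]_(x : vert G) degree x.

Definition adj_avoiding F : rel (vert G) :=
  fun x y => [exists e, (e \notin F) && (ends e == [set x; y])].

(* G - F is connected for every set F of fewer than k edges. *)
Definition edge_connected (k : nat) : Prop :=
  forall F, #|F| < k -> forall x y, connect (adj_avoiding F) x y.

(* An orientation is given by its choice of tails.  Only the values of D on F
   matter for an orientation of the edges of F. *)
Definition orientation_on F (D : edge G -> vert G) : Prop :=
  forall e, e \in F -> D e \in ends e.

Definition outdeg_on F (D : edge G -> vert G) v : nat :=
  #|[set e in F | (v \in ends e) && (D e == v)]|.

Definition indeg_on F (D : edge G -> vert G) v : nat :=
  #|[set e in F | (v \in ends e) && (D e != v)]|.

Definition balance_on F (D : edge G -> vert G) v : 'Z_3 :=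
  ((outdeg_on F D v)%:R - (indeg_on F D v)%:R)%R.

Definition boundary_function (beta : vert G -> 'Z_3) : Prop :=
  (\sum_(x : vert G) beta x = 0)%R.

Definition beta_orientation (beta : vert G -> 'Z_3) (D : edge G -> vert G)
    : Prop :=
  orientation_on [set: edge G] D /\
  forall v, balance_on [set: edge G] D v = beta v.

Definition Z3_connected : Prop :=
  forall beta, boundary_function beta -> exists D, beta_orientation beta D.

Definition Z3_extendable x : Prop :=
  forall beta Dx,
    boundary_function beta ->
    orientation_on (edge_boundary [set x]) Dx ->
    balance_on (edge_boundary [set x]) Dx x = beta x ->
    exists D, beta_orientation beta D /\ {in edge_boundary [set x], D =1 Dx}.

Definition is_subgraph W F : Prop := forall e, e \in F -> ends e \subset W.

Section Subgraph.

Variables (W : {set vert G}) (F : {set edge G}) (sWF : is_subgraph W F).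

Definition sub_ends (e : {e : edge G | e \in F}) : {set {x : vert G | x \in W}} :=
  [set x | val x \in ends (val e)].

Lemma card_sub_ends e : #|sub_ends e| = 2.
Proof.
rewrite -(card_ends (val e)) -(card_imset _ val_inj); congr #|pred_of_set _|.
apply/setP => x; apply/imsetP/idP => [[y]|xe]; first by rewrite inE => ? ->.
by exists (Sub x (fintype.subsetP (sWF (valP e)) x xe)); rewrite ?inE.
Qed.

Definition subgraph : mgraph := MGraph card_sub_ends.

End Subgraph.

End Graphs.

Definition Z3_reduced (G : mgraph) : Prop :=
  ~ exists (W : {set vert G}) (F : {set edge G}) (sWF : is_subgraph W F),
      1 < #|W| /\ Z3_connected (subgraph sWF).

Section Drawings.

Local Open Scope classical_set_scope.
Local Open Scope ring_scope.

Variables (R : realType) (G : mgraph).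

(* Drawings in the plane: vertices are distinct points, edges are simple arcs
   joining their ends whose interiors contain no vertex. *)
Record drawing := Drawing {
  point_of : vert G -> R * R;
  curve : edge G -> R -> R * R;
  point_of_inj : injective point_of;
  curve_continuous : forall e, {within `[0, 1], continuous (curve e)};
  curve_inj : forall e, {in `[0, 1] &, injective (curve e)};
  curve_ends : forall e, [set curve e 0; curve e 1] = point_of @` [set` ends e];
  curve_avoids : forall e (t : R) v, t \in `]0, 1[ -> curve e t <> point_of v
}.

Definition curve_interior (D : drawing) (e : edge G) : set (R * R) :=
  curve D e @` `]0, 1[.

(* A crossing is a pair of distinct edges together with a common point of their
   interiors, so m edges through one point give 'C(m, 2) crossings. *)
Definition crossings (D : drawing) : set ({set edge G} * (R * R)) :=
  [set c : {set edge G} * (R * R) | #|c.1| = 2%N /\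
    forall e, e \in c.1 -> curve_interior D e c.2].

Definition planar : Prop := exists D : drawing, crossings D = set0.

(* Tangential contacts are not excluded from drawings and count as crossings;
   as they can be perturbed away, the minimum is the usual crossing number. *)
Definition crossing_number_le (k : nat) : Prop :=
  exists D : drawing, (crossings D #<= `I_k)%card.

End Drawings.

(* Main.v *)
(** A drawing, followed on a fine square grid, exhibits the graph as a minor of
    the grid.  Grids and their minors carry a planar structure in the following
    algebraic sense: every edge has two sides among a set of faces, every cut
    meets every face in an even number of edges, and every edge set meeting all
    faces evenly is a cut.  This structure survives deletion, contraction and
    sliding an end of an edge along a neighbouring edge of a common face.

    On such structures a rooted statement is proved by induction.  The root [d]
    has degree at most six and its edges are oriented beforehand; an extra vertex
    [w] is joined by virtual edges, which carry no flow, to some of the other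
    vertices; a cut has at least four real edges, and at least five if no virtual
    edge crosses it.  Then every boundary of total zero is realised, unless an
    edge that is the only inner one of a cut is forced to carry zero.  In a
    minimal counterexample cuts with at most six edges are contracted away and
    root edges are slid along virtual edges, until the root has a neighbour [u]
    of degree four.  The cyclic order of the edges around [u], and around a
    second neighbour of degree four, then leaves three cases, each of which is
    reduced by sliding one edge, contracting a virtual edge into [w] and lifting
    the edges at the removed vertices.

    Parts (i) and (ii) apply this to all vertices and to the complement of [x].
    For (iv) the crossing point becomes a root of degree four.  For (iii) a
    minimal vertex set with at most four boundary edges and connected outside
    spans a Z_3-connected subgraph. *)

From mathcomp Require Import all_boot all_order all_algebra.
From mathcomp Require Import zify ring lra.

Set Implicit Arguments.
Unset Strict Implicit.
Unset Printing Implicit Defensive.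

Import GRing.Theory.

(** * Planar structures *)

(** The thresholds are tied together. Two disjoint parts have at least four boundary edges each, so
    a set with fewer than eight is connected and can be contracted; the outside of a cut with at
    most six edges becomes a root in its turn, so six root edges must be allowed. The price is the
    balance 4 + 4 = 6 + 2: with root degree six a single edge may join two tight parts, and one edge
    never carries zero. A cut may drop to four only where a virtual edge crosses it; since all
    virtual edges end in [w], planarity limits where vertices of degree four can lie. The structure
    is algebraic because every operation on it is linear over the field with two elements: sliding,
    for instance, is an elementary operation paired with its inverse transpose. The topological
    facts come back from duality: the edges around a vertex of degree four form a minimal even set,
    hence a cycle of the dual with a cyclic order, and a cycle splits the boundary of any vertex set
    containing it into two cuts, as the Jordan curve theorem would. *)

Definition cut (U E : finType) (a b : E -> U) (X : {set U}) (e : E) : bool :=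
  (a e \in X) (+) (b e \in X).

Definition inc (F E : finType) (l r : E -> F) (f : F) (e : E) : bool :=
  (l e == f) (+) (r e == f).

(** Over the field with two elements, the cut space is the orthogonal complement of the span of the
    faces. As an edge lies on at most two faces, this is MacLane's criterion, with [l] and [r] as an
    algebraic dual graph. An edge with [l e = r e] lies on no face, so it is a bridge. Restricting
    to [S] lets deletion shrink a set instead of changing the type. *)
Definition planar_struct (U E F : finType) (a b : E -> U) (l r : E -> F)
    (S : {set E}) : Prop :=
  (forall X f, \big[addb/false]_(e in S) (cut a b X e && inc l r f e) = false)
  /\ forall C : {set E}, C \subset S ->
     (forall f, \big[addb/false]_(e in C) inc l r f e = false) ->
     exists X, forall e, e \in S -> (e \in C) = cut a b X e.

Section Ops.

Variables (U E F : finType).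
Implicit Types (a b : E -> U) (l r : E -> F) (S C : {set E}) (e h k : E).
Implicit Types (X : {set U}) (f : F).

Lemma cutC a b X e : cut a b (~: X) e = cut a b X e.
Proof. by rewrite /cut !inE; case: (_ \in _); case: (_ \in _). Qed.

Lemma cut0 a b e : cut a b set0 e = false.
Proof. by rewrite /cut !inE. Qed.

Lemma xor_bool_big (I : finType) (P : pred I) (B : bool) (G : I -> bool) :
  \big[addb/false]_(i in P) (B && G i) = B && \big[addb/false]_(i in P) G i.
Proof. by case: B => //=; rewrite big1. Qed.

Lemma xor_big_eq1 (S : {set E}) k (B : bool) : k \in S ->
  \big[addb/false]_(e in S) ((e == k) && B) = B.
Proof.
move=> kS; rewrite (bigD1 k) //= eqxx /= big1 ?addbF // => i /andP[_ /negbTE ->].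
by [].
Qed.

Lemma planar_ext a b l r a' b' l' r' S :
  {in S, forall e X, cut a' b' X e = cut a b X e} ->
  {in S, forall e f, inc l' r' f e = inc l r f e} ->
  planar_struct a b l r S -> planar_struct a' b' l' r' S.
Proof.
move=> Hc Hi [D1 D2]; split=> [X f|C CS HC].
  by rewrite -[RHS](D1 X f); apply: eq_bigr => e eS; rewrite Hc // Hi.
have [f|X HX] := D2 C CS.
  by rewrite -[RHS](HC f); apply: eq_bigr => e eC; rewrite Hi // (subsetP CS).
by exists X => e eS; rewrite Hc // HX.
Qed.

(** In the cut matrix the column of [h] gains that of [k], in the face matrix the column of [k]
    gains that of [h]. Modulo two these operations are inverse transposes of each other, so
    orthogonal complements stay orthogonal complements. *)
Lemma planar_slide a b l r a' b' l' r' S h k :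
  h \in S -> k \in S -> h != k ->
  {in S, forall e X, cut a' b' X e = cut a b X e (+) ((e == h) && cut a b X k)} ->
  {in S, forall e f, inc l' r' f e = inc l r f e (+) ((e == k) && inc l r f h)} ->
  planar_struct a b l r S -> planar_struct a' b' l' r' S.
Proof.
move=> hS kS hk Hc Hi [D1 D2]; split=> [X f|C CS HC].
  rewrite (eq_bigr (fun e => (cut a b X e && inc l r f e) (+)
    (((e == h) && (cut a b X k && inc l r f h)) (+)
     ((e == k) && (cut a b X k && inc l r f h))))); last first.
    move=> e eS; rewrite Hc // Hi //.
    case: (e =P h) => [->|_] /=.
      rewrite (negbTE hk) /= !addbF.
      by case: (cut a b X h); case: (cut a b X k); case: (inc l r f h).
    case: (e =P k) => [->|_] /=; last by rewrite !addbF.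
    by case: (cut a b X k); case: (inc l r f h); case: (inc l r f k).
  by rewrite big_split /= D1 big_split /= !xor_big_eq1 // addbb.
(* The change of coordinates is undone on edge sets: [h] is toggled exactly when [k] belongs to
   [C]. *)
pose C' := if k \in C then (if h \in C then C :\ h else h |: C) else C.
have C'S : C' \subset S.
  rewrite /C'; case: (k \in C) => //; case: (h \in C).
    by apply: subset_trans CS; apply: subD1set.
  by rewrite subUset sub1set hS.
have inC' e : (e \in C') = (e \in C) (+) ((e == h) && (k \in C)).
  rewrite /C'; case kC: (k \in C); last by rewrite andbF addbF.
  rewrite andbT; case hC: (h \in C); rewrite !inE.
    by case: (e =P h) => [->|_] /=; rewrite ?hC ?addbF.
  by case: (e =P h) => [->|_] /=; rewrite ?hC ?addbF.
have [f|X HX] := D2 C' C'S.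
  have -> : \big[addb/false]_(e in C') inc l r f e =
            \big[addb/false]_(e in E) ((e \in C') && inc l r f e).
    by rewrite big_mkcond /=; apply: eq_bigr => e _; case: (e \in C').
  rewrite (eq_bigr (fun e => ((e \in C) && inc l r f e) (+)
      ((e == h) && ((k \in C) && inc l r f h)))); last first.
    move=> e _; rewrite inC'; case: (e =P h) => [->|_] /=; last by rewrite !addbF.
    by case: (h \in C); case: (k \in C); case: (inc l r f h).
  rewrite big_split /=.
  have -> : \big[addb/false]_(e in E) ((e == h) && ((k \in C) && inc l r f h)) =
     ((k \in C) && inc l r f h).
    by rewrite (bigD1 h) //= eqxx big1 ?addbF // => i /negbTE ->.
  rewrite -[RHS](HC f) [RHS]big_mkcond /=.
  rewrite [RHS](eq_bigr (fun e => ((e \in C) && inc l r f e) (+)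
     ((e == k) && ((k \in C) && inc l r f h)))); last first.
    move=> e _; case eC: (e \in C) => /=.
      rewrite Hi ?(subsetP CS) //; case: (e =P k) => [<-|_] //=.
      by rewrite eC.
    by case: (e =P k) => [<-|_] //=; rewrite eC.
  rewrite [RHS]big_split /=; congr addb.
  by rewrite (bigD1 k) //= eqxx big1 ?addbF // => i /negbTE ->.
exists X => e eS; rewrite Hc // -!HX // inC' (inC' k).
rewrite [k == h]eq_sym (negbTE hk) /= addbF.
by case: (e \in C); case: ((e == h) && _).
Qed.

(** Deleting an edge joins the faces on its two sides. [phi] sends the right face to the left one,
    so the new boundary is the sum of the two old ones, in which [k] itself cancels. *)
Lemma planar_del1 a b l r S k : k \in S -> planar_struct a b l r S ->
  exists l' r', planar_struct a b l' r' (S :\ k).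
Proof.
move=> kS [D1 D2].
pose phi f := if f == r k then l k else f.
exists (phi \o l), (phi \o r).
have Hinc f e : inc (phi \o l) (phi \o r) f e =
   if l k == r k then inc l r f e else
   if f == l k then inc l r (l k) e (+) inc l r (r k) e
   else if f == r k then false else inc l r f e.
  rewrite /inc /phi /=; case: (l k =P r k) => [E0|/eqP lr].
    have H x : (if x == r k then l k else x) = x.
      by case: (x =P r k) => // ->.
    by rewrite !H.
  have lr' : r k != l k by rewrite eq_sym.
  case: (f =P l k) => [->|/eqP fl].
    have H x : ((if x == r k then l k else x) == l k) = (x == l k) (+) (x == r k).
      case: (x =P r k) => [->|_]; first by rewrite eqxx (negbTE lr').
      by rewrite addbF.
    by rewrite !H; do 4 case: (_ == _).
  case: (f =P r k) => [->|/eqP fr].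
    have H x : ((if x == r k then l k else x) == r k) = false.
      by case: (x =P r k) => [_|/eqP/negbTE //]; apply/negbTE.
    by rewrite !H.
  have H x : ((if x == r k then l k else x) == f) = (x == f).
    case: (x =P r k) => [->|_] //.
    by rewrite ![_ == f]eq_sym (negbTE fl) (negbTE fr).
  by rewrite !H.
have Hk f : inc (phi \o l) (phi \o r) f k = false.
  rewrite Hinc; case: (l k =P r k) => [E0|/eqP lr].
    by rewrite /inc E0 addbb.
  have lr' : r k != l k by rewrite eq_sym.
  case: (f =P l k) => [_|/eqP fl].
    by rewrite /inc !eqxx (negbTE lr) (negbTE lr').
  case: (f =P r k) => [//|/eqP fr].
  by rewrite /inc ![_ == f]eq_sym (negbTE fl) (negbTE fr).
split=> [X f|C CS HC].
  have -> : \big[addb/false]_(e in S :\ k)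
      (cut a b X e && inc (phi \o l) (phi \o r) f e) =
     \big[addb/false]_(e in S) (cut a b X e && inc (phi \o l) (phi \o r) f e).
    by rewrite [RHS](big_setD1 k) //= Hk andbF.
  case lr: (l k == r k).
    by rewrite -[RHS](D1 X f); apply: eq_bigr => e _; rewrite Hinc lr.
  case: (f =P l k) => [->|/eqP fl].
    rewrite (eq_bigr (fun e => (cut a b X e && inc l r (l k) e) (+)
       (cut a b X e && inc l r (r k) e))); last first.
      move=> e _; rewrite Hinc lr eqxx.
      by case: (cut a b X e).
    by rewrite big_split /= !D1.
  case: (f =P r k) => [->|/eqP fr].
    rewrite big1 // => e _; rewrite Hinc lr eqxx eq_sym lr andbF //.
  by rewrite -[RHS](D1 X f); apply: eq_bigr => e _; rewrite Hinc lr (negbTE fl) (negbTE fr).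
have CS' : C \subset S by apply: subset_trans CS _; apply: subD1set.
have kC : k \notin C.
  by apply/negP => /(subsetP CS); rewrite !inE eqxx.
have fin C2 : C2 \subset S -> (forall e, e != k -> (e \in C2) = (e \in C)) ->
   (forall f, \big[addb/false]_(e in C2) inc l r f e = false) ->
   exists X : {set U}, forall e, e \in S :\ k -> (e \in C) = cut a b X e.
  move=> C2S EC HC2; have [X HX] := D2 C2 C2S HC2.
  by exists X => e; rewrite !inE => /andP[ek eS]; rewrite -EC // HX.
case lr: (l k == r k).
  apply: (fin C) => // f.
  by rewrite -[RHS](HC f); apply: eq_bigr => e _; rewrite Hinc lr.
have parE f : f != l k -> f != r k -> \big[addb/false]_(e in C) inc l r f e = false.
  move=> fl fr; rewrite -[RHS](HC f); apply: eq_bigr => e _.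
  by rewrite Hinc lr (negbTE fl) (negbTE fr).
have par2 : \big[addb/false]_(e in C) inc l r (l k) e =
            \big[addb/false]_(e in C) inc l r (r k) e.
  have := HC (l k).
  rewrite (eq_bigr (fun e => inc l r (l k) e (+) inc l r (r k) e)); last first.
    by move=> e _; rewrite Hinc lr eqxx.
  by rewrite big_split /=; do 2 case: (\big[_/_]_(_ in _) _).
case t: (\big[addb/false]_(e in C) inc l r (l k) e); last first.
  apply: (fin C) => // f.
  case: (f =P l k) => [->|/eqP fl] //.
  case: (f =P r k) => [->|/eqP fr]; first by rewrite -par2.
  exact: parE.
(* [C] is odd at both old faces of [k]. Adding [k] repairs both at once, and the cut found this way
   agrees with [C] off [k]. *)
apply: (fin (k |: C)) => [|e ek|f].
- by rewrite subUset sub1set kS.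
- by rewrite !inE (negbTE ek).
rewrite big_setU1 //=.
case: (f =P l k) => [->|/eqP fl].
  by rewrite t /inc eqxx eq_sym lr.
case: (f =P r k) => [->|/eqP fr]; first by rewrite -par2 t /inc eqxx lr.
rewrite parE // addbF /inc.
by rewrite ![_ == f]eq_sym (negbTE fl) (negbTE fr).
Qed.

Lemma planar_del a b l r S S' : S' \subset S -> planar_struct a b l r S ->
  exists l' r', planar_struct a b l' r' S'.
Proof.
move=> sub; have [n] := ubnP #|S :\: S'|.
elim: n S l r sub => // n IH S l r sub; rewrite ltnS => le H.
have [E0|[k kS]] := set_0Vmem (S :\: S').
  exists l, r; suff -> : S' = S by [].
  by apply/eqP; rewrite eqEsubset sub -setD_eq0 E0 eqxx.
have [kn kS0] : k \notin S' /\ k \in S by move: kS; rewrite inE => /andP.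
have [l1 [r1 H1]] := planar_del1 kS0 H.
apply: IH H1.
  apply/subsetP => e eS'; rewrite !inE (subsetP sub) // andbT.
  by apply: contraNneq kn => <-.
apply: leq_trans le.
apply: proper_card; apply/properP; split.
  by apply: setSD; apply: subD1set.
by exists k => //; rewrite !inE eqxx /= andbF.
Qed.

End Ops.

Section Minor.

Variables (U U' E E' F : finType).

(** Contraction of the edges outside [S']. A cut of the quotient needs a side that is a union of
    fibres of [psi]. Fibres need not be connected by contracted edges, so a side [X] may first be
    exchanged for another side [X0] of the same cut. *)
Lemma planar_quot (a b : E -> U) (l r : E -> F) (S S' : {set E}) (psi : U -> U') :
  S' \subset S -> {in S :\: S', forall e, psi (a e) = psi (b e)} ->
  (forall X : {set U}, {in S :\: S', forall e, ~~ cut a b X e} ->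
     exists2 X0 : {set U}, {in S, cut a b X0 =1 cut a b X} &
       forall u v, psi u = psi v -> (u \in X0) = (v \in X0)) ->
  planar_struct a b l r S -> planar_struct (psi \o a) (psi \o b) l r S'.
Proof.
move=> S'S Hin Hu [D1 D2].
have cutE X e : cut (psi \o a) (psi \o b) X e = cut a b (psi @^-1: X) e.
  by rewrite /cut !inE.
split=> [X f|C CS HC].
  rewrite -[RHS](D1 (psi @^-1: X) f) [RHS](big_setID S') /= (setIidPr S'S).
  rewrite [X in _ (+) X]big1 ?addbF; last first.
    by move=> e eS; rewrite -cutE /cut /= Hin // addbb.
  by apply: eq_bigr => e _; rewrite cutE.
have [X HX] := D2 C (subset_trans CS S'S) HC.
have [e eS|X0 HX0 unif] := Hu X.
  move: (eS); rewrite inE => /andP[eS' eS0].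
  by rewrite -HX //; apply: contra eS'; apply: (subsetP CS).
exists (psi @: X0) => e eS'; have eS := subsetP S'S e eS'.
rewrite HX // -HX0 // /cut /=.
have memE u : (psi u \in psi @: X0) = (u \in X0).
  apply/imsetP/idP => [[v vX Ev]|uX]; last by exists u.
  by rewrite (unif _ _ Ev).
by rewrite !memE.
Qed.

Lemma planar_reindex (a b : E -> U) (l r : E -> F) (i : E' -> E) :
  injective i -> planar_struct a b l r (i @: [set: E']) ->
  planar_struct (a \o i) (b \o i) (l \o i) (r \o i) [set: E'].
Proof.
move=> inj_i [D1 D2]; split=> [X f|C _ HC].
  rewrite -[RHS](D1 X f) big_imset /=; last by move=> ? ? _ _; apply: inj_i.
  by apply: eq_bigr.
have [| f|X HX] := D2 (i @: C).
- by apply: imsetS; apply: subsetT.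
- rewrite big_imset /=; last by move=> ? ? _ _; apply: inj_i.
  exact: HC.
exists X => e _; rewrite -(mem_imset C e inj_i); apply: HX; exact: imset_f.
Qed.

End Minor.

(** * Flows with values in Z/3 and rooted instances *)

Section Flows.

Variables (U E : finType).
Implicit Types (a b : E -> U) (N : {set E}) (x : E -> bool) (v : U).

(** Zero is not a value: an orientation is a nowhere-zero assignment modulo three, with [true] for
    the direction from [a e] to [b e]. *)
Definition sg (s : bool) : 'Z_3 := (if s then 1 else - 1)%R.

Definition dlt a b v e : 'Z_3 := ((a e == v)%:R - (b e == v)%:R)%R.

Definition net a b N x v : 'Z_3 := (\sum_(e in N) dlt a b v e * sg (x e))%R.

Definition inner a b (W : {set U}) (SR : {set E}) : {set E} :=
  [set e in SR | (a e \in W) && (b e \in W)].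

Definition solvable a b SR (W : {set U}) (c : U -> 'Z_3) : Prop :=
  exists x, forall v, v \in W -> net a b (inner a b W SR) x v = c v.

Definition dg a b (SR : {set E}) (A : {set U}) : nat :=
  \sum_(e in SR) cut a b A e.

Definition joins a b e u v : bool :=
  (a e == u) && (b e == v) || (a e == v) && (b e == u).

Lemma Z3P (z : 'Z_3) : [\/ z = 0, z = 1 | z = -1]%R.
Proof.
case: z => [[|[|[|//]]] i]; [constructor 1|constructor 2|constructor 3];
  by apply/val_inj.
Qed.

Lemma sg_ex (z : 'Z_3) : (z != 0)%R -> exists s, sg s = z.
Proof.
by case: (Z3P z) => ->; rewrite ?eqxx // => _; [exists true|exists false].
Qed.

Lemma sgN s : sg (~~ s) = (- sg s)%R.
Proof. by case: s => //=; rewrite /sg opprK. Qed.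

(** The sums of two signs are 2, 0 and -2, which are all residues modulo three, whereas one sign
    misses zero. Every reduction below relies on this arithmetic. *)
Lemma sg2_ex (z : 'Z_3) : exists s t, (sg s + sg t = z)%R.
Proof.
case: (Z3P z) => ->; [exists true, false|exists false, false|exists true, true];
  by apply/val_inj.
Qed.

Lemma sg3_ex (z : 'Z_3) s : exists t u, (sg s + sg t + sg u = z)%R.
Proof.
have [t [u E0]] := sg2_ex (z - sg s)%R.
by exists t, u; rewrite -addrA E0 addrC subrK.
Qed.

Lemma dltE a b v e : a e != b e ->
  dlt a b v e = (if a e == v then 1 else if b e == v then -1 else 0)%R.
Proof.
rewrite /dlt => ne; case: (a e =P v) => [<-|_].
  by rewrite eq_sym (negbTE ne) subr0.
by rewrite sub0r; case: (_ == _); rewrite ?oppr0.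
Qed.

Lemma sum_dlt a b (A : {set U}) e :
  (\sum_(v in A) dlt a b v e = (a e \in A)%:R - (b e \in A)%:R)%R.
Proof.
rewrite /dlt big_split /= sumrN.
have H u : (\sum_(v in A) (u == v)%:R = (u \in A)%:R :> 'Z_3)%R.
  case uA: (u \in A).
    by rewrite (bigD1 u) //= eqxx big1 ?addr0 // => v /andP[_]; rewrite eq_sym => /negbTE ->.
  by rewrite big1 // => v vA; case: (u =P v) uA => // ->; rewrite vA.
by rewrite !H.
Qed.

Lemma sum_net a b N x (A : {set U}) :
  (\sum_(v in A) net a b N x v =
   \sum_(e in N) ((a e \in A)%:R - (b e \in A)%:R) * sg (x e))%R.
Proof.
rewrite exchange_big /=; apply: eq_bigr => e _.
by rewrite -mulr_suml sum_dlt.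
Qed.

Lemma net_ext a b N x x' v : {in N, x =1 x'} -> net a b N x v = net a b N x' v.
Proof. by move=> H; apply: eq_bigr => e eN; rewrite H. Qed.

Lemma net_out a b N x v :
  {in N, forall e, (a e != v) && (b e != v)} -> net a b N x v = 0%R.
Proof.
move=> H; apply: big1 => e eN; have /andP[/negbTE ea /negbTE eb] := H e eN.
by rewrite /dlt ea eb subrr mul0r.
Qed.

Lemma net_split a b N N1 N2 x1 x2 v : N = N1 :|: N2 -> [disjoint N1 & N2] ->
  net a b N (fun e => if e \in N1 then x1 e else x2 e) v =
  (net a b N1 x1 v + net a b N2 x2 v)%R.
Proof.
move=> -> dis; rewrite /net (eq_bigl [predU N1 & N2]); last by move=> e; rewrite !inE.
rewrite bigU //=; congr (_ + _)%R; apply: eq_bigr => e eN; first by rewrite eN.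
by rewrite (disjointFl dis eN).
Qed.

End Flows.

Section Instances.

Variables (U E F : finType).

(** The virtual edge [pi_g] between the root and [w] keeps the process going: the root edge beside
    it on a face can be slid onto [w], and it closes the cycles through the root and [w] along which
    the graph is separated. *)
Record pinst (a b : E -> U) (l r : E -> F) (SR SV : {set E}) (W : {set U})
    (d w : U) : Prop := Pinst {
  pi_pl : planar_struct a b l r (SR :|: SV);
  pi_dis : [disjoint SR & SV];
  pi_dW : d \notin W;
  pi_wW : w \notin W;
  pi_dw : d != w;
  pi_loop : forall e, e \in SR -> a e != b e;
  pi_ra : forall e, e \in SR -> a e \in d |: W;
  pi_rb : forall e, e \in SR -> b e \in d |: W;
  pi_v : forall e, e \in SV ->
     (a e == w) && (b e \in d |: W) || (b e == w) && (a e \in d |: W);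
  pi_g : exists2 g, g \in SV & joins a b g d w }.

Definition has_virt (a b : E -> U) (SV : {set E}) (A : {set U}) : bool :=
  [exists e in SV, cut a b A e].

Record good (a b : E -> U) (l r : E -> F) (SR SV : {set E}) (W : {set U})
    (d w : U) : Prop := Good {
  go_p : pinst a b l r SR SV W d w;
  go_D : dg a b SR W <= 6;
  go_1 : forall A : {set U}, A \subset W -> A != set0 -> A != W -> 4 <= dg a b SR A;
  go_2 : forall A : {set U}, A \subset W -> A != set0 -> A != W ->
     ~~ has_virt a b SV A -> 5 <= dg a b SR A }.

(* Two disjoint cuts of size four joined by one edge leave no freedom on that
   edge; this can only happen for root degree six. *)
Definition consistent (a b : E -> U) (SR : {set E}) (W : {set U})
    (c : U -> 'Z_3) : Prop :=
  forall A : {set U}, A \subset W -> A != set0 -> A != W ->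
    \sum_(e in inner a b W SR) cut a b A e = 1 -> (\sum_(v in A) c v != 0)%R.

(** Vertices and real edges are both counted, since some reductions contract vertices while others
    only turn a real edge into a virtual one. *)
Definition solvable_below (n : nat) : Prop :=
  forall a b l r SR SV W d w c, good a b l r SR SV W d w ->
    #|W| + #|SR| < n -> (\sum_(v in W) c v = 0)%R -> consistent a b SR W c ->
    solvable a b SR W c.

Section Basic.

Variables (a b : E -> U) (l r : E -> F) (SR SV : {set E}) (W : {set U}) (d w : U).
Hypothesis P : pinst a b l r SR SV W d w.

Implicit Types A B X K T : {set U}.

Let N := inner a b W SR.

Lemma inner_sub : N \subset SR.
Proof. by apply/subsetP => e; rewrite inE => /andP[]. Qed.

Lemma dgU1 A v : v \notin A ->
  dg a b SR (v |: A) + 2 * (\sum_(e in SR) (cut a b [set v] e && cut a b A e)) =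
  dg a b SR A + dg a b SR [set v].
Proof.
move=> vA; rewrite /dg big_distrr /= -!big_split /=; apply: eq_bigr => e eS.
have := pi_loop P eS; rewrite /cut !inE.
case: (a e =P v) => [->|_]; case: (b e =P v) => [->|_];
  rewrite ?(negbTE vA) ?eqxx //=; by do ?case: (_ \in _).
Qed.

Lemma dgU A B : [disjoint A & B] ->
  dg a b SR (A :|: B) + 2 * (\sum_(e in SR) (cut a b A e && cut a b B e)) =
  dg a b SR A + dg a b SR B.
Proof.
move=> dis; rewrite /dg big_distrr /= -!big_split /=; apply: eq_bigr => e eS.
rewrite /cut !inE.
have H u : ~~ ((u \in A) && (u \in B)).
  by apply/negP => /andP[uA uB]; rewrite (disjointFr dis uA) in uB.
have := H (a e); have := H (b e).
by case: (a e \in A); case: (b e \in A); case: (a e \in B); case: (b e \in B).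
Qed.

Lemma dg_inner A B : B \subset A ->
  dg a b SR B + dg a b SR (A :\: B) =
  dg a b SR A + 2 * (\sum_(e in inner a b A SR) cut a b B e).
Proof.
move=> BA.
have -> : \sum_(e in inner a b A SR) cut a b B e =
    \sum_(e in SR) [&& a e \in A, b e \in A & cut a b B e].
  rewrite (eq_bigl (fun e => (e \in SR) && ((a e \in A) && (b e \in A)))); last first.
    by move=> e; rewrite inE.
  by rewrite big_mkcondr /=; apply: eq_bigr => e _; do 2 case: (_ \in A).
rewrite /dg big_distrr /= -!big_split /=; apply: eq_bigr => e eS.
rewrite /cut !inE; have := subsetP BA (a e); have := subsetP BA (b e).
move=> /implyP + /implyP.
by case: (a e \in A); case: (b e \in A); case: (a e \in B); case: (b e \in B).
Qed.

End Basic.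

(** A single inner edge between two parts would give 4 + 4 <= 5 + 2 for the boundary sizes. *)
Lemma consistent_small a b l r SR SV W d w c :
  good a b l r SR SV W d w -> dg a b SR W <= 5 -> consistent a b SR W c.
Proof.
move=> G D5 A AW A0 AnW E1.
have := dg_inner a b SR AW; rewrite E1.
have := go_1 G AW A0 AnW.
have : 4 <= dg a b SR (W :\: A).
  apply: (go_1 G); first exact: subsetDl.
    by rewrite setD_eq0; apply: contra AnW => WA; rewrite eqEsubset AW.
  apply: contra A0 => /eqP E2; apply/eqP/setP => u; rewrite inE; apply/negbTE.
  apply/negP => uA; have : u \in W :\: A by rewrite E2 (subsetP AW).
  by rewrite inE uA.
lia.
Qed.

End Instances.

(** * Contraction of a connected vertex set *)

Section Quotients.

Variables (U E F : finType).
Implicit Types (T X : {set U}) (SR SV : {set E}) (a b : E -> U) (t u : U).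

Definition merge (T : {set U}) (t u : U) : U := if u \in T then t else u.

Definition outside (a b : E -> U) (T : {set U}) (SR : {set E}) : {set E} :=
  [set e in SR | ~~ ((a e \in T) && (b e \in T))].

(** Connectedness of [T] by real edges inside it, phrased through the vertex sets that these edges
    do not cross, which is the form consumed by [planar_quot]. *)
Definition conn (a b : E -> U) (SR : {set E}) (T : {set U}) : Prop :=
  forall X : {set U}, {in SR, forall e, a e \in T -> b e \in T -> ~~ cut a b X e} ->
    T \subset X \/ [disjoint T & X].

Lemma cut_comp (U' : finType) (psi : U -> U') (a b : E -> U) (X : {set U'}) e :
  cut (psi \o a) (psi \o b) X e = cut a b (psi @^-1: X) e.
Proof. by rewrite /cut !inE. Qed.

Lemma mem_inner a b T SR e :
  (e \in inner a b T SR) = [&& e \in SR, a e \in T & b e \in T].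
Proof. by rewrite inE. Qed.

Lemma mem_outside a b T SR e :
  (e \in outside a b T SR) = (e \in SR) && ~~ ((a e \in T) && (b e \in T)).
Proof. by rewrite inE. Qed.

Lemma outside_sub a b T SR : outside a b T SR \subset SR.
Proof. by apply/subsetP => e; rewrite inE => /andP[]. Qed.

Lemma dg_merge (a b : E -> U) SR T t X :
  dg (merge T t \o a) (merge T t \o b) (outside a b T SR) X =
  dg a b SR (merge T t @^-1: X).
Proof.
rewrite /dg [RHS](big_setID (outside a b T SR)) /= (setIidPr (outside_sub _ _ _ _)).
rewrite [X in _ = _ + X]big1 ?addn0; first by apply: eq_bigr => e _; rewrite cut_comp.
move=> e; rewrite !inE => /andP[]; case: (e \in SR) => //=; rewrite negbK => /andP[aT bT] _.
by rewrite -cut_comp /cut /= /merge aT bT addbb.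
Qed.

Lemma planar_merge (a b : E -> U) (l r : E -> F) SR SV T t :
  conn a b SR T -> t \in T -> {in SV, forall e, ~~ ((a e \in T) && (b e \in T))} ->
  planar_struct a b l r (SR :|: SV) ->
  planar_struct (merge T t \o a) (merge T t \o b) l r (outside a b T SR :|: SV).
Proof.
move=> cT tT HV; apply: planar_quot.
- by apply: setSU; apply: outside_sub.
- move=> e; rewrite !inE; case: (e \in SV); rewrite ?orbT //= !orbF.
  case: (e \in SR) => //=; rewrite ?andbF // !andbT negbK => /andP[aT bT].
  by rewrite /merge aT bT.
move=> X HX; exists X => // u v.
have [] : T \subset X \/ [disjoint T & X].
  apply: cT => e eS aT bT; apply: HX; rewrite !inE eS aT bT /= andbT.
  by apply/negP => /HV; rewrite aT bT.
- move=> TX; rewrite /merge; case uT: (u \in T); case vT: (v \in T).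
  + by rewrite !(subsetP TX).
  + by move=> E0; rewrite -E0 tT in vT.
  + by move=> E0; rewrite E0 tT in uT.
  by move=> ->.
move=> TX; rewrite /merge; case uT: (u \in T); case vT: (v \in T).
+ by rewrite !(disjointFr TX).
+ by move=> E0; rewrite -E0 tT in vT.
+ by move=> E0; rewrite E0 tT in uT.
by move=> ->.
Qed.

End Quotients.

(** * Solving an instance on the two sides of a cut *)

Section Reduce.

Variables (U E F : finType).
Variables (a b : E -> U) (l r : E -> F) (SR SV : {set E}) (W : {set U}) (d w : U).
Hypothesis G : good a b l r SR SV W d w.
Implicit Types A B X K T : {set U}.

Let P := go_p G.

Lemma virt_not_both T : w \notin T ->
  {in SV, forall e, ~~ ((a e \in T) && (b e \in T))}.
Proof.
move=> wT e eS; apply/negP => /andP[aT bT].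
by have := pi_v P eS; case/orP => /andP[/eqP E0 _];
  [rewrite E0 (negbTE wT) in aT | rewrite E0 (negbTE wT) in bT].
Qed.

(** The cuts of the contracted instance are the old cuts that do not split [A], with the same real
    and virtual edges, so every condition is inherited. *)
Lemma good_contract A t : A \subset W -> t \in A -> conn a b SR A ->
  good (merge A t \o a) (merge A t \o b) l r (outside a b A SR) SV
    (t |: (W :\: A)) d w.
Proof.
move=> AW tA cA; have tW : t \in W by apply: (subsetP AW).
have dA : d \notin A by apply: contra (pi_dW P); apply: (subsetP AW).
have wA : w \notin A by apply: contra (pi_wW P); apply: (subsetP AW).
have mW u : u \in d |: W -> merge A t u \in d |: (t |: (W :\: A)).
  rewrite /merge !inE; case: ifP => uA /=; first by rewrite eqxx orbT.
  by case/orP => ->; rewrite ?uA ?orbT.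
have mw : merge A t w = w by rewrite /merge (negbTE wA).
have md : merge A t d = d by rewrite /merge (negbTE dA).
have preW X : X \subset t |: (W :\: A) -> merge A t @^-1: X \subset W.
  move=> XW; apply/subsetP => u; rewrite inE => /(subsetP XW).
  rewrite /merge !inE; case: ifP => uA; first by rewrite (subsetP AW u uA).
  by rewrite uA; case/orP => [/eqP -> //|/andP[]].
have pre0 X : X \subset t |: (W :\: A) -> X != set0 -> merge A t @^-1: X != set0.
  move=> XW /set0Pn[u uX]; apply/set0Pn; exists u; rewrite inE /merge.
  case uA: (u \in A) => //; have := subsetP XW u uX; rewrite !inE uA /=.
  by case/orP => // /eqP <-.
have preT X : X \subset t |: (W :\: A) -> X != t |: (W :\: A) -> merge A t @^-1: X != W.
  move=> XW; apply: contra => /eqP E0; rewrite eqEsubset XW /=; apply/subsetP => u.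
  rewrite !inE; case/orP => [/eqP ->|/andP[uA uW]].
    by have := tW; rewrite -E0 inE /merge tA.
  by have := uW; rewrite -E0 inE /merge (negbTE uA).
have virtE X : has_virt (merge A t \o a) (merge A t \o b) SV X =
    has_virt a b SV (merge A t @^-1: X).
  by apply/existsP/existsP => -[e He]; exists e; move: He; rewrite cut_comp.
split.
- split.
  + by apply: planar_merge => //; [apply: virt_not_both | apply: pi_pl P].
  + apply: disjointWl (pi_dis P); exact: outside_sub.
  + rewrite !inE (negbTE (pi_dW P)) andbF orbF.
    by apply: contraNneq dA => ->.
  + rewrite !inE (negbTE (pi_wW P)) andbF orbF.
    by apply: contraNneq wA => ->.
  + exact: pi_dw P.
  + move=> e; rewrite inE => /andP[eS] /=; have := pi_loop P eS.
    rewrite /merge; case aA: (a e \in A); case bA: (b e \in A) => //= _ _.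
      by apply: contraFneq bA => <-.
    by apply: contraFneq aA => ->.
  + by move=> e; rewrite inE => /andP[eS _] /=; apply: mW; apply: pi_ra P _ eS.
  + by move=> e; rewrite inE => /andP[eS _] /=; apply: mW; apply: pi_rb P _ eS.
  + move=> e eS /=; have := pi_v P eS; case/orP => /andP[/eqP E0 H].
      by rewrite E0 mw eqxx (mW _ H).
    by rewrite E0 mw eqxx (mW _ H) orbT.
  have [g gS Hg] := pi_g P; exists g => //.
  by move: Hg; rewrite /joins /= => /orP[]/andP[/eqP -> /eqP ->];
    rewrite mw md !eqxx ?orbT.
- rewrite dg_merge.
  have -> : merge A t @^-1: (t |: W :\: A) = W; last exact: go_D G.
  apply/setP => u; rewrite !inE /merge; case uA: (u \in A).
    by rewrite eqxx /= (subsetP AW).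
  rewrite uA /=; case: (u =P t) => //= ->; by rewrite tW.
- by move=> X XW X0 XnW; rewrite dg_merge; apply: (go_1 G); auto.
move=> X XW X0 XnW; rewrite virtE dg_merge => nV; apply: (go_2 G); auto.
Qed.

(** Everything outside [A] becomes the root, whose degree is now the size of the cut. The virtual
    edges may be thinned to [SV'], provided that cuts having one still have one and that some
    virtual edge joins the new root to [w]. *)
Lemma good_inside A (l' r' : E -> F) (SV' : {set E}) : A \subset W -> A != W -> dg a b SR A <= 6 ->
  planar_struct (merge (d |: (W :\: A)) d \o a) (merge (d |: (W :\: A)) d \o b) l' r'
    (outside a b (d |: (W :\: A)) SR :|: SV') ->
  SV' \subset SV ->
  (forall X, X \subset A -> has_virt a b SV X -> has_virt a b SV' X) ->
  (exists g x, [/\ g \in SV', x \in d |: (W :\: A) & joins a b g x w]) ->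
  good (merge (d |: (W :\: A)) d \o a) (merge (d |: (W :\: A)) d \o b) l' r'
    (outside a b (d |: (W :\: A)) SR) SV' A d w.
Proof.
set T := d |: _ => AW AnW D6 Hpl sV Hv [g [x [gS xT Hg]]].
have dA : d \notin A by apply: contra (pi_dW P); apply: (subsetP AW).
have dT : d \in T by rewrite !inE eqxx.
have wT : w \notin T.
  by rewrite !inE negb_or (negbTE (pi_wW P)) eq_sym (pi_dw P) /= andbF.
have TA u : u \in T -> u \notin A.
  by rewrite !inE => /orP[/eqP ->|/andP[]].
have mW u : u \in d |: W -> merge T d u \in d |: A.
  rewrite /merge !inE; case: (u =P d) => [->|] //=; first by rewrite eqxx.
  by move=> _ ->; rewrite andbT; case uA: (u \in A) => /=; rewrite ?uA ?orbT ?eqxx.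
have mw : merge T d w = w by rewrite /merge (negbTE wT).
have pre X : X \subset A -> merge T d @^-1: X = X.
  move=> XA; apply/setP => u; rewrite inE /merge; case uT: (u \in T) => //.
  have -> : (d \in X) = false by apply: contraNF dA; apply: (subsetP XA).
  by apply/esym/negbTE; apply: contra (TA _ uT); apply: (subsetP XA).
have notW X : X \subset A -> X != W.
  move=> XA; apply: contra AnW => /eqP E0; rewrite eqEsubset AW /= -E0 //.
split.
- split=> //.
  + apply: disjointWr sV _; apply: disjointWl (pi_dis P); exact: outside_sub.
  + by apply: contra (pi_wW P); apply: (subsetP AW).
  + exact: pi_dw P.
  + move=> e; rewrite inE => /andP[eS] /=; have := pi_loop P eS.
    rewrite /merge; case aA: (a e \in T); case bA: (b e \in T) => //= _ _.
      by apply: contraFneq bA => <-.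
    by apply: contraFneq aA => ->.
  + by move=> e; rewrite inE => /andP[eS _] /=; apply: mW; apply: (pi_ra P eS).
  + by move=> e; rewrite inE => /andP[eS _] /=; apply: mW; apply: (pi_rb P eS).
  + move=> e /(subsetP sV) eS /=; have := pi_v P eS; case/orP => /andP[/eqP E0 H].
      by rewrite E0 mw eqxx (mW _ H).
    by rewrite E0 mw eqxx (mW _ H) orbT.
  exists g => //; have mx : merge T d x = d by rewrite /merge xT.
  by move: Hg; rewrite /joins /= => /orP[]/andP[/eqP -> /eqP ->];
    rewrite mw mx !eqxx ?orbT.
- by rewrite dg_merge pre.
- move=> X XA X0 XnA; rewrite dg_merge pre //; apply: (go_1 G) => //.
    exact: subset_trans AW.
  exact: notW.
move=> X XA X0 XnA nV; rewrite dg_merge pre //; apply: (go_2 G) => //.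
- exact: subset_trans AW.
- exact: notW.
apply: contra nV => /(Hv _ XA) /existsP[e He]; apply/existsP; exists e.
by rewrite cut_comp pre.
Qed.

Variable c : U -> 'Z_3.

Lemma solve_two A :
  A \subset W ->
  (exists x1, let N1 := inner a b W SR :\: inner a b A SR in
     [/\ forall v, v \in W :\: A -> net a b N1 x1 v = c v,
      (\sum_(v in A) net a b N1 x1 v = \sum_(v in A) c v)%R
      & solvable a b SR A (fun v => c v - net a b N1 x1 v)%R]) ->
  solvable a b SR W c.
Proof.
move=> AW [x1 /= [H1 H2 [x2 Hx2]]].
set N := inner a b W SR in H1 H2 Hx2 *; set NA := inner a b A SR in H1 H2 Hx2 *.
have NAN : NA \subset N.
  apply/subsetP => e; rewrite !inE => /and3P[-> aA bA].
  by rewrite !(subsetP AW).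
have dis : [disjoint NA & N :\: NA].
  by rewrite disjoints_subset; apply/subsetP => e; rewrite !inE => ->.
have EN : N = NA :|: (N :\: NA) by rewrite -{1}(setID N NA) (setIidPr NAN).
exists (fun e => if e \in NA then x2 e else x1 e) => v vW.
rewrite -/N (net_split _ _ _ _ _ EN dis).
case vA: (v \in A); first by rewrite Hx2 // subrK.
rewrite net_out ?add0r ?H1 ?inE ?vA // => e; rewrite !inE => /and3P[_ aA bA].
by apply/andP; split; apply: contraFneq vA => <-.
Qed.

(** The contracted instance settles the edges not inside [A], and the boundary of [A] then carries
    the right total. The demand left inside [A] has total zero but is otherwise unpredictable, hence
    the quantifier over [c']. *)
Lemma solve_contract A t : A \subset W -> t \in A -> conn a b SR A ->
  solvable_below U E F (#|W| + #|SR|) -> 1 < #|A| ->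
  (\sum_(v in W) c v = 0)%R -> consistent a b SR W c ->
  (forall c', (\sum_(v in A) c' v = 0)%R -> solvable a b SR A c') ->
  solvable a b SR W c.
Proof.
move=> AW tA cA IH A1 Ec Hc solA; apply: (solve_two AW).
set psi := merge A t; set W' := t |: (W :\: A).
have tW : t \in W by apply: (subsetP AW).
pose c1 v := (\sum_(u in W | psi u == v) c u)%R.
have G1 := good_contract AW tA cA.
have psiW u : u \in W -> psi u \in W'.
  by rewrite /psi /merge !inE; case: ifP => [_|->] /=; rewrite ?eqxx // => ->; rewrite orbT.
have inW' u : (psi u \in W') = (u \in W).
  rewrite /psi /merge !inE; case: ifP => uA; first by rewrite eqxx (subsetP AW u uA).
  by rewrite uA /=; case: (u =P t) => //= ->; rewrite tW.
have innE : inner (psi \o a) (psi \o b) W' (outside a b A SR) =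
    inner a b W SR :\: inner a b A SR.
  apply/setP => e; rewrite in_setD !mem_inner mem_outside [psi \o a]lock [psi \o b]lock -!lock /comp !inW'.
  by case: (e \in SR) => //=; rewrite andbC.
have sumE X : X \subset W' -> (\sum_(v in X) c1 v = \sum_(u in psi @^-1: X) c u)%R.
  move=> XW; rewrite [RHS](partition_big psi (mem X)); last by move=> u; rewrite inE.
  apply: eq_bigr => v vX; apply: eq_bigl => u; rewrite inE.
  case: (psi u =P v) => [E0|]; rewrite ?andbF // E0 vX !andbT -inW' E0.
  exact: (subsetP XW).
have preWE : psi @^-1: W' = W by apply/setP => u; rewrite inE inW'.
have [|||x1 Hx1] := IH _ _ _ _ _ _ _ _ _ c1 G1.
- have := subset_leq_card (outside_sub a b A SR).
  have -> : #|W'| = (#|W :\: A|).+1 by rewrite cardsU1 !inE tA.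
  have := cardsID A W; rewrite (setIidPr AW); move: A1; rewrite -/W'; lia.
- by rewrite sumE // preWE.
- move=> X XW X0 XnW E1; rewrite sumE //; apply: Hc.
  + by rewrite -preWE; apply: preimsetS.
  + case/set0Pn: X0 => v vX; have := subsetP XW v vX; rewrite !inE => H.
    apply/set0Pn; exists v; rewrite inE /psi /merge.
    by case vA: (v \in A) => //; move: H vX; rewrite vA /= orbF => /eqP ->.
  + apply: contra XnW => /eqP E2; rewrite eqEsubset XW; apply/subsetP => v vW'.
    have [u uW <-] : exists2 u, u \in W & psi u = v.
      move: vW'; rewrite !inE; case/orP => [/eqP ->|/andP[vA vW]].
        by exists t => //; rewrite /psi /merge tA.
      by exists v => //; rewrite /psi /merge (negbTE vA).
    by move: uW; rewrite -E2 inE.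
  move: E1; rewrite innE => <-; rewrite [LHS](big_setID (inner a b A SR)) /=.
  rewrite big1 ?add0n => [|e]; last first.
    rewrite !inE => /andP[_ /and3P[_ aA bA]].
    by rewrite /cut !inE /psi /merge aA bA addbb.
  by apply: eq_bigr => e _; rewrite -cut_comp.
rewrite innE in Hx1.
have netE x v : net (psi \o a) (psi \o b) (inner a b W SR :\: inner a b A SR) x v =
  (\sum_(u | psi u == v) net a b (inner a b W SR :\: inner a b A SR) x u)%R.
  rewrite exchange_big /=; apply: eq_bigr => e _; rewrite -mulr_suml; congr (_ * _)%R.
  rewrite [RHS](_ : _ = \sum_(u in [set u | psi u == v]) dlt a b u e)%R; last first.
    by apply: eq_bigl => u; rewrite inE.
  by rewrite sum_dlt !inE.
exists x1 => /=; set N1 := inner a b W SR :\: inner a b A SR in Hx1 netE *.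
have HA : (\sum_(v in A) net a b N1 x1 v = \sum_(v in A) c v)%R.
  have := Hx1 t; rewrite !inE eqxx /= => /(_ isT); rewrite netE /c1.
  have fibE u : (psi u == t) = (u \in A).
    by rewrite /psi /merge; case uA: (u \in A); rewrite ?eqxx //; apply: contraFF uA => /eqP ->.
  move=> H; transitivity (\sum_(u | psi u == t) net a b N1 x1 u)%R.
    by apply: eq_bigl => u; rewrite fibE.
  rewrite H; apply: eq_bigl => u; rewrite fibE.
  by case uA: (u \in A); rewrite ?andbF // (subsetP AW).
split=> //.
- move=> v; rewrite inE => /andP[vA vW]; have := Hx1 v; rewrite !inE vA vW orbT => /(_ isT).
  have fibE u : (psi u == v) = (u == v).
    rewrite /psi /merge; case uA: (u \in A) => //.
    by apply/eqP/eqP => E0; [rewrite -E0 tA in vA | rewrite -E0 uA in vA].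
  rewrite netE /c1 => H; transitivity (\sum_(u | psi u == v) net a b N1 x1 u)%R.
    by rewrite (big_pred1 v).
  rewrite H; apply: big_pred1 => u; rewrite fibE /=.
  by case: (u =P v) => [->|]; rewrite ?vW ?andbF.
apply: solA; rewrite big_split /= sumrN HA subrr //.
Qed.

(** Since the demand inside [A] is arbitrary, consistency cannot be read off from it. It is made
    vacuous instead, by forbidding cuts of [A] with a single inner edge. *)
Lemma solve_inside_gen A (l' r' : E -> F) (SV' : {set E}) :
  A \subset W -> A != W -> dg a b SR A <= 6 ->
  planar_struct (merge (d |: (W :\: A)) d \o a) (merge (d |: (W :\: A)) d \o b) l' r'
    (outside a b (d |: (W :\: A)) SR :|: SV') ->
  SV' \subset SV ->
  (forall X, X \subset A -> has_virt a b SV X -> has_virt a b SV' X) ->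
  (exists g x, [/\ g \in SV', x \in d |: (W :\: A) & joins a b g x w]) ->
  solvable_below U E F (#|W| + #|SR|) ->
  (forall A1, A1 \subset A -> A1 != set0 -> A1 != A ->
     \sum_(e in inner a b A SR) cut a b A1 e != 1) ->
  (\sum_(v in A) c v = 0)%R -> solvable a b SR A c.
Proof.
move=> AW AnW D6 Hpl sV Hv Hg IH one Ec.
have G1 := good_inside AW AnW D6 Hpl sV Hv Hg.
set T := d |: (W :\: A) in G1 Hpl Hg *; set psi := merge T d in G1 *.
have dA : d \notin A by apply: contra (pi_dW P); apply: (subsetP AW).
have TA u : u \in T -> u \notin A by rewrite !inE => /orP[/eqP ->|/andP[]].
have psiA u v : v \in A -> (psi u == v) = (u == v).
  move=> vA; rewrite /psi /merge; case uT: (u \in T) => //.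
  have := TA _ uT => uA; apply/eqP/eqP => E0; first by rewrite -E0 (negbTE dA) in vA.
  by rewrite E0 vA in uA.
have inA u : (psi u \in A) = (u \in A).
  rewrite /psi /merge; case uT: (u \in T) => //.
  by rewrite (negbTE dA) (negbTE (TA _ uT)).
have innE : inner (psi \o a) (psi \o b) A (outside a b T SR) = inner a b A SR.
  apply/setP => e; rewrite !inE /= !inA.
  case: (e \in SR) => //=; case aA: (a e \in A) => /=; rewrite ?andbF ?andbT //.
  have -> : (a e == d) = false by apply: contraTF aA => /eqP ->.
  by case: (b e \in A).
have [|//||x Hx] := IH _ _ _ _ _ _ _ _ _ c G1.
- have := subset_leq_card (outside_sub a b T SR).
  have : #|A| < #|W| by apply: proper_card; rewrite properEneq AnW.
  lia.
- move=> X XA X0 XnA E1; exfalso; move: (one X XA X0 XnA); rewrite -E1 innE => /eqP; apply.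
  apply: eq_bigr => e _; rewrite cut_comp; congr nat_of_bool; rewrite /cut !inE.
  have H u : (psi u \in X) = (u \in X).
    rewrite /psi /merge; case uT: (u \in T) => //.
    have -> : (d \in X) = false by apply: contraNF dA; apply: (subsetP XA).
    by apply/esym/negbTE; apply: contra (TA _ uT); apply: (subsetP XA).
  by rewrite !H.
exists x => v vA; rewrite -(Hx v vA) innE; apply: eq_bigr => e _; congr (_ * _)%R.
by rewrite /dlt /= !psiA.
Qed.

Lemma solve_inside A : A \subset W -> A != W -> dg a b SR A <= 6 ->
  conn a b SR (d |: (W :\: A)) ->
  solvable_below U E F (#|W| + #|SR|) ->
  (forall A1, A1 \subset A -> A1 != set0 -> A1 != A ->
     \sum_(e in inner a b A SR) cut a b A1 e != 1) ->
  (\sum_(v in A) c v = 0)%R -> solvable a b SR A c.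
Proof.
move=> AW AnW D6 cT; apply: (@solve_inside_gen A l r SV) => //.
- apply: planar_merge => //; [by rewrite !inE eqxx | | exact: pi_pl P].
  apply: virt_not_both; rewrite !inE negb_or (negbTE (pi_wW P)) eq_sym (pi_dw P) /=.
  by rewrite andbF.
have [g gS Hg] := pi_g P; exists g, d; split=> //; by rewrite !inE eqxx.
Qed.

(** Two parts of [A] with no edge between them would divide fewer than eight boundary edges, but
    each has at least four. *)
Lemma conn_small A : A \subset W -> A != W -> dg a b SR A < 8 -> conn a b SR A.
Proof.
move=> AW AnW D8 X HX.
have [E1|A1] := eqVneq (A :&: X) set0; last first.
  have [E2|A2] := eqVneq (A :\: X) set0.
    by left; rewrite -setD_eq0 E2.
  exfalso.
  have dis : [disjoint A :&: X & A :\: X].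
    by rewrite disjoints_subset; apply/subsetP => u; rewrite !inE => /andP[_ ->].
  have := dgU a b SR dis; rewrite setID big1; last first.
    move=> e eS; apply/eqP; rewrite eqb0; apply/negP; move: (HX e eS).
    rewrite /cut !inE; case: (a e \in A); case: (b e \in A) => //=;
      case: (a e \in X); case: (b e \in X) => //= H; have := H isT isT => //.
  have sub B : B \subset A -> B \subset W /\ B != W.
    move=> BA; split; first exact: subset_trans AW.
    by apply: contra AnW => /eqP E0; rewrite eqEsubset AW -E0 BA.
  have [s1 n1] := sub _ (subsetIl A X); have [s2 n2] := sub _ (subsetDl A X).
  have := go_1 G s1 A1 n1; have := go_1 G s2 A2 n2; lia.
by right; rewrite -setI_eq0 E1.
Qed.

(** A part [K] of the outside not joined to the root sends all its edges to [A], so [A] together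
    with [K] has at most 6 - 4 boundary edges and fills [W]. Then the root and the rest of [W] are
    both adjacent to [A] only. *)
Lemma conn_root A : A \subset W -> A != set0 -> dg a b SR A <= 6 ->
  conn a b SR (d |: (W :\: A)) \/
  [/\ dg a b SR A = dg a b SR W + dg a b SR (W :\: A)
    & forall e, e \in SR -> ~~ ((a e == d) && (b e \in W :\: A)) &&
        ~~ ((b e == d) && (a e \in W :\: A))].
Proof.
move=> AW A0 D6; set T := d |: _.
case: (boolP [exists K : {set U}, [&& K \subset W :\: A, K != set0 &
   [forall e, (e \in SR) ==> (a e \in T) ==> (b e \in T) ==> ~~ cut a b K e]]]).
  case/existsP => K /and3P[KT K0 /forallP HK]; right.
  have KW : K \subset W by apply: subset_trans KT _; apply: subsetDl.
  have KnW : K != W.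
    apply: contra A0 => /eqP E0; apply/eqP/setP => u; rewrite inE; apply/negP => uA.
    have := subsetP AW u uA; rewrite -E0 => /(subsetP KT).
    by rewrite inE uA.
  have dis : [disjoint A & K].
    rewrite disjoint_sym disjoints_subset; apply: subset_trans KT _.
    by apply/subsetP => u; rewrite !inE => /andP[].
  have dK : d \notin K by apply: contra (pi_dW P); apply: (subsetP KW).
  have toA e : e \in SR -> cut a b K e -> cut a b A e.
    move=> eS cK; have := HK e; rewrite eS cK /=.
    have := pi_ra P eS; have := pi_rb P eS; rewrite !inE.
    move: cK; rewrite /cut; case aK: (a e \in K); case bK: (b e \in K) => //= _.
      have /andP[aA aW] : (a e \notin A) && (a e \in W) by have := subsetP KT _ aK; rewrite inE.
      rewrite aA aW (negbTE aA) /= orbT; case: (b e =P d) => //= _ bW _.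
      by rewrite bW andbT; case: (b e \in A).
    have /andP[bA bW] : (b e \notin A) && (b e \in W) by have := subsetP KT _ bK; rewrite inE.
    rewrite bA bW (negbTE bA) /= !orbT; case: (a e =P d) => //= _ _ aW.
    by rewrite aW andbT; case: (a e \in A).
  have E1 := dgU a b SR dis.
  have E2 : \sum_(e in SR) (cut a b A e && cut a b K e) = dg a b SR K.
    apply: eq_bigr => e eS; case cK: (cut a b K e); rewrite ?andbF // andbT.
    by rewrite (toA _ eS cK).
  rewrite E2 in E1; have K4 := go_1 G KW K0 KnW.
  have EW : A :|: K = W.
    apply/eqP; apply: contraT => ne.
    have s1 : A :|: K \subset W by rewrite subUset AW.
    have n0 : A :|: K != set0.
      by apply: contra K0 => /eqP E0; rewrite -subset0 -E0 subsetUr.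
    by have := go_1 G s1 n0 ne; lia.
  have EK : W :\: A = K.
    rewrite -EW setDUl setDv set0U; apply/setDidPl; by rewrite disjoint_sym.
  split; first by rewrite EK -EW; lia.
  move=> e eS; rewrite EK; have := HK e; rewrite eS /= /cut.
  have inT u : u \in K -> u \in T by move=> uK; rewrite inE EK uK orbT.
  have dT : d \in T by rewrite !inE eqxx.
  apply: contraLR; rewrite negb_and !negbK => /orP[]/andP[/eqP E0 H].
    by rewrite E0 dT (inT _ H) H (negbTE dK).
  by rewrite E0 dT (inT _ H) H (negbTE dK).
rewrite negb_exists => /forallP nK; left=> X HX.
wlog dX : X HX / d \notin X.
  move=> wl; case dX: (d \in X); last by apply: wl; rewrite ?dX.
  have [] := wl (~: X).
  - by move=> e eS aT bT; rewrite cutC; apply: HX.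
  - by rewrite inE dX.
  - by move=> /subsetP /(_ d); rewrite !inE eqxx dX => /(_ isT).
  by rewrite disjoints_subset setCK; left.
have := nK (T :&: X); rewrite !negb_and; case/or3P.
- case/negP; apply/subsetP => u; rewrite !inE => /andP[/orP[/eqP E0|//] uX].
  by rewrite E0 (negbTE dX) in uX.
- by rewrite negbK setI_eq0; right.
case/negP; apply/forallP => e; apply/implyP => eS; apply/implyP => aT; apply/implyP => bT.
by have := HX e eS aT bT; rewrite /cut !inE -!in_setD -!in_setU1 -/T aT bT.
Qed.

End Reduce.

(** * Minimal counterexamples *)

(* The numerous boolean hypotheses slow lia down. *)
Ltac slia := repeat match goal with
  | H : @eq ?T ?x ?y |- _ => lazymatch T with nat => fail | _ => idtac end;
      let t := eval hnf in T in lazymatch t with nat => change (@eq nat x y) in H end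
  end; repeat match goal with
  | H : ?T |- _ => lazymatch T with
    | is_true (leq _ _) => fail
    | @eq nat _ _ => fail
    | not (@eq nat _ _) => fail
    | _ => clear H
    end
  end; lia.

Section Tools.

Variables (U E F : finType).
Implicit Types (a b : E -> U) (l r : E -> F) (SR SV S N : {set E}) (A B W X : {set U}).
Implicit Types (e f h k : E) (u v x y z d w : U) (c : U -> 'Z_3).

Lemma joinsC a b e u v : joins a b e u v = joins a b e v u.
Proof. by rewrite /joins orbC. Qed.

Lemma cut_joins a b e u v X : joins a b e u v ->
  cut a b X e = (u \in X) (+) (v \in X).
Proof.
by rewrite /cut => /orP[]/andP[/eqP -> /eqP ->] //; rewrite addbC.
Qed.

Lemma cut1_joins a b e x : cut a b [set x] e -> exists2 y, y != x & joins a b e x y.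
Proof.
rewrite /cut /joins !inE; case: (a e =P x) => [->|/eqP Ha].
  by case: (b e =P x) => //= /eqP Hb _; exists (b e); rewrite ?eqxx.
by case: (b e =P x) => //= E0 _; exists (a e); [exact: Ha | rewrite eqxx].
Qed.

Lemma joins_cut1 a b e x y : x != y -> joins a b e x y -> cut a b [set x] e.
Proof. by move=> xy /cut_joins ->; rewrite !inE eqxx eq_sym (negbTE xy). Qed.

Lemma joins_inj a b e x y z : joins a b e x y -> joins a b e x z -> y = z.
Proof.
by rewrite /joins => /orP[]/andP[/eqP-> /eqP->] /orP[]/andP[/eqP E1 /eqP E2] //;
  rewrite ?E1 ?E2 // -?E1 -?E2.
Qed.

Lemma dlt_sg a b g x y (q : bool) : x != y -> joins a b g x y ->
  (dlt a b x g * sg (if a g == x then q else ~~ q) = sg q)%R.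
Proof.
move=> xy jg; have ne : a g != b g.
  by move: jg => /orP[]/andP[/eqP -> /eqP ->] //; rewrite eq_sym.
rewrite dltE //; case: (a g =P x) => [_|na]; first by rewrite mul1r.
move: jg => /orP[]/andP[/eqP Ea /eqP Eb]; first by rewrite Ea in na.
by rewrite Eb eqxx sgN mulN1r opprK.
Qed.

(** The end [x] of [h] travels along [k] to [z]. Only the faces of [k] change: [k] trades the shared
    face for the other face of [h], and if it was a bridge, it comes to lie on both faces of [h]. *)
Lemma slide_ex a b l r S h k x y z a' b' :
  h \in S -> k \in S -> h != k -> joins a b h x y -> joins a b k x z ->
  (l k == r k) || [exists f, inc l r f h && inc l r f k] ->
  (forall e, e != h -> a' e = a e /\ b' e = b e) -> joins a' b' h y z ->
  planar_struct a b l r S ->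
  exists l' r', planar_struct a' b' l' r' S /\ forall e, e != k -> l' e = l e /\ r' e = r e.
Proof.
move=> hS kS hk jh jk sh agr jh' Pl.
pose fs : F * F := if l k == r k then (l h, r h) else
  if l k == l h then (r k, r h) else if l k == r h then (r k, l h) else
  if r k == l h then (l k, r h) else (l k, l h).
exists (fun e => if e == k then fs.1 else l e), (fun e => if e == k then fs.2 else r e).
split; last by move=> e /negbTE ->.
apply: (planar_slide hS kS hk) Pl => [e eS X|e eS f].
  case: (e =P h) => [->|/eqP eh] /=; last by rewrite addbF /cut; have [-> ->] := agr e eh.
  rewrite (cut_joins _ jh') (cut_joins _ jh) (cut_joins _ jk).
  by do 3 case: (_ \in X).
rewrite /inc; case: (e =P k) => [->|_] /=; last by rewrite addbF.
rewrite /fs; case: (l k =P r k) sh => [->|/eqP lr] /= sh; first by rewrite addbb.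
case: (l k =P l h) => [->|/eqP n1] /=; first by do 3 case: (_ == f).
case: (l k =P r h) => [->|/eqP n2] /=; first by do 3 case: (_ == f).
case: (r k =P l h) => [->|/eqP n3] /=; first by do 3 case: (_ == f).
case: (r k =P r h) => [->|/eqP n4] /=; first by do 3 case: (_ == f).
case/existsP: sh => f0; rewrite /inc.
case: (l h =P f0) => [E1|_]; case: (r h =P f0) => [E2|_] //=.
  by rewrite -E1 (negbTE n1) (negbTE n3).
by rewrite -E2 (negbTE n2) (negbTE n4).
Qed.

Lemma solvable_ext a b a' b' SR SR' W c :
  inner a' b' W SR' = inner a b W SR ->
  {in inner a b W SR, forall e, a' e = a e /\ b' e = b e} ->
  solvable a' b' SR' W c -> solvable a b SR W c.
Proof.
move=> E0 agr [x Hx]; exists x => v vW; rewrite -(Hx v vW) E0.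
by apply: eq_bigr => e eN; rewrite /dlt; have [-> ->] := agr e eN.
Qed.

Lemma solvable_del a b a' b' SR W c h : h \in inner a b W SR ->
  (forall e, e != h -> a' e = a e /\ b' e = b e) ->
  solvable a' b' (SR :\ h) W (fun v => c v - dlt a b v h)%R -> solvable a b SR W c.
Proof.
move=> hN agr [x Hx]; exists (fun e => if e == h then true else x e) => v vW.
rewrite /net (big_setD1 h) //= eqxx mulr1.
have H := Hx v vW; rewrite -[RHS](addrNK (dlt a b v h)) -[(c v - _)%R]H addrC.
congr (_ + _)%R; apply: eq_big => [e|e]; rewrite !inE.
  by case: (e =P h) => //= /eqP eh; have [-> ->] := agr e eh.
by case/andP=> eh _; have [E1 E2] := agr e eh; rewrite /dlt E1 E2 (negbTE eh).
Qed.

(** Net flows inside [W] add up to zero, so the last vertex comes for free. *)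
Lemma net_last a b W SR c (x : E -> bool) v : (\sum_(u in W) c u = 0)%R -> v \in W ->
  (forall u, u \in W -> u != v -> net a b (inner a b W SR) x u = c u) ->
  net a b (inner a b W SR) x v = c v.
Proof.
move=> Ec vW H; set N := inner a b W SR.
have : (\sum_(u in W) net a b N x u = 0)%R.
  rewrite sum_net big1 // => e; rewrite inE => /and3P[_ -> ->].
  by rewrite subrr mul0r.
move: Ec; rewrite (bigD1 v) //= => E1; rewrite (bigD1 v) //=.
have -> : (\sum_(i in W | i != v) net a b N x i = \sum_(i in W | i != v) c i)%R.
  by apply: eq_bigr => i /andP[iW iv]; apply: H.
by move=> E2; apply: (addIr (\sum_(i in W | i != v) c i)%R); rewrite E1.
Qed.

(** As finite functions the orientations are finitely many, so an unsolvable instance may be assumed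
    without any appeal to choice or excluded middle. *)
Lemma solvableP a b SR W c :
  reflect (solvable a b SR W c)
    [exists x : {ffun E -> bool}, [forall v in W, net a b (inner a b W SR) x v == c v]].
Proof.
apply: (iffP existsP) => -[x Hx].
  by exists x => v vW; apply/eqP; apply: (implyP (forallP Hx v)).
exists [ffun e => x e]; apply/forallP => v; apply/implyP => vW; apply/eqP.
by rewrite -(Hx v vW); apply: net_ext => e _; rewrite ffunE.
Qed.

End Tools.

Section Minimal.

Variables (U E F : finType).
Variables (a b : E -> U) (l r : E -> F) (SR SV : {set E}) (W : {set U}) (d w : U).
Variable c : U -> 'Z_3.
Hypothesis G : good a b l r SR SV W d w.
Hypothesis IH : solvable_below U E F (#|W| + #|SR|).
Hypothesis Ec : (\sum_(v in W) c v = 0)%R.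
Hypothesis Hc : consistent a b SR W c.
Hypothesis nosol : ~ solvable a b SR W c.
Hypothesis clean : forall v e f, v != w -> e \in SV -> f \in SV ->
  cut a b [set v] e -> cut a b [set v] f -> e = f.

Implicit Types (A B X K T : {set U}) (e f h k : E) (u v x y z : U).

Let P := go_p G.
Local Notation dgr := (dg a b SR).
Local Notation deg v := (dg a b SR [set v]).
Local Notation D := (dg a b SR W).
Local Notation N := (inner a b W SR).

Lemma properN A : A \subset W -> A != W -> (A != set0 -> W :\: A != W) /\ W :\: A != set0.
Proof.
move=> AW AnW; split.
  case/set0Pn=> u uA; apply/negP => /eqP E0.
  by have := subsetP AW u uA; rewrite -E0 inE uA.
by rewrite setD_eq0; apply: contra AnW => WA; rewrite eqEsubset AW.
Qed.

Lemma sub_proper A B : B \subset A -> A \subset W -> A != W -> B \subset W /\ B != W.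
Proof.
move=> BA AW AnW; split; first exact: subset_trans AW.
by apply: contra AnW => /eqP E0; rewrite eqEsubset AW -E0.
Qed.

Lemma card_gt1_neq0 A : 1 < #|A| -> A != set0.
Proof. by move=> A1; rewrite -card_gt0; apply: leq_trans A1. Qed.

Lemma split4 A B : A \subset W -> A != W -> B \subset A -> B != set0 -> B != A ->
  4 <= dgr B /\ 4 <= dgr (A :\: B).
Proof.
move=> AW AnW BA B0 BnA; split.
  by have [? ?] := sub_proper BA AW AnW; apply: (go_1 G).
have [? ?] := sub_proper (subsetDl A B) AW AnW; apply: (go_1 G) => //.
by rewrite setD_eq0; apply: contra BnA => AB; rewrite eqEsubset BA.
Qed.

(** Both sides of a small cut are smaller instances: solve with [A] contracted, then solve [A] with
    the outside as root. In a counterexample this can fail only through a cut of [A] with a single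
    inner edge. *)
Lemma reduce_cut A : A \subset W -> A != W -> 1 < #|A| -> dgr A <= 6 ->
  conn a b SR (d |: (W :\: A)) ->
  ~ (forall B, B \subset A -> B != set0 -> B != A ->
     \sum_(e in inner a b A SR) cut a b B e != 1).
Proof.
move=> AW AnW A1 D6 cT one; apply: nosol.
have [t tA] := set0Pn _ (card_gt1_neq0 A1).
apply: (solve_contract G AW tA) => //.
  by apply: (conn_small G) => //; slia.
by move=> c' Ec'; apply: (solve_inside G) Ec'.
Qed.

Lemma cut_no_conn A : A \subset W -> A != W -> 1 < #|A| -> dgr A <= 5 ->
  ~ conn a b SR (d |: (W :\: A)).
Proof.
move=> AW AnW A1 D5 cT; apply: (reduce_cut AW AnW A1 _ cT); first by slia.
move=> B BA B0 BnA; apply/eqP => E1.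
have [] := split4 AW AnW BA B0 BnA; have := dg_inner a b SR BA; rewrite E1; slia.
Qed.

Lemma cut5 A : 0 < D -> A \subset W -> A != W -> 1 < #|A| -> 5 <= dgr A.
Proof.
move=> D0 AW AnW A1; rewrite leqNgt; apply/negP => lt.
have A0 := card_gt1_neq0 A1.
have [|cT|[E1 _]] := conn_root G AW A0; first by slia.
  by apply: (cut_no_conn AW AnW A1) cT; slia.
have [/(_ A0) n1 n2] := properN AW AnW.
by have := go_1 G (subsetDl W A) n2 n1; slia.
Qed.

Lemma cut_conn A : 3 <= D -> A \subset W -> A != W -> A != set0 -> dgr A <= 6 ->
  conn a b SR (d |: (W :\: A)).
Proof.
move=> D3 AW AnW A0 D6; have [//|[E1 _]] := conn_root G AW A0 D6.
have [/(_ A0) n1 n2] := properN AW AnW.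
by have := go_1 G (subsetDl W A) n2 n1; slia.
Qed.

Lemma cut6 A : 3 <= D -> A \subset W -> A != W -> 1 < #|A| -> 6 <= dgr A.
Proof.
move=> D3 AW AnW A1; rewrite leqNgt; apply/negP => lt.
by apply: (cut_no_conn AW AnW A1) (cut_conn D3 AW AnW (card_gt1_neq0 A1) _); slia.
Qed.

(** The obstruction is a single inner edge, and 4 + 4 = 6 + 2 leaves no slack: both parts have
    exactly four boundary edges and, by [cut6], one vertex each. *)
Lemma cut6_eq A : 3 <= D -> A \subset W -> A != W -> 1 < #|A| -> dgr A = 6 ->
  exists p q, [/\ A = [set p; q], p != q, deg p = 4 & deg q = 4].
Proof.
move=> D3 AW AnW A1 E6.
have cT := cut_conn D3 AW AnW (card_gt1_neq0 A1) (eq_leq E6).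
case: (boolP [exists B : {set U}, [&& B \subset A, B != set0, B != A &
   \sum_(e in inner a b A SR) cut a b B e == 1]]); last first.
  rewrite negb_exists => /forallP nB; exfalso.
  apply: (reduce_cut AW AnW A1 (eq_leq E6) cT) => B BA B0 BnA.
  by have := nB B; rewrite BA B0 BnA.
case/existsP => B /and4P[BA B0 BnA /eqP E1].
have [h1 h2] := split4 AW AnW BA B0 BnA.
have := dg_inner a b SR BA; rewrite E1 E6 => E8.
have [s1 s2] := sub_proper BA AW AnW.
have [s3 s4] := sub_proper (subsetDl A B) AW AnW.
have c1 : #|B| = 1.
  apply/eqP; rewrite eqn_leq card_gt0 B0 andbT leqNgt; apply/negP => lt.
  by have := cut6 D3 s1 s2 lt; slia.
have c2 : #|A :\: B| = 1.
  apply/eqP; rewrite eqn_leq card_gt0; apply/andP; split.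
    by rewrite leqNgt; apply/negP => lt; have := cut6 D3 s3 s4 lt; slia.
  by rewrite setD_eq0; apply: contra BnA => AB; rewrite eqEsubset BA.
have [p Ep] := cards1P (introT eqP c1); have [q Eq] := cards1P (introT eqP c2).
exists p, q; rewrite -Eq -Ep; split; try slia.
  by rewrite -{1}(setID A B) (setIidPr BA).
have : q \in A :\: B by rewrite Eq set11.
by rewrite Ep !inE eq_sym => /andP[].
Qed.

Lemma cut7 A v : 3 <= D -> A \subset W -> A != W -> 1 < #|A| -> v \in A -> 5 <= deg v ->
  7 <= dgr A.
Proof.
move=> D3 AW AnW A1 vA d5; have := cut6 D3 AW AnW A1.
rewrite leq_eqVlt => /orP[/eqP/esym E6|//].
have [p [q [E0 _ dp dq]]] := cut6_eq D3 AW AnW A1 E6.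
by move: vA; rewrite E0 !inE => /orP[]/eqP E1; subst v; slia.
Qed.

Lemma cut7_card A : 3 <= D -> A \subset W -> A != W -> 2 < #|A| -> 7 <= dgr A.
Proof.
move=> D3 AW AnW A2; have A1 : 1 < #|A| by slia.
have := cut6 D3 AW AnW A1.
rewrite leq_eqVlt => /orP[/eqP/esym E6|//].
have [p [q [E0 pq _ _]]] := cut6_eq D3 AW AnW A1 E6.
by move: A2; rewrite E0 cards2 pq.
Qed.

Lemma deg4 v : v \in W -> 1 < #|W| -> 4 <= deg v.
Proof.
move=> vW W1; apply: (go_1 G); rewrite ?sub1set //.
  by apply/set0Pn; exists v; rewrite set11.
by apply: contraTneq W1 => <-; rewrite cards1.
Qed.

(** Two parallel edges reach every residue by [sg2_ex], so their ends can be contracted and the pair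
    meets whatever demand is left over. *)
Lemma no_parallel e f x y : x \in W -> y \in W -> x != y -> e \in SR -> f \in SR ->
  joins a b e x y -> joins a b f x y -> e = f.
Proof.
move=> xW yW xy eS fS je jf; apply/eqP; apply: contraT => ef.
case: nosol; pose A := [set x; y].
have AW : A \subset W by apply/subsetP => u; rewrite !inE => /orP[]/eqP->.
apply: (solve_contract G AW (set21 x y)) => //; last 2 first.
- by rewrite cards2 xy.
- move=> c' Ec'; set NA := inner a b A SR.
  have eN : e \in NA.
    by move: je; rewrite !inE eS => /orP[]/andP[/eqP -> /eqP ->]; rewrite !eqxx ?orbT.
  have fN : f \in NA.
    by move: jf; rewrite !inE fS => /orP[]/andP[/eqP -> /eqP ->]; rewrite !eqxx ?orbT.
  pose R := net a b (NA :\ e :\ f) xpredT x.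
  have [s [t Est]] := sg2_ex (c' x - R)%R.
  pose X g := if g == e then (if a e == x then s else ~~ s) else
    if g == f then (if a f == x then t else ~~ t) else true.
  have dsg g q jg := @dlt_sg _ _ a b g x y q xy jg.
  have Hx : net a b NA X x = c' x.
    rewrite /net (big_setD1 e) //= (big_setD1 f) /=; last by rewrite inE fN inE eq_sym ef.
    rewrite {1}/X eqxx dsg // {1}/X eq_sym (negbTE ef) eqxx dsg //.
    rewrite (_ : \sum_(_ in _) _ = R)%R; first by rewrite addrA Est subrK.
    apply: eq_bigr => g; rewrite !inE => /and3P[gf ge _].
    by rewrite /X (negbTE gf) (negbTE ge).
  exists X => v; rewrite !inE => /orP[/eqP -> //|/eqP ->].
  apply: (net_last Ec'); first by rewrite !inE eqxx orbT.
  by move=> u; rewrite !inE => /orP[/eqP -> //|/eqP -> /eqP].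
move=> X HX.
have := HX e eS; rewrite (cut_joins X je).
move=> H.
have xyX : (x \in X) = (y \in X).
  have : ~~ ((x \in X) (+) (y \in X)).
    by apply: H; move: je; rewrite !inE => /orP[]/andP[Ha Hb]; rewrite ?Ha ?Hb ?orbT.
  by do 2 case: (_ \in X).
case xX: (x \in X).
  by left; apply/subsetP => u; rewrite !inE => /orP[]/eqP ->; rewrite -?xyX.
right; rewrite -setI_eq0; apply/eqP/setP => u; rewrite !inE.
by apply/negP => /andP[/orP[]/eqP ->]; rewrite -?xyX xX.
Qed.

Lemma dg_root B : B \subset W ->
  dgr (W :\: B) + 2 * (\sum_(e in SR) (cut a b W e && cut a b B e)) = D + dgr B.
Proof.
move=> BW; rewrite /dg big_distrr /= -!big_split /=; apply: eq_bigr => e _.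
rewrite /cut !inE; have := subsetP BW (a e); have := subsetP BW (b e).
move=> /implyP + /implyP.
by case: (a e \in W); case: (b e \in W); case: (a e \in B); case: (b e \in B).
Qed.

Lemma cut_root e : e \in SR -> cut a b W e = cut a b [set d] e.
Proof.
move=> eS; have := pi_ra P eS; have := pi_rb P eS; have := pi_loop P eS.
rewrite /cut !inE; have dW := negbTE (pi_dW P).
by case: (a e =P d) => [->|_]; case: (b e =P d) => [->|_];
  rewrite ?eqxx ?dW //=; case: (a e \in W); case: (b e \in W).
Qed.

Lemma no_loop_W e : e \in SR -> ~~ cut a b W e -> (a e \in W) && (b e \in W).
Proof.
move=> eS; rewrite cut_root //; have := pi_ra P eS; have := pi_rb P eS; have := pi_loop P eS.
rewrite /cut !inE; case: (a e =P d) => [->|_]; case: (b e =P d) => [->|_]; rewrite ?eqxx //=.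
by move=> _ -> ->.
Qed.

Lemma has_edge A : 0 < dgr A -> exists2 e, e \in SR & cut a b A e.
Proof.
rewrite /dg => H; case: (boolP [exists e in SR, cut a b A e]).
  by case/existsP => e /andP[eS ce]; exists e.
rewrite negb_exists => /forallP H1; move: H; rewrite big1 // => e eS.
by have := H1 e; rewrite eS /= => /negbTE ->.
Qed.

(** With two vertices the counts force an inner edge and [no_parallel] allows only one; consistency
    then says that the value it must carry is not zero. *)
Lemma card_W : 2 < #|W|.
Proof.
rewrite ltnNge; apply/negP => le; case: nosol.
have [W0|W1|W2] : [\/ #|W| = 0, #|W| = 1 | #|W| = 2].
  by move: le; case: #|W| => [|[|[|]]] //; [constructor 1|constructor 2|constructor 3].
- by exists xpredT => v; rewrite (cards0_eq W0) inE.
- have [v Ev] := cards1P (introT eqP W1); exists xpredT => u uW.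
  by apply: (net_last Ec) => // t; move: uW; rewrite Ev !inE => /eqP -> /eqP ->; rewrite eqxx.
have /cards2P[u [v [uv EW]]] : #|W| == 2 by rewrite W2.
have uW : u \in W by rewrite EW !inE eqxx.
have vW : v \in W by rewrite EW !inE eqxx orbT.
have sW : [set u] \subset W by rewrite sub1set.
have jN e : e \in N -> joins a b e u v.
  rewrite mem_inner => /and3P[eS]; have := pi_loop P eS; rewrite EW !inE /joins => ab Ha Hb.
  by move: ab Ha Hb => + /orP[]/eqP Ea /orP[]/eqP Eb; rewrite Ea Eb !eqxx ?orbT.
have uN e f : e \in N -> f \in N -> e = f.
  move=> eN fN; apply: (no_parallel uW vW uv) (jN _ eN) (jN _ fN).
    exact: (subsetP (inner_sub a b SR W) _ eN).
  exact: (subsetP (inner_sub a b SR W) _ fN).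
have W1 : 1 < #|W| by rewrite W2.
have EV : W :\: [set u] = [set v].
  apply/setP => t; rewrite EW !inE; case: (t =P u) => [->|] //=.
  by rewrite (negbTE uv).
have E1 := dg_inner a b SR sW; rewrite EV in E1.
have [e eN] : exists e, e \in N.
  case: (set_0Vmem N) => [N0|[e eN]]; last by exists e.
  move: E1; rewrite N0 big_set0 muln0 addn0.
  by have := deg4 uW W1; have := deg4 vW W1; have := go_D G; slia.
have EN : N = [set e].
  by apply/setP => f; rewrite inE; apply/idP/eqP => [fN|->//]; apply: uN.
have cu : (c u != 0)%R.
  have := Hc sW; rewrite EN !big_set1; apply.
  - by apply/set0Pn; exists u; rewrite set11.
  - by apply: contraTneq W1 => <-; rewrite cards1.
  by rewrite (joins_cut1 uv (jN _ eN)).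
have [s Es] := sg_ex cu.
pose X (f : E) := if a e == u then s else ~~ s.
have Hu : net a b N X u = c u.
  by rewrite /net EN big_set1 /X (dlt_sg s uv (jN _ eN)).
exists X => t tW; case: (t =P u) => [->//|/eqP tu].
have Et : t = v by move: tW tu; rewrite EW !inE => /orP[]/eqP -> //; rewrite eqxx.
rewrite Et; apply: (net_last Ec) => // y yW yv.
suff -> : y = u by [].
by move: yW yv; rewrite EW !inE => /orP[]/eqP -> //; rewrite eqxx.
Qed.

Lemma xor_other (I : finType) (Q : {set I}) (B : I -> bool) i : i \in Q -> B i ->
  \big[addb/false]_(j in Q) B j = false -> exists2 j, j \in Q & (j != i) && B j.
Proof.
move=> iQ Bi; rewrite (big_setD1 i) //= Bi => H.
case: (boolP [exists j in Q, (j != i) && B j]).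
  by case/existsP => j /andP[jQ Hj]; exists j.
rewrite negb_exists => /forallP H1; move: H; rewrite big1 // => j; rewrite !inE => /andP[ji jQ].
by have := H1 j; rewrite jQ ji /= => /negbTE.
Qed.

Lemma virt_ends e : e \in SV -> exists2 x, x \in d |: W & joins a b e x w.
Proof.
move=> eS; rewrite /joins; case/orP: (pi_v P eS) => /andP[/eqP -> H].
  by exists (b e); rewrite ?eqxx ?orbT.
by exists (a e); rewrite ?eqxx.
Qed.

Lemma dW_neq_w x : x \in d |: W -> x != w.
Proof.
rewrite !inE => /orP[/eqP ->|xW]; first exact: pi_dw P.
by apply: contraTneq xW => ->; apply: pi_wW P.
Qed.

(** The star of [x] meets a face of [k] in an even number of edges, so a second edge at [x] lies on
    that face. It is real, because [clean] leaves one virtual edge at [x]. If [k] is a bridge, any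
    real edge at [x] will do. *)
Lemma near_virt k x : k \in SV -> x \in d |: W -> joins a b k x w -> 0 < deg x ->
  exists h y, [/\ h \in SR, joins a b h x y, x != y, y \in d |: W &
     (l k == r k) || [exists f, inc l r f h && inc l r f k]].
Proof.
move=> kS xW jk dx.
suff [h hS /andP[ch sh]] : exists2 h, h \in SR &
    cut a b [set x] h && ((l k == r k) || [exists f, inc l r f h && inc l r f k]).
  have [y yx jh] := cut1_joins ch; exists h, y; split=> //; first by rewrite eq_sym.
  by move: jh (pi_ra P hS) (pi_rb P hS) => /orP[]/andP[/eqP -> /eqP ->].
case: (l k =P r k) => [_|/eqP lr] /=.
  by have [h hS ch] := has_edge dx; exists h; rewrite ?ch.
have [D1 _] := pi_pl P.
have xw := dW_neq_w xW.
have ck : cut a b [set x] k by apply: joins_cut1 xw jk.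
have ik : inc l r (l k) k by rewrite /inc eqxx eq_sym (negbTE lr).
have [||h hS /andP[hk /andP[ch ih]]] := @xor_other _ (SR :|: SV)
  (fun e => cut a b [set x] e && inc l r (l k) e) k _ _ (D1 [set x] (l k)).
- by rewrite inE kS orbT.
- by rewrite ck ik.
move: hS; rewrite inE => /orP[hS|hV].
  by exists h => //; rewrite ch /=; apply/existsP; exists (l k); rewrite ih ik.
by rewrite (clean xw hV kS ch ck) eqxx in hk.
Qed.

(** [h] leaves [x] along the virtual edge [k] and becomes a virtual edge from [y] to [w]. A cut
    crossed by [h] loses one real edge, which is why five are asked of it; a cut that afterwards has
    no virtual edge contains neither end of [h] and has lost nothing. *)
Lemma good_slide k h x y : k \in SV -> joins a b k x w -> h \in SR -> joins a b h x y ->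
  x \in d |: W -> y \in d |: W ->
  (l k == r k) || [exists f, inc l r f h && inc l r f k] ->
  (forall A, A \subset W -> A != set0 -> A != W -> cut a b A h -> 5 <= dgr A) ->
  exists a' b' (l' r' : E -> F), (forall e, e != h -> a' e = a e /\ b' e = b e) /\
    good a' b' l' r' (SR :\ h) (h |: SV) W d w.
Proof.
move=> kS jk hS jh xW yW sh Hcut.
have hV : h \notin SV by rewrite (disjointFr (pi_dis P) hS).
have kh : h != k by apply: contraNneq hV => ->.
pose a' e := if e == h then y else a e; pose b' e := if e == h then w else b e.
have agr e : e != h -> a' e = a e /\ b' e = b e by rewrite /a' /b' => /negbTE ->.
have jh' : joins a' b' h y w by rewrite /joins /a' /b' !eqxx.
have [||l' [r' [Pl' _]]] := slide_ex _ _ kh jh jk sh agr jh' (pi_pl P).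
- by rewrite inE hS.
- by rewrite inE kS orbT.
exists a', b', l', r'; split=> //.
have dgE A : dg a' b' (SR :\ h) A + cut a b A h = dgr A.
  rewrite /dg [RHS](big_setD1 h) //= addnC; congr (_ + _); apply: eq_bigr => e.
  by rewrite !inE => /andP[eh _]; have [E1 E2] := agr e eh; rewrite /cut E1 E2.
have virtE A : has_virt a b SV A -> has_virt a' b' (h |: SV) A.
  case/existsP=> e /andP[eS ce]; apply/existsP; exists e; rewrite inE eS orbT /=.
  have eh : e != h by apply: contraTneq eS => ->.
  by have [E1 E2] := agr e eh; rewrite /cut E1 E2.
split.
- split.
  + have -> // : SR :\ h :|: (h |: SV) = SR :|: SV.
    by apply/setP => e; rewrite !inE; case: (e =P h) => [->|]; rewrite ?hS.
  + rewrite disjoints_subset; apply/subsetP => e; rewrite !inE => /andP[eh eS].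
    by rewrite negb_or eh (disjointFr (pi_dis P) eS).
  + exact: pi_dW P.
  + exact: pi_wW P.
  + exact: pi_dw P.
  + by move=> e; rewrite !inE => /andP[eh eS]; have [-> ->] := agr e eh; apply: (pi_loop P eS).
  + by move=> e; rewrite in_setD1 => /andP[eh eS]; have [-> _] := agr e eh; apply: (pi_ra P eS).
  + by move=> e; rewrite in_setD1 => /andP[eh eS]; have [_ ->] := agr e eh; apply: (pi_rb P eS).
  + move=> e; rewrite in_setU1; case: (e =P h) => [-> _|/eqP eh /= eS].
      by rewrite /a' /b' !eqxx yW orbT.
    by have [-> ->] := agr e eh; apply: (pi_v P eS).
  have [g gS jg]:= pi_g P; exists g; first by rewrite inE gS orbT.
  have gh : g != h by apply: contraTneq gS => ->.
  by have [E1 E2] := agr g gh; rewrite /joins E1 E2.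
- by have := dgE W; have := go_D G; slia.
- move=> A AW A0 AnW; have := dgE A; case cA: (cut a b A h).
    by have := Hcut A AW A0 AnW cA; slia.
  by have := go_1 G AW A0 AnW; slia.
move=> A AW A0 AnW nV; have := dgE A.
have nV0 : ~~ has_virt a b SV A by apply: contra nV; apply: virtE.
have := go_2 G AW A0 AnW nV0; suff -> : cut a b A h = false by slia.
rewrite (cut_joins _ jh).
have wA : w \notin A by apply: contra (pi_wW P); apply: (subsetP AW).
have -> : (x \in A) = false.
  apply: contraNF nV0 => xA; apply/existsP; exists k; rewrite kS /=.
  by rewrite (cut_joins _ jk) xA (negbTE wA).
apply: contraNF nV => /= yA; apply/existsP; exists h; rewrite setU11 /=.
by rewrite (cut_joins _ jh') yA (negbTE wA).
Qed.

Lemma dg_compl A : D = 0 -> A \subset W -> dgr (W :\: A) = dgr A.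
Proof.
move=> D0 AW; have := dg_root AW; rewrite D0 big1 ?muln0 ?addn0 // => e eS.
have : cut a b W e = false; last by move=> ->.
apply/negbTE/negP => ce; have : 0 < D; last by rewrite D0.
by rewrite /dg (big_setD1 e) //= ce.
Qed.

Lemma D0_inner e : D = 0 -> e \in SR -> (a e \in W) && (b e \in W).
Proof.
move=> D0 eS; apply: (no_loop_W eS); apply/negP => ce; have : 0 < D; last by rewrite D0.
by rewrite /dg (big_setD1 e) //= ce.
Qed.

(** Without real edges at the root, nothing connects [d] to [T], so merging them is not a
    contraction of edges. The hypothesis on [X0] says that [d] can be moved to the side of [t] in
    any cut without changing the virtual part of that cut. *)
Lemma planar_merge_root (SV' : {set E}) (l' r' : E -> F) T t : D = 0 ->
  T \subset W -> t \in T -> conn a b SR T ->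
  {in SV', forall e, ~~ ((a e \in d |: T) && (b e \in d |: T))} ->
  [disjoint SR & SV'] ->
  (forall X, exists X0, [/\ {in SV', cut a b X0 =1 cut a b X},
     (forall u, u != d -> u != w -> (u \in X0) = (u \in X)) & (d \in X0) = (t \in X)]) ->
  planar_struct a b l' r' (SR :|: SV') ->
  planar_struct (merge (d |: T) d \o a) (merge (d |: T) d \o b) l' r'
    (outside a b (d |: T) SR :|: SV').
Proof.
move=> D0 TW tT cT HV dis HX; apply: planar_quot.
- by apply: setSU; apply: outside_sub.
- move=> e; rewrite in_setD !in_setU; case: (e \in SV'); rewrite ?orbT //= !orbF mem_outside.
  case: (e \in SR) => //=; rewrite ?andbF // !andbT negbK => /andP[aT bT].
  by rewrite /merge aT bT.
move=> X HX1; have [X0 [Hc0 H1 H2]] := HX X.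
have neqs u : u \in W -> u != d /\ u != w.
  move=> uW; split; apply: contraTneq uW => ->; [exact: pi_dW P | exact: pi_wW P].
have TX u : u \in T -> (u \in X) = (t \in X).
  move=> uT; have [] : T \subset X \/ [disjoint T & X].
  - apply: cT => e eS aT bT; apply: HX1; rewrite in_setD !in_setU eS mem_outside eS.
    by rewrite !inE aT bT !orbT /= (disjointFr dis eS).
  - by move=> /subsetP s; rewrite !s.
  - by move=> s; rewrite !(disjointFr s).
have X0T u : u \in d |: T -> (u \in X0) = (t \in X).
  rewrite !inE => /orP[/eqP ->//|uT].
  by have [n1 n2] := neqs u (subsetP TW u uT); rewrite H1 // TX.
exists X0.
  move=> e; rewrite in_setU => /orP[eS|/Hc0 //].
  have /andP[aW bW] := D0_inner D0 eS.
  by have [n1 n2] := neqs _ aW; have [n3 n4] := neqs _ bW; rewrite /cut !H1.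
move=> u v; rewrite /merge; case: ifP => uT; case: ifP => vT.
- by rewrite !X0T.
- by move=> E0; rewrite -E0 setU11 in vT.
- by move=> E0; rewrite E0 setU11 in uT.
by move=> ->.
Qed.

(** With an isolated root, a cut of at most five edges can be solved inside [A] once [T] plays the
    root. The new root needs a virtual edge. Either [T] has one, and the old edges from [d] to [w]
    are dropped; or all virtual edges join [d] to [w], and these two vertices change sides
    together. *)
Lemma reroot A : D = 0 -> A \subset W -> A != W -> 1 < #|A| ->
  has_virt a b SV (W :\: A) || ~~ has_virt a b SV W -> 6 <= dgr A.
Proof.
move=> D0 AW AnW A1 HV; rewrite leqNgt; apply/negP => lt; apply: nosol.
have A0 := card_gt1_neq0 A1; have [t tA] := set0Pn _ A0.
have [/(_ A0) TnW T0] := properN AW AnW; set T := W :\: A in HV TnW T0.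
have TW : T \subset W by apply: subsetDl.
have cT : conn a b SR T by apply: (conn_small G) => //; rewrite dg_compl //; slia.
have [s sT] := set0Pn _ T0.
apply: (solve_contract G AW tA) => //.
  by apply: (conn_small G) => //; slia.
move=> c' Ec'.
have one B : B \subset A -> B != set0 -> B != A ->
    \sum_(e in inner a b A SR) cut a b B e != 1.
  move=> BA B0 BnA; apply/eqP => E1.
  have [] := split4 AW AnW BA B0 BnA; have := dg_inner a b SR BA; rewrite E1; slia.
have wT : w \notin d |: T.
  by rewrite !inE negb_or (negbTE (pi_wW P)) eq_sym (pi_dw P) /= andbF.
have D6 : dgr A <= 6 by slia.
case: (boolP (has_virt a b SV T)) => [HT|HT].
  pose SV' := [set e in SV | ~~ cut a b [set d] e].
  have sV : SV' \subset SV by apply/subsetP => e; rewrite inE => /andP[].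
  have [l' [r' Pl']] := planar_del (setUS SR sV) (pi_pl P).
  apply: (solve_inside_gen G AW AnW D6 (l' := l') (r' := r') (SV' := SV')) => //.
  - apply: planar_merge_root (Pl') => //; first exact: sT.
    + by move=> e /(subsetP sV); apply: (virt_not_both G).
    + exact: disjointWr sV (pi_dis P).
    move=> X; exists [set u | if u == d then s \in X else u \in X]; split.
    + move=> e; rewrite inE => /andP[eS]; have [x xW jx] := virt_ends eS.
      have wd : (w == d) = false by rewrite eq_sym (negbTE (pi_dw P)).
      rewrite !(cut_joins _ jx) !inE wd addbF.
      by case: (x =P d) => [->|] //=; rewrite eqxx.
    + by move=> u /negbTE ud _; rewrite inE ud.
    by rewrite inE eqxx.
  - move=> X XA /existsP[e /andP[eS ce]]; apply/existsP; exists e; rewrite ce andbT inE eS /=.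
    have [x xW jx] := virt_ends eS; move: ce; rewrite !(cut_joins _ jx) !inE.
    have wX : w \notin X.
      by apply: contra (pi_wW P) => /(subsetP XA)/(subsetP AW).
    rewrite (negbTE wX) addbF => xX.
    have -> : (x == d) = false.
      by apply: contraTF xX => /eqP ->; apply: contra (pi_dW P) => /(subsetP XA)/(subsetP AW).
    by rewrite eq_sym (negbTE (pi_dw P)).
  case/existsP: HT => e /andP[eS ce]; have [x xW jx] := virt_ends eS; exists e, x.
  move: ce; rewrite (cut_joins _ jx) (_ : (w \in T) = false) ?addbF; last first.
    by apply: contraNF wT => wT; rewrite inE wT orbT.
  move=> xT; split=> //; last by rewrite inE xT orbT.
  rewrite inE eS (cut_joins _ jx) !inE [w == d]eq_sym (negbTE (pi_dw P)) addbF.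
  by apply: contraTneq xT => ->; apply: contra (pi_dW P); apply: (subsetP TW).
have HW : ~~ has_virt a b SV W by rewrite (negbTE HT) in HV.
have dw e : e \in SV -> joins a b e d w.
  move=> eS; have [x xW jx] := virt_ends eS; move: xW; rewrite !inE => /orP[/eqP <-//|xW].
  case/negP: HW; apply/existsP; exists e; rewrite eS (cut_joins _ jx) xW.
  by rewrite (negbTE (pi_wW P)).
apply: (solve_inside_gen G AW AnW D6 (l' := l) (r' := r) (SV' := SV)) => //.
  apply: planar_merge_root (pi_pl P) => //; first exact: sT.
  + exact: (virt_not_both G).
  + exact: pi_dis P.
  move=> X; exists [set u | if u == d then s \in X else if u == w then
    (s \in X) (+) (d \in X) (+) (w \in X) else u \in X]; split.
  + move=> e eS; rewrite !(cut_joins _ (dw e eS)) !inE !eqxx [w == d]eq_sym (negbTE (pi_dw P)).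
    by do 3 case: (_ \in X).
  + by move=> u /negbTE ud /negbTE uw; rewrite inE ud uw.
  by rewrite inE eqxx.
by have [g gS jg] := pi_g P; exists g, d; split; rewrite ?setU11 ?gS ?dw.
Qed.

(** An isolated root leaves one edge to spare. Without virtual edges at [W] all cuts have six edges,
    and any edge can be oriented and deleted. Otherwise the real edge beside a virtual one is
    oriented and slid onto [w]: a cut of size four would have virtual edges on both sides, and
    [reroot] excludes it. *)
Lemma rootless_False : D <> 0.
Proof.
move=> D0; have W2 := card_W.
have big2 A : A \subset W -> A != W -> A != set0 -> 1 < #|A| \/ 1 < #|W :\: A|.
  move=> AW AnW A0; have := cardsID A W; rewrite (setIidPr AW).
  by case: (leqP 2 #|A|) => H; [left|right; slia].
have dgs e : e \in SR -> (\sum_(v in W) (c v - dlt a b v e) = 0)%R.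
  move=> eS; rewrite big_split /= sumrN sum_dlt Ec.
  by have /andP[-> ->] := D0_inner D0 eS; rewrite subrr subr0.
have inN e : e \in SR -> e \in N.
  by move=> eS; rewrite mem_inner eS D0_inner.
have [v vW] : exists v, v \in W by apply/set0Pn; rewrite -card_gt0; slia.
have W1 : 1 < #|W| by slia.
case: (boolP (has_virt a b SV W)) => HV; last first.
  have all6 A : A \subset W -> A != set0 -> A != W -> 6 <= dgr A.
    move=> AW A0 AnW; have [A1|A1] := big2 A AW AnW A0.
      by apply: reroot => //; rewrite HV orbT.
    have [/(_ A0) TnW T0] := properN AW AnW.
    rewrite -(dg_compl D0 AW); apply: reroot => //; first exact: subsetDl.
    by rewrite HV orbT.
  have [e eS ce] : exists2 e, e \in SR & cut a b [set v] e.
    by apply: has_edge; have := deg4 vW W1; slia.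
  have sE : SR :\ e :|: SV \subset SR :|: SV by apply: setSU; apply: subD1set.
  have [l' [r' Pl']] := planar_del sE (pi_pl P).
  have dgE A : dg a b (SR :\ e) A + cut a b A e = dgr A.
    by rewrite /dg [RHS](big_setD1 e) //= addnC.
  have G' : good a b l' r' (SR :\ e) SV W d w.
    split; last 3 first.
    - by have := dgE W; slia.
    - by move=> A AW A0 AnW; have := dgE A; have := all6 A AW A0 AnW; case: (cut _ _ _ _); slia.
    - by move=> A AW A0 AnW _; have := dgE A; have := all6 A AW A0 AnW; case: (cut _ _ _ _); slia.
    split=> //; try by case: P.
    + by apply: disjointWl (pi_dis P); apply: subD1set.
    + by move=> f; rewrite in_setD1 => /andP[_ fS]; apply: (pi_loop P fS).
    + by move=> f; rewrite in_setD1 => /andP[_ fS]; apply: (pi_ra P fS).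
    by move=> f; rewrite in_setD1 => /andP[_ fS]; apply: (pi_rb P fS).
  apply: nosol; apply: (@solvable_del _ _ a b a b _ _ _ e) => //; first exact: inN.
  apply: (IH G'); last 2 first.
  - exact: dgs.
  - by apply: (consistent_small _ G'); have := dgE W; slia.
  by have := cardsD1 e SR; rewrite eS; slia.
have [k kS [u uW ju]] : exists2 k, k \in SV & exists2 u, u \in W & joins a b k u w.
  case/existsP: HV => k /andP[kS ck]; exists k => //; have [x xW jx] := virt_ends kS.
  exists x => //; move: ck; rewrite (cut_joins _ jx) (negbTE (pi_wW P)) addbF //.
have uW' : u \in d |: W by rewrite inE uW orbT.
have [|h [y [hS jh uy yW sh]]] := near_virt kS uW' ju.
  by have := deg4 uW W1; slia.
have [|a' [b' [l' [r' [agr G']]]]] := good_slide kS ju hS jh uW' yW sh.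
  move=> A AW A0 AnW _; rewrite leqNgt; apply/negP => lt.
  have E4 : dgr A = 4 by have := go_1 G AW A0 AnW; slia.
  have [/(_ A0) TnW T0] := properN AW AnW.
  have hv B : B \subset W -> B != set0 -> B != W -> dgr B = 4 -> has_virt a b SV B.
    by move=> BW B0 BnW E5; apply: contraT => nV; have := go_2 G BW B0 BnW nV; slia.
  have V1 := hv A AW A0 AnW E4.
  have E5 : dgr (W :\: A) = 4 by rewrite dg_compl.
  have V2 := hv _ (subsetDl W A) T0 TnW E5.
  have [A1|A1] := big2 A AW AnW A0.
    by have := reroot D0 AW AnW A1; rewrite V2 E4 => /(_ isT).
  have := reroot D0 (subsetDl W A) TnW A1; rewrite setDDr setDv set0U (setIidPr AW) V1 E5.
  by move=> /(_ isT).
have dgE : dg a' b' (SR :\ h) W <= D.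
  rewrite /dg [X in _ <= X](big_setD1 h) //= ; apply: leq_trans (leq_addl _ _).
  apply: leq_sum => e; rewrite in_setD1 => /andP[eh _].
  by have [E1 E2] := agr e eh; rewrite /cut E1 E2.
apply: nosol; apply: (solvable_del (inN _ hS) agr).
apply: (IH G'); last 2 first.
- exact: dgs.
- by apply: (consistent_small _ G'); slia.
by have := cardsD1 h SR; rewrite hS; slia.
Qed.

(** The root edge beside the virtual edge of the root can be slid onto [w] unless its other end has
    degree four. Such a slide costs nothing in the flow, since a root edge is not an inner edge. *)
Lemma root_four : exists h u, [/\ h \in SR, joins a b h d u, u \in W, deg u = 4 & 5 <= D] /\
  (\sum_(e in SR) (cut a b W e && cut a b [set u] e) = 1 \/ forall v, v \in W -> deg v = 4).
Proof.
have D1 : 0 < D by have := rootless_False; slia.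
have W2 := card_W; have W1 : 1 < #|W| by slia.
have [g gS jg] := pi_g P.
have dd : deg d = D by apply: eq_bigr => e eS; rewrite cut_root.
have [|h [u [hS jh du uW sh]]] := near_virt gS (setU11 d W) jg; first by rewrite dd.
have {uW} uW : u \in W by move: uW; rewrite !inE eq_sym (negbTE du).
have dW : d \notin W := pi_dW P.
have ch A : A \subset W -> cut a b A h = (u \in A).
  move=> AW; rewrite (cut_joins _ jh) (_ : (d \in A) = false) //.
  by apply: contraNF dW; apply: (subsetP AW).
have u4 : deg u = 4.
  apply/eqP; rewrite eqn_leq deg4 // andbT leqNgt; apply/negP => u5.
  have [||a' [b' [l' [r' [agr G']]]]] := good_slide gS jg hS jh (setU11 d W) _ sh.
  - by rewrite inE uW orbT.
  - move=> A AW A0 AnW; rewrite ch // => uA; case: (leqP 2 #|A|) => A1; first exact: cut5.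
    suff -> : A = [set u] by [].
    apply/esym/eqP; rewrite eqEcard sub1set uA cards1; slia.
  have dgE A : dg a' b' (SR :\ h) A + cut a b A h = dgr A.
    rewrite /dg [RHS](big_setD1 h) //= addnC; congr (_ + _); apply: eq_bigr => e.
    by rewrite in_setD1 => /andP[eh _]; have [E1 E2] := agr e eh; rewrite /cut E1 E2.
  have hN : h \notin N.
    by rewrite mem_inner hS /=; move: jh => /orP[]/andP[/eqP -> /eqP ->]; rewrite (negbTE dW) ?andbF.
  apply: nosol; apply: (@solvable_ext _ _ a b a' b' _ (SR :\ h)).
  - apply/setP => e; rewrite !mem_inner in_setD1; case: (e =P h) => [->|/eqP eh] /=.
      by move: hN; rewrite mem_inner => /negbTE ->.
    by have [-> ->] := agr e eh.
  - by move=> e eN; apply: agr; apply: contraTneq eN => ->.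
  apply: (IH G') => //; last first.
    by apply: (consistent_small _ G'); have := dgE W; rewrite ch // uW; have := go_D G; slia.
  by have := cardsD1 h SR; rewrite hS; slia.
exists h, u.
have uS : [set u] \subset W by rewrite sub1set.
have := dg_root uS; set m := \sum_(e in SR) _; rewrite u4 => Em.
have m1 : 0 < m.
  by rewrite /m (big_setD1 h) //= !ch // uW set11.
have cU : #|W :\: [set u]| = #|W|.-1 by have := cardsD1 u W; rewrite uW; slia.
have nu : W :\: [set u] != W.
  by apply/negP => /eqP E0; have := uW; rewrite -E0 !inE eqxx.
have c1 : 1 < #|W :\: [set u]| by slia.
have sU : W :\: [set u] \subset W by apply: subsetDl.
have D6 := go_D G.
have := cut5 D1 sU nu c1 => h5.
have D3 : 3 <= D by slia.
have h6 := cut6 D3 sU nu c1.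
(* If the rest of [W] has seven boundary edges, then D + 4 - 2m >= 7 with D <= 6 gives one root edge
   at [u] and D >= 5. If it has six, the rest is a pair of vertices of degree four. *)
have [E6|n6] := eqVneq (dgr (W :\: [set u])) 6; last first.
  have h7 : 6 < dgr (W :\: [set u]) by rewrite ltn_neqAle eq_sym n6 h6.
  by split; [split=> //; slia | left; slia].
have [p [q [EW pq p4 q4]]] := cut6_eq D3 sU nu c1 E6.
have all4 v : v \in W -> deg v = 4.
  move=> vW; case: (v =P u) => [->//|/eqP vu].
  have : v \in W :\: [set u] by rewrite !inE vu.
  by rewrite EW !inE => /orP[]/eqP ->.
split; last by right.
split=> //.
have pW : p \in W by apply: (subsetP sU); rewrite EW !inE eqxx.
have qW : q \in W by apply: (subsetP sU); rewrite EW !inE eqxx orbT.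
have [up uq] : u != p /\ u != q.
  have H z : z \in [set p; q] -> u != z by rewrite -EW !inE eq_sym => /andP[].
  by split; apply: H; rewrite !inE eqxx ?orbT.
have WE : W = [set u; p; q].
  apply/setP => z; have := setD1K uW => <-; rewrite in_setU1 EW !inE.
  by rewrite -orbA.
(* Each of the three vertices has at most (D - 2) / 2 root edges by [cut6], and these make up all D
   root edges; this forces D = 6. *)
have bnd z : z \in W -> \sum_(e in SR) (cut a b W e && cut a b [set z] e) <= (D - 2) %/ 2.
  move=> zW; have sz : [set z] \subset W by rewrite sub1set.
  have := dg_root sz; rewrite all4 //.
  have : 6 <= dgr (W :\: [set z]).
    apply: cut6 => //; first exact: subsetDl.
      by apply/negP => /eqP E0; have := zW; rewrite -E0 !inE eqxx.
    by have := cardsD1 z W; rewrite zW; slia.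
  by slia.
have := bnd p pW; have := bnd q qW; have := bnd u uW.
have : D <= \sum_(e in SR) (cut a b W e && cut a b [set u] e) +
   (\sum_(e in SR) (cut a b W e && cut a b [set p] e) +
    \sum_(e in SR) (cut a b W e && cut a b [set q] e)).
  have memW x : (x \in W) = (x == u) (+) (x == p) (+) (x == q).
    rewrite WE !inE; case: (x =P u) => [->|_]; first by rewrite (negbTE up) (negbTE uq).
    by case: (x =P p) => [->|_] //; rewrite (negbTE pq).
  rewrite -!big_split /=; apply: leq_sum => e _; rewrite /cut !memW !inE.
  by case: (a e == u); case: (a e == p); case: (a e == q);
     case: (b e == u); case: (b e == p); case: (b e == q).
slia.
Qed.

End Minimal.

(** * Separation and rotation *)

Section Duality.

Variables (U E F : finType).
Implicit Types (a b : E -> U) (l r : E -> F) (S C : {set E}) (X : {set U}) (Phi : {set F}).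

Lemma xor_F2 (I : finType) (Q : pred I) (B : I -> bool) :
  ((\big[addb/false]_(i | Q i) B i)%:R = \sum_(i | Q i) (B i)%:R :> 'F_2)%R.
Proof.
apply: (big_morph (fun x : bool => x%:R : 'F_2)%R) => //.
by case; case; apply/val_inj.
Qed.

Lemma F2_bool (x : 'F_2) : x = ((x != 0)%R%:R)%R.
Proof. by case: x => [[|[|//]] i]; apply/val_inj. Qed.

Lemma F2_inj (x y : bool) : (x%:R = y%:R :> 'F_2)%R -> x = y.
Proof. by case: x; case: y => // /eqP. Qed.

(* Planar duality for cycles: the double orthogonal of the span of the face
   boundaries is that span. *)
Lemma dual_cut a b l r S C : planar_struct a b l r S -> C \subset S ->
  (forall X, \big[addb/false]_(e in C) cut a b X e = false) ->
  exists Phi : {set F}, forall e, e \in S -> (e \in C) = (l e \in Phi) (+) (r e \in Phi).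
Proof.
move=> [_ D2] CS HC.
pose M : 'M['F_2]_(#|F|, #|E|) :=
  (\matrix_(i, j) ((enum_val j \in S) && inc l r (enum_val i) (enum_val j))%:R)%R.
pose v : 'rV['F_2]_#|E| := (\row_j (enum_val j \in C)%:R)%R.
case: (boolP (v <= M)%MS) => [/submxP[x Ex]|].
  exists [set f | x ord0 (enum_rank f) != 0]%R => e eS.
  apply: F2_inj; move/matrixP/(_ ord0 (enum_rank e)): Ex; rewrite !mxE enum_rankK => ->.
  rewrite (reindex (@enum_rank F)) /=; last by apply: onW_bij; apply: enum_rank_bij.
  have H f0 : (\sum_f x ord0 (enum_rank f) * (f0 == f)%:R = x ord0 (enum_rank f0))%R.
    rewrite (bigD1 f0) //= eqxx mulr1 big1 ?addr0 // => f; rewrite eq_sym => /negbTE ->.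
    by rewrite mulr0.
  transitivity (\sum_f (x ord0 (enum_rank f) * (l e == f)%:R +
      x ord0 (enum_rank f) * (r e == f)%:R))%R.
    apply: eq_bigr => f _; rewrite !mxE !enum_rankK eS /= -mulrDr; congr (_ * _)%R.
    by rewrite /inc; case: (_ == _); case: (_ == _); apply/val_inj.
  rewrite big_split /= !H !inE [x ord0 (enum_rank (l e))]F2_bool.
  rewrite [x ord0 (enum_rank (r e))]F2_bool.
  by do 2 case: (_ != _); apply/val_inj.
(* Otherwise some vector is orthogonal to all faces but not to [C]. Read as an edge set it is a cut
   by the second half of [planar_struct], and [C] meets cuts evenly. *)
rewrite submxE => /rV0Pn[j Hj]; exfalso.
have [y My vy] : exists2 y : 'cV_#|E|, (M *m y = 0)%R & ((v *m y) ord0 ord0 != 0)%R.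
  exists (col j (cokermx M)); first by rewrite colE mulmxA mulmx_coker mul0mx.
  by rewrite colE mulmxA -colE mxE.
pose C' := [set e in S | y (enum_rank e) ord0 != 0%R].
have [||X HX] := D2 C'.
- by apply/subsetP => e; rewrite inE => /andP[].
- move=> f; apply: F2_inj; rewrite xor_F2.
  transitivity ((M *m y)%R (enum_rank f) ord0); last by rewrite My mxE.
  rewrite mxE (reindex (@enum_rank E)) /=; last by apply: onW_bij; apply: enum_rank_bij.
  rewrite big_mkcond /=; apply: eq_bigr => e _; rewrite !mxE !enum_rankK inE.
  case: (e \in S); rewrite ?mul0r //= [in RHS](F2_bool (y (enum_rank e) ord0)).
  by case: (y _ _ != _)%R; rewrite ?mulr1 ?mulr0.
move: (HC X) vy => HCX /eqP; apply.
have : ((\big[addb/false]_(e in C) cut a b X e)%:R = 0 :> 'F_2)%R by rewrite HCX.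
rewrite xor_F2 => E0; rewrite -[RHS]E0 mxE.
rewrite (reindex (@enum_rank E)) /=; last by apply: onW_bij; apply: enum_rank_bij.
rewrite [RHS]big_mkcond /=; apply: eq_bigr => e _; rewrite mxE enum_rankK.
case eC: (e \in C); rewrite ?mul0r // mul1r -HX ?(subsetP CS) // inE (subsetP CS _ eC) /=.
exact: F2_bool.
Qed.

(** A discrete Jordan curve theorem: [Phi] is the set of faces on one side of the cycle [C], and [N]
    contains its vertices. An edge leaving [N] is not on the cycle, so both its faces are on one
    side. The edges leaving [N] on the side of [Phi] therefore meet a face either as the whole cut
    of [N] does or not at all, and form a cut themselves. *)
Lemma separation a b l r S C (N : {set U}) Phi : planar_struct a b l r S ->
  {in S, forall e, (e \in C) = (l e \in Phi) (+) (r e \in Phi)} ->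
  {in C, forall e, (a e \in N) && (b e \in N)} ->
  exists X, forall e, e \in S -> cut a b X e = cut a b N e && (l e \in Phi).
Proof.
move=> [D1 D2] HPhi CN.
have [||X HX] := D2 [set e in S | cut a b N e && (l e \in Phi)].
- by apply/subsetP => e; rewrite inE => /andP[].
- move=> f; transitivity ((f \in Phi) &&
      \big[addb/false]_(e in S) (cut a b N e && inc l r f e)); last by rewrite D1 andbF.
  rewrite -xor_bool_big [LHS]big_mkcond [RHS]big_mkcond /=; apply: eq_bigr => e _; rewrite inE.
  case eS: (e \in S) => //=; case cN: (cut a b N e); rewrite ?andbF //=.
  have : e \notin C.
    by apply/negP => /CN /andP[H1 H2]; move: cN; rewrite /cut H1 H2.
  rewrite (HPhi e eS) /inc.
  case: (l e =P f) => [->|_]; case: (r e =P f) => [->|_] //=;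
    by case: (l e \in Phi); case: (r e \in Phi); case: (f \in Phi).
by exists X => e eS; rewrite -HX // inE eS.
Qed.

Lemma xor_seq (s : seq E) (B : E -> bool) : uniq s ->
  \big[addb/false]_(e in [set x in s]) B e = \big[addb/false]_(e <- s) B e.
Proof. by move=> us; rewrite [RHS]big_uniq //; apply: eq_bigl => e; rewrite inE. Qed.

Lemma inc_joins l r e p q f : joins l r e p q -> inc l r f e = (f == p) (+) (f == q).
Proof.
by rewrite /inc ![_ == f]eq_sym => /orP[]/andP[/eqP -> /eqP ->] //; rewrite addbC.
Qed.

Lemma inc_ex l r e p : inc l r p e -> exists2 q, q != p & joins l r e p q.
Proof.
rewrite /inc /joins; case: (l e =P p) => [_|/eqP lp].
  by case: (r e =P p) => //= /eqP rp _; exists (r e); rewrite ?eqxx.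
by case: (r e =P p) => //= _ _; exists (l e); rewrite ?eqxx.
Qed.

Lemma joins_in l r e p q S C Phi : e \in S ->
  {in S, forall e, (e \in C) = (l e \in Phi) (+) (r e \in Phi)} -> joins l r e p q ->
  (p \in Phi) (+) (q \in Phi) = (e \in C).
Proof. by move=> eS H; rewrite H // => /orP[]/andP[/eqP -> /eqP ->] //; rewrite addbC. Qed.

Lemma joins_side l r e p q S C Phi : e \in S -> e \notin C ->
  {in S, forall e, (e \in C) = (l e \in Phi) (+) (r e \in Phi)} -> joins l r e p q ->
  (l e \in Phi) = (p \in Phi).
Proof.
move=> eS eC H jpq; have := joins_in eS H jpq; rewrite (negbTE eC).
by move: jpq => /orP[]/andP[/eqP -> _]; case: (p \in Phi); case: (q \in Phi).
Qed.

Definition par l r (K : {set E}) f : bool := \big[addb/false]_(e in K) inc l r f e.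

Section Rotation.

Variables (l r : E -> F) (K : {set E}).
Hypothesis even : forall f, par l r K f = false.
Hypothesis minimal : forall P : {set E}, P \subset K -> P != set0 -> P != K ->
  ~ forall f, par l r P f = false.

(** [P] is a path from [p] to [q] in the dual graph. As [K] is even at [q], the path continues with
    an edge of [K] outside [P]. *)
Lemma par_step (P : {set E}) p q : P \subset K -> p != q ->
  (forall f, par l r P f = (f == p) (+) (f == q)) ->
  exists e q', [/\ e \in K, e \notin P, joins l r e q q' &
    forall f, par l r (e |: P) f = (f == p) (+) (f == q')].
Proof.
move=> PK pq HP.
have [e eKP /inc_ex[q' q'q je]] : exists2 e, e \in K :\: P & inc l r q e.
  case: (boolP [exists e in K :\: P, inc l r q e]).
    by case/existsP => e /andP[? ?]; exists e.
  rewrite negb_exists => /forallP H; have := even q.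
  rewrite /par (big_setID P) /= (setIidPr PK) -/(par l r P q) HP eqxx eq_sym (negbTE pq) /=.
  rewrite big1 // => e eKP; by have := H e; rewrite eKP => /negbTE.
move: eKP; rewrite inE => /andP[eP eK]; exists e, q'; split=> // f.
rewrite /par big_setU1 //= -/(par l r P f) HP (inc_joins _ je).
by do 3 case: (f == _).
Qed.

Lemma par_neq (P : {set E}) p q : P \subset K -> P != set0 -> #|P| < #|K| ->
  (forall f, par l r P f = (f == p) (+) (f == q)) -> p != q.
Proof.
move=> PK P0 PnK HP; apply/negP => /eqP E0; apply: (minimal PK P0).
  by apply: contraTneq PnK => ->; rewrite ltnn.
by move=> f; rewrite HP E0 addbb.
Qed.

(** A minimal even set is a cycle of the dual graph. Following it from [g] yields the cyclic order
    around a vertex, and minimality prevents the path from closing early. *)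
Lemma rotation g : g \in K -> #|K| = 5 ->
  exists e1 e2 e3 e4 p0 p1 p2 p3 p4,
   [/\ K = [set g; e1; e2; e3; e4], uniq [:: g; e1; e2; e3; e4] &
   [/\ joins l r g p0 p1, joins l r e1 p1 p2, joins l r e2 p2 p3, joins l r e3 p3 p4
     & joins l r e4 p4 p0]].
Proof.
move=> gK K5.
have jg : joins l r g (l g) (r g) by rewrite /joins !eqxx.
have s0 : [set g] \subset K by rewrite sub1set.
have H0 f : par l r [set g] f = (f == l g) (+) (f == r g).
  by rewrite /par big_set1 (inc_joins _ jg).
have nz (e : E) (P : {set E}) : e |: P != set0 by apply/set0Pn; exists e; rewrite setU11.
have n0 : l g != r g.
  by apply: (par_neq s0 _ _ H0); [apply/set0Pn; exists g; rewrite set11 | rewrite cards1 K5].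
have [e1 [p2 [k1 m1 j1 H1]]] := par_step s0 n0 H0.
have s1 : e1 |: [set g] \subset K by rewrite subUset sub1set k1.
have c1 : #|e1 |: [set g]| = 2 by rewrite cardsU1 m1 cards1.
have n1 : l g != p2 by apply: (par_neq s1 _ _ H1) => //; rewrite c1 K5.
have [e2 [p3 [k2 m2 j2 H2]]] := par_step s1 n1 H1.
have s2 : e2 |: (e1 |: [set g]) \subset K by rewrite subUset sub1set k2.
have c2 : #|e2 |: (e1 |: [set g])| = 3 by rewrite cardsU1 m2 c1.
have n2 : l g != p3 by apply: (par_neq s2 _ _ H2) => //; rewrite c2 K5.
have [e3 [p4 [k3 m3 j3 H3]]] := par_step s2 n2 H2.
have s3 : e3 |: (e2 |: (e1 |: [set g])) \subset K by rewrite subUset sub1set k3.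
have c3 : #|e3 |: (e2 |: (e1 |: [set g]))| = 4 by rewrite cardsU1 m3 c2.
have n3 : l g != p4 by apply: (par_neq s3 _ _ H3) => //; rewrite c3 K5.
have [e4 [p5 [k4 m4 j4 H4]]] := par_step s3 n3 H3.
have s4 : e4 |: (e3 |: (e2 |: (e1 |: [set g]))) \subset K by rewrite subUset sub1set k4.
have c4 : #|e4 |: (e3 |: (e2 |: (e1 |: [set g])))| = 5 by rewrite cardsU1 m4 c3.
have EK : e4 |: (e3 |: (e2 |: (e1 |: [set g]))) = K.
  by apply/eqP; rewrite eqEcard s4 c4 K5.
have E5 : p5 = l g.
  have := H4 (l g); rewrite EK even eqxx; case: (l g =P p5) => //.
rewrite E5 in j4.
exists e1, e2, e3, e4, (l g), (r g), p2, p3, p4; split=> //.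
- rewrite -EK; apply/setP => e; rewrite !inE.
  by do 5 case: (e == _); rewrite ?orbT.
rewrite -rev_uniq /rev /= !inE.
move: m1 m2 m3 m4; rewrite !inE !negb_or => -> /andP[-> ->].
by move=> /and3P[-> -> ->] /and4P[-> -> -> ->].
Qed.

End Rotation.

End Duality.

(** * Configurations around vertices of degree four *)

Section Geometry.

Variables (U E F : finType).
Implicit Types (A X N : {set U}) (e h k g : E) (u v x y z s t : U) (p q : F).

(** What the planar arguments need to know about a minimal counterexample, detached from the
    induction and from the demand. *)
Record reduced (a b : E -> U) (l r : E -> F) (SR SV : {set E}) (W : {set U}) (d w : U)
    : Prop := Reduced {
  re_good : good a b l r SR SV W d w;
  re_clean : forall v (e f : E), v != w -> e \in SV -> f \in SV ->
    cut a b [set v] e -> cut a b [set v] f -> e = f;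
  re_D : 5 <= dg a b SR W;
  re_W : 2 < #|W|;
  re_6 : forall A : {set U}, A \subset W -> A != W -> 1 < #|A| -> 6 <= dg a b SR A;
  re_7 : forall (A : {set U}) v, A \subset W -> A != W -> 1 < #|A| -> v \in A ->
    5 <= dg a b SR [set v] -> 7 <= dg a b SR A;
  re_7c : forall A : {set U}, A \subset W -> A != W -> 2 < #|A| -> 7 <= dg a b SR A;
  re_par : forall (e f : E) x y, x \in W -> y \in W -> x != y -> e \in SR -> f \in SR ->
    joins a b e x y -> joins a b f x y -> e = f }.

(* The edges around a degree-four vertex v, in their cyclic order, starting with
   the virtual edge g. *)
Record star4 (a b : E -> U) (l r : E -> F) (SR SV : {set E}) (w v : U)
    (g e1 e2 e3 e4 : E) (p0 p1 p2 p3 p4 : F) : Prop := Star4 {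
  st_g : g \in SV;
  st_jg : joins a b g v w;
  st_e : forall e, (e \in SR) && cut a b [set v] e = (e \in [:: e1; e2; e3; e4]);
  st_u : uniq [:: e1; e2; e3; e4];
  st_fg : joins l r g p0 p1;
  st_f1 : joins l r e1 p1 p2;
  st_f2 : joins l r e2 p2 p3;
  st_f3 : joins l r e3 p3 p4;
  st_f4 : joins l r e4 p4 p0 }.

Lemma star4_rev a b l r SR SV w v g e1 e2 e3 e4 p0 p1 p2 p3 p4 :
  star4 a b l r SR SV w v g e1 e2 e3 e4 p0 p1 p2 p3 p4 ->
  star4 a b l r SR SV w v g e4 e3 e2 e1 p1 p0 p4 p3 p2.
Proof.
case=> gS jg se us fg f1 f2 f3 f4; split=> //; try by rewrite joinsC.
- move=> e; rewrite se !inE; do 4 case: (e == _); by rewrite ?orbT.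
by rewrite -rev_uniq /rev /=.
Qed.

Lemma sum_card (A : {set E}) (B : E -> bool) : \sum_(e in A) B e = #|[set e in A | B e]|.
Proof.
by rewrite -sum1dep_card big_mkcondr; apply: eq_bigr => e _; case: (B e).
Qed.

Lemma sum_ge_seq (SR : {set E}) (B : E -> bool) (s : seq E) : uniq s ->
  {subset s <= SR} -> \sum_(e <- s) B e <= \sum_(e in SR) B e.
Proof.
move=> us sub; rewrite big_uniq //= [X in _ <= X](big_setID [set e in s]) /=.
apply: leq_trans (leq_addr _ _); apply: eq_leq; apply: eq_bigl => e.
by rewrite !inE; case es: (e \in s); rewrite ?andbF // (sub _ es).
Qed.

Section Fixed.

Variables (a b : E -> U) (l r : E -> F) (SR SV : {set E}) (W : {set U}) (d w : U).
Hypothesis H : reduced a b l r SR SV W d w.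

Let G := re_good H.
Let P := go_p G.
Let D5 := re_D H.
Local Notation S := (SR :|: SV).
Local Notation dgr := (dg a b SR).
Local Notation deg v := (dg a b SR [set v]).
Local Notation D := (dg a b SR W).
Local Notation star := (star4 a b l r SR SV w).

Lemma dW : d \notin W. Proof. exact: pi_dW P. Qed.
Lemma wW : w \notin W. Proof. exact: pi_wW P. Qed.

Lemma W_neq x : x \in W -> x != d /\ x != w.
Proof. by move=> xW; split; apply: contraTneq xW => ->; [exact: dW | exact: wW]. Qed.

Lemma real_ends e x y : e \in SR -> joins a b e x y -> [/\ x \in d |: W, y \in d |: W & x != y].
Proof.
move=> eS; have := pi_ra P eS; have := pi_rb P eS; have := pi_loop P eS.
by rewrite /joins => + + + /orP[]/andP[/eqP <- /eqP <-] => ? ? ?; split; rewrite // eq_sym.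
Qed.

(** The vertex [w] has no real edges, and one side of every cut avoids the root, so the cuts
    produced by separation can be measured by the conditions on subsets of [W]. *)
Lemma dg_side X : dgr X = if d \in X then dgr (W :\: X) else dgr (X :&: W).
Proof.
have neW u : u \in d |: W -> (u \in W) = (u != d).
  by rewrite !inE; case: (u =P d) => //= ->; rewrite (negbTE dW).
case dX: (d \in X); apply: eq_bigr => e eS; congr nat_of_bool; rewrite /cut !inE.
  rewrite !neW ?(pi_ra P eS) ?(pi_rb P eS) //.
  by case: (a e =P d) => [->|_]; case: (b e =P d) => [->|_]; rewrite ?dX //=;
     case: (a e \in X); case: (b e \in X).
rewrite !neW ?(pi_ra P eS) ?(pi_rb P eS) //.
by case: (a e =P d) => [->|_]; case: (b e =P d) => [->|_]; rewrite ?dX //=;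
   case: (a e \in X); case: (b e \in X).
Qed.

Lemma small X x y : x \in d |: W -> y \in d |: W -> x \in X -> y \notin X -> 4 <= dgr X.
Proof.
move=> xW yW xX yX; rewrite dg_side; case dX: (d \in X).
  have yW' : y \in W :\: X.
    by move: yW; rewrite !inE yX => /orP[/eqP E0|//]; rewrite -E0 (negbTE yX) in dX.
  have [->|ne] := eqVneq (W :\: X) W; first by apply: leq_trans D5.
  apply: (go_1 G) => //; first exact: subsetDl.
  by apply/set0Pn; exists y.
have xW' : x \in X :&: W.
  by move: xW; rewrite !inE xX => /orP[/eqP E0|//]; rewrite -E0 xX in dX.
have [->|ne] := eqVneq (X :&: W) W; first by apply: leq_trans D5.
apply: (go_1 G) => //; first exact: subsetIr.
by apply/set0Pn; exists x.
Qed.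

Lemma small_edge X e : e \in SR -> cut a b X e -> 4 <= dgr X.
Proof.
move=> eS; rewrite /cut; case aX: (a e \in X); case bX: (b e \in X) => //= _.
  by apply: (small (pi_ra P eS) (pi_rb P eS) aX); rewrite bX.
by apply: (small (pi_rb P eS) (pi_ra P eS) bX); rewrite aX.
Qed.

Lemma deg_ge4 v : v \in W -> 4 <= deg v.
Proof. by move=> vW; apply: (deg4 G) => //; have := re_W H; slia. Qed.

Lemma single_ne v : v \in W -> [/\ [set v] \subset W, [set v] != set0 & [set v] != W].
Proof.
move=> vW; split; first by rewrite sub1set.
  by apply/set0Pn; exists v; rewrite set11.
by apply/eqP => E0; have := re_W H; rewrite -E0 cards1.
Qed.

Lemma virt_of v : v \in W -> deg v = 4 -> exists2 g, g \in SV & joins a b g v w.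
Proof.
move=> vW d4; have [s1 s2 s3] := single_ne vW.
have : has_virt a b SV [set v].
  by apply: contraT => nV; have := go_2 G s1 s2 s3 nV; rewrite d4.
case/existsP => g /andP[gS cg]; exists g => //.
have [x xW jx] := virt_ends G gS; move: cg; rewrite (cut_joins _ jx) !inE.
by rewrite [w == v]eq_sym (negbTE (proj2 (W_neq vW))) addbF => /eqP <-.
Qed.

Section Star.

Variables (v : U) (gv : E).
Hypotheses (vW : v \in W) (v4 : deg v = 4) (gS : gv \in SV) (jgv : joins a b gv v w).

Let K := [set e in S | cut a b [set v] e].

Let vw : v != w. Proof. exact: (W_neq vW).2. Qed.

Let gK : gv \in K.
Proof. by rewrite !inE gS orbT /=; apply: joins_cut1 jgv. Qed.

Let evenK f : par l r K f = false.
Proof.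
rewrite /par -[RHS](proj1 (pi_pl P) [set v] f) [LHS]big_mkcond [RHS]big_mkcond /=.
by apply: eq_bigr => e _; rewrite !inE; case: (_ || _) => //=; case: (cut _ _ _ _).
Qed.

Let realK : K :\ gv = [set e in SR | cut a b [set v] e].
Proof.
apply/setP => e; rewrite !inE; case cv: (cut a b [set v] e); rewrite ?andbF // !andbT.
case eR: (e \in SR) => /=.
  by rewrite andbT; apply: contraTneq eR => ->; rewrite (disjointFl (pi_dis P) gS).
apply/negP => /andP[eg eV].
by rewrite (re_clean H vw eV gS cv (joins_cut1 vw jgv)) eqxx in eg.
Qed.

Let card_real : #|K :\ gv| = 4.
Proof.
by rewrite realK -v4 /dg sum_card.
Qed.

Let cardK : #|K| = 5.
Proof. by have := cardsD1 gv K; rewrite gK card_real. Qed.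

Let dg_count X (B : {set E}) : (forall e, e \in S -> (e \in B) = cut a b X e) ->
  dgr X = #|B :&: SR|.
Proof.
move=> HB; rewrite /dg sum_card; apply: eq_card => e; rewrite !inE.
by case eS: (e \in SR); rewrite ?andbF // andbT -HB ?inE ?eS.
Qed.

(** If [gv] alone were a cut, that cut would contain no real edge. It would also separate [v] from
    the root, because the virtual edge between the root and [w] is not in it; but such cuts have at
    least four real edges. *)
Let no_bridge : ~ forall f, par l r [set gv] f = false.
Proof.
move=> Hp; have [||X HX] := (proj2 (pi_pl P)) [set gv] => //.
  by rewrite sub1set inE gS orbT.
have d0 : dgr X = 0.
  apply/eqP; rewrite (dg_count HX) cards_eq0; apply/eqP/setP => e; rewrite !inE.
  by case: (e =P gv) => [->|] //; rewrite (disjointFl (pi_dis P) gS).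
have [g gV jg] := pi_g P.
have gg : g != gv.
  apply/eqP => E0; rewrite E0 in jg; have := cut_joins [set v] jgv.
  rewrite (cut_joins _ jg) !inE eqxx; have [n1 n2] := W_neq vW.
  by rewrite ![_ == v]eq_sym (negbTE n1) (negbTE n2).
have := HX g; rewrite !inE gV orbT (negbTE gg) => /(_ isT)/esym.
have := HX gv; rewrite !inE gS orbT eqxx => /(_ isT)/esym.
rewrite (cut_joins _ jgv) (cut_joins _ jg) => c1 c2.
have dvX : (v \in X) != (d \in X) by move: c1 c2; do 3 case: (_ \in X).
have vW' : v \in d |: W by rewrite inE vW orbT.
move: dvX; case vX: (v \in X); case dX: (d \in X) => // _.
  by have := small vW' (setU11 d W) vX; rewrite dX d0 => /(_ isT).
by have := small (setU11 d W) vW' dX; rewrite vX d0 => /(_ isT).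
Qed.

(** An even part of the star that avoids [gv] is a cut of real edges, so it has at least four and is
    the whole real star. Then [gv] by itself would be even, against [no_bridge]. *)
Let minimalK (B : {set E}) : B \subset K -> B != set0 -> B != K ->
  ~ forall f, par l r B f = false.
Proof.
wlog gB : B / gv \notin B.
  move=> wl; case gB: (gv \in B); last by apply: wl; rewrite gB.
  move=> BK B0 BnK Hp; apply: (wl (K :\: B)).
  - by rewrite inE gB.
  - exact: subsetDl.
  - by rewrite setD_eq0; apply: contra BnK => KB; rewrite eqEsubset BK.
  - by apply/eqP => E0; have := gK; rewrite -E0 inE gB.
  move=> f; have := evenK f; rewrite /par (big_setID B) /= (setIidPr BK).
  by rewrite -/(par l r B f) Hp.
move=> BK B0 BnK Hp.
have BS : B \subset S by apply: subset_trans BK _; apply/subsetP => e; rewrite inE => /andP[].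
have [X HX] := (proj2 (pi_pl P)) B BS Hp.
have BR : B \subset K :\ gv by rewrite subsetD1 BK.
have BSR : B \subset SR.
  by apply: subset_trans BR _; rewrite realK; apply/subsetP => e; rewrite inE => /andP[].
have dX : dgr X = #|B| by rewrite (dg_count HX) (setIidPl BSR).
have [e eB] := set0Pn _ B0.
have := small_edge (subsetP BSR e eB); move=> /(_ X).
rewrite -HX ?(subsetP BS) // eB dX => /(_ isT) B4.
have EB : B = K :\ gv by apply/eqP; rewrite eqEcard BR card_real.
apply: no_bridge => f; have := evenK f.
rewrite {1}/par (big_setD1 gv) //= -EB -/(par l r B f) Hp addbF.
by rewrite /par big_set1.
Qed.

Lemma star_ex : exists e1 e2 e3 e4 p0 p1 p2 p3 p4, star v gv e1 e2 e3 e4 p0 p1 p2 p3 p4.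
Proof.
have [e1 [e2 [e3 [e4 [p0 [p1 [p2 [p3 [p4 [EK uK [fg f1 f2 f3 f4]]]]]]]]]]] :=
  rotation evenK minimalK gK cardK.
exists e1, e2, e3, e4, p0, p1, p2, p3, p4; split=> //; last by case/andP: uK.
move=> e; have /setP/(_ e) := realK; rewrite [e \in [set _ in _ | _]]inE => <-.
rewrite EK !inE; move: uK => /= /andP[]; rewrite !inE !negb_or => /and4P[n1 n2 n3 n4] _.
case: (e =P gv) => [->|_] /=; last by rewrite -!orbA.
by rewrite (negbTE n1) (negbTE n2) (negbTE n3) (negbTE n4).
Qed.

End Star.

Lemma star_real v g e1 e2 e3 e4 p0 p1 p2 p3 p4 e : star v g e1 e2 e3 e4 p0 p1 p2 p3 p4 ->
  e \in [:: e1; e2; e3; e4] -> exists t, [/\ e \in SR, joins a b e v t, t != v & t \in d |: W].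
Proof.
move=> st; rewrite -(st_e st) => /andP[eS ce]; have [t tv je] := cut1_joins ce.
by exists t; split=> //; have [] := real_ends eS je.
Qed.

(** What lies outside [N] falls into the two sides of the cycle, and these share the boundary of [N]
    between them. Each side is replaced by its complement if necessary, so that it avoids a chosen
    vertex [x]. *)
Lemma sides (C : {set E}) N (Phi : {set F}) x : C \subset S ->
  {in S, forall e, (e \in C) = (l e \in Phi) (+) (r e \in Phi)} ->
  {in C, forall e, (a e \in N) && (b e \in N)} ->
  exists X1 X2, [/\ forall e, e \in S -> cut a b X1 e = cut a b N e && (l e \in Phi),
     forall e, e \in S -> cut a b X2 e = cut a b N e && (l e \notin Phi),
     dgr X1 + dgr X2 = dgr N, x \notin X1 & x \notin X2].
Proof.
move=> CS HPhi CN.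
have norm X : exists2 X', cut a b X' =1 cut a b X & x \notin X'.
  case xX: (x \in X); last by exists X; rewrite ?xX.
  by exists (~: X); [move=> e; rewrite cutC | rewrite inE xX].
have [X1 HX1] := separation (pi_pl P) HPhi CN.
have HPhi' : {in S, forall e, (e \in C) = (l e \in ~: Phi) (+) (r e \in ~: Phi)}.
  by move=> e eS; rewrite HPhi // !inE; case: (l e \in Phi); case: (r e \in Phi).
have [X2 HX2] := separation (pi_pl P) HPhi' CN.
have [Y1 E1 n1] := norm X1; have [Y2 E2 n2] := norm X2.
exists Y1, Y2; split=> //.
- by move=> e eS; rewrite E1 HX1.
- by move=> e eS; rewrite E2 HX2 // inE.
rewrite /dg -big_split /=; apply: eq_bigr => e eS.
have eS' : e \in S by rewrite inE eS.
by rewrite E1 E2 HX1 // HX2 // inE; case: (cut a b N e); case: (l e \in Phi).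
Qed.

(** A real edge on either side makes both sides nontrivial, with four boundary edges each. Most
    contradictions with planarity come from finding fewer than eight edges around a short cycle. *)
Lemma two_sides (C : {set E}) N (Phi : {set F}) e (f : E) : C \subset S ->
  {in S, forall e, (e \in C) = (l e \in Phi) (+) (r e \in Phi)} ->
  {in C, forall e, (a e \in N) && (b e \in N)} -> e \in SR -> f \in SR ->
  cut a b N e -> cut a b N f -> (l e \in Phi) != (l f \in Phi) -> 8 <= dgr N.
Proof.
move=> CS HPhi CN eS fS ce cf ef.
have [X1 [X2 [H1 H2 <- _ _]]] := sides d CS HPhi CN.
have eS' : e \in S by rewrite inE eS.
have fS' : f \in S by rewrite inE fS.
have h1 : 4 <= dgr X1.
  case le: (l e \in Phi).
    by apply: (small_edge eS); rewrite H1 // ce le.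
  by apply: (small_edge fS); rewrite H1 // cf; move: ef; rewrite le; case: (l f \in Phi).
have h2 : 4 <= dgr X2.
  case le: (l e \in Phi).
    by apply: (small_edge fS); rewrite H2 // cf; move: ef; rewrite le; case: (l f \in Phi).
  by apply: (small_edge eS); rewrite H2 // ce le.
by slia.
Qed.

Lemma cycle_dual (s : seq E) : uniq s -> {subset s <= S} ->
  (forall X, \big[addb/false]_(e <- s) cut a b X e = false) ->
  exists Phi : {set F}, [set e in s] \subset S /\
    {in S, forall e, (e \in [set e in s]) = (l e \in Phi) (+) (r e \in Phi)}.
Proof.
move=> us sub ev; have sS : [set e in s] \subset S.
  by apply/subsetP => e; rewrite inE => /sub.
have [|Phi HP] := dual_cut (pi_pl P) sS; last by exists Phi.
by move=> X; rewrite xor_seq.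
Qed.

Lemma joins_N e x y N : joins a b e x y -> x \in N -> y \in N -> (a e \in N) && (b e \in N).
Proof. by move=> /orP[]/andP[/eqP -> /eqP ->] -> ->. Qed.

Lemma in_N3 e1 e2 e3 N : (a e1 \in N) && (b e1 \in N) -> (a e2 \in N) && (b e2 \in N) ->
  (a e3 \in N) && (b e3 \in N) ->
  {in [set e in [:: e1; e2; e3]], forall e, (a e \in N) && (b e \in N)}.
Proof. by move=> h1 h2 h3 e; rewrite !inE => /or3P[]/eqP ->. Qed.

Lemma in_N4 e1 e2 e3 e4 N : (a e1 \in N) && (b e1 \in N) -> (a e2 \in N) && (b e2 \in N) ->
  (a e3 \in N) && (b e3 \in N) -> (a e4 \in N) && (b e4 \in N) ->
  {in [set e in [:: e1; e2; e3; e4]], forall e, (a e \in N) && (b e \in N)}.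
Proof. by move=> h1 h2 h3 h4 e; rewrite !inE => /or4P[]/eqP ->. Qed.

Lemma virt_real_neq g e : g \in SV -> e \in SR -> g != e.
Proof. by move=> gV eS; apply: contraTneq eS => <-; rewrite (disjointFl (pi_dis P) gV). Qed.

Lemma virt_neq g1 g2 x y : x != y -> x != w -> joins a b g1 x w -> joins a b g2 y w -> g1 != g2.
Proof.
move=> xy xw j1 j2; apply: contraNneq xy => E0; rewrite E0 in j1.
by have := cut_joins [set x] j2; rewrite (joins_cut1 xw j1) !inE [w == x]eq_sym (negbTE xw) addbF eq_sym.
Qed.

Lemma dgN_w N : dgr (w |: N) = dgr N.
Proof.
apply: eq_bigr => e eS; congr nat_of_bool; rewrite /cut !inE.
have n1 := dW_neq_w G (pi_ra P eS); have n2 := dW_neq_w G (pi_rb P eS).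
by rewrite (negbTE n1) (negbTE n2).
Qed.

Lemma dg_pair x y e : x \in d |: W -> y \in d |: W -> x != y -> e \in SR -> joins a b e x y ->
  dgr [set x; y] + 2 <= deg x + deg y.
Proof.
move=> xW yW xy eS je; have dis : [disjoint [set x] & [set y]].
  by rewrite disjoints1 inE.
have := dgU a b SR dis; suff : 1 <= \sum_(f in SR) (cut a b [set x] f && cut a b [set y] f).
  by slia.
rewrite (big_setD1 e) //= (joins_cut1 xy je).
by move: je; rewrite joinsC => je; rewrite (joins_cut1 _ je) // eq_sym.
Qed.

(* If e2 led to a degree-four vertex s, the triangle w v s would separate the
   graph along at most six real edges, two of them being on each side. *)
Lemma adj_four v g e1 e2 e3 e4 p0 p1 p2 p3 p4 s : v \in W -> deg v = 4 ->
  star v g e1 e2 e3 e4 p0 p1 p2 p3 p4 -> joins a b e2 v s -> s \in W -> 5 <= deg s.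
Proof.
move=> vW v4 st j2 sW; rewrite ltnNge; apply/negP => s4.
have {}s4 : deg s = 4 by have := deg_ge4 sW; slia.
have [gs gsV jgs] := virt_of sW s4.
have inS i : i \in [:: e1; e2; e3; e4] -> i \in SR by rewrite -(st_e st) => /andP[].
have S1 : e1 \in SR by apply: inS; rewrite !inE eqxx.
have S2 : e2 \in SR by apply: inS; rewrite !inE eqxx orbT.
have S3 : e3 \in SR by apply: inS; rewrite !inE eqxx !orbT.
have [_ _ vs] := real_ends S2 j2.
have [vd vw] := W_neq vW; have [sd sw] := W_neq sW.
have gg : g != gs := virt_neq vs vw (st_jg st) jgs.
have us : uniq [:: g; e2; gs].
  rewrite /= !inE negb_or gg (virt_real_neq (st_g st) S2) /=.
  by rewrite eq_sym (virt_real_neq gsV S2).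
have sub : {subset [:: g; e2; gs] <= S}.
  move=> i; rewrite !inE => /or3P[]/eqP ->; rewrite ?S2 ?(st_g st) ?gsV ?orbT //.
have [|Phi [CS HPhi]] := cycle_dual us sub.
  move=> X; rewrite !big_cons big_nil (cut_joins _ (st_jg st)) (cut_joins _ j2) (cut_joins _ jgs).
  by do 3 case: (_ \in X).
pose N := w |: [set v; s].
have vN : v \in N by rewrite !inE eqxx orbT.
have sN : s \in N by rewrite !inE eqxx !orbT.
have wN : w \in N by rewrite !inE eqxx.
have CN : {in [set e in [:: g; e2; gs]], forall e, (a e \in N) && (b e \in N)}.
  apply: in_N3.
  - exact: joins_N (st_jg st) vN wN.
  - exact: joins_N j2 vN sN.
  - exact: joins_N jgs sN wN.
have usr := st_u st.
have cutN i : i \in [:: e1; e2; e3; e4] -> i != e2 -> cut a b N i.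
  move=> iE i2; have [t [iS ji tv tW]] := star_real st iE.
  rewrite (cut_joins _ ji) vN !inE (negbTE (dW_neq_w G tW)) (negbTE tv) /=.
  apply/negP => /eqP Et; case/negP: i2; apply/eqP.
  by rewrite Et in ji; apply: (re_par H vW sW vs iS S2 ji j2).
have [n12 n23] : e1 != e2 /\ e3 != e2.
  by move: usr; rewrite /= !inE !negb_or => /and3P[/and3P[-> _ _] /andP[H1 _] _]; rewrite eq_sym.
have notC i : i \in SR -> i != e2 -> i \notin [set e in [:: g; e2; gs]].
  move=> iS i2; rewrite !inE !negb_or i2 /=.
  by rewrite ![i == _]eq_sym (virt_real_neq (st_g st) iS) (virt_real_neq gsV iS).
have S1' : e1 \in S by rewrite inE S1.
have S2' : e2 \in S by rewrite inE S2.
have S3' : e3 \in S by rewrite inE S3.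
have := two_sides CS HPhi CN S1 S3 (cutN e1 _ n12) (cutN e3 _ n23).
rewrite !inE !eqxx !orbT => /(_ isT isT).
rewrite (joins_side S1' (notC _ S1 n12) HPhi (st_f1 st)).
rewrite (joins_side S3' (notC _ S3 n23) HPhi (st_f3 st)).
have := joins_in S1' HPhi (st_f1 st); rewrite (negbTE (notC _ S1 n12)).
have := joins_in S2' HPhi (st_f2 st); rewrite !inE eqxx orbT.
have := dg_pair _ _ vs S2 j2; rewrite v4 s4 dgN_w !inE vW sW !orbT => /(_ isT isT) h6.
case: (p1 \in Phi); case: (p2 \in Phi); case: (p3 \in Phi) => //= _ _ /(_ isT); slia.
Qed.

Lemma deg_root : deg d = D.
Proof. by apply: eq_bigr => e eS; rewrite (cut_root G). Qed.

(** The triangle on [v], [d] and [w], closed by the virtual edges of [v] and of the root; [e2] is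
    its only real edge, so the other real edges at [v] keep to one side each. *)
Lemma root_cycle v g e2 : v \in W -> g \in SV -> joins a b g v w -> e2 \in SR -> joins a b e2 v d ->
  exists (C : {set E}) (Phi : {set F}), [/\ C \subset S, {in S, forall e, (e \in C) = (l e \in Phi) (+) (r e \in Phi)},
    {in C, forall e, (a e \in w |: [set v; d]) && (b e \in w |: [set v; d])},
    forall e, e \in SR -> (e \in C) = (e == e2) & g \in C].
Proof.
move=> vW gV jg S2 j2; have [g0 g0V jg0] := pi_g P.
have [vd vw] := W_neq vW.
have gg : g != g0 := virt_neq vd vw jg jg0.
have us : uniq [:: g; e2; g0].
  rewrite /= !inE negb_or gg (virt_real_neq gV S2) /=.
  by rewrite eq_sym (virt_real_neq g0V S2).
have sub : {subset [:: g; e2; g0] <= S}.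
  move=> i; rewrite !inE => /or3P[]/eqP ->; rewrite ?S2 ?gV ?g0V ?orbT //.
have [|Phi [CS HPhi]] := cycle_dual us sub.
  move=> X; rewrite !big_cons big_nil (cut_joins _ jg) (cut_joins _ j2) (cut_joins _ jg0).
  by do 3 case: (_ \in X).
exists [set e in [:: g; e2; g0]], Phi; split=> //; last by rewrite !inE eqxx.
  have vN : v \in w |: [set v; d] by rewrite !inE eqxx orbT.
  have dN : d \in w |: [set v; d] by rewrite !inE eqxx !orbT.
  have wN : w \in w |: [set v; d] by rewrite !inE eqxx.
  apply: in_N3.
  - exact: joins_N jg vN wN.
  - exact: joins_N j2 vN dN.
  - exact: joins_N jg0 dN wN.
move=> i iS; rewrite !inE.
by rewrite ![i == g]eq_sym (negbTE (virt_real_neq gV iS)) [i == g0]eq_sym (negbTE (virt_real_neq g0V iS)) orbF.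
Qed.

Lemma star_notd v i t : v \in W -> i \in SR -> joins a b i v t -> t != d ->
  cut a b (w |: [set v; d]) i.
Proof.
move=> vW iS ji td; have [_ tW vt] := real_ends iS ji.
rewrite (cut_joins _ ji) !inE eqxx orbT (negbTE td) (negbTE (dW_neq_w G tW)).
by rewrite eq_sym (negbTE vt).
Qed.

(** The triangle through [e2] has at most 4 + 6 - 2 boundary edges, with [e1] on one side and [e3],
    [e4] on the other. The side of [e1] takes four, so the other side has at most four and reduces
    to a single vertex; then [e3] and [e4] are parallel. *)
Lemma adj_root1 v g e1 e2 e3 e4 p0 p1 p2 p3 p4 : v \in W -> deg v = 4 ->
  star v g e1 e2 e3 e4 p0 p1 p2 p3 p4 -> joins a b e2 v d ->
  ~ (forall e, e \in SR -> joins a b e v d -> e = e2).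
Proof.
move=> vW v4 st j2 uniq2.
have inS i : i \in [:: e1; e2; e3; e4] -> i \in SR by rewrite -(st_e st) => /andP[].
have S1 : e1 \in SR by apply: inS; rewrite !inE eqxx.
have S2 : e2 \in SR by apply: inS; rewrite !inE eqxx orbT.
have S3 : e3 \in SR by apply: inS; rewrite !inE eqxx !orbT.
have S4 : e4 \in SR by apply: inS; rewrite !inE eqxx !orbT.
have SS i : i \in SR -> i \in S by move=> iS; rewrite inE iS.
have [vd vw] := W_neq vW.
have [C [Phi [CS HPhi CN Ce2 gC]]] := root_cycle vW (st_g st) (st_jg st) S2 j2.
have [n12 n32 n42 n34] : [/\ e1 != e2, e3 != e2, e4 != e2 & e3 != e4].
  have := st_u st; rewrite /= !inE !negb_or => /and4P[/and3P[-> _ _] /andP[h1 h2] h3 _].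
  by split=> //; rewrite eq_sym.
have nC i : i \in SR -> i != e2 -> i \notin C by move=> iS i2; rewrite Ce2.
have notd i t : i \in SR -> i != e2 -> joins a b i v t -> t != d.
  by move=> iS i2 ji; apply: contraNneq i2 => E0; rewrite E0 in ji; apply/eqP; apply: uniq2.
have [t1 [_ j1 _ _]] : exists t, [/\ e1 \in SR, joins a b e1 v t, t != v & t \in d |: W].
  by apply: (star_real st); rewrite !inE eqxx.
have [t3 [_ j3 t3v t3W]] : exists t, [/\ e3 \in SR, joins a b e3 v t, t != v & t \in d |: W].
  by apply: (star_real st); rewrite !inE eqxx !orbT.
have [t4 [_ j4 t4v t4W]] : exists t, [/\ e4 \in SR, joins a b e4 v t, t != v & t \in d |: W].
  by apply: (star_real st); rewrite !inE eqxx !orbT.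
have c1 := star_notd vW S1 j1 (notd _ _ S1 n12 j1).
have c3 := star_notd vW S3 j3 (notd _ _ S3 n32 j3).
have c4 := star_notd vW S4 j4 (notd _ _ S4 n42 j4).
have vW' : v \in d |: W by rewrite inE vW orbT.
have := dg_pair vW' (setU11 d W) vd S2 j2; rewrite -dgN_w v4 deg_root => h8.
have D6 := go_D G.
have [X1 [X2 [H1 H2 E12 v1 v2]]] := sides v CS HPhi CN.
have q1 := joins_side (SS _ S1) (nC _ S1 n12) HPhi (st_f1 st).
have q3 := joins_side (SS _ S3) (nC _ S3 n32) HPhi (st_f3 st).
have q4 := joins_side (SS _ S4) (nC _ S4 n42) HPhi (st_f4 st).
have r1 := joins_in (SS _ S1) HPhi (st_f1 st); rewrite (negbTE (nC _ S1 n12)) in r1.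
have r2 := joins_in (SS _ S2) HPhi (st_f2 st); rewrite (Ce2 _ S2) eqxx in r2.
have r3 := joins_in (SS _ S3) HPhi (st_f3 st); rewrite (negbTE (nC _ S3 n32)) in r3.
have fin (Y : {set U}) : v \notin Y -> ~~ cut a b Y e2 -> dgr Y <= 4 -> cut a b Y e3 -> cut a b Y e4 -> False.
  move=> vY c2 Y4; rewrite (cut_joins _ j3) (cut_joins _ j4) (negbTE vY) /= => y3 y4.
  have dY : d \notin Y by move: c2; rewrite (cut_joins _ j2) (negbTE vY).
  move: Y4; rewrite dg_side (negbTE dY) => Y4.
  have t3W' : t3 \in W by move: t3W; rewrite !inE (negbTE (notd _ _ S3 n32 j3)).
  have t4W' : t4 \in W by move: t4W; rewrite !inE (negbTE (notd _ _ S4 n42 j4)).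
  have sY : Y :&: W \subset W := subsetIr _ _.
  have nY : Y :&: W != W by apply/eqP => E0; have := vW; rewrite -E0 inE (negbTE vY).
  have Y1 : #|Y :&: W| <= 1.
    by rewrite leqNgt; apply/negP => lt; have := re_6 H sY nY lt; slia.
  have E34 : t3 = t4.
    by apply: (card_le1_eqP Y1); rewrite inE ?y3 ?y4.
  rewrite -E34 in j4; case/eqP: n34.
  by apply: (re_par H vW t3W' _ S3 S4 j3 j4); rewrite eq_sym.
have c2 : cut a b (w |: [set v; d]) e2 = false.
  by rewrite (cut_joins _ j2) !inE !eqxx !orbT.
case p1P: (p1 \in Phi) in r1 r2 q1 *.
  have h1 : 4 <= dgr X1 by apply: (small_edge S1); rewrite H1 ?SS // c1 q1.
  apply: (fin X2 v2); [by rewrite H2 ?SS // c2 | by slia | |].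
    by rewrite H2 ?SS // c3 q3; move: r1 r2; case: (p2 \in Phi); case: (p3 \in Phi).
  by rewrite H2 ?SS // c4 q4; move: r1 r2 r3; case: (p2 \in Phi); case: (p3 \in Phi); case: (p4 \in Phi).
have h1 : 4 <= dgr X2 by apply: (small_edge S1); rewrite H2 ?SS // c1 q1.
apply: (fin X1 v1); [by rewrite H1 ?SS // c2 | by slia | |].
  by rewrite H1 ?SS // c3 q3; move: r1 r2; case: (p2 \in Phi); case: (p3 \in Phi).
by rewrite H1 ?SS // c4 q4; move: r1 r2 r3; case: (p2 \in Phi); case: (p3 \in Phi); case: (p4 \in Phi).
Qed.

(** Two parallel edges to the root lower the boundary of the triangle to 4 + 6 - 4, too few for [e1]
    on one side and [e4] on the other. *)
Lemma adj_root2 v g e1 e2 e3 e4 p0 p1 p2 p3 p4 t1 t4 : v \in W -> deg v = 4 ->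
  star v g e1 e2 e3 e4 p0 p1 p2 p3 p4 -> joins a b e2 v d -> joins a b e3 v d ->
  joins a b e1 v t1 -> t1 != d -> joins a b e4 v t4 -> t4 != d -> False.
Proof.
move=> vW v4 st j2 j3 j1 t1d j4 t4d.
have inS i : i \in [:: e1; e2; e3; e4] -> i \in SR by rewrite -(st_e st) => /andP[].
have S1 : e1 \in SR by apply: inS; rewrite !inE eqxx.
have S2 : e2 \in SR by apply: inS; rewrite !inE eqxx orbT.
have S3 : e3 \in SR by apply: inS; rewrite !inE eqxx !orbT.
have S4 : e4 \in SR by apply: inS; rewrite !inE eqxx !orbT.
have SS i : i \in SR -> i \in S by move=> iS; rewrite inE iS.
have [vd vw] := W_neq vW.
have [C [Phi [CS HPhi CN Ce2 gC]]] := root_cycle vW (st_g st) (st_jg st) S2 j2.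
have [n12 n32 n42] : [/\ e1 != e2, e3 != e2 & e4 != e2].
  have := st_u st; rewrite /= !inE !negb_or => /and4P[/and3P[-> _ _] /andP[h1 h2] h3 _].
  by split=> //; rewrite eq_sym.
have nC i : i \in SR -> i != e2 -> i \notin C by move=> iS i2; rewrite Ce2.
have := two_sides CS HPhi CN S1 S4 (star_notd vW S1 j1 t1d) (star_notd vW S4 j4 t4d).
rewrite (joins_side (SS _ S1) (nC _ S1 n12) HPhi (st_f1 st)).
rewrite (joins_side (SS _ S4) (nC _ S4 n42) HPhi (st_f4 st)).
have := joins_in (SS _ S1) HPhi (st_f1 st); rewrite (negbTE (nC _ S1 n12)).
have := joins_in (SS _ S2) HPhi (st_f2 st); rewrite (Ce2 _ S2) eqxx.
have := joins_in (SS _ S3) HPhi (st_f3 st); rewrite (negbTE (nC _ S3 n32)).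
have dis : [disjoint [set v] & [set d]] by rewrite disjoints1 inE.
have := dgU a b SR dis; rewrite v4 deg_root dgN_w.
have : 2 <= \sum_(f in SR) (cut a b [set v] f && cut a b [set d] f).
  have u23 : uniq [:: e2; e3] by rewrite /= inE eq_sym n32.
  have sub : {subset [:: e2; e3] <= SR} by move=> i; rewrite !inE => /orP[]/eqP ->.
  apply: leq_trans (sum_ge_seq (fun f => cut a b [set v] f && cut a b [set d] f) u23 sub).
  rewrite !big_cons big_nil !(cut_joins _ j2) !(cut_joins _ j3) !inE !eqxx.
  by rewrite [d == v]eq_sym (negbTE vd).
have := go_D G => D6 h2 h3.
by case: (p1 \in Phi); case: (p2 \in Phi); case: (p3 \in Phi); case: (p4 \in Phi) => //= _ _ _ /(_ isT);
  slia.
Qed.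

Local Notation mr v := (\sum_(e in SR) (cut a b W e && cut a b [set v] e)).

Lemma root_cut e v : v \in W -> e \in SR -> joins a b e v d -> cut a b W e && cut a b [set v] e.
Proof.
move=> vW eS je; have [vd _] := W_neq vW.
by rewrite (cut_joins _ je) vW (negbTE dW) (joins_cut1 vd je).
Qed.

Lemma mr_uniq v (e f : E) : v \in W -> mr v <= 1 -> e \in SR -> f \in SR ->
  joins a b e v d -> joins a b f v d -> e = f.
Proof.
move=> vW m1 eS fS je jf; apply/eqP; apply: contraT => ef.
have u2 : uniq [:: e; f] by rewrite /= inE ef.
have sub : {subset [:: e; f] <= SR} by move=> i; rewrite !inE => /orP[]/eqP ->.
have := sum_ge_seq (fun f => cut a b W f && cut a b [set v] f) u2 sub.
by rewrite !big_cons big_nil !root_cut // => h; have := leq_trans h m1.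
Qed.

(** By [adj_four] the two middle edges at [u] cannot lead to vertices of degree four, so both end in
    the root, and no third edge does; [adj_root2] applies. In the case left over by [root_four], the
    root, [w] and the three vertices would form a [K_5] with doubled root edges. *)
Lemma no_K5 u h : (forall v, v \in W -> deg v = 4) -> u \in W -> h \in SR -> ~ joins a b h d u.
Proof.
move=> all4 uW hS jh; have [g gV jg] := virt_of uW (all4 u uW).
have [e1 [e2 [e3 [e4 [p0 [p1 [p2 [p3 [p4 st]]]]]]]]] := star_ex uW (all4 u uW) gV jg.
have mid f1 f2 f3 f4 q0 q1 q2 q3 q4 : star u g f1 f2 f3 f4 q0 q1 q2 q3 q4 -> joins a b f2 u d.
  move=> st'; have [t [fS jf tu]] : exists t, [/\ f2 \in SR, joins a b f2 u t, t != u & t \in d |: W].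
    by apply: (star_real st'); rewrite !inE eqxx orbT.
  rewrite !inE => /orP[/eqP <-//|tW].
  by have := adj_four uW (all4 u uW) st' jf tW; rewrite all4.
have j2 := mid _ _ _ _ _ _ _ _ _ st; have j3 := mid _ _ _ _ _ _ _ _ _ (star4_rev st).
have [t1 [S1 j1 _ _]] : exists t, [/\ e1 \in SR, joins a b e1 u t, t != u & t \in d |: W].
  by apply: (star_real st); rewrite !inE eqxx.
have [t4 [S4 j4 _ _]] : exists t, [/\ e4 \in SR, joins a b e4 u t, t != u & t \in d |: W].
  by apply: (star_real st); rewrite !inE eqxx !orbT.
have [S2 S3] : e2 \in SR /\ e3 \in SR.
  by split; [have [] := star_real st (e := e2) | have [] := star_real st (e := e3)];
    rewrite ?inE ?eqxx ?orbT // => t [].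
have sU : [set u] \subset W by rewrite sub1set.
have m2 : mr u <= 2.
  have := dg_root a b SR sU; rewrite all4 //.
  have : 6 <= dgr (W :\: [set u]).
    apply: (re_6 H); first exact: subsetDl.
      by apply/eqP => E0; have := uW; rewrite -E0 !inE eqxx.
    by have := cardsD1 u W; rewrite uW; have := re_W H; slia.
  by have := go_D G; slia.
have us := st_u st.
have three i : i \in SR -> uniq [:: i; e2; e3] -> ~ joins a b i u d.
  move=> iS ui ji.
  have sub : {subset [:: i; e2; e3] <= SR} by move=> j; rewrite !inE => /or3P[]/eqP ->.
  have := sum_ge_seq (fun f => cut a b W f && cut a b [set u] f) ui sub.
  by rewrite !big_cons big_nil !root_cut // => h'; have := leq_trans h' m2.
have td i t : joins a b i u t -> i \in SR -> uniq [:: i; e2; e3] -> t != d.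
  by move=> ji iS ui; apply/eqP => E0; rewrite E0 in ji; exact: three ji.
move: us; rewrite /= !inE !negb_or => /and4P[/and3P[n12 n13 _] /andP[n23 n24] n34 _].
apply: (adj_root2 uW (all4 u uW) st j2 j3 j1 _ j4).
  by apply: td j1 S1 _; rewrite /= !inE !negb_or n12 n13 n23.
by apply: td j4 S4 _; rewrite /= !inE !negb_or ![e4 == _]eq_sym n24 n34 n23.
Qed.

Lemma adj v g e1 e2 e3 e4 p0 p1 p2 p3 p4 : v \in W -> deg v = 4 -> mr v <= 1 ->
  star v g e1 e2 e3 e4 p0 p1 p2 p3 p4 ->
  exists s, [/\ e2 \in SR, joins a b e2 v s, s \in W, s != v & 5 <= deg s].
Proof.
move=> vW v4 m1 st.
have [s [S2 j2 sv sW]] : exists t, [/\ e2 \in SR, joins a b e2 v t, t != v & t \in d |: W].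
  by apply: (star_real st); rewrite !inE eqxx orbT.
exists s; case: (s =P d) => [E0|/eqP sd].
  rewrite E0 in j2; case: (adj_root1 vW v4 st j2) => e eS je; exact: (mr_uniq vW m1 eS S2).
have {}sW : s \in W by move: sW; rewrite !inE (negbTE sd).
split=> //; exact: adj_four st j2 sW.
Qed.

Lemma joins_two (e : E) (l0 r0 : E -> F) (x y x' y' : F) : joins l0 r0 e x y -> joins l0 r0 e x' y' ->
  (x = x' /\ y = y') \/ (x = y' /\ y = x').
Proof.
by move=> /orP[]/andP[/eqP <- /eqP <-] /orP[]/andP[/eqP -> /eqP ->]; auto.
Qed.

(** The edges follow the cyclic order [gu], [h], [c], [b0], [a0] around [u]. The root edge is next
    to the virtual one because, by [adj], the two middle edges lead to vertices of degree at least
    five. *)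
Record conf1 (u : U) (gu h c b0 a0 : E) (p0 p1 p2 p3 p4 : F) (wc wb V : U) : Prop := Conf1 {
  c1_u : u \in W;
  c1_u4 : deg u = 4;
  c1_st : star u gu h c b0 a0 p0 p1 p2 p3 p4;
  c1_jh : joins a b h u d;
  c1_jc : joins a b c u wc;
  c1_jb : joins a b b0 u wb;
  c1_ja : joins a b a0 u V;
  c1_wc : wc \in W;
  c1_wb : wb \in W;
  c1_V : V \in W;
  c1_wc5 : 5 <= deg wc;
  c1_wb5 : 5 <= deg wb }.

Lemma conf1_ex u h : u \in W -> deg u = 4 -> mr u <= 1 -> h \in SR -> joins a b h d u ->
  exists gu c b0 a0 p0 p1 p2 p3 p4 wc wb V, conf1 u gu h c b0 a0 p0 p1 p2 p3 p4 wc wb V.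
Proof.
move=> uW u4 m1 hS jh; rewrite joinsC in jh.
have [gu gV jg] := virt_of uW u4; have [ud _] := W_neq uW.
have [e1 [e2 [e3 [e4 [p0 [p1 [p2 [p3 [p4 st]]]]]]]]] := star_ex uW u4 gV jg.
wlog h1 : e1 e2 e3 e4 p0 p1 p2 p3 p4 st / h = e1.
  move=> wl; have : h \in [:: e1; e2; e3; e4] by rewrite -(st_e st) hS (joins_cut1 ud jh).
  have ex2 f1 f2 f3 f4 q0 q1 q2 q3 q4 : star u gu f1 f2 f3 f4 q0 q1 q2 q3 q4 -> h != f2.
    move=> st'; apply/eqP => E0; have [s [_ js sW _ _]] := adj uW u4 m1 st'.
    by rewrite -E0 in js; have := joins_inj jh js => E1; move: dW; rewrite E1 sW.
  rewrite !inE (negbTE (ex2 _ _ _ _ _ _ _ _ _ st)) (negbTE (ex2 _ _ _ _ _ _ _ _ _ (star4_rev st))) /=.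
  by case/orP => /eqP E0; [apply: wl st E0 | apply: wl (star4_rev st) E0].
subst e1.
have [wc [_ jc wcW _ wc5]] := adj uW u4 m1 st.
have [wb [_ jb wbW _ wb5]] := adj uW u4 m1 (star4_rev st).
have [V [S4 ja Vu VW]] : exists t, [/\ e4 \in SR, joins a b e4 u t, t != u & t \in d |: W].
  by apply: (star_real st); rewrite !inE eqxx !orbT.
exists gu, e2, e3, e4, p0, p1, p2, p3, p4, wc, wb, V; split=> //.
move: VW; rewrite !inE => /orP[/eqP Ed|//]; rewrite Ed in ja.
have Eh := mr_uniq uW m1 S4 hS ja jh; have := st_u st.
by rewrite -Eh /= !inE eqxx !orbT.
Qed.

(** The faces [p0] and [p4] of [a0] reappear in the star of [V]: at both ends [p0] separates [a0]
    from the virtual edge, and [p4] is shared by [b0], [a0] and [kc]. The two stars are thus glued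
    along [a0] without a twist. *)
Record conf2 (u V : U) (a0 : E) (p0 p4 : F) (gV kc kb ka : E) (s0 s3 s4 : F) (Z Zb V0 : U)
    : Prop := Conf2 {
  c2_st : star V gV a0 kc kb ka s0 p0 p4 s3 s4;
  c2_jc : joins a b kc V Z;
  c2_jb : joins a b kb V Zb;
  c2_ja : joins a b ka V V0;
  c2_Z : Z \in W;
  c2_Zb : Zb \in W;
  c2_Z5 : 5 <= deg Z;
  c2_Zb5 : 5 <= deg Zb;
  c2_V0 : V0 \in d |: W }.

Lemma conf2_ex u gu h c b0 a0 p0 p1 p2 p3 p4 wc wb V :
  conf1 u gu h c b0 a0 p0 p1 p2 p3 p4 wc wb V -> deg V = 4 ->
  exists gV kc kb ka (s0 s3 s4 : F) Z Zb V0, conf2 u V a0 p0 p4 gV kc kb ka s0 s3 s4 Z Zb V0.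
Proof.
move=> cf V4; case: (cf) => uW u4 st jh jc jb ja wcW wbW VW wc5 wb5.
have inS i : i \in [:: h; c; b0; a0] -> i \in SR by rewrite -(st_e st) => /andP[].
have Sh : h \in SR by apply: inS; rewrite !inE eqxx.
have Sc : c \in SR by apply: inS; rewrite !inE eqxx !orbT.
have Sa : a0 \in SR by apply: inS; rewrite !inE eqxx !orbT.
have [_ _ uV] := real_ends Sa ja; have [ud uw] := W_neq uW; have [Vd Vw] := W_neq VW.
have Vwc : V != wc by apply: contraTneq wc5 => <-; rewrite V4.
have sV : [set V] \subset W by rewrite sub1set.
(* The vertex [wc] has degree at least five, so the rest of [W] has seven boundary edges by [re_7],
   which leaves at most one root edge at [V]. *)
have m1 : mr V <= 1.
  have := dg_root a b SR sV; rewrite V4.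
  have : 7 <= dgr (W :\: [set V]).
    apply: (re_7 H (v := wc)) => //; first exact: subsetDl.
    - by apply/eqP => E0; have := VW; rewrite -E0 !inE eqxx.
    - by have := cardsD1 V W; rewrite VW; have := re_W H; slia.
    by rewrite !inE eq_sym Vwc.
  by have := go_D G; slia.
have [gV gVV jgV] := virt_of VW V4.
have [e1 [e2 [e3 [e4 [s0 [s1 [s2 [s3 [s4 stV]]]]]]]]] := star_ex VW V4 gVV jgV.
have jaV : joins a b a0 V u by rewrite joinsC.
wlog a1 : e1 e2 e3 e4 s0 s1 s2 s3 s4 stV / a0 = e1.
  move=> wl; have : a0 \in [:: e1; e2; e3; e4].
    by rewrite -(st_e stV) Sa (joins_cut1 _ jaV) // eq_sym.
  have ex2 f1 f2 f3 f4 q0 q1 q2 q3 q4 : star V gV f1 f2 f3 f4 q0 q1 q2 q3 q4 -> a0 != f2.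
    move=> st'; apply/eqP => E0; have [s [_ js sW _ s5]] := adj VW V4 m1 st'.
    by rewrite -E0 in js; have := joins_inj jaV js => E1; move: s5; rewrite -E1 u4.
  rewrite !inE (negbTE (ex2 _ _ _ _ _ _ _ _ _ stV)) (negbTE (ex2 _ _ _ _ _ _ _ _ _ (star4_rev stV))) /=.
  by case/orP => /eqP E0; [apply: wl stV E0 | apply: wl (star4_rev stV) E0].
subst e1.
have [Z [Skc jkc ZW ZV Z5]] := adj VW V4 m1 stV.
have [Zb [Skb jkb ZbW _ Zb5]] := adj VW V4 m1 (star4_rev stV).
have [V0 [S4 jka V0V V0W]] : exists t, [/\ e4 \in SR, joins a b e4 V t, t != V & t \in d |: W].
  by apply: (star_real stV); rewrite !inE eqxx !orbT.
exists gV, e2, e3, e4, s0, s3, s4, Z, Zb, V0; split=> //.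
have [[E1 E2]|[E1 E2]] := joins_two (st_f4 st) (st_f1 stV); last by rewrite E1 E2.
(* the other face order would make the triangle w u V separate three edges from three *)
exfalso.
have gg : gu != gV := virt_neq uV uw (st_jg st) jgV.
have SS i : i \in SR -> i \in S by move=> iS; rewrite inE iS.
have us : uniq [:: gu; a0; gV].
  rewrite /= !inE negb_or gg (virt_real_neq (st_g st) Sa) /=.
  by rewrite eq_sym (virt_real_neq gVV Sa).
have sub : {subset [:: gu; a0; gV] <= S}.
  by move=> i; rewrite !inE => /or3P[]/eqP ->; rewrite ?Sa ?(st_g st) ?gVV ?orbT.
have [|Phi [CS HPhi]] := cycle_dual us sub.
  move=> X; rewrite !big_cons big_nil (cut_joins _ (st_jg st)) (cut_joins _ ja) (cut_joins _ jgV).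
  by do 3 case: (_ \in X).
pose N := w |: [set u; V].
have uN : u \in N by rewrite !inE eqxx orbT.
have VN : V \in N by rewrite !inE eqxx !orbT.
have wN : w \in N by rewrite !inE eqxx.
have CN : {in [set e in [:: gu; a0; gV]], forall e, (a e \in N) && (b e \in N)}.
  apply: in_N3.
  - exact: joins_N (st_jg st) uN wN.
  - exact: joins_N ja uN VN.
  - exact: joins_N jgV VN wN.
have notC i : i \in SR -> i != a0 -> i \notin [set e in [:: gu; a0; gV]].
  move=> iS i2; rewrite !inE !negb_or i2 /=.
  by rewrite ![i == _]eq_sym (virt_real_neq (st_g st) iS) (virt_real_neq gVV iS).
have [hc hb ha nca] : [/\ h != c, h != b0, h != a0 & c != a0].
  have := st_u st; rewrite /= !inE !negb_or => /and4P[/and3P[-> -> ->] /andP[_ ->] _ _].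
  by [].
have kca : e2 != a0.
  by have := st_u stV; rewrite /= !inE !negb_or => /and4P[/and3P[h1 _ _] _ _ _]; rewrite eq_sym.
have Zu : Z != u by apply: contraTneq Z5 => ->; rewrite u4.
have ccut : cut a b N c.
  rewrite (cut_joins _ jc) uN !inE (negbTE (proj2 (W_neq wcW))) [wc == V]eq_sym (negbTE Vwc).
  by have [_ _ n] := real_ends Sc jc; rewrite eq_sym (negbTE n).
have kcut : cut a b N e2.
  rewrite (cut_joins _ jkc) VN !inE (negbTE (proj2 (W_neq ZW))) (negbTE Zu) (negbTE ZV) //.
have uW' : u \in d |: W by rewrite inE uW orbT.
have VW' : V \in d |: W by rewrite inE VW orbT.
have := dg_pair uW' VW' uV Sa ja; rewrite u4 V4 -dgN_w => h6.
have := two_sides CS HPhi CN Sc Skc ccut kcut.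
rewrite (joins_side (SS _ Sc) (notC _ Sc nca) HPhi (st_f2 st)).
rewrite (joins_side (SS _ Skc) (notC _ Skc kca) HPhi (st_f2 stV)) -E2.
have := joins_in (SS _ Sh) HPhi (st_f1 st); rewrite (negbTE (notC _ Sh ha)).
have := joins_in (sub gu _) HPhi (st_fg st); rewrite !inE eqxx /= => /(_ isT).
by case: (p0 \in Phi); case: (p1 \in Phi); case: (p2 \in Phi) => //= _ _ /(_ isT); rewrite -/N in h6 *; slia.
Qed.

End Fixed.

End Geometry.

(** * Reducing the configurations *)

Section Moves.

Variables (U E F : finType).
Implicit Types (A X N R : {set U}) (e h k g : E) (u v x y z s t o : U) (p q : F).

Definition mv x y u : U := if u == x then y else u.

Lemma contract1 (a b : E -> U) (l r : E -> F) (S : {set E}) k x y : k \in S -> joins a b k x y ->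
  planar_struct a b l r S -> planar_struct (mv x y \o a) (mv x y \o b) l r (S :\ k).
Proof.
move=> kS jk; apply: planar_quot; first exact: subD1set.
  move=> e; rewrite !inE negb_and negbK andb_orl andNb orbF => /andP[/eqP -> _].
  move: jk; rewrite /mv => /orP[]/andP[/eqP -> /eqP ->]; rewrite eqxx //; by case: eqP.
move=> X HX; exists X => // u v; have : ~~ cut a b X k by apply: HX; rewrite !inE eqxx.
rewrite (cut_joins _ jk) /mv => xy.
have {}xy : (x \in X) = (y \in X) by move: xy; case: (x \in X); case: (y \in X).
by case: (u =P x) => [->|_]; case: (v =P x) => [->|_] // E0; rewrite ?xy ?E0 // -E0.
Qed.

Lemma mv_id x y u : u != x -> mv x y u = u.
Proof. by rewrite /mv => /negbTE ->. Qed.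

Lemma mv_eq x y : mv x y x = y.
Proof. by rewrite /mv eqxx. Qed.

Lemma joins_mv (a b : E -> U) e x y s t : joins a b e s t ->
  joins (mv x y \o a) (mv x y \o b) e (mv x y s) (mv x y t).
Proof. by rewrite /joins /= => /orP[]/andP[/eqP -> /eqP ->]; rewrite !eqxx ?orbT. Qed.

(** Signs are prescribed relative to an owner [o] of the edge instead of its stored direction:
    [sg s] is the flow leaving [o]. *)
Lemma contrib (a b : E -> U) e o t (s : bool) v : o != t -> joins a b e o t ->
  (dlt a b v e * sg (if a e == o then s else ~~ s) = ((o == v)%:R - (t == v)%:R) * sg s)%R.
Proof.
move=> ot /orP[]/andP[/eqP Ea /eqP Eb]; rewrite /dlt Ea Eb ?eqxx //.
by rewrite [t == o]eq_sym (negbTE ot) sgN mulrN -mulNr opprB.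
Qed.

Lemma exists_map (T : Type) (x0 : T) (s : seq E) (vals : seq T) : uniq s -> size vals = size s ->
  exists f : E -> T, map f s = vals.
Proof.
move=> us sz; exists (fun e => nth x0 vals (index e s)).
case: s us sz => [|e0 s] us sz; first by case: vals sz.
apply: (@eq_from_nth _ x0); rewrite ?size_map // => i si.
by rewrite (nth_map e0) // index_uniq.
Qed.

Lemma dg_split (a b : E -> U) (SR : {set E}) (s : seq E) A : uniq s -> {subset s <= SR} ->
  dg a b SR A = \sum_(e <- s) cut a b A e + dg a b (SR :\: [set e in s]) A.
Proof.
move=> us sub; rewrite /dg (big_setID [set e in s]) /=; congr (_ + _).
rewrite big_uniq //=; apply: eq_bigl => e; rewrite !inE.
by case es: (e \in s); rewrite ?andbF // (sub _ es).
Qed.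

Lemma net_seq (a b : E -> U) (s : seq E) (x : E -> bool) v : uniq s ->
  net a b [set e in s] x v = (\sum_(e <- s) dlt a b v e * sg (x e))%R.
Proof.
by move=> us; rewrite /net [RHS]big_uniq //=; apply: eq_bigl => e; rewrite inE.
Qed.

Lemma inner_joins (a b : E -> U) (SR : {set E}) (T : {set U}) e x y : e \in SR ->
  joins a b e x y -> (e \in inner a b T SR) = (x \in T) && (y \in T).
Proof.
by move=> eS; rewrite mem_inner eS /= => /orP[]/andP[/eqP -> /eqP ->] //; rewrite andbC.
Qed.

Lemma Z3F : (false%:R = 0 :> 'Z_3)%R. Proof. by []. Qed.
Lemma Z3T : (true%:R = 1 :> 'Z_3)%R. Proof. by []. Qed.

Lemma sg_avoid (z : 'Z_3) : exists s : bool, (z + sg s != 0)%R.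
Proof. by case: (Z3P z) => ->; [exists true|exists true|exists false]. Qed.

Lemma sum_rest (a b : E -> U) (SR Q : {set E}) (W R : {set U}) (c : U -> 'Z_3) (x0 : E -> bool) :
  R \subset W -> Q \subset inner a b W SR -> (\sum_(v in W) c v = 0)%R ->
  (forall v, v \in R -> net a b Q x0 v = c v) ->
  (\sum_(v in W :\: R) (c v - net a b Q x0 v) = 0)%R.
Proof.
move=> RW QN Ec HR; rewrite big_split /= sumrN.
have : (\sum_(v in W) net a b Q x0 v = 0)%R.
  rewrite sum_net big1 // => e /(subsetP QN); rewrite mem_inner => /and3P[_ -> ->].
  by rewrite subrr mul0r.
move: Ec; rewrite (big_setID R) /= (setIidPr RW) => E1.
rewrite (big_setID R) /= (setIidPr RW) (eq_bigr c); last by move=> v /HR.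
by move=> E2; apply/eqP; rewrite subr_eq0; apply/eqP/(addrI (\sum_(i in R) c i)%R); rewrite E1 E2.
Qed.

(** The edges touching [R] are oriented first so as to satisfy [R]; the smaller instance absorbs
    what they do to the other vertices. *)
Lemma solve_rest (a b a' b' : E -> U) (SR SR' Q : {set E}) (W R : {set U}) (c : U -> 'Z_3) (x0 : E -> bool) :
  Q = inner a b W SR :\: inner a b (W :\: R) SR ->
  (forall v, v \in R -> net a b Q x0 v = c v) -> R \subset W ->
  inner a' b' (W :\: R) SR' = inner a b (W :\: R) SR ->
  {in inner a b (W :\: R) SR, forall e, a' e = a e /\ b' e = b e} ->
  solvable a' b' SR' (W :\: R) (fun v => c v - net a b Q x0 v)%R -> solvable a b SR W c.
Proof.
move=> EQ HR RW E0 agr /(solvable_ext E0 agr) [x Hx].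
set NA := inner a b (W :\: R) SR in EQ Hx.
have NAN : NA \subset inner a b W SR.
  by apply/subsetP => e; rewrite !mem_inner => /and3P[-> ]; rewrite !inE => /andP[_ ->] /andP[_ ->].
have dis : [disjoint NA & Q].
  by rewrite EQ disjoints_subset; apply/subsetP => e; rewrite !inE => ->.
have EN : inner a b W SR = NA :|: Q by rewrite EQ -{1}(setID (inner a b W SR) NA) (setIidPr NAN).
exists (fun e => if e \in NA then x e else x0 e) => v vW.
rewrite (net_split _ _ _ _ _ EN dis).
case vR: (v \in R); last by rewrite Hx ?subrK // inE vR.
rewrite net_out ?add0r ?HR // => e; rewrite mem_inner => /and3P[_ aA bA].
by apply/andP; split; [apply: contraTneq aA | apply: contraTneq bA] => ->; rewrite inE vR.
Qed.

(** Lifting at [V]: in the smaller instance [kb] joins [V0] to [Zb] directly. The sign found there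
    is given to the whole path through [V] along [ka] and [kb], which leaves the balance of [V]
    untouched. *)
Lemma solve_lift (a b a' b' : E -> U) (SR SR' Q : {set E}) (W R : {set U}) (c : U -> 'Z_3) (x0 : E -> bool)
    ka kb (V V0 Zb : U) :
  V \in R -> V0 \in W :\: R -> Zb \in W :\: R -> V0 != Zb -> ka != kb ->
  joins a b ka V V0 -> joins a b kb V Zb -> a' kb = V0 -> b' kb = Zb ->
  ka \notin Q -> kb \notin Q -> ka \notin inner a b (W :\: R) SR -> kb \notin inner a b (W :\: R) SR ->
  inner a b W SR = ka |: (kb |: (Q :|: inner a b (W :\: R) SR)) ->
  [disjoint Q & inner a b (W :\: R) SR] ->
  (forall v, v \in R -> net a b Q x0 v = c v) -> R \subset W ->
  inner a' b' (W :\: R) SR' = kb |: inner a b (W :\: R) SR ->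
  {in inner a b (W :\: R) SR, forall e, a' e = a e /\ b' e = b e} ->
  solvable a' b' SR' (W :\: R) (fun v => c v - net a b Q x0 v)%R -> solvable a b SR W c.
Proof.
move=> VR V0W ZbW V0Zb kab jka jkb a'kb b'kb kaQ kbQ kaI kbI EN dis HR RW E0 agr [x Hx].
set I := inner a b (W :\: R) SR in EN dis E0 agr kaI kbI.
have VV0 : V0 != V by apply: contraTneq V0W => ->; rewrite inE VR.
have VZb : V != Zb by apply: contraTneq ZbW => <-; rewrite inE VR.
pose s := x kb.
pose y e := if e == ka then (if a ka == V0 then s else ~~ s) else
  if e == kb then (if a kb == V then s else ~~ s) else
  if e \in Q then x0 e else x e.
exists y => v vW.
have -> : net a b (inner a b W SR) y v =
   (((V0 == v)%:R - (Zb == v)%:R) * sg s + (net a b Q x0 v + net a b I x v))%R.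
  rewrite /net EN big_setU1 /=; last first.
    by rewrite in_setU1 in_setU !negb_or kab kaQ kaI.
  rewrite big_setU1 /=; last by rewrite in_setU negb_or kbQ kbI.
  rewrite addrA; congr (_ + _)%R.
    have jka' : joins a b ka V0 V by rewrite joinsC.
    rewrite /y eqxx (contrib s v VV0 jka') [kb == ka]eq_sym (negbTE kab) eqxx (contrib s v VZb jkb).
    by rewrite -mulrDl; congr (_ * _)%R; rewrite addrA subrK.
  rewrite (eq_bigl [predU Q & I]) ?bigU //=; last by move=> e; rewrite !inE.
  congr (_ + _)%R; apply: eq_bigr => e eQ.
    rewrite /y eQ; case: (e =P ka) eQ => [->|_]; first by rewrite (negbTE kaQ).
    by case: (e =P kb) => [->|_] //; rewrite (negbTE kbQ).
  rewrite /y (disjointFl dis eQ); case: (e =P ka) eQ => [->|_]; first by rewrite (negbTE kaI).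
  by case: (e =P kb) => [->|_] //; rewrite (negbTE kbI).
case vR: (v \in R).
  rewrite HR // (net_out (N := I)) ?addr0; last first.
    move=> e; rewrite mem_inner => /and3P[_ aA bA].
    by apply/andP; split; [apply: contraTneq aA | apply: contraTneq bA] => ->; rewrite inE vR.
  have -> : (V0 == v) = false by apply: contraTF V0W => /eqP ->; rewrite inE vR.
  have -> : (Zb == v) = false by apply: contraTF ZbW => /eqP ->; rewrite inE vR.
  by rewrite subrr mul0r add0r.
have vW' : v \in W :\: R by rewrite inE vR.
have := Hx v vW'; rewrite E0 /net big_setU1 //= {1}/dlt a'kb b'kb => E1.
have : (\sum_(i in I) dlt a' b' v i * sg (x i) = net a b I x v)%R.
  by apply: eq_bigr => e eI; rewrite /dlt; have [-> ->] := agr e eI.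
move=> E2; rewrite E2 in E1; rewrite addrCA E1 addrC subrK //.
Qed.

(** The bookkeeping shared by all reductions: edges of [del] disappear, edges of [mods] get new
    ends, and the others cross [A] as before. *)
Lemma dg_mod (a b a' b' : E -> U) (SR : {set E}) (del mods : seq E) A :
  uniq (del ++ mods) -> {subset del ++ mods <= SR} ->
  (forall e, e \in SR -> e \notin del ++ mods -> cut a' b' A e = cut a b A e) ->
  dg a b SR A + \sum_(e <- mods) cut a' b' A e =
  dg a' b' (SR :\: [set e in del]) A + \sum_(e <- del ++ mods) cut a b A e.
Proof.
move=> um sub agr; rewrite (dg_split a b A um sub).
have um2 : uniq mods by move: um; rewrite cat_uniq => /and3P[].
have sub2 : {subset mods <= SR :\: [set e in del]}.
  move=> e em; rewrite !inE sub ?mem_cat ?em ?orbT // andbT.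
  by move: um; rewrite cat_uniq => /and3P[_ /hasPn hn _]; apply: hn.
rewrite (dg_split a' b' A um2 sub2).
suff -> : dg a b (SR :\: [set e in del ++ mods]) A =
    dg a' b' (SR :\: [set e in del] :\: [set e in mods]) A by slia.
apply/esym; rewrite /dg; apply: eq_big => [e|e].
  by rewrite !inE ?mem_cat negb_or; do 3 case: (_ \in _).
by rewrite !inE => /and3P[em ed eS]; rewrite agr // mem_cat negb_or ed em.
Qed.

Lemma card_ge_seq (s : seq U) A : uniq s -> {subset s <= A} -> size s <= #|A|.
Proof. by move=> us sub; rewrite cardE; apply: uniq_leq_size => // x xs; rewrite mem_enum sub. Qed.

Lemma mem_rest (a b : E -> U) (SR : {set E}) (W R : {set U}) e :
  (e \in inner a b W SR :\: inner a b (W :\: R) SR) =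
  [&& e \in SR, a e \in W, b e \in W & (a e \in R) || (b e \in R)].
Proof.
rewrite in_setD !mem_inner !inE; case: (e \in SR) => //=.
by case: (a e \in W); case: (b e \in W); case: (a e \in R); case: (b e \in R).
Qed.

Section GoodMod.

Variables (a b : E -> U) (l r : E -> F) (SR SV : {set E}) (W : {set U}) (d w : U).
Hypothesis G : good a b l r SR SV W d w.

(** The common test for a reduction that removes [R] and turns [Cv] into virtual edges. A cut needs
    five real edges only when neither old nor new virtual edges cross it; then either it has lost
    nothing and the old bound serves, or five are counted directly. *)
Lemma good_mod (a' b' : E -> U) (l' r' : E -> F) (SR' Cv : {set E}) (R : {set U}) :
  R \subset W -> SR' \subset SR -> Cv \subset SR :\: SR' ->
  {in SV, forall e, a' e = a e /\ b' e = b e} ->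
  {in SR', forall e, [/\ a' e != b' e, a' e \in d |: (W :\: R) & b' e \in d |: (W :\: R)]} ->
  {in Cv, forall e, exists2 x, x \in W :\: R & joins a' b' e x w} ->
  planar_struct a' b' l' r' (SR' :|: ([set e in SV | ~~ cut a b R e] :|: Cv)) ->
  dg a' b' SR' (W :\: R) <= 6 ->
  (forall A, A \subset W :\: R -> A != set0 -> A != W :\: R -> 4 <= dg a' b' SR' A) ->
  (forall A, A \subset W :\: R -> A != set0 -> A != W :\: R ->
     {in Cv, forall e, ~~ cut a' b' A e} ->
     dg a b SR A <= dg a' b' SR' A \/ 5 <= dg a' b' SR' A) ->
  good a' b' l' r' SR' ([set e in SV | ~~ cut a b R e] :|: Cv) (W :\: R) d w.
Proof.
move=> RW SS' CvS agr real conv Pl D6 c4 c5; have P := go_p G.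
have wR : w \notin R by apply: contra (pi_wW P); apply: (subsetP RW).
have dR : d \notin R by apply: contra (pi_dW P); apply: (subsetP RW).
split=> //.
- split=> //.
  + rewrite disjoints_subset; apply/subsetP => e eS'; rewrite !inE negb_or negb_and negbK.
    rewrite (disjointFr (pi_dis P) (subsetP SS' _ eS')) /=.
    by apply/negP => /(subsetP CvS); rewrite inE eS'.
  + by rewrite inE negb_and (pi_dW P) orbT.
  + by rewrite inE negb_and (pi_wW P) orbT.
  + exact: pi_dw P.
  + by move=> e /real[].
  + by move=> e /real[].
  + by move=> e /real[].
  + move=> e; rewrite in_setU => /orP[|/conv[x xW /orP[]/andP[/eqP -> /eqP ->]]]; last 2 first.
    * by rewrite eqxx [x \in _ |: _]in_setU1 xW !orbT.
    * by rewrite eqxx [x \in _ |: _]in_setU1 xW !orbT.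
    rewrite inE => /andP[eS cR]; have [-> ->] := agr e eS.
    have [x xW jx] := virt_ends G eS; move: cR; rewrite (cut_joins _ jx) (negbTE wR) addbF => xR.
    have xW' : x \in d |: W :\: R by move: xW; rewrite !inE xR.
    by move: jx => /orP[]/andP[/eqP -> /eqP ->]; rewrite !eqxx xW' ?orbT.
  have [g gS jg] := pi_g P; exists g.
    by rewrite !inE gS (cut_joins _ jg) (negbTE dR) (negbTE wR).
  by have [E1 E2] := agr g gS; rewrite /joins E1 E2.
move=> A AW A0 AnW nV.
have AW0 : A \subset W by apply: subset_trans AW _; apply: subsetDl.
have AnW0 : A != W.
  by apply: contra AnW => /eqP E0; rewrite eqEsubset AW E0 subsetDl.
have [|h|//] := c5 A AW A0 AnW.
  move=> e eC; apply: contra nV => ce; apply/existsP; exists e.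
  by rewrite inE eC orbT.
apply: leq_trans h; apply: (go_2 G) => //.
apply: contra nV => /existsP[e /andP[eS ce]]; apply/existsP; exists e.
have [E1 E2] := agr e eS; rewrite {2}/cut E1 E2 -/(cut a b A e) ce andbT in_setU inE eS /=.
have [x xW jx] := virt_ends G eS; move: ce; rewrite !(cut_joins _ jx) (negbTE wR) addbF.
have -> : (w \in A) = false.
  by apply: contraNF (pi_wW P); apply: (subsetP AW0).
by rewrite addbF => /(subsetP AW); rewrite inE => /andP[->].
Qed.

End GoodMod.

Lemma rest_list (a b : E -> U) (SR : {set E}) (W R : {set U}) (s : seq E) :
  {subset s <= SR} -> (forall e, e \in SR -> (a e \in R) || (b e \in R) = (e \in s)) ->
  inner a b W SR :\: inner a b (W :\: R) SR =
  [set e in [seq e <- s | (a e \in W) && (b e \in W)]].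
Proof.
move=> sub HL; apply/setP => e; rewrite mem_rest in_set mem_filter.
case eS: (e \in SR); last by apply/esym; apply: contraFF eS => /andP[_ /sub].
by rewrite HL //= andbA.
Qed.

Lemma rest_union (a b : E -> U) (SR : {set E}) (W R : {set U}) (s : seq E) :
  {subset s <= SR} -> (forall e, e \in SR -> (a e \in R) || (b e \in R) = (e \in s)) ->
  inner a b W SR =
  [set e in [seq e <- s | (a e \in W) && (b e \in W)]] :|: inner a b (W :\: R) SR.
Proof.
move=> sub HL; rewrite -(rest_list W sub HL) setUC -{1}(setID (inner a b W SR) (inner a b (W :\: R) SR)).
congr (_ :|: _); apply/setIidPr/subsetP => e; rewrite !mem_inner => /and3P[->].
by rewrite !inE => /andP[_ ->] /andP[_ ->].
Qed.

Lemma inner_off (a b : E -> U) (SR : {set E}) (W R : {set U}) (s : seq E) e :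
  (forall e, e \in SR -> (a e \in R) || (b e \in R) = (e \in s)) ->
  e \in inner a b (W :\: R) SR -> e \notin s.
Proof.
move=> HL; rewrite mem_inner => /and3P[eS aA bA]; rewrite -HL //.
by move: aA bA; rewrite !inE => /andP[/negbTE -> _] /andP[/negbTE -> _].
Qed.

Lemma joins_both (a b : E -> U) (T : {set U}) e x y : joins a b e x y ->
  (a e \in T) && (b e \in T) = (x \in T) && (y \in T).
Proof. by move=> /orP[]/andP[/eqP -> /eqP ->] //; rewrite andbC. Qed.

Lemma inner_mod (a b a' b' : E -> U) (SR : {set E}) (W R : {set U}) (del mods : seq E) :
  uniq (del ++ mods) -> {subset del ++ mods <= SR} ->
  (forall e, e \in SR -> (a e \in R) || (b e \in R) = (e \in del ++ mods)) ->
  (forall e, e \notin del ++ mods -> a' e = a e /\ b' e = b e) ->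
  inner a' b' (W :\: R) (SR :\: [set e in del]) =
  [set e in mods | (a' e \in W :\: R) && (b' e \in W :\: R)] :|: inner a b (W :\: R) SR.
Proof.
move=> um sub HL agr; apply/setP => e; rewrite in_setU !mem_inner !in_set.
case eL: (e \in del ++ mods); last first.
  have [|-> ->] := agr e; first by rewrite eL.
  by move: eL; rewrite mem_cat => /norP[/negbTE -> /negbTE ->].
have eS := sub e eL; rewrite eS /=.
have -> : [&& (a e \notin R) && (a e \in W) & (b e \notin R) && (b e \in W)] = false.
  by have := HL e eS; rewrite eL => /orP[]->; rewrite ?andbF.
rewrite orbF andbT; move: eL um; rewrite mem_cat cat_uniq => eL /and3P[_ /hasPn hn _].
case em: (e \in mods); first by rewrite (hn _ em).
by move: eL; rewrite em orbF => ->.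
Qed.

Lemma good_mod2 (a b : E -> U) (l r : E -> F) (SR SV : {set E}) (W : {set U}) (d w : U)
    (a' b' : E -> U) (l' r' : E -> F) (R : {set U}) (del mods cv : seq E) :
  good a b l r SR SV W d w ->
  R \subset W -> uniq (del ++ mods) -> {subset del ++ mods <= SR} -> {subset cv <= del} ->
  (forall e, e \in SR -> (a e \in R) || (b e \in R) = (e \in del ++ mods)) ->
  (forall e, e \notin del ++ mods -> a' e = a e /\ b' e = b e) ->
  (forall e, e \in mods ->
     [/\ a' e != b' e, a' e \in d |: (W :\: R) & b' e \in d |: (W :\: R)]) ->
  (forall e, e \in cv -> exists2 x, x \in W :\: R & joins a' b' e x w) ->
  planar_struct a' b' l' r' (SR :\: [set e in del] :|:
     ([set e in SV | ~~ cut a b R e] :|: [set e in cv])) ->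
  dg a' b' (SR :\: [set e in del]) (W :\: R) <= 6 ->
  (forall A, A \subset W :\: R -> A != set0 -> A != W :\: R ->
     4 <= dg a' b' (SR :\: [set e in del]) A) ->
  (forall A, A \subset W :\: R -> A != set0 -> A != W :\: R ->
     {in cv, forall e, ~~ cut a' b' A e} ->
     dg a b SR A <= dg a' b' (SR :\: [set e in del]) A \/
     5 <= dg a' b' (SR :\: [set e in del]) A) ->
  good a' b' l' r' (SR :\: [set e in del])
    ([set e in SV | ~~ cut a b R e] :|: [set e in cv]) (W :\: R) d w.
Proof.
move=> G RW um sub scv HL agr Hm Hcv Pl D6 c4 c5; have P := go_p G.
apply: (good_mod G) => //.
- exact: subsetDl.
- apply/subsetP => e; rewrite !inE => /scv ed; rewrite ed /=.
  by apply: sub; rewrite mem_cat ed.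
- move=> e eV; apply: agr; apply/negP => /sub eS.
  by move: (disjointFr (pi_dis P) eS); rewrite eV.
- move=> e; rewrite in_setD in_set => /andP[ed eS]; case em: (e \in mods); first exact: Hm.
  have eL : e \notin del ++ mods by rewrite mem_cat negb_or ed em.
  have [-> ->] := agr e eL; have := HL e eS; rewrite (negbTE eL) => /negbT; rewrite negb_or => /andP[n1 n2].
  split; first exact: (pi_loop P eS).
    by have := pi_ra P eS; rewrite !inE n1.
  by have := pi_rb P eS; rewrite !inE n2.
- by move=> e; rewrite inE; apply: Hcv.
by move=> A AW A0 AnW nC; apply: c5 => // e ec; apply: nC; rewrite inE.
Qed.

Lemma off_region (a b : E -> U) (l r : E -> F) (SR SV : {set E}) (W : {set U}) (d w : U)
    (R : {set U}) (del mods cv : seq E) e :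
  good a b l r SR SV W d w -> R \subset W ->
  (forall e, e \in SR -> (a e \in R) || (b e \in R) = (e \in del ++ mods)) ->
  e \in SR :\: [set e in del] :|: ([set e in SV | ~~ cut a b R e] :|: [set e in cv]) ->
  e \notin mods -> e \notin cv -> a e \notin R /\ b e \notin R.
Proof.
move=> G RW HL; rewrite !in_setU !in_set => /or3P[|| ->] //.
  move=> /andP[ed eS] em _; have := HL e eS; rewrite mem_cat (negbTE ed) (negbTE em) /=.
  by move=> /negbT; rewrite negb_or => /andP.
move=> /andP[eV ce] _ _; have [x xW jx] := virt_ends G eV.
have wR : w \notin R by apply: contra (pi_wW (go_p G)); apply: (subsetP RW).
move: ce; rewrite (cut_joins _ jx) (negbTE wR) addbF => xR.
by move: jx => /orP[]/andP[/eqP -> /eqP ->].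
Qed.

(** A lone inner edge makes the boundaries of the two parts add up to D + 2 <= 8. All bounds are
    then tight: root degree six and two cuts of size four. *)
Lemma consistent_cut (a b : E -> U) (l r : E -> F) (SR SV : {set E}) W d w (c : U -> 'Z_3) :
  good a b l r SR SV W d w ->
  (forall A, A \subset W -> A != set0 -> A != W -> dg a b SR W = 6 ->
     dg a b SR A = 4 -> dg a b SR (W :\: A) = 4 -> (\sum_(v in A) c v != 0)%R) ->
  consistent a b SR W c.
Proof.
move=> G Hc A AW A0 AnW E1; have [/(_ A0) n1 n2] := properN AW AnW.
have := dg_inner a b SR AW; rewrite E1.
have := go_1 G AW A0 AnW; have := go_1 G (subsetDl W A) n2 n1; have := go_D G => D6 h1 h2 E2.
by apply: Hc => //; slia.
Qed.

End Moves.

(** * The three reductions, according to the degrees of [V] and [Z] *)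

Section Steps.

Variables (U E F : finType).
Variables (a b : E -> U) (l r : E -> F) (SR SV : {set E}) (W : {set U}) (d w : U).
Variable c : U -> 'Z_3.
Hypothesis H : reduced a b l r SR SV W d w.
Hypothesis IH : solvable_below U E F (#|W| + #|SR|).
Hypothesis Ec : (\sum_(v in W) c v = 0)%R.
Hypothesis nosol : ~ solvable a b SR W c.

Implicit Types (A X N R : {set U}) (e k g : E) (v x y z s t o : U) (p q : F).

Let G := re_good H.
Let P := go_p G.
Local Notation S := (SR :|: SV).
Local Notation dgr := (dg a b SR).
Local Notation deg v := (dg a b SR [set v]).
Local Notation D := (dg a b SR W).

(** A real edge with equal faces would be a cut by itself, but a cut with a real edge has at least
    four. *)
Lemma real_faces e p q : e \in SR -> joins l r e p q -> p != q.
Proof.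
move=> eS je; apply/negP => /eqP Epq.
have [||X HX] := (proj2 (pi_pl P)) [set e].
- by rewrite sub1set inE eS.
- by move=> f; rewrite big_set1 (inc_joins _ je) Epq addbb.
have : 4 <= dgr X by apply: (small_edge H eS); rewrite -HX ?inE ?eS ?eqxx.
rewrite /dg (big_setD1 e) //= big1 ?addn0; first by case: (cut _ _ _ _).
move=> f; rewrite !inE => /andP[fe fS]; rewrite -HX ?inE ?fS //.
by rewrite (negbTE fe).
Qed.

Lemma share p e k q q' : e \in SR -> k \in SR -> joins l r e p q -> joins l r k p q' ->
  inc l r p e && inc l r p k.
Proof.
move=> eS kS je jk; rewrite (inc_joins _ je) (inc_joins _ jk) eqxx.
by rewrite (negbTE (real_faces eS je)) (negbTE (real_faces kS jk)).
Qed.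

Lemma par_ne e k x y z : x \in W -> y \in W -> e \in SR -> k \in SR -> e != k ->
  joins a b e x y -> joins a b k x z -> y != z.
Proof.
move=> xW yW eS kS ek je jk; apply: contraNneq ek => E0; rewrite -E0 in jk.
by apply/eqP; apply: (re_par H xW yW _ eS kS je jk); have [] := real_ends H eS je.
Qed.

Lemma off_vertex e x : e \in S -> ~~ cut a b [set x] e -> a e != x /\ b e != x.
Proof.
move=> eS; have ab : a e != b e.
  move: eS; rewrite inE => /orP[eS|eV]; first exact: (pi_loop P eS).
  have [t tW jt] := virt_ends G eV; have tw := dW_neq_w G tW.
  by move: jt => /orP[]/andP[/eqP -> /eqP ->] //; rewrite eq_sym.
by rewrite /cut !inE; case: (a e =P x) ab => [->|_] => [|_]; [rewrite eq_sym => /negbTE -> | case: (b e =P x)].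
Qed.

Lemma star_end g e1 e2 e3 e4 q0 q1 q2 q3 q4 x e :
  star4 a b l r SR SV w x g e1 e2 e3 e4 q0 q1 q2 q3 q4 -> e \in SR ->
  (a e == x) || (b e == x) = (e \in [:: e1; e2; e3; e4]).
Proof.
move=> st0 eS; rewrite -(st_e st0) eS /= /cut !inE.
have := pi_loop P eS; case: (a e =P x) => [->|_]; case: (b e =P x) => [->|_] //=.
by rewrite eqxx.
Qed.

Variables (u : U) (gu h cc b0 a0 : E) (p0 p1 p2 p3 p4 : F) (wc wb V : U).
Hypothesis cf : conf1 a b l r SR SV W d w u gu h cc b0 a0 p0 p1 p2 p3 p4 wc wb V.

Let st := c1_st cf.
Let uW : u \in W := c1_u cf.
Let u4 : deg u = 4 := c1_u4 cf.
Let wcW : wc \in W := c1_wc cf.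
Let wbW : wb \in W := c1_wb cf.
Let VW : V \in W := c1_V cf.
Let jh := c1_jh cf.
Let jc := c1_jc cf.
Let jb := c1_jb cf.
Let ja := c1_ja cf.
Let jg := st_jg st.

Let Sh : h \in SR. Proof. by have := st_e st h; rewrite !inE eqxx => /andP[]. Qed.
Let Sc : cc \in SR. Proof. by have := st_e st cc; rewrite !inE eqxx !orbT => /andP[]. Qed.
Let Sb : b0 \in SR. Proof. by have := st_e st b0; rewrite !inE eqxx !orbT => /andP[]. Qed.
Let Sa : a0 \in SR. Proof. by have := st_e st a0; rewrite !inE eqxx !orbT => /andP[]. Qed.

Let hcc : h != cc. Proof. by have := st_u st; rewrite /= !inE !negb_or => /and4P[/and3P[]]. Qed.
Let hb0 : h != b0. Proof. by have := st_u st; rewrite /= !inE !negb_or => /and4P[/and3P[]]. Qed.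
Let ha0 : h != a0. Proof. by have := st_u st; rewrite /= !inE !negb_or => /and4P[/and3P[]]. Qed.
Let cb0 : cc != b0. Proof. by have := st_u st; rewrite /= !inE !negb_or => /and4P[_ /andP[]]. Qed.
Let ca0 : cc != a0. Proof. by have := st_u st; rewrite /= !inE !negb_or => /and4P[_ /andP[]]. Qed.
Let ba0 : b0 != a0. Proof. by have := st_u st; rewrite /= !inE !negb_or => /and4P[_ _]. Qed.

Let uwc : u != wc. Proof. by have [] := real_ends H Sc jc. Qed.
Let uwb : u != wb. Proof. by have [] := real_ends H Sb jb. Qed.
Let uV : u != V. Proof. by have [] := real_ends H Sa ja. Qed.
Let ud : u != d. Proof. by have [] := real_ends H Sh jh. Qed.
Let uw : u != w. Proof. by have [] := W_neq H uW. Qed.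

Let wcwb : wc != wb. Proof. exact: par_ne uW wcW Sc Sb cb0 jc jb. Qed.
Let wcV : wc != V. Proof. exact: par_ne uW wcW Sc Sa ca0 jc ja. Qed.
Let wbV : wb != V. Proof. exact: par_ne uW wbW Sb Sa ba0 jb ja. Qed.

Let D3 : 5 <= D := re_D H.
Let D6 : D <= 6 := go_D G.

(* c has been slid along h to the root, and u has been merged into w *)
Lemma planar_first (a1 b1 : E -> U) :
  (forall e, e != cc -> a1 e = a e /\ b1 e = b e) -> a1 cc = d -> b1 cc = wc ->
  exists l1 r1, (forall e, e != h -> l1 e = l e /\ r1 e = r e) /\
    planar_struct (mv u w \o a1) (mv u w \o b1) l1 r1 (S :\ gu).
Proof.
move=> agr Ea Eb.
have jc' : joins a1 b1 cc wc d by rewrite /joins Ea Eb !eqxx orbT.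
have f2 := st_f2 st; have f1 := st_f1 st; rewrite joinsC in f1.
have sh : (l h == r h) || [exists f, inc l r f cc && inc l r f h].
  by apply/orP; right; apply/existsP; exists p2; apply: share f2 f1.
have ScS : cc \in S by rewrite inE Sc.
have ShS : h \in S by rewrite inE Sh.
have [|l1 [r1 [Pl1 agr1]]] := slide_ex ScS ShS _ jc jh sh agr jc' (pi_pl P).
  by rewrite eq_sym.
exists l1, r1; split=> //; apply: contract1 Pl1; first by rewrite inE (st_g st) orbT.
have gc : gu != cc := virt_real_neq H (st_g st) Sc.
by have [E1 E2] := agr gu gc; rewrite /joins E1 E2; exact: jg.
Qed.

Lemma dg_u A v x : 5 <= deg v -> A \subset W -> A != W -> v \in A -> x \in A -> x != v -> 7 <= dgr A.
Proof.
move=> v5 AW AnW vA xA xv; apply: (re_7 H AW AnW _ vA v5).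
have us : uniq [:: x; v] by rewrite /= inE xv.
by apply: (card_ge_seq us) => t; rewrite !inE => /orP[]/eqP ->.
Qed.

Lemma dg_contains A v : A \subset W -> A != W -> v \in A -> 5 <= deg v -> 5 <= dgr A.
Proof.
move=> AW AnW vA v5; have [A1|A1] := leqP 2 #|A|.
  by apply: ltnW; apply: (re_6 H).
suff -> : A = [set v] by [].
by apply/esym/eqP; rewrite eqEcard sub1set vA cards1; slia.
Qed.

(** Here [u] is removed. The root trades [h] for [c], while [b0] and [a0] become virtual edges at
    [wb] and [V], two vertices of degree at least five that can each afford to lose a real edge. *)
Lemma step6 : 5 <= deg V -> False.
Proof.
move=> V5; pose R := [set u].
have RW : R \subset W by rewrite sub1set.
pose a1 e := if e == cc then d else a e; pose b1 e := if e == cc then wc else b e.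
have [|||l1 [r1 [_ Pl1]]] := @planar_first a1 b1; rewrite /a1 /b1 ?eqxx //.
  by move=> e /negbTE ->.
pose a2 e := if e == cc then d else if e == a0 then w else if e == b0 then w else a e.
pose b2 e := if e == cc then wc else if e == a0 then V else if e == b0 then wb else b e.
pose SR' := SR :\: [set e in [:: h; a0; b0]]; pose Cv := [set e in [:: a0; b0]].
have a2c : a2 cc = d by rewrite /a2 eqxx.
have b2c : b2 cc = wc by rewrite /b2 eqxx.
have ab0 : a0 != b0 by rewrite eq_sym.
have ac0 : a0 != cc by rewrite eq_sym.
have bc0 : b0 != cc by rewrite eq_sym.
have j2a : joins a2 b2 a0 w V by rewrite /joins /a2 /b2 (negbTE ac0) !eqxx.
have j2b : joins a2 b2 b0 w wb by rewrite /joins /a2 /b2 (negbTE bc0) (negbTE ba0) !eqxx.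
have j2c : joins a2 b2 cc d wc by rewrite /joins a2c b2c !eqxx.
have agr2 e : e \notin [:: h; a0; b0; cc] -> a2 e = a e /\ b2 e = b e.
  by rewrite !inE !negb_or /a2 /b2 => /and4P[_ /negbTE -> /negbTE -> /negbTE ->].
have agrV e : e \in SV -> a2 e = a e /\ b2 e = b e.
  move=> eV; apply: agr2; rewrite !inE !negb_or.
  by rewrite !(virt_real_neq H eV).
have starE e : e \in SR -> e \notin [:: h; a0; b0; cc] -> a e != u /\ b e != u.
  move=> eS; have := star_end st eS; rewrite !inE !negb_or => E0 /and4P[n1 n2 n3 n4].
  by move: E0; rewrite (negbTE n1) (negbTE n2) (negbTE n3) (negbTE n4) => /negbT; rewrite negb_or => /andP.
have inS' e : e \in SR' -> e != cc -> e \in SR /\ e \notin [:: h; a0; b0; cc].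
  by rewrite !inE !negb_or => /andP[/and3P[-> -> ->] ->] ->.
have SS : SR' :|: ([set e in SV | ~~ cut a b R e] :|: Cv) \subset S :\ gu.
  apply/subsetP => e; rewrite in_setU => /orP[eS'|].
    have eS : e \in SR by move: eS'; rewrite inE => /andP[].
    by rewrite !inE eS eq_sym (virt_real_neq H (st_g st) eS).
  rewrite in_setU => /orP[|]; rewrite !inE.
    move=> /andP[eV ce]; rewrite eV orbT andbT; apply: contraNneq ce => ->.
    exact: joins_cut1 uw jg.
  by move=> /orP[]/eqP ->; rewrite ?Sa ?Sb eq_sym (virt_real_neq H (st_g st)).
have [l2 [r2 Pl2]] := planar_del SS Pl1.
have Pl3 : planar_struct a2 b2 l2 r2 (SR' :|: ([set e in SV | ~~ cut a b R e] :|: Cv)).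
  apply: planar_ext Pl2 => // e eS X.
  have j1 e' x y : e' != cc -> joins a b e' x y ->
      joins (mv u w \o a1) (mv u w \o b1) e' (mv u w x) (mv u w y).
    by move=> n1 je; apply: joins_mv; rewrite /joins /a1 /b1 (negbTE n1).
  have [->|ec] := eqVneq e cc.
    have : joins a1 b1 cc d wc by rewrite /joins /a1 /b1 !eqxx.
    move/(joins_mv u w); rewrite !mv_id ?[_ == u]eq_sym // => jj.
    by rewrite (cut_joins _ j2c) (cut_joins _ jj).
  have [->|ea] := eqVneq e a0.
    have := j1 a0 _ _ ac0 ja; rewrite mv_eq mv_id 1?eq_sym // => jj.
    by rewrite (cut_joins _ j2a) (cut_joins _ jj).
  have [->|eb] := eqVneq e b0.
    have := j1 b0 _ _ bc0 jb; rewrite mv_eq mv_id 1?eq_sym // => jj.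
    by rewrite (cut_joins _ j2b) (cut_joins _ jj).
  have [nA nB] : a e != u /\ b e != u.
    move: eS; rewrite in_setU => /orP[eS'|]; first by have [eS n] := inS' e eS' ec; apply: starE.
    rewrite in_setU => /orP[|]; rewrite !inE; last by rewrite (negbTE ea) (negbTE eb).
    by move=> /andP[eV]; apply: off_vertex; rewrite inE eV orbT.
  rewrite /cut /a2 /b2 /a1 /b1 /= (negbTE ec) (negbTE ea) (negbTE eb) !mv_id //.
have dgE A : A \subset W :\: R -> dgr A = dg a2 b2 SR' A + (V \in A) + (wb \in A).
  move=> AW.
  have uA : (u \in A) = false by apply/negP => /(subsetP AW); rewrite !inE eqxx.
  have dA : (d \in A) = false.
    by apply/negP => /(subsetP AW); rewrite inE (negbTE (dW H)) andbF.
  have um : uniq ([:: h; a0; b0] ++ [:: cc]).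
    by rewrite /= !inE !negb_or hcc hb0 ha0 ab0 ac0 bc0.
  have sub : {subset [:: h; a0; b0] ++ [:: cc] <= SR}.
    by move=> e; rewrite !inE => /or4P[]/eqP ->.
  have agc e : e \in SR -> e \notin [:: h; a0; b0] ++ [:: cc] -> cut a2 b2 A e = cut a b A e.
    by move=> eS n; have [E1 E2] := agr2 e n; rewrite /cut E1 E2.
  have := dg_mod um sub agc; rewrite /= !big_cons !big_nil.
  rewrite (cut_joins _ j2c) !(cut_joins _ jh) !(cut_joins _ ja) !(cut_joins _ jb) !(cut_joins _ jc).
  by rewrite uA dA /= -/SR'; slia.
have mr1 : 1 <= \sum_(e in SR) (cut a b W e && cut a b R e).
  by rewrite (big_setD1 h) //= (root_cut H uW Sh jh).
have Dle : dg a2 b2 SR' (W :\: R) <= D.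
  have := dg_root a b SR RW; rewrite (dgE _ (subxx _)) u4.
  have -> : V \in W :\: R by rewrite !inE eq_sym uV VW.
  have -> : wb \in W :\: R by rewrite !inE eq_sym uwb wbW.
  by slia.
have sW A : A \subset W :\: R -> A \subset W /\ A != W.
  move=> AW; split; first by apply: subset_trans AW (subsetDl _ _).
  by apply/eqP => E0; have := subsetP AW u; rewrite E0 => /(_ uW); rewrite !inE eqxx.
have G2 : good a2 b2 l2 r2 SR' ([set e in SV | ~~ cut a b R e] :|: Cv) (W :\: R) d w.
  apply: (good_mod G) => //.
  - exact: subsetDl.
  - by apply/subsetP => e; rewrite !inE => /orP[]/eqP ->; rewrite ?Sa ?Sb eqxx ?orbT.
  - move=> e eS'; have [->|ec] := eqVneq e cc.
      rewrite a2c b2c !inE eqxx /= eq_sym (proj1 (W_neq H wcW)) wcW [wc == u]eq_sym uwc orbT //.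
    have [eS n] := inS' e eS' ec; have [-> ->] := agr2 e n; have [n1 n2] := starE e eS n.
    split; first exact: (pi_loop P eS).
      by have := pi_ra P eS; rewrite !inE n1.
    by have := pi_rb P eS; rewrite !inE n2.
  - move=> e; rewrite !inE => /orP[]/eqP ->.
      by exists V; rewrite ?inE 1?eq_sym ?uV ?VW // joinsC.
    by exists wb; rewrite ?inE 1?eq_sym ?uwb ?wbW // joinsC.
  - exact: leq_trans Dle D6.
  - move=> A AW A0 AnW; have [s1 s2] := sW A AW; have := dgE A AW.
    case VA: (V \in A); case bA: (wb \in A) => /=.
    + by have := dg_u (c1_wb5 cf) s1 s2 bA VA; rewrite eq_sym wbV => /(_ isT); slia.
    + by have := dg_contains s1 s2 VA V5; slia.
    + by have := dg_contains s1 s2 bA (c1_wb5 cf); slia.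
    by have := go_1 G s1 A0 s2; slia.
  move=> A AW A0 AnW nC; left; rewrite (dgE A AW).
  have wA : w \notin A by apply/negP => /(subsetP AW); rewrite inE (negbTE (wW H)) andbF.
  have := nC a0; rewrite !inE eqxx => /(_ isT); rewrite (cut_joins _ j2a) (negbTE wA) => /negbTE /= ->.
  have := nC b0; rewrite !inE eqxx orbT => /(_ isT); rewrite (cut_joins _ j2b) (negbTE wA) => /negbTE /= ->.
  by rewrite !addn0.
have uQ : uniq [:: cc; b0; a0] by rewrite /= !inE !negb_or cb0 ca0 ba0.
(* [c] is oriented in advance because it turns into a root edge; [b0] and [a0] then meet the demand
   of [u]. *)
have [s1 [s2 Es]] := sg3_ex (c u) true.
have [sig [E1 E2 E3]] := @exists_map E bool true [:: cc; b0; a0] [:: true; s1; s2] uQ erefl.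
pose x0 e := if a e == u then sig e else ~~ sig e.
pose Q := [set e in [:: cc; b0; a0]].
have EQ : Q = inner a b W SR :\: inner a b (W :\: R) SR.
  apply/setP => e; rewrite mem_rest !in_set1; case eS: (e \in SR) => /=; last first.
    by apply: contraFF eS; rewrite !inE => /or3P[]/eqP ->.
  rewrite (star_end st eS) [LHS]inE; have [->|eh] := eqVneq e h.
    rewrite !inE (negbTE hcc) (negbTE hb0) (negbTE ha0) /=; apply/esym/negbTE.
    by move: jh => /orP[]/andP[/eqP -> /eqP ->]; rewrite (negbTE (dW H)) ?andbF.
  rewrite [in RHS]in_cons (negbTE eh) /=.
  case eL: (e \in [:: cc; b0; a0]); rewrite ?andbF // andbT; apply/esym.
  move: eL; rewrite !inE => /or3P[]/eqP ->.
  - by move: jc => /orP[]/andP[/eqP -> /eqP ->]; rewrite uW wcW.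
  - by move: jb => /orP[]/andP[/eqP -> /eqP ->]; rewrite uW wbW.
  - by move: ja => /orP[]/andP[/eqP -> /eqP ->]; rewrite uW VW.
have netQ v : net a b Q x0 v = (((u == v)%:R - (wc == v)%:R) * sg (sig cc) +
   (((u == v)%:R - (wb == v)%:R) * sg (sig b0) + ((u == v)%:R - (V == v)%:R) * sg (sig a0)))%R.
  by rewrite net_seq // !big_cons big_nil addr0 /x0 !(contrib _ _ uwc jc) !(contrib _ _ uwb jb) !(contrib _ _ uV ja).
have HR v : v \in R -> net a b Q x0 v = c v.
  rewrite inE => /eqP ->; rewrite netQ eqxx ![_ == u]eq_sym (negbTE uwc) (negbTE uwb) (negbTE uV).
  by rewrite !subr0 !mul1r E1 E2 E3 addrA.
apply: nosol; apply: (solve_rest (a' := a2) (b' := b2) (SR' := SR') EQ HR RW).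
- apply/setP => e; rewrite !mem_inner; have [->|ec] := eqVneq e cc.
    rewrite a2c !inE (negbTE (dW H)) !andbF; apply/esym/negbTE.
    by move: jc => /orP[]/andP[/eqP -> /eqP ->]; rewrite eqxx ?andbF.
  case eL: (e \in [:: h; a0; b0]).
    rewrite inE [e \in [set _ in _]]inE eL /=; apply/esym/negbTE; rewrite negb_and.
    apply/orP; right; move: eL; rewrite !inE => /or3P[]/eqP ->.
    + by move: jh => /orP[]/andP[/eqP -> /eqP ->]; rewrite eqxx ?andbF.
    + by move: ja => /orP[]/andP[/eqP -> /eqP ->]; rewrite eqxx ?andbF.
    + by move: jb => /orP[]/andP[/eqP -> /eqP ->]; rewrite eqxx ?andbF.
  rewrite /SR' in_setD in_set eL /=.
  have [|-> ->] := agr2 e; last by [].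
  by move: eL; rewrite !inE (negbTE ec) orbF => ->.
- move=> e; rewrite mem_inner => /and3P[eS aA bA]; apply: agr2.
  apply/negP => eL; have : e \in [:: h; cc; b0; a0].
    by move: eL; rewrite !inE => /or4P[]/eqP ->; rewrite eqxx ?orbT.
  rewrite -(star_end st eS) => /orP[]/eqP E0; [move: aA | move: bA];
    by rewrite E0 !inE eqxx.
apply: (IH G2).
- have := subset_leq_card (subsetDl SR [set e in [:: h; a0; b0]]).
  by have := cardsD1 u W; rewrite uW -/SR' -/R; slia.
- by apply: (sum_rest (SR := SR) RW _ Ec HR); rewrite EQ subsetDl.
(* Each tight part would be a single vertex, but the three vertices [wc], [wb] and [V] have to be
   distributed over two parts. *)
apply: (consistent_cut G2) => A AW A0 AnW D66 A4 B4; exfalso.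
have BW : W :\: R :\: A \subset W :\: R := subsetDl _ _.
have one X : X \subset W :\: R -> dg a2 b2 SR' X = 4 -> #|X| <= 1.
  move=> XW X4; rewrite leqNgt; apply/negP => X1; have [t1 t2] := sW X XW.
  have := re_6 H t1 t2 X1; have := dgE X XW; rewrite X4.
  case VA: (V \in X); case bA: (wb \in X) => /=; [|slia..].
  by have := dg_u (c1_wb5 cf) t1 t2 bA VA; rewrite eq_sym wbV => /(_ isT); slia.
have := one _ AW A4; have := one _ BW B4.
have := cardsID A (W :\: R); rewrite (setIidPr AW).
have u3 : uniq [:: wc; wb; V] by rewrite /= !inE !negb_or wcwb wcV wbV.
have : size [:: wc; wb; V] <= #|W :\: R|.
  apply: (card_ge_seq u3) => t; rewrite !inE => /or3P[]/eqP ->; rewrite eq_sym ?uwc ?uwb ?uV //.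
by rewrite /=; slia.
Qed.

Section Second.

Variables (gV kc kb ka : E) (s0 s3 s4 : F) (Z Zb V0 : U).
Hypothesis cf2 : conf2 a b l r SR SV W d w u V a0 p0 p4 gV kc kb ka s0 s3 s4 Z Zb V0.
Hypothesis V4 : deg V = 4.

Let stV := c2_st cf2.
Let jkc := c2_jc cf2.
Let jkb := c2_jb cf2.
Let jka := c2_ja cf2.
Let ZW : Z \in W := c2_Z cf2.
Let ZbW : Zb \in W := c2_Zb cf2.
Let Z5 : 5 <= deg Z := c2_Z5 cf2.
Let Zb5 : 5 <= deg Zb := c2_Zb5 cf2.
Let jaV : joins a b a0 V u. Proof. by rewrite joinsC. Qed.

Let Skc : kc \in SR. Proof. by have := st_e stV kc; rewrite !inE eqxx !orbT => /andP[]. Qed.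
Let Skb : kb \in SR. Proof. by have := st_e stV kb; rewrite !inE eqxx !orbT => /andP[]. Qed.
Let Ska : ka \in SR. Proof. by have := st_e stV ka; rewrite !inE eqxx !orbT => /andP[]. Qed.

Let VZ : V != Z. Proof. by have [] := real_ends H Skc jkc. Qed.
Let VZb : V != Zb. Proof. by have [] := real_ends H Skb jkb. Qed.
Let VV0 : V != V0. Proof. by have [] := real_ends H Ska jka. Qed.
Let uZ : u != Z. Proof. by apply: contraTneq Z5 => <-; rewrite u4. Qed.
Let uZb : u != Zb. Proof. by apply: contraTneq Zb5 => <-; rewrite u4. Qed.
Let stVu := st_u stV.
Let a0ka : a0 != ka. Proof. by have := stVu; rewrite /= !inE !negb_or => /and4P[/and3P[]]. Qed.
Let a0kc : a0 != kc. Proof. by have := stVu; rewrite /= !inE !negb_or => /and4P[/and3P[]]. Qed.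
Let a0kb : a0 != kb. Proof. by have := stVu; rewrite /= !inE !negb_or => /and4P[/and3P[]]. Qed.
Let kckb : kc != kb. Proof. by have := stVu; rewrite /= !inE !negb_or => /and4P[_ /andP[]]. Qed.
Let kcka : kc != ka. Proof. by have := stVu; rewrite /= !inE !negb_or => /and4P[_ /andP[]]. Qed.
Let kbka : kb != ka. Proof. by have := stVu; rewrite /= !inE !negb_or => /and4P[_ _]. Qed.
Let uV0 : u != V0. Proof. exact: par_ne VW uW Sa Ska a0ka jaV jka. Qed.
Let ZZb : Z != Zb. Proof. exact: par_ne VW ZW Skc Skb kckb jkc jkb. Qed.
Let ZV0 : Z != V0. Proof. exact: par_ne VW ZW Skc Ska kcka jkc jka. Qed.
Let ZbV0 : Zb != V0. Proof. exact: par_ne VW ZbW Skb Ska kbka jkb jka. Qed.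

Let Vd : V != d. Proof. exact: (W_neq H VW).1. Qed.
Let Vw : V != w. Proof. exact: (W_neq H VW).2. Qed.

Let not_u e : e \in SR -> a e != u -> b e != u -> e \notin [:: h; cc; b0; a0].
Proof. by move=> eS n1 n2; rewrite -(star_end st eS) negb_or n1 n2. Qed.

Let joins_nu e x y : joins a b e x y -> x != u -> y != u -> a e != u /\ b e != u.
Proof. by move=> /orP[]/andP[/eqP -> /eqP ->]. Qed.

Let kc_u : kc \notin [:: h; cc; b0; a0].
Proof. by have [||n1 n2] := joins_nu jkc; rewrite 1?eq_sym //; apply: not_u. Qed.
Let kb_u : kb \notin [:: h; cc; b0; a0].
Proof. by have [||n1 n2] := joins_nu jkb; rewrite 1?eq_sym //; apply: not_u. Qed.
Let ka_u : ka \notin [:: h; cc; b0; a0].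
Proof. by have [||n1 n2] := joins_nu jka; rewrite 1?eq_sym //; apply: not_u. Qed.

Let uniq7 : uniq [:: h; a0; b0; kc; ka; cc; kb].
Proof.
move: kc_u kb_u ka_u; rewrite /= !inE !negb_or => /and4P[k1 k2 k3 k4] /and4P[k5 k6 k7 k8] /and4P[k9 k10 k11 k12].
rewrite hcc hb0 ha0 [a0 == b0]eq_sym ba0 [a0 == cc]eq_sym ca0 [b0 == cc]eq_sym cb0 a0kc a0ka a0kb.
by rewrite kckb kcka [ka == kb]eq_sym kbka [h == kc]eq_sym k1 [h == ka]eq_sym k9 [h == kb]eq_sym k5
  [b0 == kc]eq_sym k3 [b0 == ka]eq_sym k11 [b0 == kb]eq_sym k7 k2 k10 [cc == kb]eq_sym k6.
Qed.

Let dg_uV : dgr [set u; V] <= 6.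
Proof.
have := dg_pair H _ _ uV Sa ja; rewrite !inE uW VW !orbT => /(_ isT isT).
by rewrite u4 V4; slia.
Qed.

(** Otherwise the triangle [u], [V], [Z] has at most 6 + 5 - 4 boundary edges, although [h] and [b0]
    lie on different sides of it. *)
Lemma excl2 : wc = Z -> deg Z <> 5.
Proof.
move=> Ewc Z5'.
have cckc : cc != kc by move: kc_u; rewrite !inE !negb_or [kc == cc]eq_sym => /and4P[].
have us : uniq [:: a0; kc; cc] by rewrite /= !inE !negb_or a0kc [a0 == cc]eq_sym ca0 eq_sym cckc.
have SS i : i \in SR -> i \in S by move=> iS; rewrite inE iS.
have sub : {subset [:: a0; kc; cc] <= S} by move=> i; rewrite !inE => /or3P[]/eqP ->; rewrite ?Sa ?Sc ?Skc.
have [|Phi [CS HPhi]] := cycle_dual H us sub.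
  move=> X; rewrite !big_cons big_nil (cut_joins _ ja) (cut_joins _ jkc) (cut_joins _ jc) Ewc.
  by do 3 case: (_ \in X).
pose N := Z |: [set u; V].
have uN : u \in N by rewrite !inE eqxx orbT.
have VN : V \in N by rewrite !inE eqxx !orbT.
have ZN : Z \in N by rewrite !inE eqxx.
have CN : {in [set e in [:: a0; kc; cc]], forall e, (a e \in N) && (b e \in N)}.
  apply: in_N3; [exact: joins_N ja uN VN | exact: joins_N jkc VN ZN |].
  by move: jc; rewrite Ewc => jc'; exact: joins_N jc' uN ZN.
have notC i : i != a0 -> i != kc -> i != cc -> i \notin [set e in [:: a0; kc; cc]].
  by rewrite !inE !negb_or => -> -> ->.
have hkc : h != kc by move: kc_u; rewrite !inE !negb_or [kc == h]eq_sym => /and4P[].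
have bkc : b0 != kc by move: kc_u; rewrite !inE !negb_or [kc == b0]eq_sym => /and4P[].
have hC := notC h ha0 hkc hcc.
have bC : b0 \notin [set e in [:: a0; kc; cc]] by apply: notC => //; rewrite eq_sym.
have hcut : cut a b N h.
  rewrite (cut_joins _ jh) uN !inE.
  by rewrite ![d == _]eq_sym (negbTE ud) (negbTE Vd) (negbTE (proj1 (W_neq H ZW))).
have bcut : cut a b N b0.
  rewrite (cut_joins _ jb) uN !inE -Ewc [wb == wc]eq_sym (negbTE wcwb) [wb == u]eq_sym (negbTE uwb).
  by rewrite (negbTE wbV).
have h7 : dgr N <= 7.
  have ZuV : Z \notin [set u; V] by rewrite !inE negb_or ![Z == _]eq_sym uZ.
  have := dgU1 P ZuV.
  have us2 : uniq [:: kc; cc] by rewrite /= inE eq_sym cckc.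
  have sub2 : {subset [:: kc; cc] <= SR} by move=> i; rewrite !inE => /orP[]/eqP ->.
  have := sum_ge_seq (fun e => cut a b [set Z] e && cut a b [set u; V] e) us2 sub2.
  rewrite !big_cons big_nil !(cut_joins _ jkc) !(cut_joins _ jc) Ewc !inE !eqxx ?orbT.
  rewrite (negbTE uZ) (negbTE VZ) ![Z == _]eq_sym (negbTE uZ) (negbTE VZ) /= Z5'.
  by rewrite /N; have := dg_uV; slia.
have := two_sides H CS HPhi CN Sh Sb hcut bcut.
rewrite (joins_side (SS _ Sh) hC HPhi (st_f1 st)) (joins_side (SS _ Sb) bC HPhi (st_f3 st)).
have := joins_in (SS _ Sc) HPhi (st_f2 st); rewrite !inE eqxx !orbT.
have := joins_in (SS _ Sh) HPhi (st_f1 st); rewrite (negbTE hC).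
by case: (p1 \in Phi); case: (p2 \in Phi); case: (p3 \in Phi) => //= _ _ /(_ isT); slia.
Qed.

(** A set containing both ends of the lifted edge loses two edges, but has them to spare: with [V]
    added it has at least seven boundary edges, and [V] sends two or three of its four edges into
    it. *)
Lemma lifted_big A : A \subset W -> u \notin A -> V \notin A -> V0 \in A -> Zb \in A ->
  7 + 2 * (Z \in A) <= dgr A.
Proof.
move=> AW uA VA V0A ZbA.
have := dgU1 P VA; rewrite V4.
have us : uniq [:: kc; ka; kb] by rewrite /= !inE !negb_or kcka kckb eq_sym kbka.
have sub : {subset [:: kc; ka; kb] <= SR} by move=> i; rewrite !inE => /or3P[]/eqP ->.
have := sum_ge_seq (fun e => cut a b [set V] e && cut a b A e) us sub.
rewrite !big_cons big_nil !(cut_joins _ jkc) !(cut_joins _ jka) !(cut_joins _ jkb).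
rewrite (negbTE VA) V0A ZbA !inE !eqxx ![_ == V]eq_sym (negbTE VZ) (negbTE VV0) (negbTE VZb) /=.
have : 7 <= dgr (V |: A).
  apply: (re_7c H).
  - by rewrite subUset sub1set VW.
  - by apply/eqP => E0; have := uW; rewrite -E0 !inE (negbTE uV) (negbTE uA).
  have u3 : uniq [:: V; V0; Zb] by rewrite /= !inE !negb_or VV0 VZb eq_sym ZbV0.
  by apply: (card_ge_seq u3) => t; rewrite !inE => /or3P[]/eqP ->; rewrite ?eqxx ?V0A ?ZbA ?orbT.
by slia.
Qed.

Let L := [:: h; a0; b0; kc; ka; cc; kb].

Let neq i j : i < 7 -> j < 7 -> i != j -> nth h L i != nth h L j.
Proof. by move=> i7 j7 ij; rewrite nth_uniq. Qed.

Let subL : {subset L <= SR}.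
Proof.
by move=> e; rewrite !inE => /orP[/eqP ->//|/orP[/eqP ->//|/orP[/eqP ->//|/or4P[]/eqP ->]]].
Qed.

Let HL2 e : e \in SR -> (a e \in [set u; V]) || (b e \in [set u; V]) = (e \in L).
Proof.
move=> eS; transitivity (((a e == u) || (b e == u)) || ((a e == V) || (b e == V))).
  by rewrite !inE; do 4 case: (_ == _).
rewrite (star_end st eS) (star_end stV eS) !inE.
by case: (e == h); case: (e == cc); case: (e == b0); case: (e == a0); case: (e == kc);
  case: (e == kb); case: (e == ka).
Qed.

Let share4 (l1 r1 : E -> F) : (forall e, e != h -> l1 e = l e /\ r1 e = r e) ->
  (l1 a0 == r1 a0) || [exists f, inc l1 r1 f kc && inc l1 r1 f a0].
Proof.
move=> agr; apply/orP; right; apply/existsP; exists p4.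
have f1 := st_f1 stV; rewrite joinsC in f1.
have := share Skc Sa (st_f2 stV) f1; rewrite /inc.
have [-> ->] := agr kc (neq (i := 3) (j := 0) isT isT isT).
by have [-> ->] := agr a0 (neq (i := 1) (j := 0) isT isT isT).
Qed.

Let mr_ge : V0 \in d |: W ->
  1 + (V0 \notin W) <= \sum_(e in SR) (cut a b W e && cut a b [set u; V] e).
Proof.
move=> V0W; have us : uniq [:: h; ka] by rewrite /= inE (neq (i := 0) (j := 4) isT isT isT).
have sub : {subset [:: h; ka] <= SR} by move=> i; rewrite !inE => /orP[]/eqP ->.
apply: leq_trans (sum_ge_seq (fun e => cut a b W e && cut a b [set u; V] e) us sub).
rewrite !big_cons big_nil !(cut_joins _ jh) !(cut_joins _ jka) uW VW (negbTE (dW H)) !inE !eqxx.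
rewrite ![d == _]eq_sym (negbTE ud) (negbTE Vd) ![V0 == _]eq_sym (negbTE uV0) (negbTE VV0) orbT /=.
by case: (V0 \in W).
Qed.

(** Here [u] and [V] are removed. Once [u] is merged into [w], the edge [a0] joins [V] to [w], and
    [kc] can be slid along it to become virtual at [Z]; contracting [ka] then lifts [ka] and [kb] to
    one edge. The excluded case is the one in which [Z] would pay for both virtual edges [b0] and
    [kc] with degree only five. *)
Lemma step7 : ~ (wb = Z /\ deg Z = 5) -> False.
Proof.
move=> nZ; pose R := [set u; V].
have RW : R \subset W by rewrite subUset !sub1set uW VW.
have uR : u \in R by rewrite !inE eqxx.
have VR : V \in R by rewrite !inE eqxx orbT.
have inR t : t != u -> t != V -> t \notin R by rewrite !inE negb_or => -> ->.
have inWR t : t \in W -> u != t -> V != t -> t \in W :\: R.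
  by move=> tW n1 n2; rewrite inE tW inR // eq_sym.
have wbWR : wb \in W :\: R by apply: inWR => //; rewrite eq_sym.
have wcWR : wc \in W :\: R by apply: inWR => //; rewrite eq_sym.
have ZWR : Z \in W :\: R by apply: inWR.
have ZbWR : Zb \in W :\: R by apply: inWR.
have V0dW := c2_V0 cf2.
pose a1 e := if e == cc then d else a e; pose b1 e := if e == cc then wc else b e.
have [|||l1 [r1 [agr1 Pl1]]] := @planar_first a1 b1; rewrite /a1 /b1 ?eqxx //.
  by move=> e /negbTE ->.
rewrite -/a1 -/b1 in Pl1.
pose A1 := mv u w \o a1; pose B1 := mv u w \o b1; rewrite -/A1 -/B1 in Pl1.
have jA e x y : e != cc -> joins a b e x y -> joins A1 B1 e (mv u w x) (mv u w y).
  by move=> n1 je; apply: joins_mv; rewrite /joins /a1 /b1 (negbTE n1).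
have kccc : kc != cc := neq (i := 3) (j := 5) isT isT isT.
have kacc : ka != cc := neq (i := 4) (j := 5) isT isT isT.
have kbcc : kb != cc := neq (i := 6) (j := 5) isT isT isT.
have a0cc : a0 != cc := neq (i := 1) (j := 5) isT isT isT.
have b0cc : b0 != cc := neq (i := 2) (j := 5) isT isT isT.
have kakc : ka != kc := neq (i := 4) (j := 3) isT isT isT.
have kakb : ka != kb := neq (i := 4) (j := 6) isT isT isT.
have b0kb : b0 != kb := neq (i := 2) (j := 6) isT isT isT.
have b0kc : b0 != kc := neq (i := 2) (j := 3) isT isT isT.
have kcb0 : kc != b0 := neq (i := 3) (j := 2) isT isT isT.
have kbkc : kb != kc := neq (i := 6) (j := 3) isT isT isT.
pose a3 e := if e == kc then w else A1 e; pose b3 e := if e == kc then Z else B1 e.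
have j3kc : joins a3 b3 kc Z w by rewrite /joins /a3 /b3 !eqxx orbT.
have j1kc : joins A1 B1 kc V Z by have := jA kc _ _ kccc jkc; rewrite !mv_id // eq_sym.
have j1a0 : joins A1 B1 a0 V w by have := jA a0 _ _ a0cc jaV; rewrite mv_eq mv_id // eq_sym.
have inSg e : e \in SR -> e \in S :\ gu.
  by move=> eS; rewrite !inE eS eq_sym (virt_real_neq H (st_g st) eS).
have agr3 e : e != kc -> a3 e = A1 e /\ b3 e = B1 e by rewrite /a3 /b3 => /negbTE ->.
have kca0 : kc != a0 by rewrite eq_sym.
have [l3 [r3 [Pl3 _]]] := slide_ex (inSg _ Skc) (inSg _ Sa) kca0 j1kc j1a0 (share4 agr1) agr3 j3kc Pl1.
have j3ka : joins a3 b3 ka V V0.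
  have := jA ka _ _ kacc jka; rewrite !mv_id 1?eq_sym // => jj.
  by have [E1 E2] := agr3 ka kakc; rewrite /joins E1 E2.
have Pl4 := contract1 (inSg _ Ska) j3ka Pl3.
pose a2 e := if e == cc then d else if e == kb then V0 else
  if e == b0 then w else if e == kc then w else a e.
pose b2 e := if e == cc then wc else if e == kb then Zb else
  if e == b0 then wb else if e == kc then Z else b e.
pose del := [:: h; a0; b0; kc; ka]; pose mods := [:: cc; kb]; pose cv := [:: b0; kc].
have EL : del ++ mods = L by [].
have j2c : joins a2 b2 cc d wc by rewrite /joins /a2 /b2 !eqxx.
have a2kb : a2 kb = V0 by rewrite /a2 (negbTE kbcc) eqxx.
have b2kb : b2 kb = Zb by rewrite /b2 (negbTE kbcc) eqxx.
have j2kb : joins a2 b2 kb V0 Zb by rewrite /joins a2kb b2kb !eqxx.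
have j2b0 : joins a2 b2 b0 w wb.
  by rewrite /joins /a2 /b2 (negbTE b0cc) (negbTE b0kb) !eqxx.
have j2kc : joins a2 b2 kc w Z.
  by rewrite /joins /a2 /b2 (negbTE kccc) (negbTE kckb) (negbTE kcb0) !eqxx.
have agr2 e : e \notin L -> a2 e = a e /\ b2 e = b e.
  rewrite !inE !negb_or /a2 /b2 => /and5P[_ _ /negbTE -> /negbTE -> /and3P[_ /negbTE -> /negbTE ->]].
  by [].
have SS : SR :\: [set e in del] :|: ([set e in SV | ~~ cut a b R e] :|: [set e in cv])
    \subset S :\ gu :\ ka.
  apply/subsetP => e; rewrite in_setU => /orP[|].
    rewrite in_setD in_set => /andP[ed eS]; rewrite in_setD1 inSg // andbT.
    by apply: contraNneq ed => ->; rewrite !inE eqxx !orbT.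
  rewrite in_setU => /orP[|]; rewrite in_set.
    move=> /andP[eV ce]; rewrite !inE eV orbT (virt_real_neq H eV Ska) andbT /=.
    apply: contraNneq ce => ->; rewrite (cut_joins _ jg) uR.
    by rewrite (negbTE (inR w _ _)) // eq_sym.
  rewrite !inE => /orP[]/eqP ->; rewrite ?Sb ?Skc [_ == gu]eq_sym (virt_real_neq H (st_g st)) ?kcka ?andbT //.
  exact: (neq (i := 2) (j := 4) isT isT isT).
have [l2 [r2 Pl2]] := planar_del SS Pl4.
have {Pl1 Pl3 Pl4} Pl5 : planar_struct a2 b2 l2 r2 (SR :\: [set e in del] :|:
     ([set e in SV | ~~ cut a b R e] :|: [set e in cv])).
  apply: planar_ext Pl2 => // e eS X.
  have jB e' x y : e' != kc -> joins A1 B1 e' x y ->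
      joins (mv V V0 \o a3) (mv V V0 \o b3) e' (mv V V0 x) (mv V V0 y).
    by move=> n1 je; apply: joins_mv; have [E1 E2] := agr3 e' n1; rewrite /joins E1 E2.
  have [->|ecc] := eqVneq e cc.
    have : joins a1 b1 cc d wc by rewrite /joins /a1 /b1 !eqxx.
    move/(joins_mv u w); rewrite !mv_id ?[_ == u]eq_sym // => j1.
    have cckc : cc != kc by rewrite eq_sym.
    have := jB cc _ _ cckc j1; rewrite !mv_id ?[_ == V]eq_sym 1?[V == wc]eq_sym // => jj.
    by rewrite (cut_joins _ j2c) (cut_joins _ jj).
  have [->|ekb] := eqVneq e kb.
    have := jA kb _ _ kbcc jkb; rewrite !mv_id 1?eq_sym // => j1.
    have := jB kb _ _ kbkc j1; rewrite mv_eq mv_id 1?eq_sym // => jj.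
    by rewrite (cut_joins _ j2kb) (cut_joins _ jj).
  have [->|eb0] := eqVneq e b0.
    have := jA b0 _ _ b0cc jb; rewrite mv_eq mv_id 1?eq_sym // => j1.
    have := jB b0 _ _ b0kc j1; rewrite !mv_id 1?[w == V]eq_sym // => jj.
    by rewrite (cut_joins _ j2b0) (cut_joins _ jj).
  have [->|ekc] := eqVneq e kc.
    have := joins_mv V V0 j3kc; rewrite !mv_id 1?[w == V]eq_sym 1?[Z == V]eq_sym // => jj.
    by rewrite (cut_joins _ j2kc) (cut_joins _ jj) addbC.
  have eM : e \notin mods by rewrite !inE negb_or ecc ekb.
  have eC : e \notin cv by rewrite !inE negb_or eb0 ekc.
  have [nA nB] := off_region (del := del) (mods := mods) G RW HL2 eS eM eC.
  move: nA nB; rewrite !inE !negb_or => /andP[n1 n2] /andP[n3 n4].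
  rewrite /cut /a2 /b2 /a3 /b3 /= /A1 /B1 /= /a1 /b1 (negbTE ecc) (negbTE ekb) (negbTE eb0) (negbTE ekc).
  by rewrite !mv_id.
(* The terms are the prices of the reduction: one edge each for the new virtual edges at [wb] and
   [Z], and two if the lift happens within [A]. *)
have dgE A : A \subset W :\: R -> dgr A =
    dg a2 b2 (SR :\: [set e in del]) A + (wb \in A) + (Z \in A) + 2 * ((V0 \in A) && (Zb \in A)).
  move=> AW.
  have uA : (u \in A) = false by apply/negP => /(subsetP AW); rewrite inE uR.
  have VA : (V \in A) = false by apply/negP => /(subsetP AW); rewrite inE VR.
  have dA : (d \in A) = false.
    by apply/negP => /(subsetP AW); rewrite inE (negbTE (dW H)) andbF.
  have agc e : e \in SR -> e \notin del ++ mods -> cut a2 b2 A e = cut a b A e.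
    by move=> eS n; have [E1 E2] := agr2 e n; rewrite /cut E1 E2.
  have := @dg_mod _ _ a b a2 b2 SR del mods A uniq7 subL agc; rewrite /= !big_cons !big_nil.
  rewrite (cut_joins _ j2c) (cut_joins _ j2kb) !(cut_joins _ jh) !(cut_joins _ ja) !(cut_joins _ jb).
  rewrite !(cut_joins _ jc) !(cut_joins _ jkc) !(cut_joins _ jka) !(cut_joins _ jkb) uA VA dA /=.
  by case: (V0 \in A); case: (Zb \in A) => /=; slia.
set SR' := SR :\: [set e in del] in dgE Pl5.
have V0E : (V0 \in W :\: R) = (V0 \in W) by rewrite inE inR // eq_sym.
(* If [V0] is the root, the lift saves no pair of edges, but then [ka] is a second root edge at the
   removed set, and the count comes out the same. *)
have Dle : dg a2 b2 SR' (W :\: R) <= D.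
  have := dg_root a b SR RW; rewrite (dgE _ (subxx _)) wbWR ZWR ZbWR V0E andbT.
  have := mr_ge V0dW; have := dg_uV; rewrite -/R.
  by case: (V0 \in W) => /=; slia.
have sW A : A \subset W :\: R -> [/\ A \subset W, A != W, u \notin A & V \notin A].
  move=> AW.
  have uA : u \notin A by apply/negP => /(subsetP AW); rewrite inE uR.
  have VA : V \notin A by apply/negP => /(subsetP AW); rewrite inE VR.
  split=> //; first by apply: subset_trans AW (subsetDl _ _).
  by apply: contraNneq uA => ->.
have G2 : good a2 b2 l2 r2 SR' ([set e in SV | ~~ cut a b R e] :|: [set e in cv]) (W :\: R) d w.
  apply: (good_mod2 (mods := mods) G) => //.
  - by move=> e; rewrite !inE => /orP[]/eqP ->; rewrite eqxx ?orbT.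
  - move=> e; rewrite in_cons mem_seq1 => /orP[]/eqP ->.
      rewrite /a2 /b2 !eqxx eq_sym (proj1 (W_neq H wcW)) setU11.
      by split=> //; rewrite in_setU1 wcWR orbT.
    rewrite a2kb b2kb eq_sym ZbV0; split=> //; rewrite in_setU1 ?ZbWR ?orbT // V0E.
    by move: V0dW; rewrite in_setU1.
  - move=> e; rewrite !inE => /orP[]/eqP ->; [exists wb => // | exists Z => //]; by rewrite joinsC.
  - exact: leq_trans Dle D6.
  - move=> A AW A0 AnW; rewrite -/SR'; have [t1 t2 t3 t4] := sW A AW; have := dgE A AW.
    case both: ((V0 \in A) && (Zb \in A)) => /=.
      case/andP: both => V0A ZbA; have := lifted_big t1 t3 t4 V0A ZbA.
      by case: (Z \in A); case: (wb \in A) => /=; slia.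
    case bA: (wb \in A); case ZA: (Z \in A) => /=.
    + have [Eb|nb] := eqVneq wb Z; last by have := dg_u Z5 t1 t2 ZA bA nb; slia.
      have [A1'|A1'] := leqP 2 #|A|; first by have := re_6 H t1 t2 A1'; slia.
      have EA : A = [set Z] by apply/esym/eqP; rewrite eqEcard sub1set ZA cards1; slia.
      have n5 : deg Z <> 5 by move=> E5; apply: nZ.
      by rewrite EA; have := Z5; slia.
    + by have := dg_contains t1 t2 bA (c1_wb5 cf); slia.
    + by have := dg_contains t1 t2 ZA Z5; slia.
    by have := go_1 G t1 A0 t2; slia.
  move=> A AW A0 AnW nC; rewrite -/SR'.
  have [t1 t2 t3 t4] := sW A AW; have := dgE A AW.
  have wA : w \notin A by apply: contra (wW H); apply: (subsetP t1).
  have := nC b0; rewrite !inE eqxx => /(_ isT); rewrite (cut_joins _ j2b0) (negbTE wA) => /negbTE /= ->.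
  have := nC kc; rewrite !inE eqxx orbT => /(_ isT); rewrite (cut_joins _ j2kc) (negbTE wA) => /negbTE /= ->.
  case V0A: (V0 \in A); case ZbA: (Zb \in A) => /= E0; [right | left; slia..].
  by have := lifted_big t1 t3 t4 V0A ZbA; slia.
(* Two tight parts never occur. A tight part with several vertices contains [V0], [Zb] and [wb] but
   not [Z], so [Z] makes up a part by itself; edge counts and [excl2] rule this out. *)
have cons7 c' : consistent a2 b2 SR' (W :\: R) c'.
  apply: (consistent_cut G2) => A AW A0 AnW D66 A4 B4; exfalso.
  have nontriv X : X \subset W :\: R -> dg a2 b2 SR' X = 4 -> 1 < #|X| ->
      [/\ V0 \in X, Zb \in X, wb \in X, Z \notin X & dgr X = 7].
    move=> XW X4 X1; have [t1 t2 t3 t4] := sW X XW; have := dgE X XW; rewrite X4.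
    have h6 := re_6 H t1 t2 X1.
    case both: ((V0 \in X) && (Zb \in X)) => /=.
      case/andP: both => V0X ZbX; have := lifted_big t1 t3 t4 V0X ZbX.
      by case: (Z \in X); case: (wb \in X) => /= E1 E2; split=> //; slia.
    case bX: (wb \in X); case ZX: (Z \in X) => /= E1; try by exfalso; slia.
    by exfalso; have := re_7 H t1 t2 X1 ZX Z5; slia.
  have fin X Y : X \subset W :\: R -> Y = W :\: R :\: X -> dg a2 b2 SR' X = 4 -> dg a2 b2 SR' Y = 4 ->
      #|Y| <= 1 -> Z \in Y -> False.
    move=> XW EY X4 Y4 Y1 ZY; have YW : Y \subset W :\: R by rewrite EY subsetDl.
    have EYZ : Y = [set Z] by apply/esym/eqP; rewrite eqEcard sub1set ZY cards1.
    have inX t : t \in W :\: R -> t != Z -> t \in X.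
      move=> tW tZ; apply: contraT => tX; case/negP: tZ.
      by have : t \in Y; [rewrite EY inE tX tW | rewrite EYZ inE].
    have ZbX : Zb \in X by apply: inX => //; rewrite eq_sym.
    have dZ := dgE Y YW; rewrite Y4 EYZ !inE eqxx [Zb == Z]eq_sym (negbTE ZZb) andbF in dZ.
    have [t1 t2 t3 t4] := sW X XW; have dX := dgE X XW; rewrite X4 ZbX andbT in dX.
    have ZX : (Z \in X) = false by move: ZY; rewrite EY inE => /andP[/negbTE].
    rewrite ZX in dX.
    have [Ewc|nwc] := eqVneq wc Z.
      have nwb : wb != Z by rewrite -Ewc eq_sym.
      by apply: (excl2 Ewc); rewrite dZ (negbTE nwb).
    have wcX := inX _ wcWR nwc.
    have [X1|X1] := leqP 2 #|X|.
      have [V0X _ wbX _ X7] := nontriv X XW X4 X1.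
      have dis : [disjoint X & R].
        rewrite disjoints_subset; apply/subsetP => t /(subsetP XW).
        by rewrite [t \in W :\: R]inE [t \in ~: R]inE => /andP[].
      have := dgU a b SR dis.
      have us : uniq [:: b0; cc; ka; kb].
        have := uniq7; rewrite /= !inE !negb_or => /and5P[_ _ /and4P[h1 h2 h3 h4] _ /and3P[/andP[h5 h6] h7 _]].
        by rewrite h2 h3 h4 [cc == ka]eq_sym h5 h6 h7.
      have sub : {subset [:: b0; cc; ka; kb] <= SR} by move=> i; rewrite !inE => /or4P[]/eqP ->.
      have := sum_ge_seq (fun e => cut a b X e && cut a b R e) us sub.
      have nR t : t \in X -> t \in R = false by move=> tX; rewrite (disjointFr dis tX).
      rewrite !big_cons big_nil !(cut_joins _ jb) !(cut_joins _ jc) !(cut_joins _ jka) !(cut_joins _ jkb).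
      rewrite (negbTE t3) (negbTE t4) uR VR !nR // wbX wcX V0X ZbX /= X7.
      have := dg_uV; rewrite -/R.
      have : 6 <= dgr (X :|: R).
        apply: (re_6 H).
        - by rewrite subUset t1.
        - apply/eqP => E0; have := ZW; rewrite -E0 inE ZX /=.
          by move: ZWR; rewrite inE => /andP[/negbTE ->].
        by apply: leq_trans X1 _; apply: subset_leq_card; apply: subsetUl.
      by slia.
    have EX : X = [set Zb] by apply/esym/eqP; rewrite eqEcard sub1set ZbX cards1; slia.
    have Ewc : wc = Zb by move: wcX; rewrite EX inE => /eqP.
    have Ewb : wb = Z.
      apply/eqP; apply: contraT => n; have := inX wb wbWR n; rewrite EX inE -Ewc => /eqP E0.
      by move: wcwb; rewrite E0 eqxx.
    move: dX; rewrite EX !inE Ewb (negbTE ZZb) [V0 == Zb]eq_sym (negbTE ZbV0) /=.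
    by have := Zb5; slia.
  have BW : W :\: R :\: A \subset W :\: R := subsetDl _ _.
  have EB : A = W :\: R :\: (W :\: R :\: A) by rewrite setDDr setDv set0U (setIidPr AW).
  have [A1'|A1'] := leqP 2 #|A|; have [B1'|B1'] := leqP 2 #|W :\: R :\: A|.
  - have [_ x1 _ _ _] := nontriv A AW A4 A1'; have [_ x2 _ _ _] := nontriv _ BW B4 B1'.
    by move: x2; rewrite inE x1.
  - have [_ _ _ x1 _] := nontriv A AW A4 A1'.
    by apply: (fin A _ AW erefl A4 B4 B1'); rewrite inE x1.
  - have [_ _ _ x1 _] := nontriv _ BW B4 B1'.
    apply: (fin _ A BW EB B4 A4 A1'); move: x1; rewrite inE negb_and negbK => /orP[//|].
    by rewrite ZWR.
  case ZA: (Z \in A); first by apply: (fin _ A BW EB B4 A4 A1' ZA).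
  by apply: (fin A _ AW erefl A4 B4 B1'); rewrite inE ZA.
have small_size : #|W :\: R| + #|SR'| < #|W| + #|SR|.
  have : #|W :\: R| < #|W|.
    apply: proper_card; rewrite properE subsetDl /=; apply/negP => /subsetP /(_ u uW).
    by rewrite inE uR.
  have : #|SR'| <= #|SR| by apply: subset_leq_card; apply: subsetDl.
  by slia.
have innM := inner_mod W (del := del) (mods := mods) uniq7 subL HL2 agr2; rewrite -/R -/SR' in innM.
have agrI e : e \in inner a b (W :\: R) SR -> a2 e = a e /\ b2 e = b e.
  by move=> eI; apply: agr2; apply: (inner_off HL2 eI).
have ccI : (a2 cc \in W :\: R) = false by rewrite /a2 eqxx inE (negbTE (dW H)) andbF.
have modsE : [set e in mods | (a2 e \in W :\: R) && (b2 e \in W :\: R)] =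
    if V0 \in W then [set kb] else set0.
  apply/setP => e; rewrite in_set in_cons mem_seq1; have [->|ecc] := eqVneq e cc.
    by rewrite ccI; case: (V0 \in W); rewrite ?in_set1 ?in_set0 // eq_sym (negbTE kbcc).
  have [->|ekb] := eqVneq e kb; last by case: (V0 \in W); rewrite ?in_set1 ?in_set0 // (negbTE ekb).
  by rewrite a2kb b2kb V0E ZbWR; case: (V0 \in W); rewrite ?in_set1 ?in_set0 ?eqxx.
(* The owner of an edge is the removed vertex whose demand it serves, and [sig] is read as flow out
   of the owner. *)
pose own e := if (e == kc) || (e == kb) then V else u.
have own_u e : e != kc -> e != kb -> own e = u by rewrite /own => /negbTE -> /negbTE ->.
have own_kc : own kc = V by rewrite /own eqxx.
have own_kb : own kb = V by rewrite /own eqxx orbT.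
have cckc : cc != kc by rewrite eq_sym.
have cckb : cc != kb by rewrite eq_sym.
have a0kb' : a0 != kb := neq (i := 1) (j := 6) isT isT isT.
have filterL : [seq e <- L | (a e \in W) && (b e \in W)] =
    [:: a0; b0; kc] ++ (if V0 \in W then [:: ka] else [::]) ++ [:: cc; kb].
  rewrite /= (joins_both _ jh) (joins_both _ ja) (joins_both _ jb) (joins_both _ jkc).
  rewrite (joins_both _ jka) (joins_both _ jc) (joins_both _ jkb) uW VW wbW ZW wcW ZbW (negbTE (dW H)) /=.
  by case: (V0 \in W).
apply: nosol; case V0W: (V0 \in W).
  have QL : {subset [:: cc; b0; a0; kc] <= L}.
    by move=> e; rewrite !in_cons in_nil => /or4P[/eqP ->|/eqP ->|/eqP ->|/orP[/eqP ->|//]]; rewrite eqxx ?orbT.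
  have uQ : uniq [:: cc; b0; a0; kc].
    by rewrite /= !inE !negb_or cb0 ca0 cckc ba0 b0kc a0kc.
  (* The lifted pair has no effect on [V], so [a0] and [kc] must serve [V] alone: [a0] is chosen
     such that the value left for [kc] is not zero. *)
  have [sa na] := sg_avoid (c V); have [sk Ek] := sg_ex na.
  have [sc [sb Es]] := sg2_ex (c u - sg sa)%R.
  have [sig [E1 E2 E3 E4]] := @exists_map E bool true [:: cc; b0; a0; kc] [:: sc; sb; sa; sk] uQ erefl.
  pose x0 e := if a e == own e then sig e else ~~ sig e.
  pose Q := [set e in [:: cc; b0; a0; kc]].
  have netQ v : net a b Q x0 v = (((u == v)%:R - (wc == v)%:R) * sg (sig cc) +
     (((u == v)%:R - (wb == v)%:R) * sg (sig b0) + (((u == v)%:R - (V == v)%:R) * sg (sig a0) +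
      ((V == v)%:R - (Z == v)%:R) * sg (sig kc))))%R.
    rewrite net_seq // !big_cons big_nil addr0 /x0 own_kc !own_u //.
    by rewrite !(contrib _ _ uwc jc) !(contrib _ _ uwb jb) !(contrib _ _ uV ja) (contrib _ _ VZ jkc).
  have HR v : v \in R -> net a b Q x0 v = c v.
    rewrite in_set2 netQ E1 E2 E3 E4 => /orP[]/eqP ->.
      rewrite eqxx ![_ == u]eq_sym (negbTE uwc) (negbTE uwb) (negbTE uV) (negbTE uZ).
      by rewrite !subr0 mul0r !mul1r addr0 addrA Es subrK.
    rewrite eqxx (negbTE uV) (negbTE wcV) (negbTE wbV) [Z == V]eq_sym (negbTE VZ).
    by rewrite !Z3F !Z3T !subr0 !mul0r !add0r mul1r Ek mulN1r addrC addrK.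
  have V0WR : V0 \in W :\: R by rewrite V0E.
  have kaI : ka \notin inner a b (W :\: R) SR by rewrite (inner_joins _ Ska jka) inE VR.
  have kbI : kb \notin inner a b (W :\: R) SR by rewrite (inner_joins _ Skb jkb) inE VR.
  have kaQ : ka \notin Q.
    rewrite !inE !negb_or kacc kakc [ka == a0]eq_sym a0ka.
    by rewrite (neq (i := 4) (j := 2) isT isT isT).
  have kbQ : kb \notin Q.
    rewrite !inE !negb_or kbcc kbkc [kb == a0]eq_sym a0kb'.
    by rewrite [kb == b0]eq_sym b0kb.
  have V0Zb : V0 != Zb by rewrite eq_sym.
  apply: (solve_lift (a' := a2) (b' := b2) (SR' := SR') (x0 := x0)
    VR V0WR ZbWR V0Zb kakb jka jkb a2kb b2kb kaQ kbQ kaI kbI _ _ HR RW).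
  - rewrite (rest_union W subL HL2) filterL V0W; apply/setP => e.
    rewrite in_setU in_set !in_setU1 in_setU [e \in Q]in_set !in_cons !in_nil; move: (e \in inner _ _ _ _) => eI.
    by case: (e == a0); case: (e == b0); case: (e == kc); case: (e == ka); case: (e == cc); case: (e == kb).
  - rewrite disjoint_sym disjoints_subset; apply/subsetP => e /(inner_off HL2); rewrite in_setC.
    by apply: contra; rewrite in_set => /QL.
  - by rewrite innM modsE V0W.
  - exact: agrI.
  apply: (IH G2) => //.
  apply: (sum_rest (SR := SR) RW _ Ec HR); rewrite (rest_union W subL HL2) filterL V0W.
  apply: subset_trans (subsetUl _ _); apply/subsetP => e; rewrite !in_set !in_cons !in_nil.
  by case/or4P => [/eqP ->|/eqP ->|/eqP ->|/orP[/eqP ->|//]]; rewrite eqxx ?orbT.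
have uQ : uniq [:: cc; b0; a0; kc; kb].
  by rewrite /= !inE !negb_or cb0 ca0 cckc cckb ba0 b0kc b0kb a0kc a0kb' kckb.
(* Now [V0] is the root and [ka] is a root edge, so nothing passes through [V]; the two edges [kc]
   and [kb] serve it together. *)
have [sk [sl Ek]] := sg2_ex (c V + sg true)%R.
have [sc [sb Es]] := sg2_ex (c u - sg true)%R.
have [sig [E1 E2 E3 E4 E5]] := @exists_map E bool true [:: cc; b0; a0; kc; kb]
  [:: sc; sb; true; sk; sl] uQ erefl.
pose x0 e := if a e == own e then sig e else ~~ sig e.
pose Q := [set e in [:: cc; b0; a0; kc; kb]].
have netQ v : net a b Q x0 v = (((u == v)%:R - (wc == v)%:R) * sg (sig cc) +
   (((u == v)%:R - (wb == v)%:R) * sg (sig b0) + (((u == v)%:R - (V == v)%:R) * sg (sig a0) +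
    (((V == v)%:R - (Z == v)%:R) * sg (sig kc) + ((V == v)%:R - (Zb == v)%:R) * sg (sig kb)))))%R.
  rewrite net_seq // !big_cons big_nil addr0 /x0 own_kc own_kb !own_u //.
  by rewrite !(contrib _ _ uwc jc) !(contrib _ _ uwb jb) !(contrib _ _ uV ja) (contrib _ _ VZ jkc)
    (contrib _ _ VZb jkb).
have HR v : v \in R -> net a b Q x0 v = c v.
  rewrite in_set2 netQ E1 E2 E3 E4 E5 => /orP[]/eqP ->.
    rewrite eqxx ![_ == u]eq_sym (negbTE uwc) (negbTE uwb) (negbTE uV) (negbTE uZ) (negbTE uZb).
    by rewrite !subr0 !mul0r !mul1r !addr0 addrA Es subrK.
  rewrite eqxx (negbTE uV) (negbTE wcV) (negbTE wbV) [Z == V]eq_sym (negbTE VZ) [Zb == V]eq_sym (negbTE VZb).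
  by rewrite !Z3F !Z3T !subr0 !mul0r !add0r !mul1r Ek mulN1r addrC addrK.
have EQ : Q = inner a b W SR :\: inner a b (W :\: R) SR.
  rewrite (rest_list W subL HL2) filterL V0W; apply/setP => e; rewrite !in_set !in_cons !in_nil.
  by case: (e == a0); case: (e == b0); case: (e == kc); case: (e == cc); case: (e == kb).
apply: (solve_rest (a' := a2) (b' := b2) (SR' := SR') EQ HR RW).
- by rewrite innM modsE V0W set0U.
- exact: agrI.
by apply: (IH G2) => //; apply: (sum_rest (SR := SR) RW _ Ec HR); rewrite EQ subsetDl.
Qed.

Section Third.

Hypothesis (Ewb : wb = Z) (Z5' : deg Z = 5).

Let jbZ : joins a b b0 u Z. Proof. by have := jb; rewrite Ewb. Qed.
Let jbZ' : joins a b b0 Z u. Proof. by rewrite joinsC. Qed.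
Let jkcZ : joins a b kc Z V. Proof. by rewrite joinsC. Qed.
Let Zd : Z != d. Proof. exact: (W_neq H ZW).1. Qed.
Let Zw : Z != w. Proof. exact: (W_neq H ZW).2. Qed.
Let wcZ : wc != Z. Proof. by rewrite -Ewb. Qed.
Let b0kc : b0 != kc. Proof. exact: (neq (i := 2) (j := 3) isT isT isT). Qed.

Let dg_uZ : dgr [set u; Z] <= 7.
Proof.
have := dg_pair H _ _ uZ Sb jbZ; rewrite !inE uW ZW !orbT => /(_ isT isT).
by rewrite u4 Z5'; slia.
Qed.

Let dg_VZ : dgr [set V; Z] <= 7.
Proof.
have := dg_pair H _ _ VZ Skc jkc; rewrite !inE VW ZW !orbT => /(_ isT isT).
by rewrite V4 Z5'; slia.
Qed.

Let dg_R : dgr (Z |: [set u; V]) <= 7.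
Proof.
have ZuV : Z \notin [set u; V] by rewrite !inE negb_or ![Z == _]eq_sym uZ.
have := dgU1 P ZuV.
have us2 : uniq [:: b0; kc] by rewrite /= inE b0kc.
have sub2 : {subset [:: b0; kc] <= SR} by move=> i; rewrite !inE => /orP[]/eqP ->.
have := sum_ge_seq (fun e => cut a b [set Z] e && cut a b [set u; V] e) us2 sub2.
rewrite !big_cons big_nil !(cut_joins _ jkc) !(cut_joins _ jbZ) !inE !eqxx ?orbT.
rewrite (negbTE uZ) (negbTE VZ) ![Z == _]eq_sym (negbTE uZ) (negbTE VZ) /= Z5'.
by have := dg_uV; slia.
Qed.

(** Otherwise [t] is the root or has degree four, and its virtual edge closes the cycle [w], [u],
    [Z], [t]. Around this cycle there are at most nine real edges, while the side of [V] needs six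
    and the side of [wc] needs four. *)
Lemma excl3 e t : e \in SR -> joins a b e Z t -> e != b0 -> e != kc -> t \in W /\ 5 <= deg t.
Proof.
move=> eS je eb ek; have [_ tdW Zt] := real_ends H eS je.
have tw := dW_neq_w G tdW.
have tu : t != u by rewrite eq_sym; apply: (par_ne ZW uW Sb eS _ jbZ' je); rewrite eq_sym.
have tV : t != V.
  by rewrite eq_sym; apply: (par_ne ZW VW Skc eS _ jkcZ je); rewrite eq_sym.
apply/andP; apply: contraT => bad.
have t4 : t \in W -> deg t = 4.
  by move=> tW; move: bad; rewrite tW /= -ltnNge; have := deg_ge4 H tW; slia.
have [gF gFV jgF] : exists2 g, g \in SV & joins a b g t w.
  move: tdW; rewrite !inE => /orP[/eqP ->|tW]; first exact: pi_g P.
  exact: (virt_of H tW (t4 tW)).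
have big x : x \in W -> 5 <= deg x -> x != t.
  by move=> xW x5; apply/eqP => E0; move: x5; rewrite E0 t4 // -E0.
have gg : gu != gF.
  by apply: (virt_neq _ uw jg jgF); rewrite eq_sym.
have us : uniq [:: gu; b0; e; gF].
  rewrite /= !inE !negb_or gg (virt_real_neq H (st_g st) Sb) (virt_real_neq H (st_g st) eS) [b0 == e]eq_sym eb.
  by rewrite ![_ == gF]eq_sym (virt_real_neq H gFV Sb) (virt_real_neq H gFV eS).
have SS i : i \in SR -> i \in S by move=> iS; rewrite inE iS.
have sub : {subset [:: gu; b0; e; gF] <= S}.
  by move=> i; rewrite !inE => /or4P[]/eqP ->; rewrite ?Sb ?eS ?(st_g st) ?gFV ?orbT.
have [|Phi [CS HPhi]] := cycle_dual H us sub.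
  move=> X; rewrite !big_cons big_nil (cut_joins _ jg) (cut_joins _ jbZ) (cut_joins _ je) (cut_joins _ jgF).
  by do 4 case: (_ \in X).
pose N := w |: (t |: [set u; Z]).
have uN : u \in N by rewrite !inE eqxx !orbT.
have tN : t \in N by rewrite !inE eqxx !orbT.
have ZN : Z \in N by rewrite !inE eqxx !orbT.
have wN : w \in N by rewrite !inE eqxx.
have CN : {in [set i in [:: gu; b0; e; gF]], forall i, (a i \in N) && (b i \in N)}.
  apply: in_N4.
  - exact: joins_N jg uN wN.
  - exact: joins_N jbZ uN ZN.
  - exact: joins_N je ZN tN.
  - exact: joins_N jgF tN wN.
have notC i : i \in SR -> i != b0 -> i != e -> i \notin [set i in [:: gu; b0; e; gF]].
  move=> iS i1 i2; rewrite !inE !negb_or i1 i2.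
  by rewrite ![i == _]eq_sym (virt_real_neq H (st_g st) iS) (virt_real_neq H gFV iS).
have noZ i x y : joins a b i x y -> x != Z -> y != Z -> i != e.
  move=> ji xZ yZ; apply/eqP => E0; rewrite E0 in ji.
  have := cut_joins [set Z] ji; rewrite (joins_cut1 Zt je) !inE.
  by rewrite (negbTE xZ) (negbTE yZ).
have hC : h \notin [set i in [:: gu; b0; e; gF]].
  by apply: notC => //; apply: (noZ _ _ _ jh) => //; rewrite eq_sym.
have cC : cc \notin [set i in [:: gu; b0; e; gF]].
  by apply: notC => //; apply: (noZ _ _ _ jc).
have aC : a0 \notin [set i in [:: gu; b0; e; gF]].
  by apply: notC => //; [rewrite eq_sym | apply: (noZ _ _ _ ja)].
have nNt x : x \in W -> x != u -> x != Z -> x != t -> x \notin N.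
  by move=> xW n1 n2 n3; rewrite !inE !negb_or n1 n2 n3 (proj2 (W_neq H xW)).
have VN : V \notin N by apply: nNt => //; rewrite eq_sym.
have wcN : wc \notin N by apply: nNt => //; [rewrite eq_sym | apply: big => //; apply: c1_wc5 cf].
have ZbN : Zb \notin N.
  by apply: nNt; rewrite 1?eq_sym //; rewrite eq_sym; apply: big.
have h9 : dgr N <= 9.
  rewrite (dgN_w H); have tuZ : t \notin [set u; Z] by rewrite !inE negb_or tu eq_sym.
  have := dgU1 P tuZ; have := dg_uZ.
  have [Etd|td] := eqVneq t d.
    have us2 : uniq [:: h; e] by rewrite /= inE (noZ _ _ _ jh) // eq_sym.
    have sub2 : {subset [:: h; e] <= SR} by move=> i; rewrite !inE => /orP[]/eqP ->.
    have := sum_ge_seq (fun e => cut a b [set t] e && cut a b [set u; Z] e) us2 sub2.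
    rewrite !big_cons big_nil !(cut_joins _ jh) !(cut_joins _ je) Etd !inE !eqxx ?orbT.
    rewrite ![d == _]eq_sym (negbTE ud) (negbTE Zd) (deg_root H) /=.
    by slia.
  have tW : t \in W by move: tdW; rewrite !inE (negbTE td).
  have us2 : uniq [:: e] by [].
  have sub2 : {subset [:: e] <= SR} by move=> i; rewrite !inE => /eqP ->.
  have := sum_ge_seq (fun e => cut a b [set t] e && cut a b [set u; Z] e) us2 sub2.
  rewrite !big_cons big_nil !(cut_joins _ je) !inE !eqxx ?orbT.
  by rewrite (negbTE tu) [t == Z]eq_sym (negbTE Zt) (t4 tW) /=; slia.
have [X1 [X2 [H1 H2 E12 u1 u2]]] := sides H u CS HPhi CN.
(* A side meeting [W] only in [V] would cut [kb], although both ends of [kb] lie outside [N]. So it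
   has at least two vertices, and [re_6] applies. *)
have side (Y : {set U}) : u \notin Y -> cut a b Y a0 -> ~~ cut a b Y b0 -> (cut a b Y kb -> cut a b N kb) -> 6 <= dgr Y.
  move=> uY; rewrite (cut_joins _ ja) (negbTE uY) /= => VY; rewrite (cut_joins _ jbZ) (negbTE uY) /= => ZY ckb.
  rewrite (dg_side H); case dY: (d \in Y).
    apply: ltnW; apply: (dg_u (v := Z) (x := u)) => //; try by rewrite inE ?uY ?ZY.
    - exact: subsetDl.
    - by apply/eqP => E0; have := VW; rewrite -E0 inE VY.
  apply: (re_6 H); first exact: subsetIr.
    by apply/eqP => E0; have := uW; rewrite -E0 inE (negbTE uY).
  rewrite ltnNge; apply/negP => Y1.
  have EY : Y :&: W = [set V].
    by apply/esym/eqP; rewrite eqEcard sub1set inE VY VW cards1.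
  have ZbY : Zb \notin Y.
    apply/negP => ZbY; have : Zb \in Y :&: W by rewrite inE ZbY.
    by rewrite EY inE eq_sym (negbTE VZb).
  move: ckb; rewrite !(cut_joins _ jkb) VY (negbTE ZbY) (negbTE VN) (negbTE ZbN).
  by move=> /(_ isT).
have cutA : cut a b N a0 by rewrite (cut_joins _ ja) uN (negbTE VN).
have ccc : cut a b N cc by rewrite (cut_joins _ jc) uN (negbTE wcN).
have cutB : cut a b N b0 = false by rewrite (cut_joins _ jbZ) uN ZN.
have q4 := joins_side (SS _ Sa) aC HPhi (st_f4 st).
have q2 := joins_side (SS _ Sc) cC HPhi (st_f2 st).
have := joins_in (SS _ Sc) HPhi (st_f2 st); rewrite (negbTE cC).
have := joins_in (SS _ Sb) HPhi (st_f3 st); rewrite !inE eqxx orbT => r3 r2.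
have p24 : (p2 \in Phi) = ~~ (p4 \in Phi).
  by move: r2 r3; case: (p2 \in Phi); case: (p3 \in Phi); case: (p4 \in Phi).
case P4: (p4 \in Phi) in q4 p24.
  have h1 : 6 <= dgr X1.
    by apply: side; rewrite ?H1 ?SS // ?cutA ?q4 ?cutB //; case: (cut a b N kb).
  have h2 : 4 <= dgr X2 by apply: (small_edge H Sc); rewrite H2 ?SS // ccc q2 p24.
  by slia.
have h1 : 6 <= dgr X2.
  by apply: side; rewrite ?H2 ?SS // ?cutA ?q4 ?cutB //; case: (cut a b N kb).
have h2 : 4 <= dgr X1 by apply: (small_edge H Sc); rewrite H1 ?SS // ccc q2 p24.
by slia.
Qed.

(** If some edge joins [Z] to [wc], it is unique and is named [z3], so that [z4] and [z5] avoid
    [wc]. This singles out the one vertex at which consistency can be at stake later. *)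
Let starZ_ex : exists z3 z4 z5 : E, [/\ uniq [:: z3; z4; z5; b0; kc],
  forall e, e \in SR -> (a e == Z) || (b e == Z) = (e \in [:: z3; z4; z5; b0; kc]),
  {subset [:: z3; z4; z5; b0; kc] <= SR},
  ~~ joins a b z4 Z wc & ~~ joins a b z5 Z wc].
Proof.
pose T := [set e in SR | cut a b [set Z] e].
have T5 : #|T| = 5 by rewrite -Z5' /dg sum_card.
have b0T : b0 \in T by rewrite !inE Sb (joins_cut1 _ jbZ') // eq_sym.
have kcT : kc \in T by rewrite !inE Skc (joins_cut1 _ jkcZ) // eq_sym.
pose T' := T :\ b0 :\ kc.
have T3 : #|T'| = 3.
  have := cardsD1 b0 T; rewrite b0T T5; have := cardsD1 kc (T :\ b0).
  by rewrite in_setD1 kcT eq_sym b0kc -/T' /=; slia.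
have inT' e : e \in T' -> [/\ e \in SR, cut a b [set Z] e, e != b0 & e != kc].
  by rewrite !inE => /and3P[-> -> /andP[-> ->]].
have uniqwc (e f : E) : e \in T' -> f \in T' -> joins a b e Z wc -> joins a b f Z wc -> e = f.
  move=> /inT'[eS _ _ _] /inT'[fS _ _ _] je jf.
  by apply: (re_par H ZW wcW _ eS fS je jf); rewrite eq_sym.
have [z3 z3T Hz3] : exists2 z3 : E, z3 \in T' & forall e, e \in T' -> joins a b e Z wc -> e = z3.
  case: (boolP [exists e in T', joins a b e Z wc]).
    by case/existsP => e /andP[eT je]; exists e => // f fT jf; apply: uniqwc.
  rewrite negb_exists => /forallP nj.
  have [z3 z3T] : exists z3 : E, z3 \in T' by apply/set0Pn; rewrite -card_gt0 T3.
  by exists z3 => // e eT je; have := nj e; rewrite eT je.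
have : #|T' :\ z3| == 2 by apply/eqP; have := cardsD1 z3 T'; rewrite z3T T3; slia.
case/cards2P => z4 [z5 [z45 E45]].
have z4T : z4 \in T' :\ z3 by rewrite E45 !inE eqxx.
have z5T : z5 \in T' :\ z3 by rewrite E45 !inE eqxx orbT.
move: (z4T); rewrite in_setD1 => /andP[z43 z4T'].
move: (z5T); rewrite in_setD1 => /andP[z53 z5T'].
have TE e : (e \in T) = (e \in [:: z3; z4; z5; b0; kc]).
  rewrite -(setD1K b0T) -(setD1K (_ : kc \in T :\ b0)); last by rewrite in_setD1 kcT eq_sym b0kc.
  rewrite -/T' -(setD1K z3T) E45 !inE.
  by case: (e == z3); case: (e == z4); case: (e == z5); case: (e == b0); case: (e == kc).
exists z3, z4, z5; split.
- have [_ _ n1 n2] := inT' _ z3T; have [_ _ n3 n4] := inT' _ z4T'; have [_ _ n5 n6] := inT' _ z5T'.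
  by rewrite /= !inE !negb_or [z3 == z4]eq_sym z43 [z3 == z5]eq_sym z53 n1 n2 z45 n3 n4 n5 n6 b0kc.
- move=> e eS; rewrite -TE inE eS /= /cut !inE.
  have := pi_loop P eS; case: (a e =P Z) => [->|_]; case: (b e =P Z) => [->|_] //=.
  by rewrite eqxx.
- by move=> e; rewrite -TE inE => /andP[].
- by apply/negP => j4; move: z43; rewrite (Hz3 _ z4T' j4) eqxx.
- by apply/negP => j5; move: z53; rewrite (Hz3 _ z5T' j5) eqxx.
Qed.

(** [Z] has degree five and is adjacent to both [u] and [V], so it is removed along with them.
    Contracting [b0] merges it into [w], its three other edges become virtual, and by [excl3] their
    ends have degree at least five and can afford it. *)
Lemma step8 : False.
Proof.
have [z3 [z4 [z5 [uz HZ subz nwc4 nwc5]]]] := starZ_ex.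
pose R := Z |: [set u; V].
have RW : R \subset W by rewrite !subUset !sub1set uW VW ZW.
have uR : u \in R by rewrite !inE eqxx orbT.
have VR : V \in R by rewrite !inE eqxx !orbT.
have ZR : Z \in R by rewrite !inE eqxx.
have inR t : t != u -> t != V -> t != Z -> t \notin R by rewrite !inE !negb_or => -> -> ->.
have inWR t : t \in W -> u != t -> V != t -> Z != t -> t \in W :\: R.
  by move=> tW n1 n2 n3; rewrite inE tW inR // eq_sym.
have wR : w \notin R by apply: inR; rewrite eq_sym.
have [n34 n35 n45] : [/\ z3 != z4, z3 != z5 & z4 != z5].
  by move: uz; rewrite /= !inE !negb_or => /and5P[/and4P[-> -> _ _] /and3P[-> _ _] _ _ _].
have [n3b n3k] : z3 != b0 /\ z3 != kc.
  by move: uz; rewrite /= !inE !negb_or => /and5P[/and4P[_ _ -> ->]].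
have [n4b n4k] : z4 != b0 /\ z4 != kc.
  by move: uz; rewrite /= !inE !negb_or => /and5P[_ /and3P[_ -> ->]].
have [n5b n5k] : z5 != b0 /\ z5 != kc.
  by move: uz; rewrite /= !inE !negb_or => /and5P[_ _ /andP[-> ->]].
have S3 : z3 \in SR by apply: subz; rewrite !inE eqxx.
have S4 : z4 \in SR by apply: subz; rewrite !inE eqxx orbT.
have S5 : z5 \in SR by apply: subz; rewrite !inE eqxx !orbT.
have endZ e : e \in SR -> e \in [:: z3; z4; z5; b0; kc] -> exists t, joins a b e Z t.
  move=> eS; rewrite -HZ // /joins => /orP[]/eqP E0; first by exists (b e); rewrite E0 !eqxx.
  by exists (a e); rewrite E0 !eqxx orbT.
have [||F3 j3] := endZ z3 => //; first by rewrite !inE eqxx.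
have [||F4 j4] := endZ z4 => //; first by rewrite !inE eqxx orbT.
have [||F5 j5] := endZ z5 => //; first by rewrite !inE eqxx !orbT.
have [F3W F35] := excl3 S3 j3 n3b n3k.
have [F4W F45] := excl3 S4 j4 n4b n4k.
have [F5W F55] := excl3 S5 j5 n5b n5k.
have F34 : F3 != F4 := par_ne ZW F3W S3 S4 n34 j3 j4.
have F35' : F3 != F5 := par_ne ZW F3W S3 S5 n35 j3 j5.
have F45' : F4 != F5 := par_ne ZW F4W S4 S5 n45 j4 j5.
have Fu e t : e \in SR -> joins a b e Z t -> e != b0 -> u != t.
  by move=> eS je eb; apply: (par_ne ZW uW Sb eS _ jbZ' je); rewrite eq_sym.
have FV e t : e \in SR -> joins a b e Z t -> e != kc -> V != t.
  by move=> eS je ek; apply: (par_ne ZW VW Skc eS _ jkcZ je); rewrite eq_sym.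
have F3u := Fu _ _ S3 j3 n3b; have F4u := Fu _ _ S4 j4 n4b; have F5u := Fu _ _ S5 j5 n5b.
have F3V := FV _ _ S3 j3 n3k; have F4V := FV _ _ S4 j4 n4k; have F5V := FV _ _ S5 j5 n5k.
have [_ _ ZF3] := real_ends H S3 j3; have [_ _ ZF4] := real_ends H S4 j4.
have [_ _ ZF5] := real_ends H S5 j5.
have F4wc : F4 != wc by apply: contraNneq nwc4 => <-.
have F5wc : F5 != wc by apply: contraNneq nwc5 => <-.
have F3R : F3 \in W :\: R by apply: inWR.
have F4R : F4 \in W :\: R by apply: inWR.
have F5R : F5 \in W :\: R by apply: inWR.
have wcR : wc \in W :\: R by apply: inWR => //; rewrite eq_sym.
have ZbR : Zb \in W :\: R by apply: inWR.
have V0dW := c2_V0 cf2.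
have V0E : (V0 \in W :\: R) = (V0 \in W) by rewrite inE inR // eq_sym.
have zL e t : joins a b e Z t -> e \in SR -> u != t -> V != t -> e \notin L.
  move=> je eS n1 n2; rewrite -HL2 //; move: je => /orP[]/andP[/eqP -> /eqP ->].
    by rewrite !inE !negb_or ![Z == _]eq_sym uZ VZ ![t == _]eq_sym n1 n2.
  by rewrite !inE !negb_or ![Z == _]eq_sym uZ VZ ![t == _]eq_sym n1 n2.
have z3L := zL _ _ j3 S3 F3u F3V; have z4L := zL _ _ j4 S4 F4u F4V.
have z5L := zL _ _ j5 S5 F5u F5V.
pose del := [:: z3; z4; z5; h; a0; b0; kc; ka]; pose mods := [:: cc; kb]; pose cv := [:: z3; z4; z5].
have EL : del ++ mods = [:: z3, z4, z5 & L] by [].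
have uniqL : uniq (del ++ mods).
  have z45L : z4 \notin z5 :: L by rewrite in_cons negb_or n45.
  have z35L : z3 \notin z5 :: L by rewrite in_cons negb_or n35.
  have z34L : z3 \notin [:: z4, z5 & L] by rewrite in_cons negb_or n34.
  by rewrite EL (cons_uniq z3) (cons_uniq z4) (cons_uniq z5) uniq7 z5L z45L z34L.
have HL3 e : e \in SR -> (a e \in R) || (b e \in R) = (e \in del ++ mods).
  move=> eS; transitivity (((a e == Z) || (b e == Z)) || ((a e \in [set u; V]) || (b e \in [set u; V]))).
    by rewrite /R !in_setU1 orbACA.
  rewrite HZ // HL2 // !in_cons in_nil.
  case: (e == z3); case: (e == z4); case: (e == z5); case: (e == b0); case: (e == kc); by rewrite ?orbT.
have subL3 : {subset del ++ mods <= SR}.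
  move=> e; rewrite EL !in_cons => /or4P[/eqP ->|/eqP ->|/eqP ->|] //.
  by move=> eL; apply: subL; rewrite !in_cons.
have notz e : e \in L -> [/\ e != z3, e != z4 & e != z5].
  by move=> eL; split; apply: contraTneq eL => ->.
have ccL : cc \in L by rewrite !inE eqxx !orbT.
have kbL : kb \in L by rewrite !inE eqxx !orbT.
have kaL : ka \in L by rewrite !inE eqxx !orbT.
have [cz3 cz4 cz5] := notz _ ccL; have [kz3 kz4 kz5] := notz _ kbL.
have kccc : kc != cc := neq (i := 3) (j := 5) isT isT isT.
have kacc : ka != cc := neq (i := 4) (j := 5) isT isT isT.
have kbcc : kb != cc := neq (i := 6) (j := 5) isT isT isT.
have b0cc : b0 != cc := neq (i := 2) (j := 5) isT isT isT.
have kab0 : ka != b0 := neq (i := 4) (j := 2) isT isT isT.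
pose a1 e := if e == cc then d else a e; pose b1 e := if e == cc then wc else b e.
have [|||l1 [r1 [agr1 Pl1]]] := @planar_first a1 b1; rewrite /a1 /b1 ?eqxx //.
  by move=> e /negbTE ->.
rewrite -/a1 -/b1 in Pl1.
pose A1 := mv u w \o a1; pose B1 := mv u w \o b1; rewrite -/A1 -/B1 in Pl1.
have jA e x y : e != cc -> joins a b e x y -> joins A1 B1 e (mv u w x) (mv u w y).
  by move=> n1 je; apply: joins_mv; rewrite /joins /a1 /b1 (negbTE n1).
have inSg e : e \in SR -> e \in S :\ gu.
  by move=> eS; rewrite !inE eS eq_sym (virt_real_neq H (st_g st) eS).
have j1b0 : joins A1 B1 b0 Z w.
  by have := jA b0 _ _ b0cc jbZ'; rewrite mv_eq mv_id // eq_sym.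
have Pl3 := contract1 (inSg _ Sb) j1b0 Pl1.
pose A3 := mv Z w \o A1; pose B3 := mv Z w \o B1; rewrite -/A3 -/B3 in Pl3.
have jB e x y : e != cc -> joins a b e x y -> joins A3 B3 e (mv Z w (mv u w x)) (mv Z w (mv u w y)).
  by move=> n1 je; apply: joins_mv; apply: jA.
have mv0 (t : U) : u != t -> Z != t -> mv Z w (mv u w t) = t.
  by move=> m1 m2; have E1 : mv u w t = t; [apply: mv_id; rewrite eq_sym | rewrite E1 mv_id // eq_sym].
have j3ka : joins A3 B3 ka V V0.
  by have := jB ka _ _ kacc jka; rewrite (mv0 V) 1?[Z == V]eq_sym // (mv0 V0).
have kaS : ka \in S :\ gu :\ b0 by rewrite in_setD1 kab0 inSg.
have Pl4 := contract1 kaS j3ka Pl3.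
pose a2 e := if e == cc then d else if e == kb then V0 else
  if e \in cv then w else a e.
pose b2 e := if e == cc then wc else if e == kb then Zb else
  if e == z3 then F3 else if e == z4 then F4 else if e == z5 then F5 else b e.
have j2c : joins a2 b2 cc d wc by rewrite /joins /a2 /b2 !eqxx.
have a2kb : a2 kb = V0 by rewrite /a2 (negbTE kbcc) eqxx.
have b2kb : b2 kb = Zb by rewrite /b2 (negbTE kbcc) eqxx.
have j2kb : joins a2 b2 kb V0 Zb by rewrite /joins a2kb b2kb !eqxx.
have j23 : joins a2 b2 z3 w F3.
  by rewrite /joins /a2 /b2 ![z3 == _]eq_sym (negbTE cz3) (negbTE kz3) !inE !eqxx.
have j24 : joins a2 b2 z4 w F4.
  rewrite /joins /a2 /b2 [z4 == cc]eq_sym [z4 == kb]eq_sym (negbTE cz4) (negbTE kz4) !inE !eqxx.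
  by rewrite [z4 == z3]eq_sym (negbTE n34) !eqxx.
have j25 : joins a2 b2 z5 w F5.
  rewrite /joins /a2 /b2 [z5 == cc]eq_sym [z5 == kb]eq_sym (negbTE cz5) (negbTE kz5) !inE !eqxx.
  by rewrite [z5 == z3]eq_sym (negbTE n35) [z5 == z4]eq_sym (negbTE n45) !orbT !eqxx.
have agr2 e : e \notin del ++ mods -> a2 e = a e /\ b2 e = b e.
  rewrite EL !in_cons in_nil orbF !negb_or /a2 /b2 !inE => /and5P[m3 m4 m5 _ /and5P[_ _ _ _ /andP[mc mk]]].
  by rewrite (negbTE m3) (negbTE m4) (negbTE m5) (negbTE mc) (negbTE mk).
have SS : SR :\: [set e in del] :|: ([set e in SV | ~~ cut a b R e] :|: [set e in cv])
    \subset S :\ gu :\ b0 :\ ka.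
  apply/subsetP => e; rewrite in_setU => /orP[|].
    rewrite in_setD in_set => /andP[ed eS]; rewrite !in_setD1 -in_setD1 inSg // andbT.
    by apply/andP; split; apply: contraNneq ed => ->; rewrite !inE eqxx !orbT.
  rewrite in_setU => /orP[|]; rewrite in_set.
    move=> /andP[eV ce]; rewrite !inE eV orbT (virt_real_neq H eV Ska) (virt_real_neq H eV Sb) andbT /=.
    by apply: contraNneq ce => ->; rewrite (cut_joins _ jg) uR (negbTE wR).
  have kz e' : e' \in L -> e \in cv -> e != e'.
    by move=> eL; rewrite !inE => /or3P[]/eqP ->; rewrite eq_sym; have [] := notz _ eL.
  have b0L : b0 \in L by rewrite !inE eqxx !orbT.
  move=> ecv; rewrite !in_setD1 (kz _ kaL ecv) (kz _ b0L ecv) /=.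
  by move: ecv; rewrite !inE => /or3P[]/eqP ->; rewrite ?S3 ?S4 ?S5 [_ == gu]eq_sym (virt_real_neq H (st_g st)).
have [l2 [r2 Pl2]] := planar_del SS Pl4.
have {Pl1 Pl3 Pl4} Pl5 : planar_struct a2 b2 l2 r2 (SR :\: [set e in del] :|:
     ([set e in SV | ~~ cut a b R e] :|: [set e in cv])).
  apply: planar_ext Pl2 => // e eS X.
  have mvF t : u != t -> V != t -> Z != t -> mv V V0 (mv Z w (mv u w t)) = t.
    by move=> m1 m2 m3; rewrite mv0 // mv_id // eq_sym.
  have mvZ : mv V V0 (mv Z w (mv u w Z)) = w.
    have -> : mv u w Z = Z by apply: mv_id; rewrite eq_sym.
    by rewrite mv_eq mv_id // eq_sym.
  have jC e' x y : e' != cc -> joins a b e' x y ->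
      joins (mv V V0 \o A3) (mv V V0 \o B3) e' (mv V V0 (mv Z w (mv u w x))) (mv V V0 (mv Z w (mv u w y))).
    by move=> n1 je; apply: joins_mv; apply: jB.
  have [->|ecc] := eqVneq e cc.
    have : joins a1 b1 cc d wc by rewrite /joins /a1 /b1 !eqxx.
    move/(joins_mv u w)/(joins_mv Z w)/(joins_mv V V0); rewrite -/A1 -/B1 -/A3 -/B3.
    rewrite (mvF d) // (mvF wc) // 1?[_ == wc]eq_sym // => jj.
    by rewrite (cut_joins _ j2c) (cut_joins _ jj).
  have [->|ekb] := eqVneq e kb.
    have := jC kb _ _ kbcc jkb; rewrite (mvF Zb) //.
    rewrite (mv0 V) 1?[Z == V]eq_sym // mv_eq => jj.
    by rewrite (cut_joins _ j2kb) (cut_joins _ jj).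
  have [->|e3] := eqVneq e z3.
    have := jC z3 _ _ _ j3; rewrite mvZ (mvF F3) // eq_sym => /(_ cz3) jj.
    by rewrite (cut_joins _ j23) (cut_joins _ jj).
  have [->|e4] := eqVneq e z4.
    have := jC z4 _ _ _ j4; rewrite mvZ (mvF F4) // eq_sym => /(_ cz4) jj.
    by rewrite (cut_joins _ j24) (cut_joins _ jj).
  have [->|e5] := eqVneq e z5.
    have := jC z5 _ _ _ j5; rewrite mvZ (mvF F5) // eq_sym => /(_ cz5) jj.
    by rewrite (cut_joins _ j25) (cut_joins _ jj).
  have eM : e \notin mods by rewrite !inE negb_or ecc ekb.
  have eC : e \notin cv by rewrite !inE !negb_or e3 e4 e5.
  have [nA nB] := off_region (del := del) (mods := mods) G RW HL3 eS eM eC.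
  move: nA nB; rewrite !inE !negb_or => /and3P[m1 m2 m3] /and3P[m4 m5 m6].
  rewrite /cut /a2 /b2 (negbTE eC) /A3 /B3 /= /A1 /B1 /= /a1 /b1 (negbTE ecc) (negbTE ekb) (negbTE e3) (negbTE e4) (negbTE e5).
  by rewrite !mvF // eq_sym.
pose k A := (F3 \in A) + (F4 \in A) + (F5 \in A).
have notA A t : A \subset W :\: R -> t \in R -> (t \in A) = false.
  by move=> AW tR; apply/negP => /(subsetP AW); rewrite inE tR.
have dgE A : A \subset W :\: R -> dgr A =
    dg a2 b2 (SR :\: [set e in del]) A + k A + 2 * ((V0 \in A) && (Zb \in A)).
  move=> AW; have uA := notA A u AW uR; have VA := notA A V AW VR; have ZA := notA A Z AW ZR.
  have dA : (d \in A) = false.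
    by apply/negP => /(subsetP AW); rewrite inE (negbTE (dW H)) andbF.
  have agc e : e \in SR -> e \notin del ++ mods -> cut a2 b2 A e = cut a b A e.
    by move=> eS n; have [E1 E2] := agr2 e n; rewrite /cut E1 E2.
  have := @dg_mod _ _ a b a2 b2 SR del mods A uniqL subL3 agc; rewrite /= !big_cons !big_nil.
  rewrite (cut_joins _ j2c) (cut_joins _ j2kb) !(cut_joins _ jh) !(cut_joins _ ja) !(cut_joins _ jbZ).
  rewrite !(cut_joins _ jc) !(cut_joins _ jkc) !(cut_joins _ jka) !(cut_joins _ jkb).
  rewrite !(cut_joins _ j3) !(cut_joins _ j4) !(cut_joins _ j5) uA VA ZA dA /k /=.
  by case: (V0 \in A); case: (Zb \in A) => /=; slia.
set SR' := SR :\: [set e in del] in dgE Pl5.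
have mrR : 1 + (V0 \notin W) <= \sum_(e in SR) (cut a b W e && cut a b R e).
  have us : uniq [:: h; ka] by rewrite /= inE (neq (i := 0) (j := 4) isT isT isT).
  have sub : {subset [:: h; ka] <= SR} by move=> i; rewrite !inE => /orP[]/eqP ->.
  apply: leq_trans (sum_ge_seq (fun e => cut a b W e && cut a b R e) us sub).
  have dR : d \in R = false by apply/negP => /(subsetP RW); rewrite (negbTE (dW H)).
  have V0R : V0 \in R = false by apply/negbTE; apply: inR; rewrite eq_sym.
  rewrite !big_cons big_nil !(cut_joins _ jh) !(cut_joins _ jka) uW VW (negbTE (dW H)) uR VR dR V0R /=.
  by case: (V0 \in W).
have Dle : dg a2 b2 SR' (W :\: R) <= D.
  have := dg_root a b SR RW; rewrite (dgE _ (subxx _)) /k F3R F4R F5R ZbR V0E andbT.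
  have := dg_R; rewrite -/R; move: mrR; set mm := \sum_(e in SR) _.
  by case: (V0 \in W) => /=; slia.
have sW A : A \subset W :\: R -> A \subset W /\ A != W.
  move=> AW; split; first by apply: subset_trans AW (subsetDl _ _).
  by apply/eqP => E0; have := notA A u AW uR; rewrite E0 uW.
(* The count of [lifted_big], now with both [V] and [Z] added to [A]: their pair has at most seven
   boundary edges, and [k A + 2] edges run from it into [A]. *)
have big8 A : A \subset W :\: R -> V0 \in A -> Zb \in A -> 4 + 2 * k A <= dgr A /\ 7 <= dgr A.
  move=> AW V0A ZbA; have [t1 t2] := sW A AW.
  have uA := notA A u AW uR; have VA := notA A V AW VR; have ZA := notA A Z AW ZR.
  split; last by apply: (dg_u Zb5 t1 t2 ZbA V0A); rewrite eq_sym.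
  have dis : [disjoint A & [set V; Z]].
    rewrite disjoint_sym disjoints_subset; apply/subsetP => t; rewrite !inE => /orP[]/eqP ->; by rewrite ?VA ?ZA.
  have := dgU a b SR dis.
  have us : uniq [:: z3; z4; z5; ka; kb].
    have [az3 az4 az5] := notz _ kaL.
    rewrite /= !inE !negb_or n34 n35 n45 ![_ == ka]eq_sym az3 az4 az5 ![_ == kb]eq_sym kz3 kz4 kz5.
    by rewrite kbka.
  have sub : {subset [:: z3; z4; z5; ka; kb] <= SR}.
    by move=> i; rewrite !inE => /or4P[/eqP->|/eqP->|/eqP->|/orP[]/eqP->].
  have := sum_ge_seq (fun e => cut a b A e && cut a b [set V; Z] e) us sub.
  rewrite !big_cons big_nil !(cut_joins _ j3) !(cut_joins _ j4) !(cut_joins _ j5) !(cut_joins _ jka) !(cut_joins _ jkb).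
  rewrite VA ZA V0A ZbA !inE !eqxx orbT ![_ == V]eq_sym ![_ == Z]eq_sym.
  rewrite (negbTE F3V) (negbTE F4V) (negbTE F5V) (negbTE ZF3) (negbTE ZF4) (negbTE ZF5).
  rewrite (negbTE VV0) (negbTE VZb) (negbTE ZV0) (negbTE ZZb) /= !andbT.
  have : 7 <= dgr (A :|: [set V; Z]).
    apply: (re_7c H).
    - by rewrite !subUset t1 !sub1set VW ZW.
    - apply/eqP => E0; have := uW; rewrite -E0 !inE uA (negbTE uV) (negbTE uZ) //.
    have u3 : uniq [:: V; V0; Zb] by rewrite /= !inE !negb_or VV0 VZb eq_sym ZbV0.
    by apply: (card_ge_seq u3) => t; rewrite !inE => /or3P[]/eqP ->; rewrite ?eqxx ?V0A ?ZbA ?orbT.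
  by have := dg_VZ; rewrite /k; slia.
have twoF A : A \subset W :\: R -> 2 <= k A -> 7 <= dgr A.
  move=> AW; have [t1 t2] := sW A AW; rewrite /k.
  case f3: (F3 \in A); case f4: (F4 \in A); case f5: (F5 \in A) => //= _;
  try (by apply: (dg_u F35 t1 t2 f3 f4); rewrite eq_sym);
  try (by apply: (dg_u F35 t1 t2 f3 f5); rewrite eq_sym);
  by apply: (dg_u F45 t1 t2 f4 f5); rewrite eq_sym.
have oneF A : A \subset W :\: R -> 1 <= k A -> 5 <= dgr A.
  move=> AW; have [t1 t2] := sW A AW; rewrite /k.
  case f3: (F3 \in A); first by move=> _; apply: dg_contains F35.
  case f4: (F4 \in A); first by move=> _; apply: dg_contains F45.
  by case f5: (F5 \in A) => //= _; apply: dg_contains F55.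
have G2 : good a2 b2 l2 r2 SR' ([set e in SV | ~~ cut a b R e] :|: [set e in cv]) (W :\: R) d w.
  apply: (good_mod2 (mods := mods) G) => //.
  - by move=> e; rewrite !inE => /or3P[]/eqP ->; rewrite eqxx ?orbT.
  - move=> e; rewrite in_cons mem_seq1 => /orP[]/eqP ->.
      rewrite /a2 /b2 !eqxx eq_sym (proj1 (W_neq H wcW)) setU11.
      by split=> //; rewrite in_setU1 wcR orbT.
    rewrite a2kb b2kb eq_sym ZbV0; split=> //; rewrite in_setU1 ?ZbR ?orbT // V0E.
    by move: V0dW; rewrite in_setU1.
  - move=> e; rewrite !inE => /or3P[]/eqP ->; [exists F3 => // | exists F4 => // | exists F5 => //];
      by rewrite joinsC.
  - exact: leq_trans Dle D6.
  - move=> A AW A0 AnW; rewrite -/SR'; have [t1 t2] := sW A AW; have := dgE A AW.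
    have k3 : k A <= 3 by rewrite /k; case: (F3 \in A); case: (F4 \in A); case: (F5 \in A).
    case both: ((V0 \in A) && (Zb \in A)) => /=.
      by case/andP: both => V0A ZbA; have [] := big8 A AW V0A ZbA; slia.
    have [k2|k2] := leqP 2 (k A); first by have := twoF A AW k2; slia.
    have [k1|k1] := leqP 1 (k A); first by have := oneF A AW k1; slia.
    by have := go_1 G t1 A0 t2; slia.
  move=> A AW A0 AnW nC; rewrite -/SR'.
  have [t1 t2] := sW A AW; have := dgE A AW.
  have wA : w \notin A by apply: contra (wW H); apply: (subsetP t1).
  have := nC z3; rewrite !inE eqxx => /(_ isT); rewrite (cut_joins _ j23) (negbTE wA) => /negbTE /= f3.
  have := nC z4; rewrite !inE eqxx orbT => /(_ isT); rewrite (cut_joins _ j24) (negbTE wA) => /negbTE /= f4.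
  have := nC z5; rewrite !inE eqxx !orbT => /(_ isT); rewrite (cut_joins _ j25) (negbTE wA) => /negbTE /= f5.
  rewrite {1}/k f3 f4 f5 /=; case both: ((V0 \in A) && (Zb \in A)) => /= E0; [right | left; slia].
  by case/andP: both => V0A ZbA; have [] := big8 A AW V0A ZbA; slia.
have part X Y t : Y = W :\: R :\: X -> X \subset W :\: R -> t \in W :\: R -> (t \in Y) = (t \notin X).
  by move=> -> XW tW; rewrite inE tW andbT.
have nontriv X : X \subset W :\: R -> dg a2 b2 SR' X = 4 -> 1 < #|X| ->
    if (V0 \in X) && (Zb \in X) then (1 <= k X <= 2) && (dgr X == 6 + k X) else (k X == 3) && (dgr X == 7).
  move=> XW X4 X1; have [t1 t2] := sW X XW; have := dgE X XW; rewrite X4.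
  have h6 := re_6 H t1 t2 X1.
  have k3 : k X <= 3 by rewrite /k; case: (F3 \in X); case: (F4 \in X); case: (F5 \in X).
  case both: ((V0 \in X) && (Zb \in X)) => /= E0.
    case/andP: both => V0X ZbX; have [h1 h2] := big8 X XW V0X ZbX.
    by apply/andP; split; [apply/andP; split; slia | apply/eqP; slia].
  have [k2|k2] := leqP 2 (k X); last by exfalso; slia.
  have h7 := twoF X XW k2.
  by apply/andP; split; apply/eqP; slia.
(* A tight split with a one-vertex part is not excluded, but it forces that vertex to be [wc],
   reached from [Z] by [z3], with [V0] in [W]. The sign of [z3] will take care of it. *)
have fin X Y : X \subset W :\: R -> Y = W :\: R :\: X -> Y != set0 -> dg a2 b2 SR' X = 4 ->
    dg a2 b2 SR' Y = 4 -> 1 < #|X| -> #|Y| <= 1 -> [/\ Y = [set wc], F3 = wc & V0 \in W].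
  move=> XW EY Y0 X4 Y4 X1 Y1; have [t1 t2] := sW X XW.
  have YW : Y \subset W :\: R by rewrite EY subsetDl.
  have uX := notA X u XW uR; have VX := notA X V XW VR; have ZX := notA X Z XW ZR.
  have [y yY] := set0Pn _ Y0.
  have EYy : Y = [set y] by apply/esym/eqP; rewrite eqEcard sub1set yY cards1.
  have inX t : t \in W :\: R -> t != y -> t \in X.
    move=> tW ty; apply: contraT => tX; case/negP: ty.
    by have : t \in Y; [rewrite EY inE tX tW | rewrite EYy inE].
  have dy := dgE Y YW; rewrite Y4 in dy.
  have noboth : (V0 \in Y) && (Zb \in Y) = false.
    rewrite EYy !inE; apply/negP => /andP[/eqP E1 /eqP E2].
    by move: ZbV0; rewrite E1 E2 eqxx.
  have kXY : k X + k Y = 3.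
    rewrite /k (part X Y F3 EY XW F3R) (part X Y F4 EY XW F4R) (part X Y F5 EY XW F5R).
    by case: (F3 \in X); case: (F4 \in X); case: (F5 \in X).
  have kY1 : k Y <= 1.
    rewrite /k EYy !inE; case: (F3 =P y) => [<-|_].
      by rewrite ![_ == F3]eq_sym (negbTE F34) (negbTE F35').
    by case: (F4 =P y) => [<-|_]; rewrite ?[F5 == F4]eq_sym ?(negbTE F45') //; case: (F5 == y).
  have dis : [disjoint X & R].
    rewrite disjoints_subset; apply/subsetP => t /(subsetP XW).
    by rewrite in_setC in_setD => /andP[].
  have dU := dgU a b SR dis.
  have hU : 6 <= dgr (X :|: R).
    apply: (re_6 H).
    - by rewrite subUset t1.
    - apply/eqP => E0; have yW : y \in W by move: (subsetP YW _ yY); rewrite inE => /andP[].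
      move: yW; rewrite -E0 in_setU => /orP[yX|yR].
        by move: yY; rewrite EY inE yX.
      by move: (subsetP YW _ yY); rewrite inE yR.
    by apply: leq_trans X1 _; apply: subset_leq_card; apply: subsetUl.
  have us : uniq [:: z3; z4; z5; cc; kb; ka].
    have [az3 az4 az5] := notz _ kaL.
    rewrite /= !inE !negb_or n34 n35 n45 ![_ == cc]eq_sym cz3 cz4 cz5 ![_ == ka]eq_sym az3 az4 az5.
    by rewrite ![_ == kb]eq_sym kz3 kz4 kz5 kbcc kacc kbka.
  have sub : {subset [:: z3; z4; z5; cc; kb; ka] <= SR}.
    by move=> i; rewrite !inE => /or4P[/eqP->|/eqP->|/eqP->|/or3P[]/eqP->].
  have := sum_ge_seq (fun e => cut a b X e && cut a b R e) us sub.
  have nR t : t \in W :\: R -> t \in R = false by rewrite inE => /andP[/negbTE].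
  have V0R : V0 \in R = false by apply/negbTE; apply: inR; rewrite eq_sym.
  rewrite !big_cons big_nil !(cut_joins _ j3) !(cut_joins _ j4) !(cut_joins _ j5) !(cut_joins _ jka) !(cut_joins _ jkb).
  rewrite !(cut_joins _ jc) uX VX ZX uR VR ZR V0R !nR //= !andbT => hS.
  have hR := dg_R; rewrite -/R in hR.
  have := nontriv X XW X4 X1; case both: ((V0 \in X) && (Zb \in X)).
    case/andP: both => V0X ZbX /andP[/andP[k1 k2] /eqP dX].
    have V0W : V0 \in W by apply: (subsetP t1).
    rewrite V0X ZbX in hS.
    have kX2 : k X = 2 by slia.
    have kYE : k Y = 1 by slia.
    case wcX: (wc \in X) in hS.
      by exfalso; have := kX2; rewrite {1}/k => kX3; slia.
    have wcY : wc \in Y by rewrite (part X Y wc EY XW wcR) wcX.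
    have Ey : y = wc by move: wcY; rewrite EYy inE => /eqP.
    split=> //; first by rewrite EYy Ey.
    move: kYE; rewrite /k EYy Ey !inE (negbTE F4wc) (negbTE F5wc) !addn0.
    by case: (F3 =P wc).
  move=> /andP[/eqP k3 /eqP dX]; exfalso.
  have kY0 : k Y = 0 by slia.
  have dy4 : deg y = 4 by move: dy; rewrite noboth kY0 EYy; slia.
  have wcX : wc \in X by apply: inX => //; apply/eqP => E0; have := c1_wc5 cf; rewrite E0 dy4.
  have ZbX : Zb \in X by apply: inX => //; apply/eqP => E0; have := Zb5; rewrite E0 dy4.
  by have := k3; rewrite {1}/k => k3'; move: hS; rewrite wcX ZbX; case: (V0 \in X) => /=; slia.
have W3 : 3 <= #|W :\: R|.
  have u3 : uniq [:: F3; F4; F5] by rewrite /= !inE !negb_or F34 F35' F45'.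
  by apply: (card_ge_seq u3) => t; rewrite !inE => /or3P[]/eqP ->; [move: F3R|move: F4R|move: F5R]; rewrite !inE.
(* The demands of the two parts are opposite, so it suffices that the demand left at [wc] is not
   zero, whichever of the parts [wc] forms. *)
have cons8 c' : (\sum_(v in W :\: R) c' v = 0)%R -> (F3 = wc -> V0 \in W -> c' wc != 0)%R ->
    consistent a2 b2 SR' (W :\: R) c'.
  move=> Ec' cw; apply: (consistent_cut G2) => A AW A0 AnW D66 A4 B4.
  have BW : W :\: R :\: A \subset W :\: R := subsetDl _ _.
  have EB : A = W :\: R :\: (W :\: R :\: A) by rewrite setDDr setDv set0U (setIidPr AW).
  have B0 : W :\: R :\: A != set0.
    by rewrite setD_eq0; apply: contra AnW => WA; rewrite eqEsubset AW.
  have cAB := cardsID A (W :\: R); rewrite (setIidPr AW) in cAB.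
  have [A1'|A1'] := leqP 2 #|A|; have [B1'|B1'] := leqP 2 #|W :\: R :\: A|.
  - exfalso; have := nontriv A AW A4 A1'; have := nontriv _ BW B4 B1'.
    have kAB : k A + k (W :\: R :\: A) = 3.
      rewrite /k (part A _ F3 erefl AW F3R) (part A _ F4 erefl AW F4R) (part A _ F5 erefl AW F5R).
      by case: (F3 \in A); case: (F4 \in A); case: (F5 \in A).
    rewrite (part A _ Zb erefl AW ZbR); case ZbA: (Zb \in A); rewrite ?andbF ?andbT /=.
      case: (V0 \in A) => /andP[/eqP m1 _]; first by move=> /andP[/andP[m2 m3] _]; slia.
      by move=> /andP[/eqP m2 _]; slia.
    case: (_ \in _) => [/andP[/andP[m1 m2] _]|/andP[/eqP m1 _]] /andP[/eqP m3 _]; slia.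
  - have [EBw E3 V0W] := fin A _ AW erefl B0 A4 B4 A1' B1'.
    have := Ec'; rewrite (big_setID A) /= (setIidPr AW) EBw big_set1 => E0.
    apply/eqP => E1; move: E0; rewrite E1 add0r => E2.
    by move: (cw E3 V0W); rewrite E2 eqxx.
  - have [EBw E3 V0W] := fin _ A BW EB A0 B4 A4 B1' A1'.
    by rewrite EBw big_set1; apply: cw.
  by exfalso; slia.
have small_size : #|W :\: R| + #|SR'| < #|W| + #|SR|.
  have : #|W :\: R| < #|W|.
    apply: proper_card; rewrite properE subsetDl /=; apply/negP => /subsetP /(_ u uW).
    by rewrite inE uR.
  have : #|SR'| <= #|SR| by apply: subset_leq_card; apply: subsetDl.
  by slia.
have innM := inner_mod W (del := del) (mods := mods) uniqL subL3 HL3 agr2; rewrite -/R -/SR' in innM.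
have agrI e : e \in inner a b (W :\: R) SR -> a2 e = a e /\ b2 e = b e.
  by move=> eI; apply: agr2; apply: (inner_off HL3 eI).
have ccI : (a2 cc \in W :\: R) = false by rewrite /a2 eqxx inE (negbTE (dW H)) andbF.
have modsE : [set e in mods | (a2 e \in W :\: R) && (b2 e \in W :\: R)] =
    if V0 \in W then [set kb] else set0.
  apply/setP => e; rewrite in_set in_cons mem_seq1; have [->|ecc] := eqVneq e cc.
    by rewrite ccI; case: (V0 \in W); rewrite ?in_set1 ?in_set0 // eq_sym (negbTE kbcc).
  have [->|ekb] := eqVneq e kb; last by case: (V0 \in W); rewrite ?in_set1 ?in_set0 // (negbTE ekb).
  by rewrite a2kb b2kb V0E ZbR; case: (V0 \in W); rewrite ?in_set1 ?in_set0 ?eqxx.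
pose own e := if (e == kc) || (e == kb) then V else if e \in cv then Z else u.
have kcL : kc \in L by rewrite !inE eqxx !orbT.
have a0L : a0 \in L by rewrite !inE eqxx !orbT.
have b0L : b0 \in L by rewrite !inE eqxx !orbT.
have Lcv e : e \in L -> e \notin cv.
  by move=> /notz[m1 m2 m3]; rewrite !inE !negb_or m1 m2 m3.
have own_u e : e \in L -> e != kc -> e != kb -> own e = u.
  by move=> eL; rewrite /own (negbTE (Lcv e eL)) => /negbTE -> /negbTE ->.
have own_kc : own kc = V by rewrite /own eqxx.
have own_kb : own kb = V by rewrite /own eqxx orbT.
have [kcz3 kcz4 kcz5] := notz _ kcL.
have own3 : own z3 = Z by rewrite /own ![z3 == _]eq_sym (negbTE kcz3) (negbTE kz3) !inE eqxx.
have own4 : own z4 = Z.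
  by rewrite /own [z4 == kc]eq_sym [z4 == kb]eq_sym (negbTE kcz4) (negbTE kz4) !inE eqxx orbT.
have own5 : own z5 = Z.
  by rewrite /own [z5 == kc]eq_sym [z5 == kb]eq_sym (negbTE kcz5) (negbTE kz5) !inE eqxx !orbT.
have cckc : cc != kc by rewrite eq_sym.
have cckb : cc != kb by rewrite eq_sym.
have a0kb' : a0 != kb := neq (i := 1) (j := 6) isT isT isT.
have b0kb : b0 != kb := neq (i := 2) (j := 6) isT isT isT.
have kakb : ka != kb by rewrite eq_sym.
have filterL : [seq e <- del ++ mods | (a e \in W) && (b e \in W)] =
    [:: z3; z4; z5; a0; b0; kc] ++ (if V0 \in W then [:: ka] else [::]) ++ [:: cc; kb].
  rewrite /= (joins_both _ jh) (joins_both _ ja) (joins_both _ jbZ) (joins_both _ jkc).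
  rewrite (joins_both _ j3) (joins_both _ j4) (joins_both _ j5) F3W F4W F5W.
  rewrite (joins_both _ jka) (joins_both _ jc) (joins_both _ jkb) uW VW ZW wcW ZbW (negbTE (dW H)) /=.
  by case: (V0 \in W).
have uniqQ (s : seq E) : uniq s -> {subset s <= L} -> uniq ([:: z3; z4; z5] ++ s).
  move=> us sL; rewrite cat_uniq us andbT /= !inE !negb_or n34 n35 n45 /=.
  by apply/hasPn => e /sL /Lcv.
apply: nosol; case V0W: (V0 \in W).
  have sQ : {subset [:: cc; b0; a0; kc] <= L}.
    by move=> e; rewrite !inE => /or4P[]/eqP ->; rewrite eqxx ?orbT.
  have uQ : uniq [:: z3; z4; z5; cc; b0; a0; kc].
    by apply: (uniqQ [:: cc; b0; a0; kc]) => //; rewrite /= !inE !negb_or cb0 ca0 cckc ba0 b0kc a0kc.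
  have [sa na] := sg_avoid (c V); have [sk Ek] := sg_ex na.
  have [sc [sb Es]] := sg2_ex (c u - sg sa)%R.
  (* [z3] is oriented so that a non-zero demand remains at [wc] in case it leads there; [z4] and
     [z5] then complete the demand of [Z]. *)
  have [t3 n3] := sg_avoid (c wc + sg sc)%R.
  have [t4 [t5 E45]] := sg2_ex (c Z + sg sb + sg sk - sg t3)%R.
  have [sig [E3 E4 E5 E1 E2 Ea Ekc]] := @exists_map E bool true [:: z3; z4; z5; cc; b0; a0; kc]
    [:: t3; t4; t5; sc; sb; sa; sk] uQ erefl.
  pose x0 e := if a e == own e then sig e else ~~ sig e.
  pose Q := [set e in [:: z3; z4; z5; cc; b0; a0; kc]].
  have netQ v : net a b Q x0 v = (((Z == v)%:R - (F3 == v)%:R) * sg t3 +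
     (((Z == v)%:R - (F4 == v)%:R) * sg t4 + (((Z == v)%:R - (F5 == v)%:R) * sg t5 +
     (((u == v)%:R - (wc == v)%:R) * sg sc + (((u == v)%:R - (Z == v)%:R) * sg sb +
     (((u == v)%:R - (V == v)%:R) * sg sa + ((V == v)%:R - (Z == v)%:R) * sg sk))))))%R.
    rewrite net_seq // !big_cons big_nil addr0 /x0 own_kc own3 own4 own5 !own_u // E3 E4 E5 E1 E2 Ea Ekc.
    by rewrite (contrib _ _ ZF3 j3) (contrib _ _ ZF4 j4) (contrib _ _ ZF5 j5) (contrib _ _ uwc jc)
      (contrib _ _ uZ jbZ) (contrib _ _ uV ja) (contrib _ _ VZ jkc).
  have HR v : v \in R -> net a b Q x0 v = c v.
    rewrite in_setU1 in_set2 netQ => /or3P[]/eqP ->.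
    - rewrite eqxx ![_ == Z]eq_sym (negbTE ZF3) (negbTE ZF4) (negbTE ZF5) ![Z == _]eq_sym.
      rewrite (negbTE uZ) (negbTE wcZ) (negbTE VZ) !Z3F !Z3T !subr0 !sub0r !mul0r !mul1r !mulN1r !add0r.
      by rewrite [(sg t4 + _)%R]addrA E45 -opprD [(c Z + _ + _)%R]addrAC -!addrA [(sg sb + sg sk)%R]addrC -opprD; ring.
    - rewrite eqxx ![_ == u]eq_sym (negbTE uZ) (negbTE F3u) (negbTE F4u) (negbTE F5u) (negbTE uwc) (negbTE uV).
      by rewrite !Z3F !Z3T !subr0 !mul0r !mul1r !add0r addr0 addrA Es subrK.
    rewrite eqxx ![Z == V]eq_sym (negbTE VZ) ![_ == V]eq_sym ![V == u]eq_sym (negbTE uV) (negbTE F3V) (negbTE F4V) (negbTE F5V).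
    rewrite [V == wc]eq_sym (negbTE wcV).
    by rewrite !Z3F !Z3T !subr0 !mul0r !add0r mul1r Ek mulN1r addrC addrK.
  have V0WR : V0 \in W :\: R by rewrite V0E.
  have kaI : ka \notin inner a b (W :\: R) SR by rewrite (inner_joins _ Ska jka) inE VR.
  have kbI : kb \notin inner a b (W :\: R) SR by rewrite (inner_joins _ Skb jkb) inE VR.
  have kakc : ka != kc by rewrite eq_sym.
  have kaQ : ka \notin Q.
    have [m1 m2 m3] := notz _ kaL.
    by rewrite in_set !in_cons in_nil !negb_or m1 m2 m3 kacc kab0 kakc eq_sym a0ka.
  have kbQ : kb \notin Q.
    rewrite in_set !in_cons in_nil !negb_or kz3 kz4 kz5 kbcc eq_sym b0kb /=.
    by rewrite eq_sym a0kb' eq_sym kckb.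
  have V0Zb : V0 != Zb by rewrite eq_sym.
  have QI : Q \subset inner a b W SR.
    rewrite (rest_union W subL3 HL3) filterL V0W; apply: subset_trans (subsetUl _ _); apply/subsetP => e.
    rewrite !in_set !in_cons !in_nil.
    case: (e == z3); case: (e == z4); case: (e == z5); case: (e == a0); case: (e == b0); by case: (e == kc); case: (e == cc); rewrite ?orbT.
  apply: (solve_lift (a' := a2) (b' := b2) (SR' := SR') (x0 := x0)
    VR V0WR ZbR V0Zb kakb jka jkb a2kb b2kb kaQ kbQ kaI kbI _ _ HR RW).
  - rewrite (rest_union W subL3 HL3) filterL V0W; apply/setP => e.
    rewrite in_setU in_set !in_setU1 in_setU [e \in Q]in_set !in_cons !in_nil; move: (e \in inner _ _ _ _) => eI.
    by case: (e == z3); case: (e == z4); case: (e == z5); case: (e == a0); case: (e == b0);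
      case: (e == kc); case: (e == ka); case: (e == cc); case: (e == kb).
  - rewrite disjoint_sym disjoints_subset; apply/subsetP => e /(inner_off HL3); rewrite in_setC.
    apply: contra; rewrite in_set EL !in_cons !in_nil.
    by case: (e == z3); case: (e == z4); case: (e == z5); case: (e == a0); case: (e == b0);
      case: (e == kc); case: (e == cc); rewrite ?orbT.
  - by rewrite innM modsE V0W.
  - exact: agrI.
  have Ec' := sum_rest (SR := SR) RW QI Ec HR.
  apply: (IH G2) => //; apply: cons8 => // E3w _.
  rewrite netQ E3w eqxx ![_ == wc]eq_sym ![wc == _]eq_sym.
  rewrite [Z == wc]eq_sym (negbTE wcZ) (negbTE F4wc) (negbTE F5wc) (negbTE uwc) [V == wc]eq_sym (negbTE wcV).
  rewrite !Z3F !Z3T !subr0 !sub0r !mul0r !mulN1r !add0r !addr0 -opprD opprK.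
  by move: n3; rewrite -addrA [(sg sc + _)%R]addrC.
have sQ : {subset [:: cc; b0; a0; kc; kb] <= L}.
  by move=> e; rewrite !inE => /or4P[/eqP->|/eqP->|/eqP->|/orP[]/eqP->]; rewrite eqxx ?orbT.
have uQ : uniq [:: z3; z4; z5; cc; b0; a0; kc; kb].
  apply: (uniqQ [:: cc; b0; a0; kc; kb]) => //.
  by rewrite /= !inE !negb_or cb0 ca0 cckc cckb ba0 b0kc b0kb a0kc a0kb' kckb.
have [sk [sl Ek]] := sg2_ex (c V + sg true)%R.
have [sc [sb Es]] := sg2_ex (c u - sg true)%R.
have [t4 [t5 E45]] := sg2_ex (c Z + sg sb + sg sk - sg true)%R.
have [sig [E3 E4 E5 E1 E2 Ea Ekc Ekb]] := @exists_map E bool true [:: z3; z4; z5; cc; b0; a0; kc; kb]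
  [:: true; t4; t5; sc; sb; true; sk; sl] uQ erefl.
pose x0 e := if a e == own e then sig e else ~~ sig e.
pose Q := [set e in [:: z3; z4; z5; cc; b0; a0; kc; kb]].
have netQ v : net a b Q x0 v = (((Z == v)%:R - (F3 == v)%:R) * sg true +
   (((Z == v)%:R - (F4 == v)%:R) * sg t4 + (((Z == v)%:R - (F5 == v)%:R) * sg t5 +
   (((u == v)%:R - (wc == v)%:R) * sg sc + (((u == v)%:R - (Z == v)%:R) * sg sb +
   (((u == v)%:R - (V == v)%:R) * sg true + (((V == v)%:R - (Z == v)%:R) * sg sk +
    ((V == v)%:R - (Zb == v)%:R) * sg sl)))))))%R.
  rewrite net_seq // !big_cons big_nil addr0 /x0 own_kc own_kb own3 own4 own5 !own_u // E3 E4 E5 E1 E2 Ea Ekc Ekb.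
  by rewrite (contrib _ _ ZF3 j3) (contrib _ _ ZF4 j4) (contrib _ _ ZF5 j5) (contrib _ _ uwc jc)
    (contrib _ _ uZ jbZ) (contrib _ _ uV ja) (contrib _ _ VZ jkc) (contrib _ _ VZb jkb).
have HR v : v \in R -> net a b Q x0 v = c v.
  rewrite in_setU1 in_set2 netQ => /or3P[]/eqP ->.
  - rewrite eqxx ![_ == Z]eq_sym (negbTE ZF3) (negbTE ZF4) (negbTE ZF5) (negbTE ZZb) ![Z == _]eq_sym.
    rewrite (negbTE uZ) (negbTE wcZ) (negbTE VZ) !Z3F !Z3T !subr0 !sub0r !mul0r !mul1r !mulN1r !add0r !addr0.
    by rewrite [(sg t4 + _)%R]addrA E45; ring.
  - rewrite eqxx ![_ == u]eq_sym (negbTE uZ) (negbTE F3u) (negbTE F4u) (negbTE F5u) (negbTE uwc) (negbTE uV) (negbTE uZb).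
    by rewrite !Z3F !Z3T !subr0 !mul0r !mul1r !add0r !addr0 addrA Es subrK.
  rewrite eqxx ![Z == V]eq_sym (negbTE VZ) ![_ == V]eq_sym ![V == u]eq_sym (negbTE uV) (negbTE F3V) (negbTE F4V) (negbTE F5V).
  rewrite [V == wc]eq_sym (negbTE wcV) (negbTE VZb).
  by rewrite !Z3F !Z3T !subr0 !mul0r !add0r !mul1r Ek mulN1r addrC addrK.
have EQ : Q = inner a b W SR :\: inner a b (W :\: R) SR.
  rewrite (rest_list W subL3 HL3) filterL V0W; apply/setP => e; rewrite !in_set !in_cons !in_nil.
  by case: (e == z3); case: (e == z4); case: (e == z5); case: (e == a0); case: (e == b0);
      case: (e == kc); case: (e == cc); case: (e == kb).
apply: (solve_rest (a' := a2) (b' := b2) (SR' := SR') EQ HR RW).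
- by rewrite innM modsE V0W set0U.
- exact: agrI.
have Ec' : (\sum_(v in W :\: R) (c v - net a b Q x0 v) = 0)%R.
  by apply: (sum_rest (SR := SR) RW _ Ec HR); rewrite EQ subsetDl.
by apply: (IH G2) => //; apply: cons8 => //; rewrite V0W.
Qed.

End Third.

End Second.

End Steps.

(** * The extension theorem *)

Section Core.

Variables (U E F : finType).
Implicit Types (a b : E -> U) (l r : E -> F) (SR SV : {set E}) (A W : {set U}).

(** The conditions ask whether a cut has a virtual edge, not how many, so one representative per
    vertex is enough. *)
Lemma good_clean a b l r SR SV W d w : good a b l r SR SV W d w ->
  exists l' r' SV', good a b l' r' SR SV' W d w /\
    forall v e f, v != w -> e \in SV' -> f \in SV' ->
      cut a b [set v] e -> cut a b [set v] f -> e = f.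
Proof.
move=> G; have P := go_p G.
pose o e := if a e == w then b e else a e.
pose pk v := [pick f in SV | o f == v]; pose rep e := odflt e (pk (o e)).
pose SV' := [set e in SV | rep e == e].
have dwn x : x \in d |: W -> x != w.
  by rewrite !inE => /orP[/eqP ->|xW]; [exact: pi_dw P | apply: contraTneq xW => ->; exact: pi_wW P].
have jo e : e \in SV -> joins a b e (o e) w /\ o e \in d |: W.
  move=> eV; rewrite /joins /o; have := pi_v P eV => /orP[]/andP[/eqP E1 E2].
    by rewrite E1 !eqxx orbT.
  by rewrite (negbTE (dwn _ E2)) E1 !eqxx.
have cutv e v : e \in SV -> v != w -> cut a b [set v] e = (o e == v).
  move=> eV vw; have [je _] := jo e eV; rewrite (cut_joins _ je) !inE.
  by rewrite [w == v]eq_sym (negbTE vw) addbF.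
have cutA e A : e \in SV -> A \subset W -> cut a b A e = (o e \in A).
  move=> eV AW; have [je _] := jo e eV; rewrite (cut_joins _ je).
  case wA: (w \in A); last by rewrite addbF.
  by have := pi_wW P; rewrite (subsetP AW _ wA).
have repP e : e \in SV -> rep e \in SV' /\ o (rep e) = o e.
  move=> eV; have [f Ef /andP[fV /eqP of_]] : exists2 f, pk (o e) = Some f & (f \in SV) && (o f == o e).
    by rewrite /pk; case: pickP => [f Hf|/(_ e)]; [exists f | rewrite eV eqxx].
  by rewrite /SV' inE /rep Ef /= of_ Ef fV eqxx.
have sub : SV' \subset SV by apply/subsetP => e; rewrite inE => /andP[].
have [|l' [r' Pl]] := planar_del (S' := SR :|: SV') _ (pi_pl P); first exact: setUS.
exists l', r', SV'; split.
  split; [split=> //| exact: go_D G | exact: go_1 G |].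
  - exact: disjointWr sub (pi_dis P).
  - exact: pi_dW P.
  - exact: pi_wW P.
  - exact: pi_dw P.
  - by move=> e; apply: (pi_loop P).
  - by move=> e; apply: (pi_ra P).
  - by move=> e; apply: (pi_rb P).
  - by move=> e /(subsetP sub); apply: (pi_v P).
  - have [g gV jg] := pi_g P; have [g' og'] := repP g gV.
    exists (rep g) => //; have [j' _] := jo _ (subsetP sub _ g').
    suff <- : o (rep g) = d by [].
    apply/eqP; rewrite og' -cutv //; last exact: pi_dw P.
    by rewrite (joins_cut1 _ jg) //; apply: pi_dw P.
  move=> A AW A0 AnW nv; apply: (go_2 G) => //; apply: contra nv.
  case/existsP => e /andP[eV ce]; have [e' oe'] := repP e eV.
  apply/existsP; exists (rep e); rewrite e' /= cutA ?(subsetP sub _ e') // oe'.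
  by rewrite -cutA.
move=> v e f vw; rewrite !inE => /andP[eV re] /andP[fV rf]; rewrite !cutv // => /eqP oe /eqP of_.
move: re rf => /eqP <- /eqP <-; rewrite /rep oe of_ /pk.
by case: pickP => //= /(_ e); rewrite eV oe eqxx.
Qed.

Lemma no_counterexample a b l r SR SV W d w c : good a b l r SR SV W d w ->
  solvable_below U E F (#|W| + #|SR|) -> (\sum_(v in W) c v = 0)%R ->
  consistent a b SR W c -> solvable a b SR W c.
Proof.
move=> G0 IH Ec Hc; case: (solvableP a b SR W c) => // nosol; exfalso.
have [l' [r' [SV' [G cl]]]] := good_clean G0.
have [h [u [[hS jh uW u4 D5] mr]]] := root_four G IH Ec Hc nosol cl.
have D3 : 3 <= dg a b SR W by slia.
have R : reduced a b l' r' SR SV' W d w.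
  split=> //.
  - exact: (card_W G IH Ec Hc nosol).
  - by move=> A AW AnW A1; apply: (cut6 G IH Ec Hc nosol).
  - by move=> A v AW AnW A1 vA v5; apply: (cut7 G IH Ec Hc nosol D3 AW AnW A1 vA v5).
  - by move=> A AW AnW A2; apply: (cut7_card G IH Ec Hc nosol).
  by move=> e f x y xW yW xy; apply: (no_parallel G IH Ec Hc nosol xW yW xy).
case: mr => [m1|all4]; last exact: (no_K5 R all4 uW hS jh).
have m1' : \sum_(e in SR) (cut a b W e && cut a b [set u] e) <= 1 by rewrite m1.
have [gu [cc [b0 [a0 [p0 [p1 [p2 [p3 [p4 [wc [wb [V cf]]]]]]]]]]]] := conf1_ex R uW u4 m1' hS jh.
have [V5|V4'] := leqP 5 (dg a b SR [set V]); first exact: (step6 R IH Ec nosol cf V5).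
have V4 : dg a b SR [set V] = 4.
  by have := deg_ge4 R (c1_V cf); slia.
have [gV [kc [kb [ka [s0 [s3 [s4 [Z [Zb [V0 cf2]]]]]]]]]] := conf2_ex R cf V4.
case: (wb =P Z) => [EZ|nZ]; last by apply: (step7 R IH Ec nosol cf cf2 V4) => -[].
case: (dg a b SR [set Z] =P 5) => [Z5|nZ5]; last by apply: (step7 R IH Ec nosol cf cf2 V4) => -[].
exact: (step8 R IH Ec nosol cf cf2 V4 EZ Z5).
Qed.

Theorem core a b l r SR SV W d w c : good a b l r SR SV W d w ->
  (\sum_(v in W) c v = 0)%R -> consistent a b SR W c -> solvable a b SR W c.
Proof.
suff below n : solvable_below U E F n by move=> G; apply: below G (ltnSn _).
elim: n => [|n IH]; first by move=> *.
move=> a' b' l' r' SR' SV' W' d' w' c' G; rewrite ltnS leq_eqVlt => /orP[/eqP En|lt].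
  by move=> Ec Hc; apply: (no_counterexample G _ Ec Hc); rewrite En.
exact: IH G lt.
Qed.

End Core.

(** * Regions of a planar graph as rooted instances *)

Section Pendant.

Variables (U E F : finType).

(** The new edge is a bridge: its two sides coincide, so it lies on no face, and the added face
    [None] has an empty boundary. The side of [w] is free to fit any prescribed membership of the
    new edge. *)
Lemma planar_pendant (a b : E -> U) (l r : E -> F) (S : {set E})
    (a' b' : option E -> U) (l' r' : option E -> option F) (d w : U) :
  (forall e, e \in S -> (a e != w) && (b e != w)) -> d != w ->
  (forall e, a' (Some e) = a e /\ b' (Some e) = b e) -> a' None = d -> b' None = w ->
  (forall e, l' (Some e) = Some (l e) /\ r' (Some e) = Some (r e)) -> l' None = r' None ->
  planar_struct a b l r S -> planar_struct a' b' l' r' (None |: Some @: S).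
Proof.
move=> Sw dw agr a0 b0 fac f0 [D1 D2].
have cutS X e : cut a' b' X (Some e) = cut a b X e by have [E1 E2] := agr e; rewrite /cut E1 E2.
have cut0 X : cut a' b' X None = (d \in X) (+) (w \in X) by rewrite /cut a0 b0.
have inc0 f : inc l' r' f None = false by rewrite /inc f0 addbb.
have incS f e : inc l' r' (Some f) (Some e) = inc l r f e.
  by have [E1 E2] := fac e; rewrite /inc E1 E2.
have incN e : inc l' r' None (Some e) = false by have [E1 E2] := fac e; rewrite /inc E1 E2.
have nS : None \notin Some @: S by apply/imsetP => -[].
have Sinj (T : {set E}) : {in T &, injective (@Some E)} by move=> ? ? _ _ [].
split=> [X f|C CS HC].
  rewrite big_setU1 //= inc0 andbF addFb big_imset //=.
  case: f => [f|]; last by rewrite big1 // => e _; rewrite incN andbF.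
  by rewrite -[RHS](D1 X f); apply: eq_bigr => e _; rewrite cutS incS.
pose C0 := [set e | Some e \in C].
have C0S : C0 \subset S.
  apply/subsetP => e; rewrite inE => /(subsetP CS); rewrite !inE /= => /imsetP[e' e'S [->]].
  exact: e'S.
have [f|X HX] := D2 C0 C0S.
  rewrite -[RHS](HC (Some f)) [RHS](bigID (fun e => e == None)) /= [X in _ = X (+) _]big1 ?addFb; last first.
    by move=> e /andP[_ /eqP ->].
  have -> : \big[addb/false]_(i in C | i != None) inc l' r' (Some f) i =
      \big[addb/false]_(i in Some @: C0) inc l' r' (Some f) i.
    apply: eq_bigl => -[e|]; rewrite /= ?andbT ?andbF; last by apply/esym/imsetP => -[].
    by rewrite mem_imset ?inE // => ? ? [].
  by rewrite big_imset //=; apply: eq_bigr => e _; rewrite incS.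
pose t := (d \in X) (+) (None \in C).
exists [set u | if u == w then t else u \in X] => -[e|]; rewrite !inE /=.
  rewrite mem_imset; last by move=> ? ? [].
  move=> eS; rewrite cutS /cut !inE; have /andP[/negbTE -> /negbTE ->] := Sw e eS.
  by rewrite -/(cut a b X e) -HX // inE.
by rewrite cut0 !inE eqxx (negbTE dw) /t; case: (d \in X); case: (None \in C).
Qed.

End Pendant.

Section Inside.

Variables (V E F : finType).
Variables (a b : E -> V) (l r : E -> F).
Hypothesis Pl : planar_struct a b l r [set: E].
Hypothesis loopless : forall e, a e != b e.

(* The part of the graph outside A meets A in at most one component, so that
   contracting all of it to a single vertex preserves planarity. *)
Definition outside_connected (A : {set V}) : Prop :=
  forall K : {set V}, K \subset ~: A ->
    (forall e, a e \in ~: A -> b e \in ~: A -> ~~ cut a b K e) ->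
    dg a b [set: E] K = 0 \/ dg a b [set: E] (~: A :\: K) = 0.

(** The outside of [A] becomes the root; a pendant vertex [w] with one virtual edge supplies what
    [pi_g] asks for. With at most five root edges consistency is automatic. *)
Theorem solve_region (A : {set V}) (c : V -> 'Z_3) :
  outside_connected A -> dg a b [set: E] A <= 5 ->
  (forall B : {set V}, B \subset A -> B != set0 -> B != A -> 5 <= dg a b [set: E] B) ->
  (\sum_(v in A) c v = 0)%R -> solvable a b [set: E] A c.
Proof.
move=> oc D5 big Ec.
pose U := option (option V); pose d : U := None; pose w : U := Some None.
pose psi v : U := if v \in A then Some (Some v) else d.
pose S' := [set e | (a e \in A) || (b e \in A)].
have Pl1 : planar_struct (psi \o a) (psi \o b) l r S'.
  apply: (planar_quot (subsetT _) _ _ Pl).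
    by move=> e; rewrite !inE andbT negb_or /psi => /andP[/negbTE -> /negbTE ->].
  move=> X HX; pose K := X :\: A.
  have hK : forall e, a e \in ~: A -> b e \in ~: A -> ~~ cut a b K e.
    move=> e; rewrite !inE => aA bA; have := HX e; rewrite !inE andbT negb_or aA bA => /(_ isT).
    by rewrite /cut !inE aA bA.
  have KA : K \subset ~: A by apply/subsetP => v; rewrite !inE => /andP[].
  have uniA (X0 : {set V}) t : (forall v, v \notin A -> (v \in X0) = t) ->
      forall u v, psi u = psi v -> (u \in X0) = (v \in X0).
    move=> H0 u v; rewrite /psi; case uA: (u \in A); case vA: (v \in A) => //; first by case=> ->.
    by rewrite !H0 ?uA ?vA.
  have dg0 Y e : dg a b [set: E] Y = 0 -> cut a b Y e = false.
    move=> /eqP; rewrite /dg sum_nat_eq0 => /forallP /(_ e); rewrite inE /=.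
    by case: (cut a b Y e).
  (* [K] is the trace of the cut outside [A]. No edge leaves [K], or none leaves the rest of the
     outside, so the whole outside can be put on one side without changing the cut. *)
  have [K0|K0] := oc K KA hK.
    exists (X :&: A); last by apply: (uniA _ false) => v /negbTE vA; rewrite inE vA andbF.
    move=> e _; have := dg0 _ e K0; rewrite /cut !inE.
    by case: (a e \in A); case: (b e \in A); case: (a e \in X); case: (b e \in X).
  exists (X :|: ~: A); last by apply: (uniA _ true) => v vA; rewrite !inE vA orbT.
  move=> e _; have := dg0 _ e K0; have := HX e; rewrite /cut !inE.
  by case: (a e \in A); case: (b e \in A); case: (a e \in X); case: (b e \in X) => // /(_ isT).
pose a' (e : option E) := if e is Some e then psi (a e) else d.
pose b' (e : option E) := if e is Some e then psi (b e) else w.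
pose l' (e : option E) := omap l e; pose r' (e : option E) := omap r e.
have psi_w v : psi v != w by rewrite /psi; case: ifP.
have Pl2 : planar_struct a' b' l' r' (None |: Some @: S').
  by apply: (@planar_pendant _ _ _ _ _ _ _ _ a' b' l' r' d w _ _ _ _ _ _ _ Pl1) => // e _ /=; rewrite !psi_w.
pose SR := Some @: S'; pose SV := [set (None : option E)].
pose W : {set U} := [set x | if x is Some (Some v) then v \in A else false].
pose dn (B : {set U}) := [set v | Some (Some v) \in B].
have memW v : (psi v \in W) = (v \in A) by rewrite inE /psi; case: ifP.
have Sinj : {in S' &, injective (@Some E)} by move=> ? ? _ _ [].
have cutE (B : {set U}) e : B \subset W -> cut a' b' B (Some e) = cut a b (dn B) e.
  have pB v : B \subset W -> (psi v \in B) = (Some (Some v) \in B).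
    move=> BW; rewrite /psi; case vA: (v \in A) => //; transitivity false.
      by apply/negP => /(subsetP BW); rewrite inE.
    by apply/esym/negP => /(subsetP BW); rewrite inE vA.
  by move=> BW; rewrite /cut /= !pB // !inE.
have dnA (B : {set U}) : B \subset W -> dn B \subset A.
  by move=> BW; apply/subsetP => v; rewrite inE => /(subsetP BW); rewrite inE.
have dgE (B : {set U}) : B \subset W -> dg a' b' SR B = dg a b [set: E] (dn B).
  move=> BW; rewrite /dg big_imset //= [RHS](big_setID S') /= setTI.
  rewrite [X in _ + X]big1 ?addn0; first by apply: eq_bigr => e _; rewrite cutE.
  move=> e; rewrite !inE andbT negb_or => /andP[/negbTE aA /negbTE bA]; rewrite /cut.
  have nB v : v \in A = false -> v \in dn B = false.
    by move=> vA; apply/negP => /(subsetP (dnA B BW)); rewrite vA.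
  by rewrite !nB.
have dnW : dn W = A by apply/setP => v; rewrite !inE.
have dn_inj (B : {set U}) : B \subset W -> dn B = A -> B = W.
  move=> BW E0; apply/eqP; rewrite eqEsubset BW; apply/subsetP => -[[v|]|]; rewrite inE //.
  by rewrite -E0 inE.
have dn0 (B : {set U}) : B \subset W -> B != set0 -> dn B != set0.
  move=> BW /set0Pn[x xB]; have := subsetP BW _ xB; rewrite inE.
  by case: x xB => [[v|]|] // vB _; apply/set0Pn; exists v; rewrite inE.
have big' (B : {set U}) : B \subset W -> B != set0 -> B != W -> 5 <= dg a' b' SR B.
  move=> BW B0 BnW; rewrite dgE //; apply: big; rewrite ?dnA ?dn0 //.
  by apply: contraNneq BnW => /(dn_inj B BW) ->.
have G : good a' b' l' r' SR SV W d w.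
  split; last 3 first.
  - by rewrite dgE // dnW (leq_trans D5).
  - by move=> B BW B0 BnW; apply: leq_trans (big' B BW B0 BnW).
  - by move=> B BW B0 BnW _; apply: big'.
  have inSR (e : option E) : e \in SR -> exists2 e0, e = Some e0 & e0 \in S'.
    by case/imsetP => e0 e0S ->; exists e0.
  have pdW v : psi v \in d |: W by rewrite !inE /psi; case vA: (v \in A); rewrite ?eqxx ?orbT.
  split; rewrite ?inE //.
  - by rewrite setUC.
  - by rewrite disjoint_sym disjoints1; apply/imsetP => -[].
  - move=> e /inSR[e0 -> e0S] /=; rewrite /psi; move: e0S; rewrite inE.
    case: (a e0 \in A); case: (b e0 \in A) => // _; apply/eqP => -[E0].
    by have := loopless e0; rewrite E0 eqxx.
  - by move=> e /inSR[e0 -> e0S]; apply: pdW.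
  - by move=> e /inSR[e0 -> e0S]; apply: pdW.
  - by move=> e; rewrite inE => /eqP ->; rewrite /= !inE.
  by exists None; rewrite ?inE // /joins !eqxx.
pose c' (x : U) : 'Z_3 := if x is Some (Some v) then c v else 0%R.
have Ec' : (\sum_(x in W) c' x = 0)%R.
  rewrite -[RHS]Ec; have -> : W = [set Some (Some v) | v in A].
    apply/setP => -[[v|]|]; rewrite !inE; try by apply/esym/imsetP => -[].
    by rewrite mem_imset // => ? ? [].
  by rewrite big_imset //= => ? ? _ _ [].
have D5' : dg a' b' SR W <= 5 by rewrite dgE // dnW.
have [x Hx] := core G Ec' (consistent_small c' G D5').
exists (fun e => x (Some e)) => v vA.
have vW : Some (Some v) \in W by rewrite inE.
rewrite -[RHS](Hx _ vW) /net; have -> : inner a' b' W SR = Some @: inner a b A [set: E].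
  apply/setP => -[e|]; last by rewrite inE; apply/idP/imsetP => [/andP[/imsetP[]]|[]].
  rewrite mem_imset; last by move=> ? ? [].
  rewrite [in LHS]inE [in RHS]inE /= !memW mem_imset; last by move=> ? ? [].
  by rewrite !inE; case: (a e \in A); case: (b e \in A).
rewrite big_imset /=; last by move=> ? ? _ _ [].
apply: eq_bigr => e; rewrite !inE => /andP[_ /andP[aA bA]]; congr (_ * _)%R.
by rewrite /dlt /= /psi aA bA.
Qed.

End Inside.

(** * Planar structures on minors *)

Section Minors.

Variables (U V E E0 F : finType).
Variables (a0 b0 : E0 -> U) (l0 r0 : E0 -> F) (a b : E -> V).
Hypothesis Pl : planar_struct a0 b0 l0 r0 [set: E0].

(** [phi] sends a vertex to the name of its branch set, or to [None] if it is discarded. Edges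
    inside branch sets are contracted; as these sets are connected, a cut avoiding the contracted
    edges is a union of branch sets, up to discarded vertices, which no kept edge touches. *)
Theorem planar_minor (phi : U -> option V) (i : E -> E0) : injective i ->
  (forall e, joins (phi \o a0) (phi \o b0) (i e) (Some (a e)) (Some (b e))) ->
  (forall e, a e != b e) ->
  (forall v x y, phi x = Some v -> phi y = Some v ->
     connect (fun x y => (phi x == phi y) && [exists e, joins a0 b0 e x y]) x y) ->
  exists l r : E -> F, planar_struct a b l r [set: E].
Proof.
move=> inj_i Hi loopless cn.
pose S' := i @: [set: E]; pose K := [set e | (phi (a0 e) == phi (b0 e)) && (phi (a0 e) != None)].
have [l1 [r1 Pl1]] := planar_del (subsetT (S' :|: K)) Pl.
have Pl2 : planar_struct (phi \o a0) (phi \o b0) l1 r1 S'.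
  apply: (planar_quot (subsetUl _ _) _ _ Pl1).
    by move=> e; rewrite in_setD in_setU => /andP[/negbTE ->] /=; rewrite inE => /andP[/eqP].
  move=> X HX.
  have unif v x y : phi x = Some v -> phi y = Some v -> (x \in X) = (y \in X).
    move=> Ex Ey; have /connectP[p pp Ep] := cn v x y Ex Ey.
    elim: p x Ex pp Ep => [|z p IH] x Ex /=; first by move=> _ ->.
    case/andP => /andP[/eqP Exz /existsP[e je]] pp Ep.
    have Ez : phi z = Some v by rewrite -Exz.
    rewrite -(IH z Ez pp Ep).
    have eK : e \in K.
      by move: je; rewrite inE => /orP[]/andP[/eqP -> /eqP ->]; rewrite Ex Ez eqxx.
    have := HX e; rewrite in_setD in_setU eK orbT andbT.
    case eS: (e \in S').
      case/imsetP: eS => f _ Ef; have := Hi f; rewrite -Ef /joins /=.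
      have := loopless f; move: je => /orP[]/andP[/eqP -> /eqP ->]; rewrite Ex Ez.
        by move=> ab /orP[]/andP[/eqP[E1] /eqP[E2]]; move: ab; rewrite -E1 -E2 eqxx.
      by move=> ab /orP[]/andP[/eqP[E1] /eqP[E2]]; move: ab; rewrite -E1 -E2 eqxx.
    move=> /(_ isT); rewrite (cut_joins _ je).
    by case: (x \in X); case: (z \in X).
  exists (X :&: [set x | phi x != None]).
    move=> e; rewrite in_setU => eS; rewrite /cut !inE.
    have [-> ->] : phi (a0 e) != None /\ phi (b0 e) != None.
      case/orP: eS => [/imsetP[f _ ->]|].
        by have := Hi f; rewrite /joins /= => /orP[]/andP[/eqP -> /eqP ->].
      by rewrite inE => /andP[/eqP <- ->].
    by rewrite !andbT.
  move=> x y Exy; rewrite !inE -Exy; case Ex: (phi x) => [v|]; last by rewrite !andbF.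
  by rewrite !andbT; apply: (unif v) => //; rewrite -Exy.
have Pl3 := planar_reindex inj_i Pl2.
exists (l1 \o i), (r1 \o i); case: Pl3 => D1 D2.
have cutE X e : cut ((phi \o a0) \o i) ((phi \o b0) \o i) X e = cut a b [set v | Some v \in X] e.
  have je : joins ((phi \o a0) \o i) ((phi \o b0) \o i) e (Some (a e)) (Some (b e)) := Hi e.
  by rewrite (cut_joins X je) /cut !inE.
split=> [X f|C CS HC].
  rewrite -[RHS](D1 (Some @: X) f); apply: eq_bigr => e _; rewrite cutE /cut !inE.
  by rewrite !mem_imset // => ? ? [].
have [X HX] := D2 C CS HC.
by exists [set v | Some v \in X] => e eS; rewrite HX // cutE.
Qed.

End Minors.

(** * Grids and their minors *)

Section Grid.

Variable n : nat.

Local Notation U := ('I_n.+1 * 'I_n.+1)%type.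
Local Notation E := ('I_n * 'I_n.+1 + 'I_n.+1 * 'I_n)%type.
Local Notation F := (option ('I_n * 'I_n)).

Local Notation lo := (@lift n.+1 ord_max).
Local Notation hi := (@lift n.+1 ord0).

Definition grid_a (e : E) : U :=
  match e with inl (i, j) => (lo i, j) | inr (i, j) => (i, lo j) end.

Definition grid_b (e : E) : U :=
  match e with inl (i, j) => (hi i, j) | inr (i, j) => (i, hi j) end.

(** At the border [unlift] returns [None], which thereby becomes the outer face. *)
Definition grid_l (e : E) : F :=
  match e with
  | inl (i, j) => omap (fun j => (i, j)) (unlift ord_max j)
  | inr (i, j) => omap (fun i => (i, j)) (unlift ord_max i)
  end.

Definition grid_r (e : E) : F :=
  match e with
  | inl (i, j) => omap (fun j => (i, j)) (unlift ord0 j)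
  | inr (i, j) => omap (fun i => (i, j)) (unlift ord0 i)
  end.

Let loE (k : 'I_n) : lo k = k :> nat.
Proof. exact: lift_max. Qed.

Let hiE (k : 'I_n) : hi k = k.+1 :> nat.
Proof. exact: lift0. Qed.

Lemma grid_inc i0 j0 (C : E -> bool) :
  \big[addb/false]_e (C e && inc grid_l grid_r (Some (i0, j0)) e) =
  C (inl (i0, lo j0)) (+) C (inl (i0, hi j0)) (+) (C (inr (lo i0, j0)) (+) C (inr (hi i0, j0))).
Proof.
have lohi (k : 'I_n) : lo k != hi k.
  by apply/eqP => /(congr1 (@nat_of_ord _)); rewrite loE hiE => /n_Sn.
have unE (h : 'I_n.+1) (x : 'I_n.+1) (k : 'I_n) : (unlift h x == Some k) = (x == lift h k).
  case: unliftP => [y ->|->]; first by rewrite (inj_eq lift_inj).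
  by apply/esym/negbTE; apply: neq_lift.
have two (B : 'I_n.+1 -> bool) k : \big[addb/false]_x (B x && ((x == lo k) (+) (x == hi k))) = B (lo k) (+) B (hi k).
  rewrite (bigD1 (lo k)) //= (bigD1 (hi k)) /=; last by rewrite eq_sym.
  rewrite !eqxx (negbTE (lohi k)) [hi k == _]eq_sym (negbTE (lohi k)) !andbT big1 ?addbF // => x /andP[/negbTE -> /negbTE ->].
  by rewrite andbF.
rewrite big_sumType /=; congr (_ (+) _).
  rewrite (eq_bigr (fun p => (p.1 == i0) && (C (inl (p.1, p.2)) && ((p.2 == lo j0) (+) (p.2 == hi j0))))); last first.
    move=> [i j] _ /=; rewrite /inc /=.
    have om h : (omap (fun j => (i, j)) (unlift h j) == Some (i0, j0)) = (i == i0) && (j == lift h j0).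
      rewrite -unE; case: (unlift h j) => [k|]; last by rewrite andbF.
      by rewrite /= !(inj_eq (@Some_inj _)) -pair_eqE.
    by rewrite !om; case: (i == i0); rewrite ?andbF.
  rewrite -(pair_bigA _ (fun i j => (i == i0) && (C (inl (i, j)) && ((j == lo j0) (+) (j == hi j0))))) /=.
  rewrite (bigD1 i0) //= [X in _ (+) X]big1 ?addbF; last by move=> i /negbTE ->; rewrite big1.
  by rewrite eqxx /= (two (fun j => C (inl (i0, j)))).
rewrite (eq_bigr (fun p => (p.2 == j0) && (C (inr (p.1, p.2)) && ((p.1 == lo i0) (+) (p.1 == hi i0))))); last first.
  move=> [i j] _ /=; rewrite /inc /=.
  have om h : (omap (fun i => (i, j)) (unlift h i) == Some (i0, j0)) = (j == j0) && (i == lift h i0).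
    rewrite -unE; case: (unlift h i) => [k|]; last by rewrite andbF.
    by rewrite /= !(inj_eq (@Some_inj _)) -pair_eqE andbC.
  by rewrite !om; case: (j == j0); rewrite ?andbF.
rewrite -(pair_bigA _ (fun i j => (j == j0) && (C (inr (i, j)) && ((i == lo i0) (+) (i == hi i0))))) /= exchange_big /=.
rewrite (bigD1 j0) //= [X in _ (+) X]big1 ?addbF; last by move=> i /negbTE ->; rewrite big1.
by rewrite eqxx /= (two (fun i => C (inr (i, j0)))).
Qed.

(** A discrete Poincare lemma: an edge set that is even on every unit square has a potential,
    obtained by summing it along the row of index zero and then along a column, and the potential
    marks one side of the cut. The outer face needs no separate argument for the first half, being
    the sum of all squares. *)
Lemma grid_planar : planar_struct grid_a grid_b grid_l grid_r [set: E].
Proof.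
have onT (B : E -> bool) : \big[addb/false]_(e in [set: E]) B e = \big[addb/false]_e B e.
  by apply: eq_bigl => e; rewrite inE.
split=> [X f|C _ HC].
  have inner i j : \big[addb/false]_e (cut grid_a grid_b X e && inc grid_l grid_r (Some (i, j)) e) = false.
    rewrite grid_inc /cut /=.
    by case: (_ \in X); case: (_ \in X); case: (_ \in X); case: (_ \in X).
  rewrite onT; case: f => [[i j]|]; first exact: inner.
  have incN e : inc grid_l grid_r None e = \big[addb/false]_f inc grid_l grid_r (Some f) e.
    have one (g : F) : (g == None) = ~~ \big[addb/false]_f (g == Some f).
      case: g => [p|]; last by rewrite big1.
      rewrite (bigD1 p) //= eqxx big1 // => q /negbTE qp.
      by rewrite (inj_eq (@Some_inj _)) eq_sym.
    by rewrite /inc !one big_split /=; do 2 case: (\big[addb/false]_f _).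
  rewrite (eq_bigr (fun e => \big[addb/false]_f (cut grid_a grid_b X e && inc grid_l grid_r (Some f) e))).
    by rewrite exchange_big big1 //= => -[i j] _; apply: inner.
  by move=> e _; rewrite incN big_distrr.
have sq i j : (inl (i, lo j) \in C) (+) (inl (i, hi j) \in C) (+)
    ((inr (lo i, j) \in C) (+) (inr (hi i, j) \in C)) = false.
  have := HC (Some (i, j)); rewrite big_mkcond /= => H0.
  rewrite -[RHS]H0 -(grid_inc i j (fun e => e \in C)).
  by apply: eq_bigr => e _; case: (e \in C).
pose hC i j := if insub i is Some i' then inl (i', inord j) \in C else false.
pose vC i j := if insub j is Some j' then inr (inord i, j') \in C else false.
pose pot i j := \big[addb/false]_(0 <= k < i) hC k 0 (+) \big[addb/false]_(0 <= k < j) vC i k.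
have step i j : i < n -> j <= n -> pot i.+1 j (+) pot i j = hC i j.
  move=> lin; elim: j => [|j IH] jn; rewrite /pot.
    by rewrite big_nat_recr //= ![\big[_/_]_(0 <= k < 0) _]big_geq // !addbF addbAC addbb addFb.
  rewrite !(big_nat_recr j) //=; have := IH (ltnW jn); rewrite /pot.
  have := sq (Ordinal lin) (Ordinal jn).
  have -> : inl (Ordinal lin, lo (Ordinal jn)) \in C = hC i j.
    rewrite /hC insubT; congr (inl (_, _) \in C); apply: ord_inj.
    by rewrite loE inordK // ltnS ltnW.
  have -> : inl (Ordinal lin, hi (Ordinal jn)) \in C = hC i j.+1.
    rewrite /hC insubT; congr (inl (_, _) \in C); apply: ord_inj.
    by rewrite hiE inordK.
  have -> : inr (lo (Ordinal lin), Ordinal jn) \in C = vC i j.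
    rewrite /vC insubT; congr (inr (_, _) \in C); apply: ord_inj.
    by rewrite loE inordK // ltnS ltnW.
  have -> : inr (hi (Ordinal lin), Ordinal jn) \in C = vC i.+1 j.
    rewrite /vC insubT; congr (inr (_, _) \in C); apply: ord_inj.
    by rewrite hiE inordK.
  move: (\big[_/_]_(0 <= k < i.+1) _) (\big[_/_]_(0 <= k < i) _) (\big[_/_]_(0 <= k < j) _) (\big[_/_]_(0 <= k < j) _).
  move: (hC i j) (hC i j.+1) (vC i j) (vC i.+1 j).
  by do 8 case.
have mem (i j : 'I_n.+1) : ((i, j) \in [set p : U | pot p.1 p.2]) = pot i j by rewrite inE.
exists [set p : U | pot p.1 p.2] => -[[i j]|[i j]] _; rewrite /cut [grid_a _]/= [grid_b _]/= !mem loE hiE.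
  rewrite addbC step //; last by rewrite -ltnS.
  rewrite /hC insubT //= => lt; congr (inl (_, _) \in C); first exact: val_inj.
  by rewrite inord_val.
have -> : inr (i, j) \in C = vC i j.
  rewrite /vC insubT //= => lt; congr (inr (_, _) \in C); last exact: val_inj.
  by rewrite inord_val.
rewrite /pot (big_nat_recr j) //=.
by move: (\big[_/_]_(0 <= k < i) _) (\big[_/_]_(0 <= k < j) _) (vC i j); do 3 case.
Qed.

End Grid.

Lemma connect_mono (T : finType) (g h : rel T) x y :
  (forall z z', connect g x z -> g z z' -> connect h z z') ->
  connect g x y -> connect h x y.
Proof.
move=> gh /connectP[p + ->] {y}.
elim/last_ind: p => [|p z IH]; first by rewrite connect0.
rewrite rcons_path last_rcons => /andP[pp gz]; apply: connect_trans (IH pp) _.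
by apply: gh gz; apply/connectP; exists p.
Qed.

Lemma connect_closed (T : finType) (g : rel T) (Q : pred T) x y :
  (forall z z', Q z -> g z z' -> Q z') -> Q x -> connect g x y -> Q y.
Proof.
move=> cl Qx /connectP[p + ->] {y}; elim: p x Qx => //= z p IH x Qx /andP[gz].
exact: IH (cl _ _ Qx gz).
Qed.

Definition has_planar_struct (V E : finType) (a b : E -> V) : Prop :=
  exists (F : finType) (l r : E -> F), planar_struct a b l r [set: E].

(** * A graph followed by lattice walks is a minor of the grid *)

Section Lattice.

Variables (V E : finType) (a b : E -> V).
Hypothesis loopless : forall e, a e != b e.

Variables (n N : nat) (q : E -> nat -> nat * nat) (P : V -> nat * nat).

Definition nearby (m : nat) (x y : nat * nat) : bool :=
  [&& x.1 <= y.1 + m, y.1 <= x.1 + m, x.2 <= y.2 + m & y.2 <= x.2 + m].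

(** A walk has [3 * N] steps; its outer thirds belong to the two ends of the edge, its middle third
    to the edge itself. *)
Definition end_at (v : V) (e : E) (k : nat) : bool :=
  ((a e == v) && (k <= N)) || ((b e == v) && (2 * N <= k <= 3 * N)).

Hypothesis q_step : forall e k, k < 3 * N -> nearby 1 (q e k) (q e k.+1).
Hypothesis q_bound : forall e k, k <= 3 * N ->
  [&& 0 < (q e k).1, (q e k).1 < n, 0 < (q e k).2 & (q e k).2 < n].
Hypothesis q_a : forall e, q e 0 = P (a e).
Hypothesis q_b : forall e, q e (3 * N) = P (b e).
(** Distance three is what thickened walks need: one for the block around each of the two points,
    and one for a grid edge between the blocks. *)
Hypothesis far_ends : forall v v' e f k m, v != v' -> end_at v e k -> end_at v' f m ->
  ~~ nearby 3 (q e k) (q f m).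
Hypothesis far_mid : forall e f k m, e != f -> N <= k <= 2 * N -> N <= m <= 2 * N ->
  ~~ nearby 3 (q e k) (q f m).
Hypothesis far_end_mid : forall v e f k m, a e != v -> b e != v -> N <= k <= 2 * N -> end_at v f m ->
  ~~ nearby 3 (q e k) (q f m).

Local Notation U := ('I_n.+1 * 'I_n.+1)%type.
Local Notation E0 := ('I_n * 'I_n.+1 + 'I_n.+1 * 'I_n)%type.

Definition pt (x : U) : nat * nat := (val x.1, val x.2).

Definition grid_adj (x y : U) : bool := [exists e : E0, joins (@grid_a n) (@grid_b n) e x y].

Definition adj_in (Y : pred U) : rel U := fun x y => [&& Y x, Y y & grid_adj x y].

Definition blk (p : nat * nat) (x : U) : bool := nearby 1 (pt x) p.

(** The core of the branch set of [v]: all end thirds at [v], thickened. They are connected through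
    the lattice point of [v]. *)
Definition Aset (v : V) (x : U) : bool :=
  [exists e, [exists k : 'I_(3 * N).+1, end_at v e k && blk (q e k) x]].

Definition Mset (e : E) (x : U) : bool :=
  [exists k : 'I_(3 * N).+1, (N <= k <= 2 * N) && blk (q e k) x].

Lemma adj_sym x y : grid_adj x y = grid_adj y x.
Proof. by apply: eq_existsb => e; rewrite /joins orbC. Qed.

Lemma adj_in_sym (Y : pred U) x y : adj_in Y x y = adj_in Y y x.
Proof. by rewrite /adj_in adj_sym; case: (Y x); case: (Y y). Qed.

Lemma nearby_sym i x y : nearby i x y = nearby i y x.
Proof. by rewrite /nearby; apply/and4P/and4P => -[]. Qed.

Lemma nearby_adj x y : grid_adj x y -> nearby 1 (pt x) (pt y).
Proof.
have ab (e : E0) : nearby 1 (pt (grid_a e)) (pt (grid_b e)).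
  case: e => -[i j]; rewrite /nearby /pt /= /bump leq0n.
    by rewrite [n <= i]leqNgt ltn_ord /=; apply/and4P; split; lia.
  by rewrite [n <= j]leqNgt ltn_ord /=; apply/and4P; split; lia.
case/existsP => e /orP[]/andP[/eqP <- /eqP <-] //.
by rewrite nearby_sym.
Qed.

Lemma adj_h (x y : U) : y.1 = x.1.+1 :> nat -> y.2 = x.2 -> grid_adj x y.
Proof.
case: x y => [x1 x2] [y1 y2] /= E1 ->.
have lt : x1 < n by have := ltn_ord y1; rewrite E1.
apply/existsP; exists (inl (Ordinal lt, x2)); rewrite /joins /=; apply/orP; left.
by apply/andP; split; apply/eqP; congr (_, _); apply: ord_inj; rewrite ?lift_max ?lift0.
Qed.

Lemma adj_v (x y : U) : y.2 = x.2.+1 :> nat -> y.1 = x.1 -> grid_adj x y.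
Proof.
case: x y => [x1 x2] [y1 y2] /= E1 ->.
have lt : x2 < n by have := ltn_ord y2; rewrite E1.
apply/existsP; exists (inr (x1, Ordinal lt)); rewrite /joins /=; apply/orP; left.
by apply/andP; split; apply/eqP; congr (_, _); apply: ord_inj; rewrite ?lift_max ?lift0.
Qed.

Lemma connect_h (Y : pred U) (i j k : 'I_n.+1) : i <= j ->
  (forall m : 'I_n.+1, i <= m <= j -> Y (m, k)) -> connect (adj_in Y) (i, k) (j, k).
Proof.
move=> ij HY; have [m] := ubnP (j - i); elim: m j ij HY => // m IH j ij HY lt.
have [E0|n0] := eqVneq (i : nat) j; first by rewrite (ord_inj E0) connect0.
have lt' : j.-1 < n.+1 by have := ltn_ord j; lia.
apply: (@connect_trans _ _ (Ordinal lt', k)).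
  by apply: IH => [|o /= /andP[o1 o2]|] /=; [lia | apply: HY; lia | lia].
apply: connect1; rewrite /adj_in !HY /=; try by apply/andP; split; lia.
by apply: adj_h => //=; lia.
Qed.

Lemma connect_v (Y : pred U) (i j k : 'I_n.+1) : i <= j ->
  (forall m : 'I_n.+1, i <= m <= j -> Y (k, m)) -> connect (adj_in Y) (k, i) (k, j).
Proof.
move=> ij HY; have [m] := ubnP (j - i); elim: m j ij HY => // m IH j ij HY lt.
have [E0|n0] := eqVneq (i : nat) j; first by rewrite (ord_inj E0) connect0.
have lt' : j.-1 < n.+1 by have := ltn_ord j; lia.
apply: (@connect_trans _ _ (k, Ordinal lt')).
  by apply: IH => [|o /= /andP[o1 o2]|] /=; [lia | apply: HY; lia | lia].
apply: connect1; rewrite /adj_in !HY /=; try by apply/andP; split; lia.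
by apply: adj_v => //=; lia.
Qed.

Lemma connect_adj_in_sym (Y : pred U) : connect_sym (adj_in Y).
Proof. by apply: sym_connect_sym => x y; apply: adj_in_sym. Qed.

Lemma connect_blk (Y : pred U) p x y : (forall z, blk p z -> Y z) -> blk p x -> blk p y ->
  connect (adj_in Y) x y.
Proof.
move=> HY; case: x y => [x1 x2] [y1 y2]; rewrite /blk /nearby /pt /= => /and4P[h1 h2 h3 h4] /and4P[h5 h6 h7 h8].
have inb (m o : 'I_n.+1) : minn x1 y1 <= m <= maxn x1 y1 -> minn x2 y2 <= o <= maxn x2 y2 -> Y (m, o).
  by move=> m1 o1; apply: HY; rewrite /blk /nearby /pt /=; apply/and4P; split; lia.
apply: (@connect_trans _ _ (y1, x2)).
  have [le|/ltnW le] := leqP x1 y1; last rewrite connect_adj_in_sym;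
    by apply: connect_h => // m mi; apply: inb; lia.
have [le|/ltnW le] := leqP x2 y2; last rewrite connect_adj_in_sym;
  by apply: connect_v => // m mi; apply: inb; lia.
Qed.

Definition ctr (p : nat * nat) : U := (inord p.1, inord p.2).

Lemma pt_ctr e k : k <= 3 * N -> pt (ctr (q e k)) = q e k.
Proof.
move=> kN; have /and4P[h1 h2 h3 h4] := q_bound e kN; rewrite /pt /ctr /= !inordK ?ltnS; try by lia.
by case: (q e k).
Qed.

Lemma blk_ctr e k : k <= 3 * N -> blk (q e k) (ctr (q e k)).
Proof. by move=> kN; rewrite /blk pt_ctr // /nearby; apply/and4P; split; lia. Qed.

Lemma connect_walk (Y : pred U) e k m : k <= m -> m <= 3 * N ->
  (forall i z, k <= i <= m -> blk (q e i) z -> Y z) ->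
  connect (adj_in Y) (ctr (q e k)) (ctr (q e m)).
Proof.
elim: m => [|m IH] km mN HY; first by move: km; rewrite leqn0 => /eqP ->.
move: (km); rewrite leq_eqVlt => /orP[/eqP ->|]; first by rewrite connect0.
rewrite ltnS => km'; apply: (@connect_trans _ _ (ctr (q e m))).
  by apply: IH => // [|i z /andP[i1 i2]]; [lia | apply: HY; lia].
apply: (@connect_blk _ (q e m.+1)); first by move=> z; apply: HY; lia.
- by rewrite /blk pt_ctr ?q_step //; lia.
- exact: blk_ctr.
Qed.

Lemma A_connect v x y : Aset v x -> Aset v y -> connect (adj_in (Aset v)) x y.
Proof.
suff base z : Aset v z -> connect (adj_in (Aset v)) (ctr (P v)) z.
  move=> /base hx /base hy; apply: connect_trans hy.
  by rewrite connect_adj_in_sym.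
case/existsP => e /existsP[k /andP[ek bz]].
have kN : k <= 3 * N by rewrite -ltnS.
have inA i z' : i <= 3 * N -> end_at v e i -> blk (q e i) z' -> Aset v z'.
  move=> iN ei bz'; apply/existsP; exists e; apply/existsP.
  by exists (Ordinal (iN : i < (3 * N).+1)); rewrite ei.
apply: (@connect_trans _ _ (ctr (q e k))); last first.
  by apply: (connect_blk (p := q e k)) => //; [move=> z'; apply: inA | apply: blk_ctr].
case/orP: (ek) => /andP[/eqP Ev kk].
  have -> : P v = q e 0 by rewrite q_a Ev.
  apply: connect_walk => // i z' /andP[_ ik]; apply: inA; first by lia.
  by rewrite /end_at Ev eqxx (leq_trans ik kk).
have -> : P v = q e (3 * N) by rewrite q_b Ev.
rewrite connect_adj_in_sym; apply: connect_walk => // i z' /andP[ki iN]; apply: inA => //.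
by rewrite /end_at Ev eqxx iN (leq_trans _ ki) ?orbT //; case/andP: kk.
Qed.

Lemma blk_nearby2 p p' x : blk p x -> blk p' x -> nearby 3 p p'.
Proof. by rewrite /blk /nearby => /and4P[? ? ? ?] /and4P[? ? ? ?]; apply/and4P; split; lia. Qed.

Lemma blk_nearby3 p p' x y : grid_adj x y -> blk p x -> blk p' y -> nearby 3 p p'.
Proof.
move=> /nearby_adj; rewrite /blk /nearby => /and4P[? ? ? ?] /and4P[? ? ? ?] /and4P[? ? ? ?].
by apply/and4P; split; lia.
Qed.

Lemma A_disj v v' x : Aset v x -> Aset v' x -> v = v'.
Proof.
case/existsP => e /existsP[k /andP[ek bk]] /existsP[f /existsP[m /andP[fm bm]]].
apply/eqP; apply: contraT => vv'; have := far_ends vv' ek fm.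
by rewrite (blk_nearby2 bk bm).
Qed.

Lemma A_nonadj v v' x y : grid_adj x y -> Aset v x -> Aset v' y -> v = v'.
Proof.
move=> xy /existsP[e /existsP[k /andP[ek bk]]] /existsP[f /existsP[m /andP[fm bm]]].
apply/eqP; apply: contraT => vv'; have := far_ends vv' ek fm.
by rewrite (blk_nearby3 xy bk bm).
Qed.

Lemma M_disj e f x : Mset e x -> Mset f x -> e = f.
Proof.
case/existsP => k /andP[ek bk] /existsP[m /andP[fm bm]].
apply/eqP; apply: contraT => ef; have := far_mid ef ek fm.
by rewrite (blk_nearby2 bk bm).
Qed.

Lemma M_A e v x : Mset e x -> Aset v x -> (v == a e) || (v == b e).
Proof.
case/existsP => k /andP[ek bk] /existsP[f /existsP[m /andP[fm bm]]].
rewrite eq_sym [v == b e]eq_sym; apply: contraT; rewrite negb_or => /andP[va vb].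
by have := far_end_mid va vb ek fm; rewrite (blk_nearby2 bk bm).
Qed.

Definition MB (e : E) (x : U) : bool := Mset e x && ~~ Aset (b e) x.

(** The part of the middle third that joins the branch set of [a e]. The end sets may cut the
    thickened middle into pieces, so only what is reachable from its start without entering the set
    of [b e] is taken. *)
Definition Tset (e : E) (x : U) : bool :=
  [&& Mset e x, ~~ Aset (a e) x, ~~ Aset (b e) x &
   connect (adj_in (MB e)) (ctr (q e N)) x].

Lemma start_A e : Aset (a e) (ctr (q e N)) /\ Mset e (ctr (q e N)).
Proof.
have N3 : N < (3 * N).+1 by lia.
have bl := @blk_ctr e N _; split.
  apply/existsP; exists e; apply/existsP; exists (Ordinal N3).
  by rewrite /= /end_at eqxx leqnn bl.
by apply/existsP; exists (Ordinal N3); rewrite /= leqnn bl // andbT; lia.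
Qed.

Lemma finish_A e : Aset (b e) (ctr (q e (2 * N))) /\ Mset e (ctr (q e (2 * N))).
Proof.
have N3 : 2 * N < (3 * N).+1 by lia.
have le : 2 * N <= 3 * N by lia.
have bl := @blk_ctr e (2 * N) le; split.
  apply/existsP; exists e; apply/existsP; exists (Ordinal N3).
  by rewrite /= /end_at eqxx leqnn bl le !orbT.
by apply/existsP; exists (Ordinal N3); rewrite /= leqnn bl // !andbT; lia.
Qed.

(** The middle third leads from the set of [a e] to that of [b e]; where it first enters the latter,
    a grid edge is found that will represent [e]. *)
Lemma link_ex e : exists e0 : E0, exists x y : U,
  [/\ joins (@grid_a n) (@grid_b n) e0 x y, Tset e x & Aset (b e) y].
Proof.
have [sA sM] := start_A e; have [fA fM] := finish_A e.
pose Z x := MB e x && connect (adj_in (MB e)) (ctr (q e N)) x.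
have sZ : Z (ctr (q e N)).
  rewrite /Z connect0 andbT /MB sM; apply/negP => sB.
  by have := loopless e; rewrite (A_disj sA sB) eqxx.
have cM : connect (adj_in (Mset e)) (ctr (q e N)) (ctr (q e (2 * N))).
  apply: connect_walk; [lia|lia|move=> i z iN bz].
  have lt : i < (3 * N).+1 by lia.
  by apply/existsP; exists (Ordinal lt); rewrite iN bz.
case: (boolP [exists x, [exists y, [&& Z x, Mset e y, Aset (b e) y & grid_adj x y]]]).
  case/existsP => x /existsP[y /and4P[Zx My By /existsP[e0 je]]]; exists e0, x, y; split=> //.
  case/andP: Zx => /andP[Mx nB] cx; rewrite /Tset Mx nB cx !andbT /=.
  apply/negP => Ax; have xy : grid_adj x y by apply/existsP; exists e0.
  by have := loopless e; rewrite (A_nonadj xy Ax By) eqxx.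
rewrite negb_exists => /forallP none.
have : Z (ctr (q e (2 * N))).
  apply: connect_closed sZ cM => z z' Zz /and3P[Mz Mz' zz'].
  have := none z; rewrite negb_exists => /forallP /(_ z'); rewrite Zz Mz' zz' andbT /= => nB.
  have Mb : MB e z' by rewrite /MB Mz' nB.
  rewrite /Z Mb /=; case/andP: Zz => Mz0 cz; apply: connect_trans cz _.
  by apply: connect1; rewrite /adj_in Mz0 Mb zz'.
by rewrite /Z /MB fA andbF.
Qed.

Theorem lattice_planar : has_planar_struct a b.
Proof.
have [i Hi1] := fin_all_exists link_ex; have [X Hi2] := fin_all_exists Hi1.
have [Y Hi] := fin_all_exists Hi2.
have TA e v x : Tset e x -> ~~ Aset v x.
  case/and4P => Mx nA nB _; apply/negP => Ax.
  by case/orP: (M_A Mx Ax) => /eqP Ev; move: Ax; rewrite Ev ?(negbTE nA) ?(negbTE nB).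
(* Branch sets: the core of [v] together with [Tset e] for every edge [e] starting at [v].
   Contracting them leaves the grid edge of [link_ex] as a copy of [e]. *)
pose phi (x : U) : option V := if [pick v | Aset v x] is Some v then Some v else
  if [pick e | Tset e x] is Some e then Some (a e) else None.
have phiA v x : Aset v x -> phi x = Some v.
  by move=> Ax; rewrite /phi; case: pickP => [v' /A_disj/(_ Ax) ->//|/(_ v)]; rewrite Ax.
have phiT e x : Tset e x -> phi x = Some (a e).
  move=> Tx; rewrite /phi; case: pickP => [v Ax|_]; first by have := TA _ v _ Tx; rewrite Ax.
  case: pickP => [f /and4P[Mx _ _ _]|/(_ e)]; last by rewrite Tx.
  by case/and4P: Tx => Mx' _ _ _; rewrite (M_disj Mx Mx').
have phiI x v : phi x = Some v -> Aset v x \/ exists2 e, a e = v & Tset e x.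
  rewrite /phi; case: pickP => [v' Ax [<-]|_]; first by left.
  by case: pickP => [e Tx [<-]|//]; right; exists e.
have inj_i : injective i.
  move=> e f Eif; have [je Te Be] := Hi e; have [jf Tf Bf] := Hi f; rewrite Eif in je.
  have EX : X e = X f.
    have nXY : X e <> Y f by move=> E0; have := TA _ (b f) _ Te; rewrite E0 Bf.
    move: je jf; rewrite /joins => /orP[]/andP[/eqP E1 /eqP E2] /orP[]/andP[/eqP E3 /eqP E4].
    - by rewrite -E1 -E3.
    - by case: nXY; rewrite -E1 -E3.
    - by case: nXY; rewrite -E2 -E4.
    by rewrite -E2 -E4.
  case/and4P: Te => Me _ _ _; case/and4P: Tf => Mf _ _ _.
  by apply: (M_disj Me); rewrite EX.
have G := grid_planar n.
have [||l [r Pl]] := @planar_minor _ V E _ _ _ _ _ _ a b G phi i inj_i _ loopless.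
- move=> e; have [je Te Be] := Hi e; have := phiT _ _ Te; have := phiA _ _ Be => E1 E2.
  by move: je; rewrite /joins /= => /orP[]/andP[/eqP -> /eqP ->]; rewrite E1 E2 !eqxx ?orbT.
- pose R x y := (phi x == phi y) && grid_adj x y.
  have Rsym : connect_sym R.
    by apply: sym_connect_sym => x y; rewrite /R eq_sym adj_sym.
  move=> v x y Ex Ey; change (connect R x y).
  have AR z z' : Aset v z -> Aset v z' -> connect R z z'.
    move=> Az Az'; apply: connect_sub (A_connect Az Az') => u u' /and3P[Au Au' uu'].
    by apply: connect1; rewrite /R (phiA v) // (phiA v) // eqxx.
  suff toA z : phi z = Some v -> exists2 z', Aset v z' & connect R z' z.
    have [x' Ax' cx] := toA x Ex; have [y' Ay' cy] := toA y Ey.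
    apply: connect_trans cy; apply: connect_trans (AR _ _ Ax' Ay').
    by rewrite Rsym.
  case/phiI => [Az|[e Ev Tz]]; first by exists z.
  have [sA sM] := start_A e; rewrite Ev in sA.
  exists (ctr (q e N)) => //; case/and4P: Tz => _ _ _.
  have inP u : MB e u -> connect (adj_in (MB e)) (ctr (q e N)) u -> phi u = Some v.
    move=> /andP[Mu nB] cu; case Au: (Aset v u); first exact: phiA.
    by rewrite (phiT e) ?Ev // /Tset Mu nB cu Ev Au.
  apply: connect_mono => u u' cu uu'; have /and3P[Bu Bu' auu'] := uu'.
  apply: connect1; rewrite /R auu' andbT !inP //.
  by apply: connect_trans cu (connect1 _).
by exists _, l, r.
Qed.

End Lattice.

(** * Orientations of graphs *)

Require Import Defs.

Section Graph.

Variables (G : mgraph) (a b : edge G -> vert G).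
Hypothesis ends_ab : forall e, ends e = [set a e; b e].

Local Notation V := (vert G).
Local Notation E := (edge G).
Local Notation dgr := (dg a b [set: E]).

Lemma ends_neq e : a e != b e.
Proof. by have := card_ends e; rewrite ends_ab cards2; case: (a e == b e). Qed.

Lemma boundaryE (A : {set V}) : edge_boundary A = [set e | cut a b A e].
Proof.
apply/setP => e; rewrite !inE ends_ab setIUl cardsU /cut.
have c1 (x : V) : #|[set x] :&: A| = (x \in A).
  case xA: (x \in A); first by rewrite (setIidPl _) ?cards1 // sub1set.
  by apply/eqP; rewrite cards_eq0; apply/eqP/setP => y; rewrite !inE; case: eqP => // ->.
have -> : [set a e] :&: A :&: ([set b e] :&: A) = set0.
  apply/setP => y; rewrite !inE; have [->|//] := eqVneq y (a e).
  by rewrite (negbTE (ends_neq e)) andbF.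
by rewrite cards0 subn0 !c1; case: (a e \in A); case: (b e \in A).
Qed.

Lemma card_boundary (A : {set V}) : #|edge_boundary A| = dgr A.
Proof.
rewrite boundaryE /dg sum_card; apply: eq_card => e; rewrite !inE.
by [].
Qed.

Lemma connected_cut k (A : {set V}) : edge_connected G k -> A != set0 -> A != setT -> k <= dgr A.
Proof.
move=> cn /set0Pn[x xA] AT; rewrite leqNgt -card_boundary; apply/negP => lt.
have [y yA] : exists y, y \notin A.
  apply/existsP; apply: contraR AT; rewrite negb_exists => /forallP H0.
  by apply/eqP/setP => y; rewrite inE; have := H0 y; rewrite negbK.
have cxy := cn _ lt x y; case/negP: yA.
apply: (connect_closed (Q := fun z => z \in A)) xA cxy => z z' zA /existsP[e /andP[]].
rewrite boundaryE inE /cut => nc /eqP Ee.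
have ze : z' \in ends e by rewrite Ee !inE eqxx orbT.
have zz : z \in ends e by rewrite Ee !inE eqxx.
have Eab : (a e \in A) = (b e \in A) by move: nc; case: (a e \in A); case: (b e \in A).
have aA : a e \in A.
  by move: zz; rewrite ends_ab !inE => /orP[]/eqP Ez; [rewrite -Ez | rewrite Eab -Ez].
by move: ze; rewrite ends_ab !inE => /orP[]/eqP -> //; rewrite -Eab.
Qed.

Definition orient (x : E -> bool) e : V := if x e then a e else b e.

Lemma orient_ends (F : {set E}) x : orientation_on F (orient x).
Proof. by move=> e _; rewrite ends_ab /orient !inE; case: (x e); rewrite eqxx ?orbT. Qed.

Lemma balanceE (F : {set E}) x v : balance_on F (orient x) v = net a b F x v.
Proof.
rewrite /balance_on /outdeg_on /indeg_on.
have cardR (Q : pred E) : (#|[set e in F | Q e]|%:R = \sum_(e in F) (Q e)%:R :> 'Z_3)%R.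
  rewrite -sum1_card natr_sum (eq_bigl (fun e => (e \in F) && Q e)); last by move=> e; rewrite inE.
  by rewrite big_mkcondr /=; apply: eq_bigr => e _; case: (Q e).
rewrite !cardR -sumrB; apply: eq_bigr => e _; rewrite ends_ab !inE /orient /dlt.
have ab := ends_neq e; have ba : b e != a e by rewrite eq_sym.
rewrite ![v == _]eq_sym; case: (x e).
  have [Ea|na] := eqVneq (a e) v; first by rewrite -Ea (negbTE ba) subr0 mulr1.
  by rewrite /= andbF andbT mulr1.
have [Eb|nb] := eqVneq (b e) v; first by rewrite -Eb (negbTE ab) orbT /sg mulrN1 opprB.
by rewrite /= andbF orbF andbT /sg mulrN1 opprB.
Qed.

Lemma balance_ext (F : {set E}) D D' v : {in F, D =1 D'} -> balance_on F D v = balance_on F D' v.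
Proof.
move=> DD'; rewrite /balance_on /outdeg_on /indeg_on.
by congr (_%:R - _%:R)%R; apply: eq_card => e; rewrite !inE; case eF: (e \in F); rewrite //= DD'.
Qed.

Lemma orient_all (F : {set E}) D : orientation_on F D ->
  {in F, D =1 orient (fun e => D e == a e)}.
Proof.
move=> oD e eF; rewrite /orient; case: eqP => // na.
by have := oD e eF; rewrite ends_ab !inE => /orP[]/eqP.
Qed.

Lemma combine_orientations (S : {set E}) x0 x (beta : V -> 'Z_3) :
  (forall v, net a b S x0 v + net a b (~: S) x v = beta v)%R ->
  exists y, (forall v, balance_on [set: E] (orient y) v = beta v) /\ {in S, y =1 x0}.
Proof.
move=> H0; exists (fun e => if e \in S then x0 e else x e); split=> [v|e ->] //.
rewrite balanceE -H0; apply: net_split; first by rewrite setUCr.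
by rewrite disjoints_subset setCK.
Qed.

Lemma sum_netT (S : {set E}) x : (\sum_(v : V) net a b S x v = 0)%R.
Proof.
rewrite (eq_bigl (fun v => v \in [set: V])); last by move=> v; rewrite inE.
by rewrite sum_net big1 // => e _; rewrite !inE subrr mul0r.
Qed.

End Graph.

(** * Parts (i) to (iii) for graphs with a planar structure *)

Section PlanarGraph.

Variables (G : mgraph) (a b : edge G -> vert G).
Hypothesis ends_ab : forall e, ends e = [set a e; b e].

Local Notation V := (vert G).
Local Notation E := (edge G).
Local Notation dgr := (dg a b [set: E]).

Hypothesis pl : has_planar_struct a b.

Theorem planar_connected : edge_connected G 5 -> Z3_connected G.
Proof.
case: pl => F [l [r Pl]] cn beta Ebeta.
have [||||x Hx] := @solve_region _ _ _ a b l r Pl (ends_neq ends_ab) [set: V] beta.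
- by move=> K; rewrite setCT subset0 => /eqP -> _; left; rewrite /dg big1 // => e _; rewrite /cut !inE.
- by rewrite /dg big1 // => e _; rewrite /cut !inE.
- by move=> B _ B0 BT; apply: (connected_cut ends_ab).
- by rewrite -[RHS]Ebeta; apply: eq_bigl => v; rewrite inE.
exists (orient a b x); split; first exact: orient_ends.
move=> v; rewrite (balanceE ends_ab) -(Hx v) ?inE //; congr net.
by apply/setP => e; rewrite !inE.
Qed.

(** The edges at [u] are given by [Dx], and their effect is subtracted from the demand of the other
    vertices; [u] itself is the outside of the region, with the five edges allowed by
    [solve_region]. *)
Theorem planar_extendable : edge_connected G 5 ->
  forall x : V, degree x = 5 -> Z3_extendable x.
Proof.
case: pl => F [l [r Pl]] cn u u5 beta Dx Ebeta oD bu.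
pose S := edge_boundary [set u]; pose x0 e := Dx e == a e.
have ES : S = [set e | cut a b [set u] e] := boundaryE ends_ab _.
have Dx0 : {in S, Dx =1 orient a b x0} := orient_all ends_ab oD.
have n0 : net a b S x0 u = beta u by rewrite -(balanceE ends_ab) -bu; apply: balance_ext => e /Dx0.
pose A := ~: [set u].
have dgA : dgr A = 5 by rewrite -u5 /degree (card_boundary ends_ab) /dg; apply: eq_bigr => e _; rewrite cutC.
have [||||x Hx] := @solve_region _ _ _ a b l r Pl (ends_neq ends_ab) A (fun v => beta v - net a b S x0 v)%R.
- move=> K; rewrite setCK => Ku _.
  have dg0 : dgr set0 = 0 by rewrite /dg big1 // => e _; rewrite /cut !inE.
  case uK: (u \in K); [right|left].
    by suff -> : [set u] :\: K = set0 by []; apply/eqP; rewrite setD_eq0 sub1set.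
  suff -> : K = set0 by [].
  apply/setP => v; rewrite inE; apply/negP => vK; have := subsetP Ku _ vK; rewrite inE => /eqP E0.
  by rewrite -E0 vK in uK.
- by rewrite dgA.
- move=> B BA B0 BnA; apply: (connected_cut ends_ab) => //; apply/eqP => E0.
  by have := subsetP BA u; rewrite E0 !inE eqxx => /(_ isT).
- rewrite sumrB; apply/eqP; rewrite subr_eq0; apply/eqP.
  have D1 (f : V -> 'Z_3) : (\sum_(v in A) f v = \sum_v f v - f u)%R.
    by rewrite [in RHS](bigD1 u) //= addrC addrK; apply: eq_bigl => v; rewrite !inE.
  by rewrite !D1 n0 Ebeta sum_netT.
have EN : inner a b A [set: E] = ~: S.
  apply/setP => e; rewrite ES !inE /cut !inE; have := ends_neq ends_ab e.
  by case: (a e =P u) => [->|_]; case: (b e =P u) => [->|_] //=; rewrite eqxx.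
have [v|y [Hy yS]] := combine_orientations ends_ab (S := S) (x0 := x0) (x := x) (beta := beta).
  have [->|vu] := eqVneq v u.
    rewrite n0 net_out ?addr0 // => e; rewrite ES !inE /cut !inE; have := ends_neq ends_ab e.
    by case: (a e =P u) => [->|_]; case: (b e =P u) => [->|_] //=; rewrite eqxx.
  by rewrite -EN Hx ?inE // addrC subrK.
exists (orient a b y); split; first by split=> //; apply: orient_ends.
by move=> e eS; rewrite (Dx0 e eS) /orient yS.
Qed.

(** Take [A] of least size and, if it has a bad part, one of least boundary, [C]. If the outside of
    [C] fell into [K] and [L], both with edges to [C], then the outside of [A], being connected,
    would leave one of them alone; the trace of that one on [A] would have a smaller boundary than
    [C]. So [C] has a connected outside, against the choice of [A]. *)
Lemma min_cut_region : 0 < #|V| -> exists A : {set V}, [/\ A != set0, dgr A <= 4,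
  outside_connected a b A & forall B : {set V}, B \subset A -> B != set0 -> B != A -> 5 <= dgr B].
Proof.
move=> V0.
pose oc (A : {set V}) := [forall K : {set V}, (K \subset ~: A) ==>
  [forall e, (a e \in ~: A) ==> (b e \in ~: A) ==> ~~ cut a b K e] ==>
  ((dgr K == 0) || (dgr (~: A :\: K) == 0))].
have ocP A : reflect (outside_connected a b A) (oc A).
  apply: (iffP forallP) => H0 K; last first.
    apply/implyP => KA; apply/implyP => /forallP H1; apply/orP.
    case: (H0 K KA) => [e ae be|->|->]; rewrite ?eqxx; try by [left|right].
    by have := H1 e; rewrite ae be.
  move=> KA H1; have := H0 K; rewrite KA /=.
  have -> : [forall e, (a e \in ~: A) ==> (b e \in ~: A) ==> ~~ cut a b K e].
    by apply/forallP => e; apply/implyP => ae; apply/implyP => be; apply: H1.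
  by case/orP => /eqP; [left|right].
pose ok (A : {set V}) := [&& A != set0, dgr A <= 4 & oc A].
have dg0 : dgr set0 = 0 by rewrite /dg big1 // => e _; rewrite /cut !inE.
have okT : ok setT.
  rewrite /ok -card_gt0 cardsT V0 /=; apply/andP; split.
    by rewrite /dg big1 // => e _; rewrite /cut !inE.
  by apply/ocP => K; rewrite setCT subset0 => /eqP -> _; left.
case: (arg_minnP (fun A : {set V} => #|A|) okT) => A /and3P[A0 A4 /ocP ocA] minA.
exists A; split=> // B BA B0 BnA; rewrite leqNgt ltnS; apply/negP => B4.
pose bad (B : {set V}) := [&& B \subset A, B != set0 & B != A].
have badB : bad B by rewrite /bad BA B0.
case: (arg_minnP (fun B : {set V} => dgr B) badB) => C /and3P[CA C0 CnA] minC.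
have C4 : dgr C <= 4 := leq_trans (minC B badB) B4.
suff okC : ok C.
  by have := minA C okC; rewrite leqNgt proper_card // properEneq CnA.
rewrite /ok C0 C4; apply/ocP => K KC Ksep.
pose L := ~: C :\: K.
have parts v : [\/ [/\ v \in C, v \notin K & v \notin L], [/\ v \notin C, v \in K & v \notin L]
    | [/\ v \notin C, v \notin K & v \in L]].
  rewrite /L !inE; case vC: (v \in C); case vK: (v \in K).
  - by have := subsetP KC v vK; rewrite inE vC.
  - by constructor 1.
  - by constructor 2.
  by constructor 3.
have noKL e : ~~ [|| (a e \in K) && (b e \in L) | (a e \in L) && (b e \in K)].
  have h1 : (a e \in ~: C) ==> (b e \in ~: C) ==> ~~ cut a b K e.
    by apply/implyP => ae; apply/implyP => be; apply: Ksep.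
  have kC v : (v \in K) ==> (v \notin C) by apply/implyP => /(subsetP KC); rewrite inE.
  move: h1 (kC (a e)) (kC (b e)); rewrite /L !inE /cut.
  by case: (a e \in C); case: (b e \in C); case: (a e \in K); case: (b e \in K).
have sumKL : dgr C = dgr K + dgr L.
  rewrite /dg -big_split /=; apply: eq_bigr => e _; have := noKL e; rewrite /cut.
  by case: (parts (a e)) => -[p1 p2 p3]; case: (parts (b e)) => -[q1 q2 q3];
    rewrite ?p1 ?p2 ?p3 ?q1 ?q2 ?q3 ?(negbTE p1) ?(negbTE p2) ?(negbTE p3) ?(negbTE q1) ?(negbTE q2) ?(negbTE q3).
have [K0|K0] := posnP (dgr K); first by left.
have [L0|L0] := posnP (dgr L); first by right.
exfalso.
have key (X Y : {set V}) : X \subset ~: C -> Y = ~: C :\: X ->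
   (forall e, ~~ [|| (a e \in X) && (b e \in Y) | (a e \in Y) && (b e \in X)]) ->
   0 < dgr X -> 0 < dgr Y -> dgr C = dgr X + dgr Y -> dgr (X :\: A) = 0 -> False.
  move=> XC EY noXY X0 Y0 sumXY XA0.
  have cutXA e : cut a b (X :\: A) e = false.
    move/eqP: XA0; rewrite /dg sum_nat_eq0 => /forallP /(_ e); rewrite inE /=.
    by case: (cut a b _ e).
  have dgXA : dgr (X :&: A) = dgr X.
    rewrite /dg; apply: eq_bigr => e _; have := cutXA e; rewrite /cut !inE.
    by case: (a e \in X); case: (b e \in X); case: (a e \in A); case: (b e \in A).
  have badX : bad (X :&: A).
    rewrite /bad subsetIr /=; apply/andP; split.
      by apply/eqP => E0; move: X0; rewrite -dgXA E0 dg0.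
    apply/eqP => E0; have [v vC] := set0Pn _ C0; have := subsetP CA v vC.
    by rewrite -E0 inE => /andP[/(subsetP XC)]; rewrite inE vC.
  by have := minC _ badX; rewrite dgXA sumXY; lia.
have sub1 : K :\: A \subset ~: A by apply/subsetP => v; rewrite !inE => /andP[].
have sep1 e : a e \in ~: A -> b e \in ~: A -> ~~ cut a b (K :\: A) e.
  move=> aA bA; have aC : a e \in ~: C by move: aA; rewrite !inE; apply: contra; apply: (subsetP CA).
  have bC : b e \in ~: C by move: bA; rewrite !inE; apply: contra; apply: (subsetP CA).
  by have := Ksep e aC bC; move: aA bA; rewrite /cut !inE => -> ->.
have [K1|L1] := ocA _ sub1 sep1; first exact: (key K L).
have sumLK : dgr C = dgr L + dgr K by rewrite addnC.
apply: (key L K _ _ _ L0 K0 sumLK).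
- exact: subsetDl.
- by rewrite /L setDDr setDv set0U; apply/esym/setIidPr.
- by move=> e; have := noKL e; rewrite orbC.
suff <- : ~: A :\: (K :\: A) = L :\: A by [].
apply/setP => v; rewrite /L !inE; case vA: (v \in A) => //=.
by case vK: (v \in K) => //=; case vC: (v \in C) => //=; rewrite (subsetP CA v vC) in vA.
Qed.

Theorem planar_reduced : Z3_reduced G -> min_degree G <= 4.
Proof.
case: pl => F [l [r Pl]] red; rewrite leqNgt; apply/negP => md.
have deg5 v : 5 <= dgr [set v].
  rewrite -(card_boundary ends_ab); apply: leq_trans md _; rewrite /min_degree.
  have := mem_index_enum v; elim: (index_enum V) => // u s IHs; rewrite in_cons big_cons.
  by case/orP => [/eqP ->|/IHs]; [exact: geq_minl | apply: leq_trans; exact: geq_minr].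
have V0 : 0 < #|V|.
  rewrite lt0n; apply/eqP => V0; move: md; rewrite /min_degree big_pred0; last first.
    by move=> v; have := fintype0 v; rewrite V0.
  move=> E5; have [e _] : exists e, e \in [set: E] by apply/set0Pn; rewrite -card_gt0 cardsT; lia.
  by have := fintype0 (a e); rewrite V0.
have [A [A0 A4 ocA bigA]] := min_cut_region V0.
(* A one-vertex set has at least five boundary edges by the degree assumption, but [A] has at most
   four. *)
have A2 : 1 < #|A|.
  rewrite ltnNge; apply/negP => A1; have [v vA] := set0Pn _ A0.
  have EA : A = [set v] by apply/esym/eqP; rewrite eqEcard sub1set vA cards1.
  by have := deg5 v; rewrite -EA; lia.
pose FA := inner a b A [set: E].
have sub : is_subgraph A FA.
  by move=> e; rewrite inE ends_ab => /andP[_ /andP[aA bA]]; apply/subsetP => v; rewrite !inE => /orP[]/eqP ->.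
apply: red; exists A, FA, sub; split=> // beta Ebeta.
pose c v : 'Z_3 := if insub v is Some v' then beta v' else 0%R.
have cE (v : {x : V | x \in A}) : c (val v) = beta v by rewrite /c valK.
have Ec : (\sum_(v in A) c v = 0)%R.
  rewrite -[RHS]Ebeta [LHS](@reindex_omap _ _ _ _ {x : V | x \in A} val insub) /=; last first.
    by move=> v vA; rewrite insubT.
  by apply: eq_big => [v|v _]; rewrite ?cE // valK eqxx andbT (valP v).
have [|x Hx] := @solve_region _ _ _ a b l r Pl (ends_neq ends_ab) A c ocA _ bigA Ec; first by lia.
have inA (e : {e : E | e \in FA}) : (a (val e) \in A) && (b (val e) \in A).
  by have := valP e; rewrite /= inE inE.
pose aA (e : {e : E | e \in FA}) : {x : V | x \in A} := exist _ (a (val e)) (proj1 (andP (inA e))).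
pose bA (e : {e : E | e \in FA}) : {x : V | x \in A} := exist _ (b (val e)) (proj2 (andP (inA e))).
pose H := subgraph sub.
have endsH (e : edge H) : ends e = [set aA e; bA e].
  by apply/setP => v; rewrite !inE ends_ab !inE -!val_eqE.
exists (@orient H aA bA (fun e : edge H => x (val e))); split; first exact: orient_ends endsH _ _.
move=> v; rewrite (balanceE endsH); transitivity (net a b FA x (val v)).
  rewrite /net [RHS](@reindex_omap _ _ _ _ {e : E | e \in FA} val insub) /=; last by move=> e eF; rewrite insubT.
  apply: eq_big => [e|e _]; last by rewrite /dlt -!val_eqE.
  by rewrite inE -[sval e]/(val e) valK eqxx andbT; apply/esym; exact: (valP e).
by rewrite Hx ?cE //; apply: (valP v).
Qed.

End PlanarGraph.

(** * Part (iv): the crossing point as a root *)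

Section OneCrossing.

Variables (G : mgraph) (a b : edge G -> vert G) (e1 e2 : edge G).
Hypothesis ends_ab : forall e, ends e = [set a e; b e].
Hypothesis e12 : e1 != e2.

Local Notation V := (vert G).
Local Notation E := (edge G).

(* The edges e1 and e2 are subdivided by a common new vertex None; their second
   halves are inr true and inr false. *)
Definition split_a (x : E + bool) : option V := if x is inl e then Some (a e) else None.

Definition split_b (x : E + bool) : option V :=
  match x with
  | inl e => if (e == e1) || (e == e2) then None else Some (b e)
  | inr s => Some (b (if s then e1 else e2))
  end.

(** The two crossing edges are oriented beforehand, and all four halves end in the new vertex, the
    root. A cut that avoids it is at least as large as in the graph, since an edge crossing the cut
    keeps one of its halves there. The inner edges are exactly the edges other than [e1] and
    [e2]. *)
Theorem crossing_connected : has_planar_struct split_a split_b ->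
  edge_connected G 5 -> Z3_connected G.
Proof.
case=> F [l [r Pl]] cn beta Ebeta.
pose S := [set e1; e2]; pose A : {set option V} := [set v | v != None].
pose c (v : option V) : 'Z_3 := if v is Some v then (beta v - net a b S xpredT v)%R else 0%R.
have loopless x : split_a x != split_b x.
  case: x => [e|s] //=; case: ifP => // _.
  by rewrite (inj_eq (@Some_inj _)) (ends_neq ends_ab).
have dg0 : dg split_a split_b [set: E + bool] set0 = 0.
  by rewrite /dg big1 // => e _; rewrite /cut !inE.
have [||||x Hx] := @solve_region _ _ _ split_a split_b l r Pl loopless A c.
- move=> K KA _; case uK: (None \in K); [right|left].
    suff -> : ~: A :\: K = set0 by [].
    by apply/setP => -[v|]; rewrite !inE ?uK ?andbF.
  suff -> : K = set0 by [].
  apply/setP => -[v|]; rewrite ?uK !inE //; apply/negP => vK.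
  by have := subsetP KA _ vK; rewrite !inE.
- rewrite /dg sum_card.
  apply: (@leq_trans #|[:: inl e1; inl e2; inr true; inr false : E + bool]|).
    apply: subset_leq_card; apply/subsetP => -[e|[]]; rewrite !inE /cut !inE //=.
    have [->|n1] := eqVneq e e1; first by rewrite !eqxx.
    have [->|n2] := eqVneq e e2; first by rewrite !eqxx orbT.
    by [].
  exact: leq_trans (card_size _) _.
- move=> B BA B0 BnA; pose B1 := [set v | Some v \in B].
  have NB : None \in B = false by apply/negP => /(subsetP BA); rewrite inE.
  have : 5 <= dg a b [set: E] B1.
    apply: (connected_cut ends_ab) => //.
      have [[v|] vB] := set0Pn _ B0; last by rewrite vB in NB.
      by apply/set0Pn; exists v; rewrite inE.
    apply: contraNneq BnA => E0; rewrite eqEsubset BA; apply/subsetP => -[v|]; rewrite !inE // => _.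
    by have := in_setT v; rewrite -E0 inE.
  move/leq_trans; apply.
  pose f (x : E + bool) : nat := cut split_a split_b B x.
  have -> : dg split_a split_b [set: E + bool] B = \sum_e f (inl e) + (f (inr true) + f (inr false)).
    rewrite /dg (eq_bigl xpredT); last by move=> e; rewrite inE.
    by rewrite big_sumType /= big_bool.
  rewrite /dg (eq_bigl xpredT); last by move=> e; rewrite inE.
  rewrite (bigD1 e1) //= (bigD1 e2) /=; last by rewrite eq_sym.
  rewrite [X in _ <= X + _](bigD1 e1) //= [X in _ <= _ + X + _](bigD1 e2) /=; last by rewrite eq_sym.
  have -> : \sum_(i | (i != e1) && (i != e2)) f (inl i) =
     \sum_(i | (i != e1) && (i != e2)) cut a b B1 i.
    by apply: eq_bigr => e /andP[/negbTE n1 /negbTE n2]; rewrite /f /cut /= n1 n2 !inE.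
  rewrite /f /cut /= !eqxx orbT !inE NB.
  by do 4 case: (_ \in B); lia.
- have -> : (\sum_(v in A) c v = \sum_(v : V) c (Some v))%R.
    have -> : A = [set Some v | v in [set: V]].
      apply/setP => -[v|]; rewrite !inE ?eqxx; last by apply/esym/imsetP => -[].
      by apply/esym/imsetP; exists v.
    rewrite big_imset /=; last by move=> ? ? _ _ [].
    by apply: eq_bigl => v; rewrite inE.
  by rewrite sumrB Ebeta sum_netT subr0.
have [v|y [Hy _]] := @combine_orientations G a b ends_ab S xpredT (fun e => x (inl e)) beta.
  have := Hx (Some v); rewrite inE => /(_ isT) Hv.
  suff -> : net a b (~: S) (fun e => x (inl e)) v = c (Some v) by rewrite addrC subrK.
  rewrite -Hv /net.
  have -> : inner split_a split_b A [set: E + bool] = inl @: (~: S).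
    apply/setP => -[e|s]; rewrite !inE; last by apply/esym/imsetP => -[].
    rewrite mem_imset ?inE; last by move=> ? ? [].
    by rewrite /=; case: (_ || _).
  rewrite big_imset /=; last by move=> ? ? _ _ [].
  by apply: eq_bigr => e; rewrite !inE => /negbTE ne; rewrite /dlt /= ne.
by exists (orient a b y); split=> //; apply: orient_ends.
Qed.

End OneCrossing.

(** * Approximating curves on a grid *)

From mathcomp Require Import all_classical all_reals all_analysis.

Import Order.TTheory Num.Theory.
Import numFieldNormedType.Exports.

Section Curves.

Local Open Scope ring_scope.

Variable R : realType.

(** Compactness of the unit interval in the shape used below: a bound [d] that works locally for all
    small values can be chosen uniformly in [t]. *)
Lemma interval_compact (P : R -> R -> Prop) :
  (forall t : R, 0 <= t <= 1 -> exists2 e : R, 0 < e & forall t' d : R, 0 <= t' <= 1 ->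
     `|t' - t| < e -> 0 < d < e -> P d t') ->
  exists2 d : R, 0 < d & forall t : R, 0 <= t <= 1 -> P d t.
Proof.
move=> H0.
have /compact_near_coveringP cpt := @segment_compact R 0 1.
have Hd : (\forall d \near (0 : R)^'+, forall t : R, 0 <= t <= 1 -> P d t)%classic.
  have := cpt R (0^'+)%classic (fun d t => 0 <= t <= 1 -> P d t) _ => /(_ _) cpt'.
  apply: filterS (cpt' _) => [d Hd t t01|t]; first by apply: Hd => //=; rewrite in_itv.
  rewrite /= in_itv /= => /H0[e e0 He].
  exists ([set t' | `|t' - t| < e], [set d | 0 < d < e])%classic => /=.
    split=> /=.
      by exists e => //= t' /=; rewrite distrC.
    by near=> d; apply/andP; split; near: d; [exact: nbhs_right_gt | exact: nbhs_right_lt].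
  by move=> [t' d] /= [h1 h2] t01; apply: He.
near (0 : R)^'+%classic => d; exists d; last by near: d.
by near: d; exact: nbhs_right_gt.
Unshelve. all: by end_near. Qed.

(** The distance is taken coordinatewise because points are rounded to the grid one coordinate at a
    time. *)
Definition closeby (e : R) (x y : R * R) : bool :=
  (`|x.1 - y.1| < e) && (`|x.2 - y.2| < e).

Definition cont_curve (c : R -> R * R) : Prop :=
  forall t, 0 <= t <= 1 -> forall e, 0 < e -> exists2 d, 0 < d &
    forall s, 0 <= s <= 1 -> `|s - t| < d -> closeby e (c s) (c t).

Lemma closeC e x y : closeby e x y = closeby e y x.
Proof. by rewrite /closeby distrC [`|x.2 - _|]distrC. Qed.

Lemma close_trans e f x y z : closeby e x y -> closeby f y z -> closeby (e + f) x z.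
Proof.
move=> /andP[h1 h2] /andP[h3 h4]; apply/andP; split.
  by rewrite -(subrKA y.1); apply: le_lt_trans (ler_normD _ _) (ltrD h1 h3).
by rewrite -(subrKA y.2); apply: le_lt_trans (ler_normD _ _) (ltrD h2 h4).
Qed.

Lemma close_le e f x y : e <= f -> closeby e x y -> closeby f x y.
Proof. by move=> ef /andP[h1 h2]; rewrite /closeby (lt_le_trans h1 ef) (lt_le_trans h2 ef). Qed.

Lemma cont_unif c e : cont_curve c -> 0 < e -> exists2 d, 0 < d &
  forall s t, 0 <= s <= 1 -> 0 <= t <= 1 -> `|s - t| < d -> closeby e (c s) (c t).
Proof.
move=> cc e0.
have [t t01|d d0 Hd] := @interval_compact (fun d t => forall s, 0 <= s <= 1 -> `|s - t| < d -> closeby e (c s) (c t)).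
  have [|d d0 Hd] := cc t t01 (e / 2); first by lra.
  exists (d / 2) => [|t' f t'01 t't /andP[f0 fd] s s01 st]; first by lra.
  have -> : e = e / 2 + e / 2 by lra.
  apply: (@close_trans _ _ _ (c t)); first apply: Hd => //; last rewrite closeC; last apply: Hd => //.
    rewrite -(subrKA t'); apply: le_lt_trans (ler_normD _ _) _; lra.
  lra.
by exists d => // s t s01 t01 st; apply: Hd.
Qed.

Lemma cont_bounded c : cont_curve c -> exists2 B, 0 < B &
  forall t, 0 <= t <= 1 -> closeby B (c t) (0, 0).
Proof.
move=> cc.
have [t t01|d d0 Hd] := @interval_compact (fun d t => closeby d^-1 (c t) (0, 0)); last first.
  by exists d^-1; rewrite ?invr_gt0.
have [|d d0 Hd] := cc t t01 1; first by lra.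
pose B := 1 + (`|(c t).1| + `|(c t).2| + 1).
have B0 : 0 < B by rewrite /B; have := normr_ge0 (c t).1; have := normr_ge0 (c t).2; lra.
exists (Num.min d B^-1) => [|t' f t'01]; first by rewrite lt_min d0 invr_gt0.
rewrite lt_min => /andP[h1 h2] /andP[f0]; rewrite lt_min => /andP[h3 h4].
apply: (@close_le B); first by rewrite -[B]invrK lef_pV2 ?posrE ?invr_gt0 // ltW.
apply: (@close_trans _ _ _ (c t)); first exact: Hd.
by rewrite /closeby /= !subr0; have := normr_ge0 (c t).1; have := normr_ge0 (c t).2; lra.
Qed.

Lemma far_point c x : cont_curve c -> (forall t, 0 <= t <= 1 -> c t <> x) ->
  exists2 e, 0 < e & forall t, 0 <= t <= 1 -> ~~ closeby e (c t) x.
Proof.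
move=> cc nx; apply: (@interval_compact (fun d t => ~~ closeby d (c t) x)) => t t01.
have [e e0 He] : exists2 e, 0 < e & ~~ closeby e (c t) x.
  have : ((c t).1 != x.1) || ((c t).2 != x.2).
    rewrite -negb_and; apply/negP => /andP[/eqP h1 /eqP h2].
    by apply: (nx t t01); case: (c t) h1 h2 => ? ? /= -> ->; case: x nx.
  case/orP => h; [exists `|(c t).1 - x.1| | exists `|(c t).2 - x.2|];
    by rewrite ?normr_gt0 ?subr_eq0 // /closeby ltxx ?andbF.
have [|d d0 Hd] := cc t t01 (e / 2); first by lra.
exists (Num.min d (e / 2)) => [|t' f t'01]; first by rewrite lt_min d0; lra.
rewrite lt_min => /andP[h1 h2] /andP[f0]; rewrite lt_min => /andP[h3 h4].
apply: contra He => cl; have -> : e = e / 2 + e / 2 by lra.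
apply: (@close_trans _ _ _ (c t')); first by rewrite closeC Hd.
exact: close_le (ltW h4) cl.
Qed.

(** Compactness is used twice: for a fixed point against a curve in [far_point], and here for the
    point moving along the second curve. *)
Lemma far_curves c c' : cont_curve c -> cont_curve c' ->
  (forall s t, 0 <= s <= 1 -> 0 <= t <= 1 -> c s <> c' t) ->
  exists2 e, 0 < e & forall s t, 0 <= s <= 1 -> 0 <= t <= 1 -> ~~ closeby e (c s) (c' t).
Proof.
move=> cc cc' dis.
have [t t01|d d0 Hd] := @interval_compact (fun d t => forall s, 0 <= s <= 1 -> ~~ closeby d (c s) (c' t)); last first.
  by exists d => // s t s01 t01; apply: Hd.
have [s s01|e e0 He] := @far_point c (c' t) cc; first exact: dis.
have [|d d0 Hd] := cc' t t01 (e / 2); first by lra.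
exists (Num.min d (e / 2)) => [|t' f t'01]; first by rewrite lt_min d0; lra.
rewrite lt_min => /andP[h1 h2] /andP[f0]; rewrite lt_min => /andP[h3 h4] s s01.
apply: contra (He s s01) => cl; have -> : e = e / 2 + e / 2 by lra.
apply: (@close_trans _ _ _ (c' t')); last exact: Hd.
exact: close_le (ltW h4) cl.
Qed.

Lemma fin_min_ex (T : finType) (P : T -> R -> Prop) :
  (forall i e f, 0 < f -> f <= e -> P i e -> P i f) -> (forall i, exists2 e, 0 < e & P i e) ->
  exists2 e, 0 < e & forall i, P i e.
Proof.
move=> mono H0.
suff [e e0 He] : exists2 e, 0 < e & forall i, i \in enum T -> P i e.
  by exists e => // i; apply: He; rewrite mem_enum.
elim: (enum T) => [|i s [e e0 He]]; first by exists 1.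
have [f f0 Hf] := H0 i; exists (Num.min e f) => [|j]; first by rewrite lt_min e0.
rewrite in_cons => /orP[/eqP ->|/He Hj]; [apply: mono Hf | apply: mono Hj]; rewrite ?lt_min ?e0 //.
  by rewrite ge_min lexx orbT.
by rewrite ge_min lexx.
Qed.

Lemma truncn_near (x y : R) : 0 <= x -> 0 <= y -> x - y < 1 ->
  (Num.truncn x <= Num.truncn y + 1)%N.
Proof.
move=> x0 y0 xy; have /andP[h1 _] := truncn_itv x0; have /andP[_ h2] := truncn_itv y0.
rewrite -ltnS -(ltr_nat R) -addnS natrD; move: h2; rewrite -natr1; lra.
Qed.

Lemma truncn_far (x y : R) : 0 <= x -> 0 <= y ->
  (Num.truncn x <= Num.truncn y + 3)%N -> x - y < 4.
Proof.
move=> x0 y0; have /andP[_ h1] := truncn_itv x0; have /andP[h2 _] := truncn_itv y0.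
rewrite -(ler_nat R) natrD; move: h1; rewrite -natr1; lra.
Qed.

Lemma ord3P (i : 'I_3) : [\/ i = 0%N :> nat, i = 1%N :> nat | i = 2%N :> nat].
Proof. by case: i => [[|[|[|//]]] lt]; [constructor 1|constructor 2|constructor 3]. Qed.

Lemma third_itv (i : 'I_3) (t : R) : 0 <= t <= 1 -> 0 <= (i%:R + t) / 3 <= 1.
Proof. by move=> t01; case: (ord3P i) => ->; lra. Qed.

Lemma third_eq0 (i : 'I_3) (t : R) : 0 <= t <= 1 -> (i%:R + t) / 3 = 0 -> i = 0%N :> nat.
Proof. by move=> t01; case: (ord3P i) => -> // h; exfalso; lra. Qed.

Lemma third_eq1 (i : 'I_3) (t : R) : 0 <= t <= 1 -> (i%:R + t) / 3 = 1 -> i = 2%N :> nat.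
Proof. by move=> t01; case: (ord3P i) => -> // h; exfalso; lra. Qed.

(** The outer thirds are disjoint intervals, so a common parameter determines the third. The middle
    one is left out because it touches both. *)
Lemma third_inj (i j : 'I_3) (s t : R) : 0 <= s <= 1 -> 0 <= t <= 1 -> i != 1%N :> nat ->
  j != 1%N :> nat -> (i%:R + s) / 3 = (j%:R + t) / 3 -> i = j.
Proof.
move=> s01 t01 i1 j1 h; apply: ord_inj; move: i1 j1 h.
by case: (ord3P i) => ->; case: (ord3P j) => -> // _ _ h; exfalso; lra.
Qed.

Section Drawn.

Variables (V E : finType) (a b : E -> V) (p : V -> R * R) (c : E -> R -> R * R).
Hypothesis loopless : forall e, a e != b e.
Hypothesis cont_c : forall e, cont_curve (c e).
Hypothesis c_a : forall e, c e 0 = p (a e).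
Hypothesis c_b : forall e, c e 1 = p (b e).
Hypothesis p_inj : injective p.
Hypothesis c_inj : forall e s t, 0 <= s <= 1 -> 0 <= t <= 1 -> c e s = c e t -> s = t.
Hypothesis c_avoid : forall e t v, 0 < t < 1 -> c e t <> p v.
Hypothesis c_disj : forall e f s t, e != f -> 0 < s < 1 -> 0 < t < 1 -> c e s <> c f t.

Let third e (i : nat) (t : R) : R * R := c e ((i%:R + t) / 3).

Let third_cont e (i : 'I_3) : cont_curve (third e i).
Proof.
have i2 : i%:R <= 2 :> R by rewrite ler_nat -ltnS.
have i0 : 0 <= i%:R :> R by [].
move=> t t01 eps eps0.
have T01 : 0 <= (i%:R + t) / 3 <= 1 by lra.
have [d d0 Hd] := @cont_c e _ T01 _ eps0.
exists d => // s s01; rewrite ltr_norml => st; apply: Hd; first by lra.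
by rewrite ltr_norml; lra.
Qed.

Let meet e f s t : 0 <= s <= 1 -> 0 <= t <= 1 -> c e s = c f t ->
  (e = f /\ s = t) \/ exists2 v, (s = 0 /\ a e = v) \/ (s = 1 /\ b e = v) &
    (t = 0 /\ a f = v) \/ (t = 1 /\ b f = v).
Proof.
move=> s01 t01 Est.
have ends e' s' : 0 <= s' <= 1 -> (0 < s' < 1) \/ exists2 v, (s' = 0 /\ a e' = v) \/ (s' = 1 /\ b e' = v) & c e' s' = p v.
  move=> s'01; have [->|s0] := eqVneq s' 0; first by right; exists (a e'); [left|rewrite c_a].
  have [->|s1] := eqVneq s' 1; first by right; exists (b e'); [right|rewrite c_b].
  by left; rewrite !lt_neqAle s1 [0 == _]eq_sym s0.
have [si|[v Hv Ev]] := ends e s s01; have [ti|[v' Hv' Ev']] := ends f t t01.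
- have [Eef|nef] := eqVneq e f; last by case: (c_disj nef si ti).
  by left; split=> //; apply: (@c_inj e); rewrite // Est Eef.
- by case: (@c_avoid e s v' si); rewrite Est.
- by case: (@c_avoid f t v ti); rewrite -Est.
right; exists v => //; suff -> : v = v' by [].
by apply: p_inj; rewrite -Ev -Ev'.
Qed.

(** Edges with a common end come arbitrarily close, so whole curves admit no separation. Cut into
    thirds, finitely many pairs of disjoint arcs remain, and these have a common distance [rho];
    pairs that do meet need not be separated in the lattice. *)
Theorem curves_planar : has_planar_struct a b.
Proof.
have [rho rho0 Hrho] : exists2 rho, 0 < rho & forall x : (E * 'I_3) * (E * 'I_3),
    (forall s t, 0 <= s <= 1 -> 0 <= t <= 1 -> third x.1.1 x.1.2 s <> third x.2.1 x.2.2 t) ->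
    forall s t, 0 <= s <= 1 -> 0 <= t <= 1 -> ~~ closeby rho (third x.1.1 x.1.2 s) (third x.2.1 x.2.2 t).
  apply: fin_min_ex => [x e f f0 fe H0 dis s t s01 t01|x].
    by apply: contra (H0 dis s t s01 t01); apply: close_le.
  case: (pselect (forall s t, 0 <= s <= 1 -> 0 <= t <= 1 ->
    third x.1.1 x.1.2 s <> third x.2.1 x.2.2 t)) => [dis|ndis]; last by exists 1.
  by have [e e0 He] := far_curves (@third_cont _ _) (@third_cont _ _) dis; exists e.
(* Cells whose indices differ by at most three contain points less than four mesh widths apart, so
   the mesh is a quarter of the separation. *)
pose h := rho / 4; have h0 : 0 < h by rewrite /h; lra.
have [d d0 Hd] : exists2 d, 0 < d & forall e s t, 0 <= s <= 1 -> 0 <= t <= 1 ->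
    `|s - t| < d -> closeby h (c e s) (c e t).
  apply: fin_min_ex => [e f g g0 gf H0 s t s01 t01 st|e].
    by apply: H0 => //; apply: lt_le_trans gf.
  exact: cont_unif.
have [B B0 HB] : exists2 B, 0 < B & forall e t, 0 <= t <= 1 -> closeby B (c e t) (0, 0).
  have [B B0 HB] : exists2 B, 0 < B & forall e t, 0 <= t <= 1 -> closeby B^-1 (c e t) (0, 0).
    apply: fin_min_ex => [e f g g0 gf H0 t t01|e].
      by apply: close_le (H0 t t01); rewrite lef_pV2 ?posrE //; apply: lt_le_trans gf.
    have [B B0 HB] := cont_bounded (cont_c e); exists B^-1; first by rewrite invr_gt0.
    by move=> t t01; rewrite invrK; apply: HB.
  by exists B^-1 => //; rewrite invr_gt0.
(* One time step is shorter than [d] and moves a point by less than the mesh, hence to a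
   neighbouring cell at most. The summand 3 in [n] and the successors in [Q] leave a margin for
   blocks at the border of the grid. *)
pose N := (Num.truncn d^-1).+1; pose n := (Num.truncn (2 * B / h) + 3)%N.
have N0 : 0 < N%:R :> R by rewrite ltr0n.
have Nd : (3 * N)%:R^-1 < d.
  have Nd : N%:R^-1 < d.
    rewrite -[d]invrK ltf_pV2 ?posrE ?invr_gt0 //; have dV : 0 <= d^-1 by rewrite invr_ge0 ltW.
    by have /andP[] := truncn_itv dV.
  apply: le_lt_trans Nd; rewrite lef_pV2 ?posrE ?ltr0n // ?ler_nat; lia.
pose sc (y : R) := (y + B) / h; pose Q (x : R * R) := ((Num.truncn (sc x.1)).+1, (Num.truncn (sc x.2)).+1).
have scB y : `|y| < B -> 0 <= sc y <= 2 * B / h.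
  rewrite ltr_norml => /andP[y1 y2]; rewrite /sc; apply/andP; split.
    by apply: divr_ge0; lra.
  by rewrite ler_pM2r ?invr_gt0 //; lra.
have bd e t : 0 <= t <= 1 -> (`|(c e t).1| < B) /\ (`|(c e t).2| < B).
  by move=> t01; have /andP[] := HB e t t01; rewrite /= !subr0.
pose tm (k : nat) : R := k%:R / (3 * N)%:R.
have N3 : 0 < (3 * N)%:R :> R by rewrite ltr0n.
have tm01 k : (k <= 3 * N)%N -> 0 <= tm k <= 1.
  move=> kN; rewrite /tm divr_ge0 //= ler_pdivrMr // mul1r ler_nat //.
have near_close m x y : `|x.1| < B -> `|x.2| < B -> `|y.1| < B -> `|y.2| < B ->
    (m = 3)%N -> nearby m (Q x) (Q y) -> closeby rho x y.
  move=> /scB/andP[x1 _] /scB/andP[x2 _] /scB/andP[y1 _] /scB/andP[y2 _] ->; rewrite /nearby /Q /= !addSn !ltnS.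
  have E4 : rho = 4 * h by rewrite /h; lra.
  have scd u v : sc u - sc v < 4 -> u - v < rho.
    by rewrite /sc -mulrBl ltr_pdivrMr // E4; lra.
  move=> /and4P[n1 n2 n3 n4]; rewrite /closeby !ltr_norml.
  have := scd _ _ (truncn_far x1 y1 n1); have := scd _ _ (truncn_far y1 x1 n2).
  have := scd _ _ (truncn_far x2 y2 n3); have := scd _ _ (truncn_far y2 x2 n4).
  by move=> *; apply/andP; split; lra.
have close_near x y : `|x.1| < B -> `|x.2| < B -> `|y.1| < B -> `|y.2| < B ->
    closeby h x y -> nearby 1 (Q x) (Q y).
  move=> /scB/andP[x1 _] /scB/andP[x2 _] /scB/andP[y1 _] /scB/andP[y2 _].
  rewrite /closeby !ltr_norml => /andP[/andP[h1 h2] /andP[h3 h4]].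
  have scd u v : u - v < h -> sc u - sc v < 1.
    by rewrite /sc -mulrBl ltr_pdivrMr // mul1r; lra.
  rewrite /nearby /Q /= !addSn !ltnS; apply/and4P; split; apply: truncn_near => //; apply: scd; lra.
have at_third e k (i : 'I_3) : (i * N <= k <= i.+1 * N)%N ->
    exists2 t, 0 <= t <= 1 & c e (tm k) = third e i t /\ tm k = (i%:R + t) / 3.
  move=> /andP[k1 k2]; have E3 : tm k = (i%:R + (k%:R / N%:R - i%:R)) / 3.
    by rewrite /tm natrM; field; rewrite pnatr_eq0.
  exists (k%:R / N%:R - i%:R); last by rewrite /third -E3.
  rewrite subr_ge0 lerBlDr ler_pdivlMr // ler_pdivrMr // -natrM ler_nat k1 /=.
  by rewrite [1 + _]addrC natr1 -natrM ler_nat.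
have far e f k m (i j : 'I_3) : (i * N <= k <= i.+1 * N)%N -> (j * N <= m <= j.+1 * N)%N ->
    (forall s t, 0 <= s <= 1 -> 0 <= t <= 1 -> third e i s <> third f j t) ->
    ~~ nearby 3 (Q (c e (tm k))) (Q (c f (tm m))).
  move=> ki mj dis; have [s s01 [Es Es']] := at_third e k i ki; have [t t01 [Et Et']] := at_third f m j mj.
  have tmk : 0 <= tm k <= 1 by apply: tm01; case/andP: ki => _ ki'; apply: leq_trans ki' _; rewrite leq_mul2r ltn_ord orbT.
  have tmm : 0 <= tm m <= 1 by apply: tm01; case/andP: mj => _ mj'; apply: leq_trans mj' _; rewrite leq_mul2r ltn_ord orbT.
  have [k1 k2] := bd e _ tmk; have [m1 m2] := bd f _ tmm.
  apply: contra (Hrho ((e, i), (f, j)) dis s t s01 t01) => /=.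
  by rewrite -Es -Et; apply: near_close.
have i0 : (0 < 3)%N by []. have i1 : (1 < 3)%N by []. have i2 : (2 < 3)%N by [].
pose o0 := Ordinal i0; pose o1 := Ordinal i1; pose o2 := Ordinal i2.
pose endv (i : 'I_3) e := if i == 0%N :> nat then a e else b e.
have end_third v e k : end_at a b N v e k -> exists i : 'I_3,
    [/\ (i * N <= k <= i.+1 * N)%N, i != 1%N :> nat & endv i e = v].
  case/orP => /andP[/eqP <- kN]; first by exists o0; rewrite mul1n.
  by exists o2.
have end_only (i : 'I_3) e v (t : R) : 0 <= t <= 1 ->
    ((i%:R + t) / 3 = 0 /\ a e = v) \/ ((i%:R + t) / 3 = 1 /\ b e = v) ->
    i != 1%N :> nat /\ endv i e = v.
  move=> t01 [[/(third_eq0 t01) + <-]|[/(third_eq1 t01) + <-]]; by rewrite /endv => ->.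
apply: (@lattice_planar V E a b loopless n N (fun e k => Q (c e (tm k))) (Q \o p)).
- move=> e k kN; have t1 := tm01 k (ltnW kN); have t2 := tm01 k.+1 kN.
  have [k1 k2] := bd e _ t1; have [m1 m2] := bd e _ t2.
  apply: close_near => //; apply: Hd => //; rewrite /tm -mulrBl -natr1 opprD addNKr.
  by rewrite mulN1r normrN normfV ger0_norm // ltW.
- move=> e k kN; have [k1 k2] := bd e _ (tm01 k kN); rewrite /Q /=.
  have lt y : `|y| < B -> ((Num.truncn (sc y)).+1 < n)%N.
    by move=> /scB/andP[_ y2]; rewrite /n; have := le_truncn y2; lia.
  by rewrite !lt.
- by move=> e; rewrite /tm mul0r c_a.
- by move=> e; rewrite /tm divff ?c_b // gt_eqF.
- move=> v v' e f k m vv' /end_third[i [ki i1' Ei]] /end_third[j [mj j1' Ej]].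
  apply: (far _ _ _ _ i j ki mj) => s t s01 t01; rewrite /third.
  case/(meet (third_itv i s01) (third_itv j t01)) => [[Eef Est]|[u /(end_only i)-/(_ s01)[_ E1] /(end_only j)-/(_ t01)[_ E2]]].
    have Eij := third_inj s01 t01 i1' j1' Est.
    by move: vv'; rewrite -Ei -Ej Eef Eij eqxx.
  by move: vv'; rewrite -Ei -Ej E1 E2 eqxx.
- move=> e f k m ef; rewrite -{1 3}[N]mul1n => ki mj.
  apply: (far _ _ _ _ o1 o1 ki mj) => s t s01 t01; rewrite /third.
  case/(meet (third_itv o1 s01) (third_itv o1 t01)) => [[Eef _]|[u /(end_only o1)-/(_ s01)[]]] //.
  by move: ef; rewrite Eef eqxx.
move=> v e f k m va vb; rewrite -{1}[N]mul1n => ki /end_third[j [mj j1' Ej]].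
apply: (far _ _ _ _ o1 j ki mj) => s t s01 t01; rewrite /third.
case/(meet (third_itv o1 s01) (third_itv j t01)) => [[Eef _]|[u /(end_only o1)-/(_ s01)[]]] //.
by move: va vb; rewrite Eef -Ej /endv; case: ifP => _; rewrite eqxx.
Qed.

End Drawn.

End Curves.

(** * From drawings to planar structures *)

Section Drawn.

Local Open Scope ring_scope.

Variables (R : realType) (G : mgraph) (D : drawing R G).

Lemma drawing_cont e : cont_curve (curve D e).
Proof.
move=> t t01 eps eps0.
have /subspace_continuousP/(_ t) := @curve_continuous _ _ D e.
rewrite /= in_itv /= => /(_ t01) /cvgrPdist_lt /(_ eps eps0).
rewrite /within /= => -[d d0 Hd]; exists d => // s s01 st.
have := Hd s; rewrite /= distrC in_itv /= => /(_ st s01).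
rewrite prod_normE gt_max => /andP[h1 h2].
by apply/andP; split; rewrite distrC.
Qed.

Lemma drawing_ends : exists a b : edge G -> vert G, forall e,
  [/\ ends e = [set a e; b e]%SET, curve D e 0 = point_of D (a e) & curve D e 1 = point_of D (b e)].
Proof.
suff H0 e : exists a b : vert G,
    [/\ ends e = [set a; b]%SET, curve D e 0 = point_of D a & curve D e 1 = point_of D b].
  have [a Ha] := fin_all_exists H0; have [b Hb] := fin_all_exists Ha.
  by exists a, b.
have E0 := @curve_ends _ _ D e.
have [a aE Ea] : (point_of D @` [set` ends e])%classic (curve D e 0) by rewrite -E0; left.
have [b bE Eb] : (point_of D @` [set` ends e])%classic (curve D e 1) by rewrite -E0; right.
exists a, b; split=> //; apply/esym/eqP; rewrite eqEcard card_ends.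
rewrite /= in aE bE; apply/andP; split.
  by apply/fintype.subsetP => v; rewrite !inE => /orP[]/eqP ->.
rewrite cards2; case: eqP => // Eab; rewrite Eab Eb in Ea.
have : 1 = 0 :> R by apply: (@curve_inj _ _ D e) => //; rewrite in_itv /= ?lexx ?ler01.
by move/eqP; rewrite oner_eq0.
Qed.

Lemma drawing_inj e s t : 0 <= s <= 1 -> 0 <= t <= 1 -> curve D e s = curve D e t -> s = t.
Proof. by move=> s01 t01; apply: (@curve_inj _ _ D e); rewrite in_itv. Qed.

Lemma drawing_avoid e t v : 0 < t < 1 -> curve D e t <> point_of D v.
Proof. by move=> t01; apply: curve_avoids; rewrite in_itv. Qed.

Lemma drawing_crossing e f s t : e != f -> 0 < s < 1 -> 0 < t < 1 -> curve D e s = curve D f t ->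
  crossings D ([set e; f]%SET, curve D e s).
Proof.
move=> ef s01 t01 Est; split=> /=; first by rewrite cards2 ef.
move=> g; rewrite !inE => /orP[]/eqP ->; [exists s | exists t] => //=; by rewrite in_itv.
Qed.

Lemma crossing_ex (C : {set edge G} * (R * R)) : crossings D C -> exists e1 e2 s1 s2,
  [/\ e1 != e2, 0 < s1 < 1, 0 < s2 < 1, C.1 = [set e1; e2]%SET
   & curve D e1 s1 = C.2 /\ curve D e2 s2 = C.2].
Proof.
case: C => C q [/= C2 HC]; have /cards2P[e1 [e2 [e12 EC]]] : #|C| == 2 by rewrite C2.
have [|s1 /=] := HC e1; first by rewrite EC !inE eqxx.
rewrite in_itv /= => s101 E1.
have [|s2 /=] := HC e2; first by rewrite EC !inE eqxx orbT.
rewrite in_itv /= => s201 E2.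
by exists e1, e2, s1, s2.
Qed.

End Drawn.

Section Final.

Local Open Scope ring_scope.

Variable R : realType.

Lemma planar_struct_of_drawing (G : mgraph) : planar R G ->
  exists a b : edge G -> vert G, (forall e, ends e = [set a e; b e]%SET) /\ has_planar_struct a b.
Proof.
case=> D nocr; have [a [b Hab]] := drawing_ends D.
have ends_ab e : ends e = [set a e; b e]%SET by have [] := Hab e.
exists a, b; split=> //; apply: (@curves_planar R _ _ a b (point_of D) (curve D)).
- exact: ends_neq ends_ab.
- exact: drawing_cont.
- by move=> e; have [] := Hab e.
- by move=> e; have [] := Hab e.
- exact: point_of_inj.
- exact: drawing_inj.
- exact: drawing_avoid.
move=> e f s t ef s01 t01 Est; have := drawing_crossing ef s01 t01 Est.
by rewrite nocr.
Qed.

(** The unique crossing point is made a vertex, and the two edges through it are cut there. The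
    pieces are reparametrised over the unit interval by [tm], so that [curves_planar] applies to the
    subdivided graph. *)
Lemma split_struct_of_drawing (G : mgraph) : crossing_number_le R G 1 ->
  planar R G \/ exists (a b : edge G -> vert G) e1 e2,
    [/\ forall e, ends e = [set a e; b e]%SET, e1 != e2 &
        has_planar_struct (split_a a) (split_b b e1 e2)].
Proof.
case=> D cr1; have [a [b Hab]] := drawing_ends D.
have ends_ab e : ends e = [set a e; b e]%SET by have [] := Hab e.
case: (pselect (crossings D = set0)) => [E0|/eqP/set0P[C crC]]; first by left; exists D.
(* An injection into a one-element set: any common interior point of two edges gives back the same
   pair of edges and the same point. *)
have only C' : crossings D C' -> C' = C.
  have /pcard_leP[f] := cr1.
  have f0 C'' : crossings D C'' -> f C'' = 0%N.
    by move=> /(@funS _ _ _ _ f) /=; rewrite ltnS leqn0 => /eqP.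
  move=> crC'; have E0 : f C' = f C by rewrite !f0.
  exact: (@inj _ _ _ f _ _ (mem_set crC') (mem_set crC) E0).
have [e1 [e2 [s1 [s2 [e12 s101 s201 EC [E1 E2]]]]]] := crossing_ex crC.
right; exists a, b, e1, e2; split=> //.
pose ed (x : edge G + bool) := match x with inl e => e | inr s => if s then e1 else e2 end.
pose lo (x : edge G + bool) : R := match x with inl e => 0 | inr s => if s then s1 else s2 end.
pose hi (x : edge G + bool) : R :=
  match x with inl e => if e == e1 then s1 else if e == e2 then s2 else 1 | inr s => 1 end.
have lohi x : [/\ 0 <= lo x, lo x < hi x & hi x <= 1].
  case: x => [e|[]]; rewrite /lo /hi; try by split; lra.
  by case: ifP => _; [split; lra | case: ifP => _; split; lra].
pose tm x (t : R) := lo x + (hi x - lo x) * t.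
have tm01 x t : 0 <= t <= 1 -> 0 <= tm x t <= 1.
  by move=> t01; have [h1 h2 h3] := lohi x; rewrite /tm; nra.
have tmi x t : 0 < t < 1 -> lo x < tm x t < hi x.
  by move=> t01; have [h1 h2 h3] := lohi x; rewrite /tm; nra.
have tmi01 x t : 0 < t < 1 -> 0 < tm x t < 1.
  by move=> t01; have [h1 h2 h3] := lohi x; have := tmi x t t01; lra.
(* A third edge through the point would form another crossing with [e1]; on [e1] and [e2] themselves
   the point is an end of the pieces, since curves are injective. *)
have off x t : 0 < t < 1 -> curve D (ed x) (tm x t) <> C.2.
  move=> t01 EC2; have ti := tmi x t t01; have ti' := tmi01 x t t01.
  have le01 (s : R) : 0 < s < 1 -> 0 <= s <= 1 by lra.
  have [Ed1|n1] := eqVneq (ed x) e1.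
    have Et : tm x t = s1 by apply: (@drawing_inj _ _ D e1); rewrite ?le01 // -Ed1 EC2 Ed1 E1.
    move: ti Ed1; rewrite Et; case: x {EC2 ti' Et} => [e|[]] /=; rewrite /lo /hi /ed; last 2 first.
    - by rewrite ltxx.
    - by move=> _ E0; move: e12; rewrite E0 eqxx.
    by move=> + Ee; rewrite Ee eqxx ltxx andbF.
  have [Ed2|n2] := eqVneq (ed x) e2.
    have Et : tm x t = s2 by apply: (@drawing_inj _ _ D e2); rewrite ?le01 // -Ed2 EC2 Ed2 E2.
    move: ti Ed2; rewrite Et; case: x {EC2 ti' Et n1} => [e|[]] /=; rewrite /lo /hi /ed; last 2 first.
    - by move=> _ E0; move: e12; rewrite E0 eqxx.
    - by rewrite ltxx.
    by move=> + Ee; rewrite Ee eq_sym (negbTE e12) eqxx ltxx andbF.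
  have := only _ (@drawing_crossing _ _ D _ _ _ _ n1 ti' s101 _).
  rewrite EC2 E1 => /(_ erefl) /(congr1 fst) /= E0.
  have : ed x \in [set e1; e2]%SET by rewrite -EC -E0 !inE eqxx.
  by rewrite !inE (negbTE n1) (negbTE n2).
pose p (v : option (vert G)) := if v is Some v then point_of D v else C.2.
have C2v v : C.2 <> point_of D v by rewrite -E1; apply: drawing_avoid.
apply: (@curves_planar R _ _ _ _ p (fun x t => curve D (ed x) (tm x t))).
- case=> [e|s] //=; case: ifP => // _; rewrite (inj_eq (@Some_inj _)); exact: (ends_neq ends_ab).
- move=> x t t01 eps eps0; have [d d0 Hd] := @drawing_cont _ _ D (ed x) _ (tm01 x t t01) _ eps0.
  exists d => // s s01; rewrite ltr_norml => st; apply: Hd; first exact: tm01.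
  by have [h1 h2 h3] := lohi x; rewrite /tm ltr_norml; nra.
- case=> [e|[]] /=; rewrite /tm mulr0 addr0 /lo /= //.
  by have [_ ->] := Hab e.
- case=> [e|[]] /=; rewrite /tm mulr1 addrC subrK /hi /=; try by have [] := Hab e1; have [] := Hab e2.
  have [->|n1] := eqVneq e e1 => //=.
  have [->|n2] := eqVneq e e2 => //=.
  by have [] := Hab e.
- move=> [u|] [v|] //= E0; last 2 first.
  - by case: (C2v u).
  - by case: (C2v v).
  by rewrite (@point_of_inj _ _ D _ _ E0).
- move=> x s t s01 t01 /(drawing_inj (tm01 x s s01) (tm01 x t t01)).
  have [h1 h2 h3] := lohi x; rewrite /tm => /addrI/mulfI; apply.
  by apply/eqP; lra.
- by move=> x t [v|] t01 /=; [apply: drawing_avoid; apply: tmi01 | apply: off].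
move=> x y s t xy s01 t01 Exy.
have [Ed|nd] := eqVneq (ed x) (ed y).
  have Et : tm x s = tm y t.
    by apply: (@drawing_inj _ _ D (ed x)); rewrite ?tm01 //; [lra|lra|rewrite Exy Ed].
  have := tmi x s s01; have := tmi y t t01; rewrite Et; move: xy Ed.
  case: x {Exy Et} => [e|[]]; case: y => [f|[]] //=; rewrite /lo /hi /ed /=.
  - by move=> + E0; rewrite E0 eqxx.
  - by move=> _ ->; rewrite eqxx; lra.
  - by move=> _ ->; rewrite eq_sym (negbTE e12) eqxx; lra.
  - by move=> _ <-; rewrite eqxx; lra.
  - by move=> _ E0; move: e12; rewrite E0 eqxx.
  - by move=> _ <-; rewrite eq_sym (negbTE e12) eqxx; lra.
  - by move=> _ E0; move: e12; rewrite E0 eqxx.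
(* Distinct edges could meet only in the crossing point, which no piece contains in its interior. *)
have := only _ (drawing_crossing nd (tmi01 x s s01) (tmi01 y t t01) Exy).
by move=> /(congr1 snd) /=; apply: off.
Qed.

End Final.

Theorem theorem1p3 (R : realType) :
  (forall G : mgraph,
      edge_connected G 5 -> planar R G -> Z3_connected G) /\
  (forall G : mgraph,
      edge_connected G 5 -> planar R G ->
      forall x : vert G, degree x = 5 -> Z3_extendable x) /\
  (forall G : mgraph,
      Z3_reduced G -> planar R G -> min_degree G <= 4) /\
  (forall G : mgraph,
      edge_connected G 5 -> crossing_number_le R G 1 -> Z3_connected G).
Proof.
split=> [G cn /planar_struct_of_drawing[a [b [ends_ab pl]]]|].
  exact: planar_connected ends_ab pl cn.
split=> [G cn /planar_struct_of_drawing[a [b [ends_ab pl]]]|].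
  exact: planar_extendable ends_ab pl cn.
split=> [G red /planar_struct_of_drawing[a [b [ends_ab pl]]]|].
  exact: planar_reduced ends_ab pl red.
move=> G cn /split_struct_of_drawing[/planar_struct_of_drawing[a [b [ends_ab pl]]]|[a [b [e1 [e2 [ends_ab e12 pl]]]]]].
  exact: planar_connected ends_ab pl cn.
exact: crossing_connected ends_ab e12 pl cn.
Qed.
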